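(* Let $\mathcal A$ be a non-positive DG-category and $n$ a positive integer. Then $\mathcal A$ is an abelian $n$-truncated DG-category if and only if its DG-nerve $N_{\mathrm{dg}}(\mathcal A)$ is an abelian $(n,1)$-category in the sense of Stefanich.
   Context: **DG-categories.** Let $k$ be a commutative ring. DG-categories are $k$-linear with cohomological grading (differential $d$ of degree $+1$); $\mathcal A$ non-positive means $\mathcal A(X,Y)^i=0$ for $i>0$. A morphism $f$ is closed if $d(f)=0$. $H^0(\mathcal A)$ is the homotopy category. $N_{\mathrm{dg}}(\mathcal A)$ is the quasicategory given by the DG-nerve (Lurie, Higher Algebra, 1.3.1). **Exactness.** For a chain map $\varphi:M\to N$ let $\mathrm{Fib}(\varphi)=\mathrm{Cone}(\varphi)[-1]$ be the complex $\mathrm{Fib}(\varphi)^i=M^i\oplus N^{i-1}$, $d(m,h)=(dm,-\varphi(m)-dh)$. A 3-term homotopy complex $(f,g,h)$ consists of closed degree-$0$ morphisms $f:X\to Y$, $g:Y\to Z$ and a degree $-1$ morphism $h:X\to Z$ with $d(h)=-g\circ f$. It is left exact (a homotopy kernel of $g$) if for every object $W$ and every $i\le 0$ the chain map $\mathcal A(W,X)\to \mathrm{Fib}(g\circ-:\mathcal A(W,Y)\to\mathcal A(W,Z))$, $u\mapsto (f\circ u,h\circ u)$, induces an isomorphism on $H^i$. It is right exact (a homotopy cokernel of $f$) if for every $W$ and $i\le0$ the chain map $\mathcal A(Z,W)\to\mathrm{Fib}(-\circ f:\mathcal A(Y,W)\to\mathcal A(X,W))$, $u\mapsto(u\circ g,(-1)^{|u|}u\circ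 h)$, induces an isomorphism on $H^i$. It is a homotopy short exact sequence if it is both. **Abelian $n$-truncated DG-categories.** A closed degree-$0$ morphism $f:X\to Y$ is an $n$-monomorphism if for every $W$ the map $H^i(f\circ-):H^i(\mathcal A(W,X))\to H^i(\mathcal A(W,Y))$ is injective for $i=-n+1$ and bijective for all $i\le -n$; it is an $n$-epimorphism if it is an $n$-monomorphism in $\mathcal A^{\mathrm{op}}$. $\mathcal A$ is $n$-truncated if $H^i(\mathcal A(X,Y))=0$ for all $X,Y$ and all $i\le -n$. $\mathcal A$ is abelian $n$-truncated if it is $n$-truncated and: (i) $H^0(\mathcal A)$ is additive and every closed degree-$0$ morphism has a homotopy kernel and a homotopy cokernel; (ii) every right exact $(f,g,h)$ with $f$ an $n$-monomorphism is a homotopy short exact sequence; (iii) every left exact $(f,g,h)$ with $g$ an $n$-epimorphism is a homotopy short exact sequence. **Abelian $(n,1)$-categories (Stefanich).** A quasicategory $\mathcal C$ is an abelian $(n,1)$-category if: (i) $\mathcal C$ is an additive $(n,1)$-category (up to equivalence: an additive $\infty$-category all of whose mapping spaces are $(n-1)$-truncated) with finite limits and colimits; (ii) for every $(n-2)$-truncated morphism $f:X\to Y$ (i.e. $\mathrm{map}_{\mathcal C}(C,X)\to\mathrm{map}_{\mathcal C}(C,Y)$ is an $(n-2)$-truncated map of spaces for all $C$), the cofiber sequence $X\to Y\to\mathrm{cof}(f)$ is also a fiber sequence; (iii) the dual of (ii), i.e. (ii) holds for $\mathcal C^{\mathrm{op}}$. *)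

(* Defs.v *)
From mathcomp Require Import all_boot all_order all_algebra.
From mathcomp Require Import zify.
From Stdlib Require Import FunctionalExtensionality ProofIrrelevance.

Set Implicit Arguments.
Unset Strict Implicit.
Unset Printing Implicit Defensive.

Import Order.TTheory GRing.Theory Num.Theory.
Local Open Scope ring_scope.

(* Operations that shift degrees take the target degree together with an
   equation identifying it, so that no transport is needed in the axioms. *)
Record cplx (k : comPzRingType) := Cplx {
  cdeg :> int -> lmodType k;
  cd : forall i j : int, i + 1 = j -> cdeg i -> cdeg j;
  cd_linear : forall i j (e : i + 1 = j), linear (cd e);
  cd_cd : forall i j l (e : i + 1 = j) (e' : j + 1 = l) x, cd e' (cd e x) = 0 }.

Record cmap (k : comPzRingType) (M N : cplx k) := Cmap {
  cfun :> forall i : int, M i -> N i;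
  cfun_linear : forall i, linear (@cfun i);
  cfun_d : forall i j (e : i + 1 = j) x, @cfun j (cd e x) = cd e (@cfun i x) }.

Record dgcat (k : comPzRingType) := DGCat {
  dgob :> Type;
  dghom : dgob -> dgob -> cplx k;
  dgcomp : forall (X Y Z : dgob) (i j l : int), i + j = l ->
    dghom Y Z i -> dghom X Y j -> dghom X Z l;
  dgid : forall X : dgob, dghom X X 0;
  dgcomp_linearl : forall X Y Z i j l (e : i + j = l) (f : dghom X Y j),
    linear (fun g : dghom Y Z i => dgcomp e g f);
  dgcomp_linearr : forall X Y Z i j l (e : i + j = l) (g : dghom Y Z i),
    linear (fun f : dghom X Y j => dgcomp e g f);
  dgcompA : forall X Y Z T a b c ab bc abc
      (e1 : a + b = ab) (e2 : ab + c = abc) (e3 : b + c = bc) (e4 : a + bc = abc)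
      (h : dghom Z T a) (g : dghom Y Z b) (f : dghom X Y c),
    dgcomp e2 (dgcomp e1 h g) f = dgcomp e4 h (dgcomp e3 g f);
  dgcomp1l : forall X Y i (e : 0 + i = i) (f : dghom X Y i),
    dgcomp e (dgid Y) f = f;
  dgcomp1r : forall X Y i (e : i + 0 = i) (f : dghom X Y i),
    dgcomp e f (dgid X) = f;
  dg_leibniz : forall X Y Z i j l i' j' l'
      (e : i + j = l) (el : l + 1 = l') (ei : i + 1 = i') (ej : j + 1 = j')
      (e1 : i' + j = l') (e2 : i + j' = l')
      (g : dghom Y Z i) (f : dghom X Y j),
    cd el (dgcomp e g f) =
      dgcomp e1 (cd ei g) f + (-1) ^+ `|i|%N *: dgcomp e2 g (cd ej f) }.

Definition nonpositive (k : comPzRingType) (A : dgcat k) : Prop :=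
  forall (X Y : A) (i : int) (x : dghom X Y i), 0 < i -> x = 0.

Lemma cplx_irr (k : comPzRingType) (M : cplx k) i j (e e' : i + 1 = j) (x : M i) :
  cd e x = cd e' x.
Proof. by rewrite (eq_irrelevance e e'). Qed.

Lemma dgcomp_irr (k : comPzRingType) (A : dgcat k) (X Y Z : A) i j l
    (e e' : i + j = l) (g : dghom Y Z i) (f : dghom X Y j) :
  dgcomp e g f = dgcomp e' g f.
Proof. by rewrite (eq_irrelevance e e'). Qed.

Lemma linear_props (k : comPzRingType) (U V : lmodType k) (f : U -> V) :
  linear f -> [/\ f 0 = 0, (forall x, f (- x) = - f x),
    (forall x y, f (x + y) = f x + f y) & (forall a x, f (a *: x) = a *: f x)].
Proof.
move=> lf.
have f0 : f 0 = 0.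
  have := lf (-1) 0 0; rewrite scaler0 addr0 scaleN1r addNr => h.
  exact: h.
have fD x y : f (x + y) = f x + f y by have := lf 1 x y; rewrite !scale1r.
have fZ a x : f (a *: x) = a *: f x by have := lf a x 0; rewrite !addr0 f0 addr0.
by split=> // x; rewrite -scaleN1r fZ scaleN1r.
Qed.

Lemma dgcompN (k : comPzRingType) (A : dgcat k) (X Y Z : A) i j l
    (e : i + j = l) (g : dghom Y Z i) (f : dghom X Y j) :
  dgcomp e (- g) f = - dgcomp e g f.
Proof. by have [h0 hN _ hZ] := linear_props (dgcomp_linearl (Z := Z) e f); first [exact: h0 | exact: hN | exact: hZ]. Qed.

Lemma dgcompNr (k : comPzRingType) (A : dgcat k) (X Y Z : A) i j l
    (e : i + j = l) (g : dghom Y Z i) (f : dghom X Y j) :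
  dgcomp e g (- f) = - dgcomp e g f.
Proof. by have [h0 hN _ hZ] := linear_props (dgcomp_linearr (X := X) e g); first [exact: h0 | exact: hN | exact: hZ]. Qed.

Lemma dgcomp0 (k : comPzRingType) (A : dgcat k) (X Y Z : A) i j l
    (e : i + j = l) (f : dghom X Y j) :
  dgcomp e (0 : dghom Y Z i) f = 0.
Proof. by have [h0 hN _ hZ] := linear_props (dgcomp_linearl (Z := Z) e f); first [exact: h0 | exact: hN | exact: hZ]. Qed.

Lemma dgcompr0 (k : comPzRingType) (A : dgcat k) (X Y Z : A) i j l
    (e : i + j = l) (g : dghom Y Z i) :
  dgcomp e g (0 : dghom X Y j) = 0.
Proof. by have [h0 hN _ hZ] := linear_props (dgcomp_linearr (X := X) e g); first [exact: h0 | exact: hN | exact: hZ]. Qed.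

Lemma dgcompZ (k : comPzRingType) (A : dgcat k) (X Y Z : A) i j l
    (e : i + j = l) a (g : dghom Y Z i) (f : dghom X Y j) :
  dgcomp e (a *: g) f = a *: dgcomp e g f.
Proof. by have [h0 hN _ hZ] := linear_props (dgcomp_linearl (Z := Z) e f); first [exact: h0 | exact: hN | exact: hZ]. Qed.

Lemma dgcompZr (k : comPzRingType) (A : dgcat k) (X Y Z : A) i j l
    (e : i + j = l) a (g : dghom Y Z i) (f : dghom X Y j) :
  dgcomp e g (a *: f) = a *: dgcomp e g f.
Proof. by have [h0 hN _ hZ] := linear_props (dgcomp_linearr (X := X) e g); first [exact: h0 | exact: hN | exact: hZ]. Qed.

Lemma cd0 (k : comPzRingType) (M : cplx k) i j (e : i + 1 = j) :
  cd e (0 : M i) = 0.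
Proof. by have [h0 hN hD hZ] := linear_props (cd_linear (c := M) e); first [exact: h0 | exact: hN | exact: hD | exact: hZ]. Qed.

Lemma cdN (k : comPzRingType) (M : cplx k) i j (e : i + 1 = j) (x : M i) :
  cd e (- x) = - cd e x.
Proof. by have [h0 hN hD hZ] := linear_props (cd_linear (c := M) e); first [exact: h0 | exact: hN | exact: hD | exact: hZ]. Qed.

Lemma cdD (k : comPzRingType) (M : cplx k) i j (e : i + 1 = j) (x y : M i) :
  cd e (x + y) = cd e x + cd e y.
Proof. by have [h0 hN hD hZ] := linear_props (cd_linear (c := M) e); first [exact: h0 | exact: hN | exact: hD | exact: hZ]. Qed.

Lemma cdZ (k : comPzRingType) (M : cplx k) i j (e : i + 1 = j) a (x : M i) :
  cd e (a *: x) = a *: cd e x.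
Proof. by have [h0 hN hD hZ] := linear_props (cd_linear (c := M) e); first [exact: h0 | exact: hN | exact: hD | exact: hZ]. Qed.

Lemma dg_d1 (k : comPzRingType) (A : dgcat k) (X : A) (e : 0 + 1 = 1) :
  cd e (dgid X) = 0.
Proof.
have := dg_leibniz (addr0 0) e e e (addr0 1) e (dgid X) (dgid X).
rewrite !dgcomp1l dgcomp1r expr0 scale1r => /eqP.
by rewrite -subr_eq0 opprD addNKr oppr_eq0 => /eqP.
Qed.

Lemma dgop_sign (a b : int) (k : comPzRingType) :
  ((-1) ^+ (absz (a + 1)%R * absz b)%N : k) =
  (-1) ^+ (`|a| * `|b|)%N * (-1) ^+ `|b|%N.
Proof.
rewrite -exprD -signr_odd -[RHS]signr_odd; congr (_ ^+ _).
rewrite oddD !oddM.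
have -> : odd (absz (a + 1)) = ~~ odd (absz a) by lia.
by case: (odd _); case: (odd _).
Qed.

(* [g^op o f^op = (-1)^(|f||g|) (f o g)^op] *)
Definition dgop_comp (k : comPzRingType) (A : dgcat k) (X Y Z : A) (i j l : int)
    (e : i + j = l) (g : dghom Z Y i) (f : dghom Y X j) : dghom Z X l :=
  (-1) ^+ (`|i| * `|j|)%N *: dgcomp (etrans (addrC j i) e) f g.

Definition dgop (k : comPzRingType) (A : dgcat k) : dgcat k.
Proof.
refine (@DGCat k A (fun X Y => dghom Y X)
  (fun X Y Z i j l e g f => dgop_comp e g f) (@dgid k A) _ _ _ _ _ _).
- move=> X Y Z i j l e f a g h; rewrite /dgop_comp (dgcomp_linearr _ f).
  by rewrite scalerDr !scalerA mulrC.
- move=> X Y Z i j l e g a f h; rewrite /dgop_comp (dgcomp_linearl _ g).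
  by rewrite scalerDr !scalerA mulrC.
- move=> X Y Z T a b c ab bc abc e1 e2 e3 e4 h g f; rewrite /dgop_comp.
  rewrite dgcompZ dgcompZr !scalerA.
  rewrite -(dgcompA (etrans (addrC c b) e3) (etrans (addrC bc a) e4)).
  congr (_ *: _); subst; rewrite -!exprD -signr_odd -[RHS]signr_odd.
  by congr (_ ^+ _); lia.
- by move=> X Y i e f; rewrite /dgop_comp mul0n expr0 scale1r dgcomp1r.
- by move=> X Y i e f; rewrite /dgop_comp muln0 expr0 scale1r dgcomp1l.
- move=> X Y Z i j l i' j' l' e el ei ej e1 e2 g f; rewrite /dgop_comp.
  have f1 : j' + i = l' by rewrite addrC.
  have f2 : j + i' = l' by rewrite addrC.
  rewrite cdZ (dg_leibniz _ el ej ei f1 f2) scalerDr [LHS]addrC; congr (_ + _).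
    rewrite scalerA; subst; rewrite dgop_sign.
    by congr (_ *: _); exact: dgcomp_irr.
  have sE : ((-1) ^+ (`|i| * `|j|)%N : k) = (-1) ^+ `|i|%N * (-1) ^+ (`|i| * `|j'|)%N.
    rewrite [(`|i| * `|j'|)%N]mulnC -ej dgop_sign mulrCA -exprD addnn -[X in _ * X]signr_odd.
    by rewrite odd_double mulr1 mulnC.
  by rewrite scalerA -sE; congr (_ *: _); exact: dgcomp_irr.
Defined.

Definition cocycle (k : comPzRingType) (M : cplx k) (i : int) (x : M i) : Prop :=
  cd (erefl (i + 1)) x = 0.

(* [x] and [y] represent the same class in [H^i(M)] when they are cocycles *)
Definition cohomologous (k : comPzRingType) (M : cplx k) (i : int) (x y : M i) : Prop :=
  exists z : M (i - 1), cd (subrK 1 i) z = x - y.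

Definition H_zero (k : comPzRingType) (M : cplx k) (i : int) : Prop :=
  forall x : M i, cocycle x -> cohomologous x 0.

Definition H_inj (k : comPzRingType) (M N : cplx k) (phi : cmap M N) (i : int) : Prop :=
  forall x y : M i, cocycle x -> cocycle y ->
    cohomologous (phi i x) (phi i y) -> cohomologous x y.

Definition H_surj (k : comPzRingType) (M N : cplx k) (phi : cmap M N) (i : int) : Prop :=
  forall y : N i, cocycle y -> exists2 x : M i, cocycle x & cohomologous (phi i x) y.

Definition H_bij (k : comPzRingType) (M N : cplx k) (phi : cmap M N) (i : int) : Prop :=
  H_inj phi i /\ H_surj phi i.

Definition ctr (k : comPzRingType) (M : cplx k) (i j : int) (e : i = j) (x : M i) : M j :=
  eq_rect i (fun l => M l) x j e.

Lemma cd_ctr (k : comPzRingType) (M : cplx k) (i j l : int) (e : i = j)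
    (e' : j + 1 = l) (e'' : i + 1 = l) (x : M i) :
  cd e' (ctr e x) = cd e'' x.
Proof. by case: j / e e' => e' /=; exact: cplx_irr. Qed.

Lemma ctr_cd (k : comPzRingType) (M : cplx k) (i j l : int) (e : j = l)
    (e' : i + 1 = j) (e'' : i + 1 = l) (x : M i) :
  ctr e (cd e' x) = cd e'' x.
Proof. by case: l / e e'' => e'' /=; exact: cplx_irr. Qed.

Lemma ctr_comp (k : comPzRingType) (A : dgcat k) (X Y Z : A) (i j l l' : int)
    (e : l = l') (e1 : i + j = l) (e2 : i + j = l') (g : dghom Y Z i) (f : dghom X Y j) :
  ctr e (dgcomp e1 g f) = dgcomp e2 g f.
Proof. by case: l' / e e2 => e2 /=; exact: dgcomp_irr. Qed.

Lemma ctr_linear (k : comPzRingType) (M : cplx k) (i j : int) (e : i = j) :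
  linear (@ctr k M i j e).
Proof. by case: j / e. Qed.

Lemma fib_eq (i j : int) : i + 1 = j -> i = j - 1.
Proof. by move=> <-; rewrite addrK. Qed.

Lemma fib_eq' (i j : int) : i + 1 = j -> (i - 1) + 1 = j - 1.
Proof. by move=> <-; rewrite subrK addrK. Qed.

Definition fib_d (k : comPzRingType) (M N : cplx k) (phi : cmap M N) (i j : int)
    (e : i + 1 = j) (x : M i * N (i - 1)) : M j * N (j - 1) :=
  (cd e x.1, - ctr (fib_eq e) (phi i x.1) - cd (fib_eq' e) x.2).

Definition fib (k : comPzRingType) (M N : cplx k) (phi : cmap M N) : cplx k.
Proof.
refine (@Cplx k (fun i => (M i * N (i - 1))%type) (@fib_d k M N phi) _ _).
- move=> i j e a [x1 x2] [y1 y2]; rewrite /fib_d /=; congr pair => /=.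
    exact: cd_linear.
  rewrite (cfun_linear phi) ctr_linear (cd_linear (c := N)).
  by rewrite !opprD scalerBr scalerN addrACA.
- move=> i j l e e' [x1 x2]; rewrite /fib_d /=; congr pair => /=.
    exact: cd_cd.
  have e2 : i + 1 = l - 1 by rewrite -e' addrK.
  rewrite (cfun_d phi) (ctr_cd _ _ e2) cdD !cdN cd_cd oppr0 addr0.
  have e3 : j - 1 + 1 = l - 1 by lia.
  by rewrite (cd_ctr _ _ e2) opprK addNr.
Defined.

Record closed0 (k : comPzRingType) (A : dgcat k) (X Y : A) := Closed0 {
  c0 :> dghom X Y 0;
  c0_closed : cocycle c0 }.

Definition closed0_id (k : comPzRingType) (A : dgcat k) (X : A) : closed0 X X :=
  Closed0 (dg_d1 X (erefl _)).

Definition closed0_op (k : comPzRingType) (A : dgcat k) (X Y : A) (f : closed0 X Y) :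
    @closed0 k (dgop A) Y X :=
  @Closed0 k (dgop A) Y X (c0 f) (c0_closed f).

Lemma closed0_d (k : comPzRingType) (A : dgcat k) (X Y : A) (f : closed0 X Y) j
    (e : 0 + 1 = j) : cd e (c0 f) = 0.
Proof. by case: j / e; exact: c0_closed. Qed.

Definition postcomp (k : comPzRingType) (A : dgcat k) (W X Y : A) (f : closed0 X Y) :
  cmap (dghom W X) (dghom W Y).
Proof.
refine (@Cmap k _ _ (fun i u => dgcomp (add0r i) f u) _ _).
- by move=> i a u v; exact: (dgcomp_linearr (X := W)).
- move=> i j e u.
  rewrite (dg_leibniz _ e (erefl (0 + 1)) e (etrans (addrC _ _) e) (add0r j)).
  by rewrite closed0_d dgcomp0 add0r expr0 scale1r.
Defined.

Definition precomp (k : comPzRingType) (A : dgcat k) (X Y W : A) (f : closed0 X Y) :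
  cmap (dghom Y W) (dghom X W).
Proof.
refine (@Cmap k _ _ (fun i u => dgcomp (addr0 i) u f) _ _).
- by move=> i a u v; exact: (dgcomp_linearl (Z := W)).
- move=> i j e u.
  rewrite (dg_leibniz _ e e (erefl (0 + 1)) (addr0 j) e).
  by rewrite closed0_d dgcompr0 scaler0 addr0.
Defined.

Record hcomplex3 (k : comPzRingType) (A : dgcat k) (X Y Z : A) := HComplex3 {
  hc_f : closed0 X Y;
  hc_g : closed0 Y Z;
  hc_h : dghom X Z (-1);
  hc_d : cd (addNr 1) hc_h = - dgcomp (addr0 0) (c0 hc_g) (c0 hc_f) }.

Definition to_fib (k : comPzRingType) (A : dgcat k) (X Y Z : A)
    (T : hcomplex3 X Y Z) (W : A) :
  cmap (dghom W X) (fib (postcomp W (hc_g T))).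
Proof.
refine (@Cmap k _ _ (fun i (u : dghom W X i) =>
  (dgcomp (add0r i) (hc_f T) u, dgcomp (addrC (-1) i) (hc_h T) u)
    : fib (postcomp W (hc_g T)) i) _ _).
- by move=> i a u v; congr pair; exact: (dgcomp_linearr (X := W)).
- move=> i j e u; rewrite /= /fib_d /=; congr pair.
    exact: (cfun_d (postcomp W (hc_f T)) e u).
  rewrite (dg_leibniz _ _ (addNr 1) e (etrans (add0r i) (fib_eq e)) (addrC (-1) j)).
  rewrite hc_d dgcompN expr1 scaleN1r opprD opprK addrA.
  rewrite (ctr_comp _ _ (etrans (add0r i) (fib_eq e))).
  rewrite (dgcompA (addr0 0) (etrans (add0r i) (fib_eq e)) (add0r i)
    (etrans (add0r i) (fib_eq e))).
  by rewrite opprK addNr add0r.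
Defined.

Definition from_cofib (k : comPzRingType) (A : dgcat k) (X Y Z : A)
    (T : hcomplex3 X Y Z) (W : A) :
  cmap (dghom Z W) (fib (precomp W (hc_f T))).
Proof.
refine (@Cmap k _ _ (fun i (u : dghom Z W i) =>
  (dgcomp (addr0 i) u (hc_g T), (-1) ^+ `|i|%N *: dgcomp (erefl (i - 1)) u (hc_h T))
    : fib (precomp W (hc_f T)) i) _ _).
- move=> i a u v; congr pair; first exact: (dgcomp_linearl (Z := W)).
  by rewrite /= (dgcomp_linearl (Z := W)) scalerDr !scalerA mulrC -scalerA.
- move=> i j e u; rewrite /= /fib_d /=; congr pair.
    exact: (cfun_d (precomp W (hc_g T)) e u).
  rewrite cdZ (dg_leibniz _ _ e (addNr 1) (erefl (j - 1)) (etrans (addr0 i) (fib_eq e))).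
  rewrite hc_d dgcompNr scalerDr !scalerN scalerA.
  have -> : (-1) ^+ `|i|%N * (-1) ^+ `|i|%N = 1 :> k.
    by rewrite -exprD addnn -signr_odd odd_double.
  rewrite scale1r.
  rewrite (ctr_comp _ _ (etrans (addr0 i) (fib_eq e))).
  rewrite (dgcompA (addr0 i) (etrans (addr0 i) (fib_eq e)) (addr0 0)
    (etrans (addr0 i) (fib_eq e))).
  rewrite opprB addrA [- _ + _]addrC subrr sub0r -scaleNr; congr (_ *: _).
  rewrite -[RHS]mulN1r -exprS -e -signr_odd -[RHS]signr_odd; congr (_ ^+ _).
  by lia.
Defined.

Definition left_exact (k : comPzRingType) (A : dgcat k) (X Y Z : A)
    (T : hcomplex3 X Y Z) : Prop :=
  forall (W : A) (i : int), i <= 0 -> H_bij (to_fib T W) i.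

Definition right_exact (k : comPzRingType) (A : dgcat k) (X Y Z : A)
    (T : hcomplex3 X Y Z) : Prop :=
  forall (W : A) (i : int), i <= 0 -> H_bij (from_cofib T W) i.

Definition homotopy_ses (k : comPzRingType) (A : dgcat k) (X Y Z : A)
    (T : hcomplex3 X Y Z) : Prop :=
  left_exact T /\ right_exact T.

Definition has_homotopy_kernel (k : comPzRingType) (A : dgcat k) (Y Z : A)
    (g : closed0 Y Z) : Prop :=
  exists (X : A) (T : hcomplex3 X Y Z), hc_g T = g /\ left_exact T.

Definition has_homotopy_cokernel (k : comPzRingType) (A : dgcat k) (X Y : A)
    (f : closed0 X Y) : Prop :=
  exists (Z : A) (T : hcomplex3 X Y Z), hc_f T = f /\ right_exact T.

Definition n_mono (k : comPzRingType) (n : nat) (A : dgcat k) (X Y : A)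
    (f : closed0 X Y) : Prop :=
  forall W : A, H_inj (postcomp W f) (- n%:Z + 1) /\
    (forall i : int, i <= - n%:Z -> H_bij (postcomp W f) i).

Definition n_epi (k : comPzRingType) (n : nat) (A : dgcat k) (X Y : A)
    (f : closed0 X Y) : Prop :=
  n_mono n (closed0_op f).

Definition dg_truncated (k : comPzRingType) (n : nat) (A : dgcat k) : Prop :=
  forall (X Y : A) (i : int), i <= - n%:Z -> H_zero (dghom X Y) i.

Definition comp0 (k : comPzRingType) (A : dgcat k) (X Y Z : A)
    (g : closed0 Y Z) (f : closed0 X Y) : dghom X Z 0 :=
  dgcomp (addr0 0) (c0 g) (c0 f).

(* The morphisms [X -> Y] of [H^0(A)] are the closed morphisms of degree 0 up to
   [cohomologous]; [H^0(A)] is preadditive, hence additive as soon as it has a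
   zero object and binary biproducts. *)
Definition H0_zero_object (k : comPzRingType) (A : dgcat k) (O : A) : Prop :=
  forall X : A, (forall f : closed0 X O, cohomologous (c0 f) 0) /\
    (forall f : closed0 O X, cohomologous (c0 f) 0).

Definition H0_biproduct (k : comPzRingType) (A : dgcat k) (X Y S : A)
    (i1 : closed0 X S) (i2 : closed0 Y S) (p1 : closed0 S X) (p2 : closed0 S Y) : Prop :=
  [/\ cohomologous (comp0 p1 i1) (dgid X), cohomologous (comp0 p2 i2) (dgid Y),
      cohomologous (comp0 p1 i2) 0, cohomologous (comp0 p2 i1) 0
    & cohomologous (comp0 i1 p1 + comp0 i2 p2) (dgid S)].

Definition H0_additive (k : comPzRingType) (A : dgcat k) : Prop :=
  (exists O : A, H0_zero_object O) /\
  (forall X Y : A, exists (S : A) (i1 : closed0 X S) (i2 : closed0 Y S)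
     (p1 : closed0 S X) (p2 : closed0 S Y), H0_biproduct i1 i2 p1 p2).

Definition abelian_truncated_dg (k : comPzRingType) (n : nat) (A : dgcat k) : Prop :=
  [/\ dg_truncated n A,
      [/\ H0_additive A,
          (forall (Y Z : A) (g : closed0 Y Z), has_homotopy_kernel g)
        & (forall (X Y : A) (f : closed0 X Y), has_homotopy_cokernel f)],
      (forall (X Y Z : A) (T : hcomplex3 X Y Z),
         right_exact T -> n_mono n (hc_f T) -> homotopy_ses T)
    & (forall (X Y Z : A) (T : hcomplex3 X Y Z),
         left_exact T -> n_epi n (hc_g T) -> homotopy_ses T)].

(* order-preserving maps [m] -> [n] *)
Record dmap (m n : nat) := Dmap {
  dfun :> 'I_m.+1 -> 'I_n.+1;
  dfun_homo : forall i j : 'I_m.+1, (i <= j)%N -> (dfun i <= dfun j)%N }.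

Lemma dmap_eq (m n : nat) (a b : dmap m n) : a =1 b -> a = b.
Proof.
case: a b => [a ha] [b hb] /= e; have {e} e := functional_extensionality _ _ e.
by case: b / e hb => hb; congr Dmap; exact: proof_irrelevance.
Qed.

Definition did (n : nat) : dmap n n := @Dmap n n id (fun _ _ h => h).

Definition dcomp (l m n : nat) (a : dmap m n) (b : dmap l m) : dmap l n :=
  @Dmap l n (a \o b) (fun i j h => dfun_homo a (dfun_homo b h)).

Definition dconst (m n : nat) (i : 'I_n.+1) : dmap m n :=
  @Dmap m n (fun=> i) (fun _ _ _ => leqnn i).

Lemma dface_homo (n : nat) (h : 'I_n.+2) (i j : 'I_n.+1) :
  (i <= j)%N -> (lift h i <= lift h j)%N.
Proof. by rewrite /= leq_bump2. Qed.

(* the coface map omitting the vertex [h] *)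
Definition dface (n : nat) (h : 'I_n.+2) : dmap n n.+1 :=
  @Dmap n n.+1 (lift h) (@dface_homo n h).

Lemma drev_homo (m n : nat) (a : dmap m n) (i j : 'I_m.+1) :
  (i <= j)%N -> (rev_ord (a (rev_ord i)) <= rev_ord (a (rev_ord j)))%N.
Proof.
move=> h; rewrite /= leq_sub2l // ltnS; apply: dfun_homo.
by rewrite /= leq_sub2l.
Qed.

Definition drev (m n : nat) (a : dmap m n) : dmap m n := Dmap (drev_homo a).

(* [m] * [j], the ordinal sum, is [m + j.+1]: the first [m.+1] elements form [m]
   and the last [j.+1] form [j] *)
Definition dsum_fun (m' m j' j : nat) (a : dmap m' m) (b : dmap j' j)
    (i : 'I_(m'.+1 + j'.+1)) : 'I_(m.+1 + j.+1) :=
  match split i with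
  | inl u => lshift j.+1 (a u)
  | inr v => rshift m.+1 (b v)
  end.

Lemma dsum_homo (m' m j' j : nat) (a : dmap m' m) (b : dmap j' j)
    (x y : 'I_(m'.+1 + j'.+1)) :
  (x <= y)%N -> (dsum_fun a b x <= dsum_fun a b y)%N.
Proof.
rewrite /dsum_fun; case: (splitP x) => u eu; case: (splitP y) => v ev h /=.
- by apply: dfun_homo; rewrite -eu -ev.
- by rewrite (leq_trans (ltnW (ltn_ord _))) // leq_addr.
- by move: h; rewrite eu ev leqNgt ltn_addr.
- by rewrite leq_add2l; apply: dfun_homo; rewrite -(leq_add2l m'.+1) -eu -ev.
Qed.

Definition dsum (m' m j' j : nat) (a : dmap m' m) (b : dmap j' j) :
    dmap (m' + j'.+1) (m + j.+1) :=
  @Dmap (m' + j'.+1) (m + j.+1) (dsum_fun a b) (@dsum_homo m' m j' j a b).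

Definition dinl (m j : nat) : dmap m (m + j.+1) :=
  @Dmap m (m + j.+1) (@lshift m.+1 j.+1) (fun _ _ h => h).

Lemma dinr_homo (m j : nat) (x y : 'I_j.+1) :
  (x <= y)%N -> (rshift m.+1 x <= rshift m.+1 y)%N.
Proof. by rewrite /= leq_add2l. Qed.

Definition dinr (m j : nat) : dmap j (m + j.+1) :=
  @Dmap j (m + j.+1) (@rshift m.+1 j.+1) (@dinr_homo m j).

Lemma dsum_id (m j : nat) : dsum (did m) (did j) = did (m + j.+1).
Proof.
apply: dmap_eq => i; rewrite /= /dsum_fun; apply: val_inj.
by case: splitP => /= u ->.
Qed.

Lemma dsum_comp (m'' m' m j'' j' j : nat) (a : dmap m' m) (a' : dmap m'' m')
    (b : dmap j' j) (b' : dmap j'' j') :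
  dsum (dcomp a a') (dcomp b b') = dcomp (dsum a b) (dsum a' b').
Proof.
apply: dmap_eq => i; rewrite /= /dsum_fun.
by case: (@split m''.+1 j''.+1 i) => u; rewrite (unsplitK (inl _)) || rewrite (unsplitK (inr _)).
Qed.

Lemma dsum_inl (m' m j' j : nat) (a : dmap m' m) (b : dmap j' j) :
  dcomp (dsum a b) (dinl m' j') = dcomp (dinl m j) a.
Proof. by apply: dmap_eq => i; rewrite /= /dsum_fun (unsplitK (inl _)). Qed.

Lemma dsum_inr (m' m j' j : nat) (a : dmap m' m) (b : dmap j' j) :
  dcomp (dsum a b) (dinr m' j') = dcomp (dinr m j) b.
Proof. by apply: dmap_eq => i; rewrite /= /dsum_fun (unsplitK (inr _)). Qed.

Lemma dsum_exch (m n i j : nat) (a : dmap m n) (b : dmap i j) :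
  dcomp (dsum (did n) b) (dsum a (did i)) = dcomp (dsum a (did j)) (dsum (did m) b).
Proof. by rewrite -!dsum_comp; congr dsum; exact: dmap_eq. Qed.

Lemma dsum_compl (l m n j : nat) (a : dmap m n) (b : dmap l m) :
  dsum (dcomp a b) (did j) = dcomp (dsum a (did j)) (dsum b (did j)).
Proof. by rewrite -dsum_comp; congr dsum; exact: dmap_eq. Qed.

Lemma dmap0_irr (m : nat) (a b : dmap m 0) : a = b.
Proof. by apply: dmap_eq => i; rewrite !ord1. Qed.

Record sset := SSet {
  simp :> nat -> Type;
  act : forall m n : nat, dmap m n -> simp n -> simp m;
  act_id : forall n (x : simp n), act (did n) x = x;
  act_comp : forall l m n (a : dmap m n) (b : dmap l m) (x : simp n),
    act (dcomp a b) x = act b (act a x) }.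

Record smap (K L : sset) := SMap {
  sfun :> forall n : nat, K n -> L n;
  sfun_act : forall m n (a : dmap m n) (x : K n),
    @sfun m (act a x) = act a (@sfun n x) }.

Definition sset_op (C : sset) : sset.
Proof.
refine (@SSet C (fun m n a x => act (drev a) x) _ _).
- move=> n x; rewrite -[RHS]act_id; congr act.
  by apply: dmap_eq => i; rewrite /= rev_ordK.
- move=> l m n a b x; rewrite -act_comp; congr act.
  by apply: dmap_eq => i; rewrite /= rev_ordK.
Defined.

Definition std (n : nat) : sset.
Proof.
refine (@SSet (fun j => dmap j n) (fun _ _ a x => dcomp x a) _ _).
- by move=> m x; exact: dmap_eq.
- by move=> l m j a b x; exact: dmap_eq.
Defined.

Definition sset_prod (K L : sset) : sset.
Proof.
refine (@SSet (fun n => (K n * L n)%type) (fun m n a x => (act a x.1, act a x.2)) _ _).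
- by move=> n [x y]; rewrite !act_id.
- by move=> l m n a b [x y]; rewrite !act_comp.
Defined.

(* the constant simplicial set, i.e. the discrete diagram shape on [T] *)
Definition sset_disc (T : Type) : sset :=
  @SSet (fun _ => T) (fun _ _ _ x => x) (fun _ _ => erefl) (fun _ _ _ _ _ _ => erefl).

Lemma sig_eq (T : Type) (P : T -> Prop) (x y : {x : T | P x}) :
  proj1_sig x = proj1_sig y -> x = y.
Proof.
case: x y => [x hx] [y hy] /= e; case: y / e hy => hy.
by congr exist; exact: proof_irrelevance.
Qed.

(* the simplicial subset of [K] cut out by a stable family [P] *)
Definition sset_sub (K : sset) (P : forall n, K n -> Prop)
    (hP : forall m n (a : dmap m n) (x : K n), P n x -> P m (act a x)) : sset.
Proof.
refine (@SSet (fun n => {x : K n | P n x})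
  (fun m n a x => exist _ (act a (proj1_sig x)) (hP m n a _ (proj2_sig x))) _ _).
- by move=> n x; apply: sig_eq; rewrite /= act_id.
- by move=> l m n a b x; apply: sig_eq; rewrite /= act_comp.
Defined.

Definition in_boundary (n j : nat) (a : std n j) : Prop :=
  exists i : 'I_n.+1, forall u : 'I_j.+1, a u <> i.

Lemma in_boundary_act (n m j : nat) (b : dmap m j) (a : std n j) :
  in_boundary a -> in_boundary (act b a).
Proof. by move=> [i h]; exists i => u; exact: h. Qed.

Definition boundary (n : nat) : sset := sset_sub (@in_boundary_act n).

Definition in_horn (n : nat) (i : 'I_n.+1) (j : nat) (a : std n j) : Prop :=
  exists2 l : 'I_n.+1, l <> i & forall u : 'I_j.+1, a u <> l.

Lemma in_horn_act (n : nat) (i : 'I_n.+1) (m j : nat) (b : dmap m j) (a : std n j) :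
  in_horn i a -> in_horn i (act b a).
Proof. by move=> [l hl h]; exists l => // u; exact: h. Qed.

Definition horn (n : nat) (i : 'I_n.+1) : sset := sset_sub (@in_horn_act n i).

(* By the Yoneda lemma, an extension to [std n] of a map defined on a simplicial
   subset of [std n] is an [n]-simplex with the prescribed restrictions. *)
Definition fills (n : nat) (P : forall j, std n j -> Prop)
    (hP : forall m j (a : dmap m j) (x : std n j), P j x -> P m (act a x))
    (C : sset) (u : smap (sset_sub hP) C) (x : C n) : Prop :=
  forall j (a : sset_sub hP j), act (proj1_sig a : dmap j n) x = u j a.

Definition is_quasicategory (C : sset) : Prop :=
  forall (n : nat) (i : 'I_n.+1), (0 < i < n)%N ->
  forall u : smap (horn i) C, exists x : C n, fills u x.

Definition degenerate (K : sset) (n : nat) (x : K n) : Prop :=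
  exists (m : nat) (a : dmap n m) (y : K m), (m < n)%N /\ x = act a y.

Definition finite_sset (K : sset) : Prop :=
  exists s : list {n : nat & K n},
    forall n (x : K n), ~ degenerate x -> List.In (existT _ n x) s.

Definition vertex (C : sset) (n : nat) (i : 'I_n.+1) (x : C n) : C 0 :=
  act (dconst 0 i) x.

Definition src (C : sset) (e : C 1) : C 0 := vertex ord0 e.
Definition tgt (C : sset) (e : C 1) : C 0 := vertex ord_max e.

(* the totally degenerate [n]-simplex at a vertex *)
Definition const_simplex (C : sset) (n : nat) (x : C 0) : C n :=
  act (dconst n ord0) x.

Definition idarrow (C : sset) (x : C 0) : C 1 := const_simplex 1 x.

(* [h] is a composite of [f] followed by [g] *)
Definition composite (C : sset) (f g h : C 1) : Prop :=
  exists s : C 2, [/\ act (dface (inord 2)) s = f, act (dface (inord 0)) s = g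
    & act (dface (inord 1)) s = h].

Definition is_equivalence (C : sset) (f : C 1) : Prop :=
  exists g : C 1, composite f g (idarrow (src f)) /\ composite g f (idarrow (tgt f)).

(* The slice [C_(/p)]: an [m]-simplex is a map [Delta^m * K -> C] out of the join
   extending [p]. Such a map is given by its restriction to [Delta^m] and by its
   values on the simplices [Delta^m * Delta^j -> Delta^m * K] induced by the
   [j]-simplices of [K]. *)
Record slice_simplex (K C : sset) (p : smap K C) (m : nat) := SliceSimplex {
  sl_front : C m;
  sl_join :> forall j : nat, K j -> C (m + j.+1)%N;
  sl_nat : forall i j (b : dmap i j) (x : K j),
    sl_join (act b x) = act (dsum (did m) b) (sl_join x);
  sl_inl : forall j (x : K j), act (dinl m j) (sl_join x) = sl_front;
  sl_inr : forall j (x : K j), act (dinr m j) (sl_join x) = p j x }.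

Lemma slice_simplex_eq (K C : sset) (p : smap K C) (m : nat) (s t : slice_simplex p m) :
  sl_front s = sl_front t -> (forall j x, s j x = t j x) -> s = t.
Proof.
case: s t => [sf sj sn sl sr] [tf tj tn tl tr] /= ef ej.
have {}ej : sj = tj.
  by apply: functional_extensionality_dep => j; exact: functional_extensionality.
case: tf / ef tl => tl; case: tj / ej tn tl tr => tn tl tr.
by congr SliceSimplex; exact: proof_irrelevance.
Qed.

Definition slice_act (K C : sset) (p : smap K C) (m n : nat) (a : dmap m n)
    (s : slice_simplex p n) : slice_simplex p m.
Proof.
refine (@SliceSimplex K C p m (act a (sl_front s))
  (fun j x => act (dsum a (did j)) (s j x)) _ _ _).
- move=> i j b x; by rewrite sl_nat -!act_comp dsum_exch.
- by move=> j x; rewrite -act_comp dsum_inl act_comp sl_inl.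
- by move=> j x; rewrite -act_comp dsum_inr act_comp sl_inr act_id.
Defined.

Definition slice (K C : sset) (p : smap K C) : sset.
Proof.
refine (@SSet (slice_simplex p) (@slice_act K C p) _ _).
- move=> n s; apply: slice_simplex_eq => [|j x] /=; first exact: act_id.
  by rewrite dsum_id act_id.
- move=> l m n a b s; apply: slice_simplex_eq => [|j x] /=; first exact: act_comp.
  by rewrite -act_comp -dsum_compl.
Defined.

(* [t] is final: [D_(/t) -> D] is a trivial Kan fibration *)
Definition terminal (D : sset) (t : D 0) : Prop :=
  forall (n : nat) (u : smap (boundary n.+1) D),
    (forall v : boundary n.+1 0,
       (proj1_sig v : dmap 0 n.+1) ord0 = ord_max -> u 0 v = t) ->
    exists x : D n.+1, fills u x.

Definition initial (D : sset) (t : D 0) : Prop := @terminal (sset_op D) t.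

Definition is_limit (K C : sset) (p : smap K C) (t : slice p 0) : Prop := terminal t.

Definition has_limit (K C : sset) (p : smap K C) : Prop :=
  exists t : slice p 0, is_limit t.

Definition has_finite_limits (C : sset) : Prop :=
  forall (K : sset) (p : smap K C), finite_sset K -> has_limit p.

Definition has_finite_colimits (C : sset) : Prop := has_finite_limits (sset_op C).

(* For [s : C j], the fiber over [E] of [C_(/s) -> C]. For [j = 0] this is the
   right-pinched mapping space [Hom^R_C(E, s)]. *)
Definition in_pinch (C : sset) (E : C 0) (j : nat) (s : C j) (m : nat)
    (x : C (m + j.+1)%N) : Prop :=
  act (dinl m j) x = const_simplex m E /\ act (dinr m j) x = s.

Definition decalage (C : sset) (j : nat) : sset.
Proof.
refine (@SSet (fun m => C (m + j.+1)%N) (fun m n a x => act (dsum a (did j)) x) _ _).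
- by move=> n x; rewrite dsum_id act_id.
- move=> l m n a b x; by rewrite -act_comp -dsum_compl.
Defined.

Lemma in_pinch_act (C : sset) (E : C 0) (j : nat) (s : C j) (m n : nat) (a : dmap m n)
    (x : decalage C j n) :
  in_pinch E s (x : C (n + j.+1)%N) -> in_pinch E s (act a x : C (m + j.+1)%N).
Proof.
move=> [h1 h2]; split.
  by rewrite /= -act_comp dsum_inl act_comp h1 /const_simplex -act_comp; congr act;
    exact: dmap0_irr.
by rewrite /= -act_comp dsum_inr act_comp h2 act_id.
Qed.

Definition pinch (C : sset) (E : C 0) (j : nat) (s : C j) : sset :=
  @sset_sub (decalage C j) (@in_pinch C E j s) (@in_pinch_act C E j s).

Definition map_space (C : sset) (X Y : C 0) : sset := pinch X Y.

Definition pinch_restr (C : sset) (E : C 0) (j : nat) (s : C j) (i : nat) (b : dmap i j) :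
  smap (pinch E s) (pinch E (act b s)).
Proof.
unshelve refine (@SMap (pinch E s) (pinch E (act b s)) (fun m x =>
  exist _ (act (dsum (did m) b) (proj1_sig x)) _) _).
- case: x => x [h1 h2] /=; split.
    by rewrite -act_comp dsum_inl act_comp h1 act_id.
  by rewrite -act_comp dsum_inr act_comp h2.
- move=> m n a x; apply: sig_eq => /=; by rewrite -!act_comp dsum_exch.
Defined.

(* Composition with [f : X -> Y] on mapping spaces out of [E]. The restriction
   [pinch E f -> map_space E X] is a trivial Kan fibration when [C] is a
   quasicategory, so [map_space E X -> map_space E Y] is represented, up to a
   contractible choice of section, by the restriction of [pinch E f] to the target. *)
Definition post_comp (C : sset) (E : C 0) (f : C 1) :
    smap (pinch E f) (map_space E (tgt f)) :=
  pinch_restr E f (dconst 0 ord_max).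

(* for [K] a Kan complex; [k = -2] means contractible *)
Definition truncated (k : int) (K : sset) : Prop :=
  forall n : nat, k + 2 <= n%:Z ->
  forall u : smap (boundary n) K, exists x : K n, fills u x.

Definition in_fiber (K L : sset) (phi : smap K L) (b : L 0) (n : nat) (x : K n) : Prop :=
  phi n x = const_simplex n b.

Lemma in_fiber_act (K L : sset) (phi : smap K L) (b : L 0) (m n : nat) (a : dmap m n)
    (x : K n) : in_fiber phi b x -> in_fiber phi b (act a x).
Proof.
rewrite /in_fiber sfun_act => ->; rewrite /const_simplex -act_comp; congr act.
Qed.

Definition fiber (K L : sset) (phi : smap K L) (b : L 0) : sset :=
  sset_sub (@in_fiber_act K L phi b).

(* [post_comp E f] is a Kan fibration when [C] is a quasicategory, being obtained
   from the right fibration [C_(/f) -> C_(/Y)]; its fibers are therefore the homotopy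
   fibers of [map_space E X -> map_space E Y]. *)
Definition truncated_morphism (k : int) (C : sset) (f : C 1) : Prop :=
  forall (E : C 0) (b : map_space E (tgt f) 0), truncated k (fiber (post_comp E f) b).

Definition square_shape : sset := sset_prod (std 1) (std 1).

Definition square (C : sset) : Type := smap square_shape C.

Definition square_op (C : sset) (q : square C) : square (sset_op C).
Proof.
refine (@SMap square_shape (sset_op C)
  (fun n x => q n (drev x.1 , drev x.2)) _).
move=> m n a x; rewrite /= -sfun_act; congr (sfun _ _).
by congr pair; apply: dmap_eq => i; rewrite /= rev_ordK.
Defined.

Definition sq_vertex (C : sset) (q : square C) (a b : 'I_2) : C 0 :=
  q 0 (dconst 0 a, dconst 0 b).

(* the edge [(0,0) -> (1,0)] *)
Definition sq_top (C : sset) (q : square C) : C 1 := q 1 (did 1, dconst 1 ord0).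

(* the cospan [(1,0) -> (1,1) <- (0,1)] *)
Definition in_cospan (n : nat) (x : square_shape n) : Prop :=
  forall i : 'I_n.+1, ~ ((x.1 : dmap n 1) i = ord0 /\ (x.2 : dmap n 1) i = ord0).

Lemma in_cospan_act (m n : nat) (a : dmap m n) (x : square_shape n) :
  in_cospan x -> in_cospan (act a x).
Proof. by move=> h i; exact: (h (a i)). Qed.

Definition cospan_shape : sset := sset_sub in_cospan_act.

Definition sq_cospan (C : sset) (q : square C) : smap cospan_shape C :=
  @SMap cospan_shape C (fun n x => q n (proj1_sig x))
    (fun m n a x => sfun_act q a (proj1_sig x)).

Definition dcone_fun (j : nat) (a : dmap j 1) (i : 'I_(1 + j.+1)) : 'I_2 :=
  match split i with
  | inl _ => ord0
  | inr v => a v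
  end.

Lemma dcone_homo (j : nat) (a : dmap j 1) (x y : 'I_(1 + j.+1)) :
  (x <= y)%N -> (dcone_fun a x <= dcone_fun a y)%N.
Proof.
rewrite /dcone_fun; case: (splitP x) => u eu; case: (splitP y) => v ev h //=.
- by move: h; rewrite eu ev leqNgt ltn_addr.
- by apply: dfun_homo; rewrite -(leq_add2l 1) -eu -ev.
Qed.

(* [a] preceded by the vertex [0] *)
Definition dcone (j : nat) (a : dmap j 1) : dmap (0 + j.+1) 1 :=
  @Dmap (0 + j.+1) 1 (dcone_fun a) (@dcone_homo j a).

(* the cone over the cospan whose apex is the corner [(0,0)] *)
Definition sq_cone (C : sset) (q : square C) : slice (sq_cospan q) 0.
Proof.
refine (@SliceSimplex cospan_shape C (sq_cospan q) 0 (sq_vertex q ord0 ord0)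
  (fun j x => q (0 + j.+1)%N (dcone (proj1_sig x).1, dcone (proj1_sig x).2)) _ _ _).
- move=> i j b [[x y] h] /=; rewrite -sfun_act /=; congr (sfun _ _).
  congr pair; apply: dmap_eq => u; rewrite /= /dcone_fun /dsum_fun;
  by case: (@split 1 i.+1 u) => v; rewrite (unsplitK (inl _)) || rewrite (unsplitK (inr _)).
- move=> j [[x y] h] /=; rewrite -sfun_act /=; congr (sfun _ _).
  by congr pair; apply: dmap_eq => u; rewrite /= /dcone_fun (unsplitK (inl _)).
- move=> j [[x y] h] /=; rewrite -sfun_act /=; congr (sfun _ _).
  by congr pair; apply: dmap_eq => u; rewrite /= /dcone_fun (unsplitK (inr _)).
Defined.

Definition is_pullback (C : sset) (q : square C) : Prop := is_limit (sq_cone q).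
Definition is_pushout (C : sset) (q : square C) : Prop := is_pullback (square_op q).

Definition zero_object (C : sset) (z : C 0) : Prop := terminal z /\ initial z.

Definition zero_arrow (C : sset) (w : C 1) : Prop :=
  exists (z : C 0) (u v : C 1), [/\ zero_object z, tgt u = z & composite u v w].

(* For a coproduct cocone [s] and a product cone [t] on two families of objects,
   [m] is a map from the coproduct to the product whose [(a, b)] entry, from the
   [a]-th summand to the [b]-th factor, is an identity if [M a b] and zero otherwise. *)
Definition matrix_arrow (C : sset) (q : smap (sset_disc bool) (sset_op C))
    (p : smap (sset_disc bool) C) (s : slice q 0) (t : slice p 0)
    (M : bool -> bool -> bool) (m : C 1) : Prop :=
  [/\ src m = sl_front s, tgt m = sl_front t
    & forall a b : bool, exists u w : C 1,
        [/\ composite (sl_join s (a : sset_disc bool 0) : C 1) m u,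
            composite u (sl_join t (b : sset_disc bool 0) : C 1) w
          & if M a b then w = idarrow (q 0 a : C 0) else zero_arrow w]].

(* Preadditivity as the comparison [X + Y -> X x Y] being an equivalence; additive
   inverses as invertibility of the shear maps. *)
Definition additive_quasicategory (C : sset) : Prop :=
  [/\ (exists z : C 0, zero_object z),
      (forall p : smap (sset_disc bool) C, has_limit p),
      (forall q : smap (sset_disc bool) (sset_op C), has_limit q),
      (forall (q : smap (sset_disc bool) (sset_op C)) (p : smap (sset_disc bool) C)
         (s : slice q 0) (t : slice p 0) (m : C 1),
         (forall a : bool, q 0 a = p 0 a) -> is_limit s -> is_limit t ->
         matrix_arrow s t (fun a b => a == b) m -> is_equivalence m)
    & (* the shear map [(1, 0; 1, 1)] of [X + X] *)
      (forall (q : smap (sset_disc bool) (sset_op C)) (p : smap (sset_disc bool) C)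
         (X : C 0) (s : slice q 0) (t : slice p 0) (m : C 1),
         (forall a : bool, q 0 a = X) -> (forall a : bool, p 0 a = X) ->
         is_limit s -> is_limit t ->
         matrix_arrow s t (fun a b => a || ~~ b) m -> is_equivalence m)].

Definition cofiber_is_fiber (n : nat) (C : sset) : Prop :=
  forall q : square C,
    truncated_morphism (n%:Z - 2) (sq_top q) ->
    zero_object (sq_vertex q ord0 ord_max) ->
    is_pushout q -> is_pullback q.

Definition abelian_n1 (n : nat) (C : sset) : Prop :=
  is_quasicategory C /\
  [/\ additive_quasicategory C /\
        (forall X Y : C 0, truncated (n%:Z - 1) (map_space X Y)),
      has_finite_limits C /\ has_finite_colimits C,
      cofiber_is_fiber n C
    & cofiber_is_fiber n (sset_op C)].

(* [a <= s_1 <= ... <= s_m <= b] in [n] *)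
Definition wchain (n m : nat) (a : 'I_n.+1) (s : seq 'I_n.+1) (b : 'I_n.+1) : bool :=
  (size s == m) && path (fun i j : 'I_n.+1 => (i <= j)%N) a (rcons s b).

Definition strict_chain (n : nat) (a : 'I_n.+1) (s : seq 'I_n.+1) (b : 'I_n.+1) : bool :=
  path (fun i j : 'I_n.+1 => (i < j)%N) a (rcons s b).

Lemma wchain_pathE (n : nat) (a : 'I_n.+1) (s : seq 'I_n.+1) :
  path (fun i j : 'I_n.+1 => (i <= j)%N) a s = path leq a (map val s).
Proof. by elim: s a => //= x s IH a; rewrite IH. Qed.

Lemma strict_pathE (n : nat) (a : 'I_n.+1) (s : seq 'I_n.+1) :
  path (fun i j : 'I_n.+1 => (i < j)%N) a s = path ltn a (map val s).
Proof. by elim: s a => //= x s IH a; rewrite IH. Qed.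

Lemma wchain_split (n m j : nat) (a : 'I_n.+1) (s : seq 'I_n.+1) (b : 'I_n.+1) :
  wchain m.+1 a s b -> (j < m.+1)%N ->
  s = take j s ++ nth a s j :: drop j.+1 s.
Proof.
move=> /andP[/eqP sz _] hj.
by rewrite -drop_nth ?sz // cat_take_drop.
Qed.

Lemma wchain_face (n m : nat) (j : 'I_m.+1) (a : 'I_n.+1) (s : seq 'I_n.+1)
    (b : 'I_n.+1) :
  wchain m.+1 a s b -> wchain m a (take j s ++ drop j.+1 s) b.
Proof.
move=> h; have es := wchain_split h (ltn_ord j).
case/andP: (h) => /eqP sz hp; apply/andP; split.
  by rewrite size_cat size_take size_drop sz ltn_ord; apply/eqP; have := ltn_ord j; lia.
move: hp; rewrite {1}es !rcons_cat !wchain_pathE !map_cat !cat_path /=.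
case/andP=> -> /=; set r := map _ (rcons _ _); case: r => //= x r.
by case/and3P=> h1 h2 ->; rewrite (leq_trans h1 h2).
Qed.

Lemma wchain_take (n m : nat) (j : 'I_m.+1) (a : 'I_n.+1) (s : seq 'I_n.+1)
    (b : 'I_n.+1) :
  wchain m.+1 a s b -> wchain j a (take j s) (nth a s j).
Proof.
move=> h; have es := wchain_split h (ltn_ord j).
case/andP: (h) => /eqP sz hp; apply/andP; split.
  by rewrite size_take sz ltn_ord.
move: hp; rewrite {1}es rcons_cat rcons_cons -cat_rcons !wchain_pathE map_cat cat_path.
by case/andP.
Qed.

Lemma wchain_drop (n m : nat) (j : 'I_m.+1) (a : 'I_n.+1) (s : seq 'I_n.+1)
    (b : 'I_n.+1) :
  wchain m.+1 a s b -> wchain (m - j) (nth a s j) (drop j.+1 s) b.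
Proof.
move=> h; have es := wchain_split h (ltn_ord j).
case/andP: (h) => /eqP sz hp; apply/andP; split.
  by rewrite size_drop sz subSS.
move: hp; rewrite {1}es rcons_cat rcons_cons -cat_rcons !wchain_pathE map_cat cat_path.
by rewrite map_rcons last_rcons => /andP[].
Qed.

Lemma wchain_map (n n' m : nat) (al : dmap n n') (a : 'I_n.+1) (s : seq 'I_n.+1)
    (b : 'I_n.+1) :
  wchain m a s b -> wchain m (al a) (map al s) (al b).
Proof.
rewrite /wchain size_map => /andP[-> /=]; rewrite -map_rcons.
elim: (rcons s b) a => //= x r IH a /andP[h1 h2].
by rewrite (dfun_homo al h1) IH.
Qed.

Lemma nerve_deg (m : nat) : - (m.+1%:Z) + 1 = - m%:Z.
Proof. by lia. Qed.

Lemma nerve_deg_comp (m : nat) (j : 'I_m.+1) : - (m - j)%N%:Z + - j%:Z = - m%:Z.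
Proof. by have := ltn_ord j; lia. Qed.

(* The boundary formula of the DG-nerve. In Lurie's notation the chain is
   [i_- < i_m < ... < i_1 < i_+]: his [i_j] is the entry at position [m - j] of [s],
   and [Map(x, y)_m] is [dghom x y (- m)]. *)
Definition nerve_rhs (k : comPzRingType) (A : dgcat k) (n : nat) (nv : 'I_n.+1 -> A)
    (nm : forall m a s b, @wchain n m a s b -> dghom (nv a) (nv b) (- m%:Z))
    (m : nat) (a : 'I_n.+1) (s : seq 'I_n.+1) (b : 'I_n.+1) (h : wchain m.+1 a s b) :
    dghom (nv a) (nv b) (- m%:Z) :=
  \sum_(j < m.+1) (-1) ^+ (m.+1 - j)%N *:
    (nm _ _ _ _ (wchain_face j h) -
     dgcomp (nerve_deg_comp j) (nm _ _ _ _ (wchain_drop j h)) (nm _ _ _ _ (wchain_take j h))).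

(* An [n]-simplex consists of objects [X_0, ..., X_n] and morphisms [f_I] for
   [I = {a < s_1 < ... < s_m < b}]. The family is extended to weakly increasing
   sequences by [f_(a, a) = id] and [f_I = 0] on the other sequences with a
   repetition; these are the values that make the simplicial operators
   [f_I |-> f_(al I)], including for non-injective [al]. *)
Record nerve_simplex (k : comPzRingType) (A : dgcat k) (n : nat) := NerveSimplex {
  nv : 'I_n.+1 -> A;
  nm : forall m a s b, @wchain n m a s b -> dghom (nv a) (nv b) (- m%:Z);
  nm_id : forall a (h : wchain 0 a [::] a), nm h = dgid (nv a);
  nm_degen : forall m a s b (h : wchain m.+1 a s b), ~~ strict_chain a s b -> nm h = 0;
  nm_closed : forall a s b (h : wchain 0 a s b), strict_chain a s b -> cocycle (nm h);
  nm_d : forall m a s b (h : wchain m.+1 a s b), strict_chain a s b ->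
    cd (nerve_deg m) (nm h) = nerve_rhs nm h }.

(* The boundary formula for weakly increasing sequences with a repetition follows
   from the prescribed values. *)
Lemma weak_chainP (n m : nat) (a : 'I_n.+1) (s : seq 'I_n.+1) (b : 'I_n.+1) :
  wchain m.+1 a s b -> ~~ strict_chain a s b ->
  [\/ exists r, s = a :: r, exists r, s = rcons r b
    | exists p x r, s = p ++ x :: x :: r].
Proof.
rewrite /wchain /strict_chain => /andP[/eqP sz].
case: s sz => [//|x s] _ /= /andP[hax hp]; rewrite negb_and.
have [eax|nax] := eqVneq a x; first by move=> _; apply: Or31; exists s; rewrite eax.
have -> : (a < x)%N by rewrite ltn_neqAle hax andbT.
rewrite /= => hs.
have {hs hp} : (exists r, x :: s = rcons r b) \/ exists p y r, x :: s = p ++ y :: y :: r.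
  elim: s x hp hs {hax nax} => [|y s IH] x /=.
    rewrite !andbT => h1 h2; left; exists [::]; congr [:: _]; apply: val_inj => /=.
    by apply/eqP; rewrite eqn_leq h1 leqNgt.
  move=> /andP[hxy hp]; rewrite negb_and.
  have [exy|nxy] := eqVneq x y.
    by move=> _; right; exists [::], x, s; rewrite -exy.
  have -> : (x < y)%N by rewrite ltn_neqAle hxy andbT.
  move=> /(IH _ hp) [[r ->]|[p [z [r ->]]]]; first by left; exists (x :: r).
  by right; exists (x :: p), z, r.
by case=> h; [apply: Or32|apply: Or33].
Qed.

Lemma strict_dup (n : nat) (a : 'I_n.+1) (p : seq 'I_n.+1) (x : 'I_n.+1)
    (r : seq 'I_n.+1) (b : 'I_n.+1) :
  ~~ strict_chain a (p ++ x :: x :: r) b.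
Proof. by rewrite /strict_chain rcons_cat cat_path /= ltnn !andbF. Qed.

Lemma strict_dupl (n : nat) (a : 'I_n.+1) (r : seq 'I_n.+1) (b : 'I_n.+1) :
  ~~ strict_chain a (a :: r) b.
Proof. by rewrite /strict_chain /= ltnn. Qed.

Lemma strict_dupr (n : nat) (a : 'I_n.+1) (r : seq 'I_n.+1) (b : 'I_n.+1) :
  ~~ strict_chain a (rcons r b) b.
Proof. by rewrite /strict_chain rcons_path last_rcons ltnn andbF. Qed.

Definition nm_family (k : comPzRingType) (A : dgcat k) (n : nat) (X : 'I_n.+1 -> A) :=
  forall m a s b, @wchain n m a s b -> dghom (X a) (X b) (- m%:Z).

Lemma nm_eq (k : comPzRingType) (A : dgcat k) (n : nat) (X : 'I_n.+1 -> A)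
    (F : nm_family X) m a s s' b (h : wchain m a s b) (h' : wchain m a s' b) :
  s = s' -> F _ _ _ _ h = F _ _ _ _ h'.
Proof. by move=> e; case: s' / e h' => h'; congr F; exact: bool_irrelevance. Qed.

Lemma nm_comp_eq (k : comPzRingType) (A : dgcat k) (n : nat) (X : 'I_n.+1 -> A)
    (F : nm_family X) m d1 d2 (E E' : - d1%:Z + - d2%:Z = - m%:Z) a b c c' r r' t t'
    (h1 : wchain d1 c r b) (h2 : wchain d2 a t c)
    (h1' : wchain d1 c' r' b) (h2' : wchain d2 a t' c') :
  c = c' -> r = r' -> t = t' ->
  dgcomp E (F _ _ _ _ h1) (F _ _ _ _ h2) = dgcomp E' (F _ _ _ _ h1') (F _ _ _ _ h2').
Proof.
move=> ec er et; subst.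
by rewrite (bool_irrelevance h1 h1') (bool_irrelevance h2 h2'); exact: dgcomp_irr.
Qed.

Definition nm_unital (k : comPzRingType) (A : dgcat k) (n : nat) (X : 'I_n.+1 -> A)
    (F : nm_family X) : Prop :=
  forall a (h : wchain 0 a [::] a), F _ _ _ _ h = dgid (X a).

Definition nm_normal (k : comPzRingType) (A : dgcat k) (n : nat) (X : 'I_n.+1 -> A)
    (F : nm_family X) : Prop :=
  forall m a s b (h : wchain m.+1 a s b), ~~ strict_chain a s b -> F _ _ _ _ h = 0.

Lemma nm_zero (k : comPzRingType) (A : dgcat k) (n : nat) (X : 'I_n.+1 -> A)
    (F : nm_family X) m a s b (h : wchain m a s b) :
  nm_normal F -> (0 < m)%N -> ~~ strict_chain a s b -> F _ _ _ _ h = 0.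
Proof. by case: m h => // m h F_degen _; exact: F_degen. Qed.

Lemma nm_comp_idl (k : comPzRingType) (A : dgcat k) (n : nat) (X : 'I_n.+1 -> A)
    (F : nm_family X) m d1 d2 (E : - d1%:Z + - d2%:Z = - m%:Z) a b c r t
    (h1 : wchain d1 c r b) (h2 : wchain d2 a t c) (h : wchain m a t b) :
  nm_unital F -> d1 = 0%N -> c = b ->
  dgcomp E (F _ _ _ _ h1) (F _ _ _ _ h2) = F _ _ _ _ h.
Proof.
move=> F_id e1 e2; subst; have e3 : d2 = m by lia.
subst; case/andP: (h1) => /nilP er _; subst.
by rewrite F_id (bool_irrelevance h2 h) dgcomp1l.
Qed.

Lemma nm_comp_idr (k : comPzRingType) (A : dgcat k) (n : nat) (X : 'I_n.+1 -> A)
    (F : nm_family X) m d1 d2 (E : - d1%:Z + - d2%:Z = - m%:Z) a b c r t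
    (h1 : wchain d1 c r b) (h2 : wchain d2 a t c) (h : wchain m a r b) :
  nm_unital F -> d2 = 0%N -> a = c ->
  dgcomp E (F _ _ _ _ h1) (F _ _ _ _ h2) = F _ _ _ _ h.
Proof.
move=> F_id e1 e2; subst; have e3 : d1 = m by lia.
subst; case/andP: (h2) => /nilP er _; subst.
by rewrite F_id (bool_irrelevance h1 h) dgcomp1r.
Qed.

Lemma nerve_rhs_weak (k : comPzRingType) (A : dgcat k) (n : nat) (X : 'I_n.+1 -> A)
    (F : nm_family X) m a s b (h : wchain m.+1 a s b) :
  nm_unital F -> nm_normal F -> ~~ strict_chain a s b -> nerve_rhs F h = 0.
Proof.
move=> F_id F_degen hs; have sz : size s = m.+1 by case/andP: (h) => /eqP.
rewrite /nerve_rhs; case: (weak_chainP h hs) => [[r er]|[r er]|[p [x [r er]]]].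
- subst; rewrite big_ord_recl big1 ?addr0.
    by rewrite (nm_comp_idr _ _ _ (wchain_face ord0 h)) //= subrr scaler0.
  move=> j _; rewrite (nm_zero (wchain_face _ _)) ?(nm_zero (wchain_take _ _)) //=.
  + by rewrite dgcompr0 subr0 scaler0.
  + exact: strict_dupl.
  + by have := ltn_ord j; lia.
  + exact: strict_dupl.
- have szr : size r = m by move: sz; rewrite er size_rcons; case.
  subst s; rewrite big_ord_recr big1 ?add0r.
    have nb : nth a (rcons r b) m = b by rewrite nth_rcons szr ltnn eqxx.
    have h' : wchain m a (take m (rcons r b)) b.
      by have := wchain_take ord_max h; rewrite /= nb.
    rewrite (nm_comp_idl _ _ _ h') ?subnn //.
    rewrite (nm_eq F (wchain_face ord_max h) h'); first by rewrite subrr scaler0; exact: addr0.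
    by rewrite /= drop_oversize ?size_rcons ?szr // cats0.
  move=> j _; rewrite (nm_zero (wchain_face _ _)) ?(nm_zero (wchain_drop _ _)) //.
  + by rewrite dgcomp0 subr0 scaler0.
  + by have := ltn_ord j; rewrite /=; lia.
  + by rewrite drop_rcons ?strict_dupr // szr; have := ltn_ord j; rewrite /=; lia.
  + by have := ltn_ord j; rewrite /=; lia.
  + by rewrite drop_rcons -?rcons_cat ?strict_dupr // szr; have := ltn_ord j; rewrite /=; lia.
- have szp : m.+1 = (size p + (size r).+2)%N by rewrite -sz er size_cat.
  have hq : (size p < m.+1)%N by lia.
  have hq1 : ((size p).+1 < m.+1)%N by lia.
  subst s.
  pose s := p ++ x :: x :: r.
  have dropl j : (j <= size p)%N -> drop j s = drop j p ++ x :: x :: r.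
    rewrite leq_eqVlt /s drop_cat => /predU1P[->|->] //.
    by rewrite ltnn subnn drop0 drop_size.
  have taker j : ((size p).+2 <= j)%N -> take j s = p ++ x :: x :: take (j - (size p).+2) r.
    move=> hj; rewrite /s take_cat ltnNge (leq_trans _ hj) ?leqW //=.
    by have -> : (j - size p = (j - (size p).+2).+2)%N by lia.
  have nthp : nth a s (size p) = x by rewrite /s nth_cat ltnn subnn.
  have nthp1 : nth a s (size p).+1 = x by rewrite /s nth_cat ltnNge leqnSn subSn // subnn.
  have dropp : drop (size p).+1 s = x :: r.
    by rewrite /s drop_cat ltnNge leqnSn subSn // subnn /= ?drop0.
  have dropp1 : drop (size p).+2 s = r.
    by rewrite /s drop_cat ltnNge (leq_trans (leqnSn _)) // !subSn // subnn /= ?drop0.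
  have takep : take (size p) s = p by rewrite /s take_size_cat.
  have takep1 : take (size p).+1 s = rcons p x.
    by rewrite /s take_cat ltnNge leqnSn subSn // subnn /= ?take0 cats1.
  have comp0 (j : 'I_m.+1) : dgcomp (nerve_deg_comp j) (F _ _ _ _ (wchain_drop j h))
        (F _ _ _ _ (wchain_take j h)) = 0.
    have [hj|hj] := leqP j (size p).
      rewrite (nm_zero (wchain_drop _ _)) ?dgcomp0 //; first by lia.
      move: hj; rewrite leq_eqVlt => /predU1P[->|hj].
        by rewrite -/s nthp dropp; exact: strict_dupl.
      by rewrite -/s dropl //; exact: strict_dup.
    rewrite (nm_zero (wchain_take _ _)) ?dgcompr0 //; first by lia.
    move: hj; rewrite leq_eqVlt => /predU1P[<-|hj].
      by rewrite -/s nthp1 takep1; exact: strict_dupr.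
    by rewrite -/s taker //; exact: strict_dup.
  under eq_bigr => j _ do rewrite comp0 subr0.
  rewrite (bigD1 (Ordinal hq)) //= (bigD1 (Ordinal hq1)) /=; last first.
    by rewrite -val_eqE /=; lia.
  rewrite big1 ?addr0.
    rewrite (nm_eq F (wchain_face (Ordinal hq1) h) (wchain_face (Ordinal hq) h)); last first.
      by rewrite /= -/s takep takep1 dropp dropp1 cat_rcons.
    rewrite -scalerDl /=.
    have -> : (m.+1 - size p = (m.+1 - (size p).+1).+1)%N by lia.
    by rewrite exprS mulN1r addNr scale0r.
  move=> j /andP[]; rewrite -!val_eqE /= => hj1 hj2.
  have hjm := ltn_ord j.
  rewrite nm_zero ?scaler0 //; first by lia.
  have [hj|hj] := ltnP j (size p).
    by rewrite -/s dropl // catA; exact: strict_dup.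
  rewrite -/s taker; last by lia.
  by rewrite -catA /=; exact: strict_dup.
Qed.


Lemma nm_id_eq (k : comPzRingType) (A : dgcat k) (n : nat) (X : 'I_n.+1 -> A)
    (F : nm_family X) (a b : 'I_n.+1) s (h : wchain 0 a s b) :
  nm_unital F -> a = b -> cocycle (F _ _ _ _ h).
Proof.
move=> F_id e; subst; case/andP: (h) => /nilP es _; subst.
by rewrite F_id; exact: dg_d1.
Qed.

Lemma nm_closed_weak (k : comPzRingType) (A : dgcat k) (n : nat)
    (x : nerve_simplex A n) a s b (h : wchain 0 a s b) : cocycle (nm x h).
Proof.
have [hs|] := boolP (strict_chain a s b); first exact: nm_closed.
case/andP: (h) => /nilP es hp; subst; move: hp; rewrite /strict_chain /= !andbT => h1 h2.
apply: nm_id_eq; first exact: nm_id.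
by apply: val_inj; apply/eqP; rewrite eqn_leq h1 leqNgt.
Qed.

Lemma nm_d_weak (k : comPzRingType) (A : dgcat k) (n : nat)
    (x : nerve_simplex A n) m a s b (h : wchain m.+1 a s b) :
  cd (nerve_deg m) (nm x h) = nerve_rhs (nm x) h.
Proof.
have [hs|hs] := boolP (strict_chain a s b); first exact: nm_d.
by rewrite nm_degen // cd0 nerve_rhs_weak //; [exact: nm_id | exact: nm_degen].
Qed.

Lemma strict_chain_map (n n' : nat) (al : dmap n n') (a : 'I_n.+1) (s : seq 'I_n.+1)
    (b : 'I_n.+1) :
  path (fun i j : 'I_n.+1 => (i <= j)%N) a (rcons s b) ->
  strict_chain (al a) (map al s) (al b) -> strict_chain a s b.
Proof.
rewrite /strict_chain -map_rcons.
elim: (rcons s b) a => //= x r IH a /andP[h1 h2] /andP[h3 h4].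
rewrite (IH x) // andbT ltn_neqAle h1 andbT.
by apply/eqP => e; move: h3; rewrite (val_inj e) ltnn.
Qed.

Definition nerve_act (k : comPzRingType) (A : dgcat k) (n' n : nat) (al : dmap n' n)
    (x : nerve_simplex A n) : nerve_simplex A n'.
Proof.
refine (@NerveSimplex k A n' (fun i => nv x (al i))
  (fun m a s b h => nm x (wchain_map al h)) _ _ _ _).
- by move=> a h; exact: nm_id.
- move=> m a s b h hs; apply: nm_degen; apply: contra hs; apply: strict_chain_map.
  by case/andP: h.
- by move=> a s b h _; exact: nm_closed_weak.
- move=> m a s b h _; rewrite nm_d_weak; apply: eq_bigr => j _; congr (_ *: (_ - _)).
    by apply: nm_eq; rewrite map_cat map_take map_drop.
  apply: nm_comp_eq; rewrite ?map_take ?map_drop //.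
  by rewrite (nth_map a) //; case/andP: h => /eqP ->.
Defined.

Lemma nerve_simplex_eq (k : comPzRingType) (A : dgcat k) (n : nat)
    (X : 'I_n.+1 -> A) (F G : nm_family X) F1 F2 F3 F4 G1 G2 G3 G4 :
  (forall m a s b (h : wchain m a s b), F m a s b h = G m a s b h) ->
  @NerveSimplex k A n X F F1 F2 F3 F4 = @NerveSimplex k A n X G G1 G2 G3 G4.
Proof.
move=> e; have {}e : F = G.
  do 5 (apply: functional_extensionality_dep => ?); exact: e.
by subst; congr NerveSimplex; exact: proof_irrelevance.
Qed.

Definition dg_nerve (k : comPzRingType) (A : dgcat k) : sset.
Proof.
refine (@SSet (nerve_simplex A) (@nerve_act k A) _ _).
- move=> n [X F F1 F2 F3 F4]; apply: nerve_simplex_eq => m a s b h.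
  by apply: nm_eq; rewrite map_id.
- move=> l m n a b [X F F1 F2 F3 F4]; apply: nerve_simplex_eq => d i s j h /=.
  by apply: nm_eq; rewrite -map_comp.
Defined.

(* Main.v *)
(* The nerve is unwound into Hom complexes. For a diagram [p : K -> N(A)] and an object [W],
   families of morphisms from [W] to the last vertices of the simplices of [K] form a
   complex, whose differential [cD] is the Maurer-Cartan equation of the nerve, and a cone
   with apex [W] is a closed normalized family of degree 0. Correcting fillings of
   boundaries one cochain at a time shows that a cone [lam] on [L] is a limit iff the total
   cone of [Hom(W, L) -> coch(W)] induced by [lam] is acyclic in degrees [<= 0]. Finite
   limits are built by attaching one nondegenerate simplex at a time, each step being the
   homotopy fiber of a map of degree [1 - d]; these exist thanks to biproducts, kernels and
   loop objects. For the cospan of a square with a contractible corner, acyclicity of the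
   total cone is left exactness of the associated 3-term complex. The nerve of [A^op] is
   the opposite of the nerve of [A], which gives the dual statements; finally, filling
   boundaries in (relative) mapping spaces translates truncatedness into the vanishing,
   respectively injectivity and bijectivity, of maps on negative cohomology. *)

Require Import Defs.
From mathcomp Require Import all_boot all_order all_algebra.
From mathcomp Require Import zify.
From Stdlib Require Import FunctionalExtensionality ProofIrrelevance ClassicalEpsilon.
From Stdlib Require Import Classical PropExtensionality.

Set Implicit Arguments.
Unset Strict Implicit.
Unset Printing Implicit Defensive.

Import Order.TTheory GRing.Theory Num.Theory.
Local Open Scope ring_scope.

(** * Morphisms with free degrees *)

(** The Maurer-Cartan equation is quadratic, yet the filling problems become linear. The facet
    opposite to vertex 0 is always among the data, so the unknowns are components on faces through
    vertex 0, and in each composite the later factor lies in that facet and is known. Hence the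
    unknowns form a cochain on that facet, with differential [cD]; obstructions are cocycles because
    [cD] squares to zero. The converses use differences: in a degenerate simplex built on zero
    components one facet is perturbed by a given cocycle, the new boundary is filled, and the
    difference of the two simplices is the primitive sought. Nonpositivity enters at the top:
    morphisms of degree 1 vanish, so acyclicity in degrees [<= 0] suffices. Statements concern a
    simplicial set [C] with an isomorphism onto the nerve, not the nerve itself, so that they apply
    verbatim to its opposite. The objects at the vertices of faces agree only propositionally;
    morphisms are therefore indexed by arbitrary objects and degrees, with value 0 when these do not
    match. *)

Section TotalOperations.
Variable k : comPzRingType.

(* Differential and composition with a free target degree: they are zero when the
   degrees do not match, so that no equation between degrees occurs in a term. *)
Definition dd (M : cplx k) (i j : int) (x : M i) : M j :=
  match @eqP _ (i + 1) j with ReflectT e => cd e x | ReflectF _ => 0 end.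

Definition cp (A : dgcat k) (X Y Z : A) (i j l : int) (g : dghom Y Z i)
    (f : dghom X Y j) : dghom X Z l :=
  match @eqP _ (i + j) l with ReflectT e => dgcomp e g f | ReflectF _ => 0 end.

Section Cplx.
Variable M : cplx k.

Lemma ddE i j (e : i + 1 = j) (x : M i) : dd j x = cd e x.
Proof. by rewrite /dd; case: eqP => // e'; exact: cplx_irr. Qed.

Lemma dd_linear i j : linear (@dd M i j).
Proof.
rewrite /dd => a x y; case: eqP => e; last by rewrite scaler0 addr0.
exact: cd_linear.
Qed.

Lemma dd0 i j : dd j (0 : M i) = 0.
Proof. by have [] := linear_props (@dd_linear i j). Qed.
Lemma ddN i j (x : M i) : dd j (- x) = - dd j x.
Proof. by have [] := linear_props (@dd_linear i j). Qed.
Lemma ddD i j (x y : M i) : dd j (x + y) = dd j x + dd j y.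
Proof. by have [] := linear_props (@dd_linear i j). Qed.
Lemma ddB i j (x y : M i) : dd j (x - y) = dd j x - dd j y.
Proof. by rewrite ddD ddN. Qed.
Lemma ddZ i j a (x : M i) : dd j (a *: x) = a *: dd j x.
Proof. by have [] := linear_props (@dd_linear i j). Qed.
Lemma dd_sum i j (I : Type) (r : seq I) (P : pred I) (F : I -> M i) :
  dd j (\sum_(u <- r | P u) F u) = \sum_(u <- r | P u) dd j (F u).
Proof. by apply: big_morph; [exact: ddD | exact: dd0]. Qed.

Lemma dd_dd i j l (x : M i) : dd l (dd j x) = 0.
Proof.
rewrite {1}/dd; case: eqP => // e'; rewrite /dd; case: eqP => e; last exact: cd0.
exact: cd_cd.
Qed.
End Cplx.

Section Comp.
Variable A : dgcat k.
Implicit Types X Y Z : A.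

Lemma cpE X Y Z i j l (e : i + j = l) (g : dghom Y Z i) (f : dghom X Y j) :
  cp l g f = dgcomp e g f.
Proof. by rewrite /cp; case: eqP => // e'; exact: dgcomp_irr. Qed.

Lemma cp_linearl X Y Z i j l (f : dghom X Y j) :
  linear (fun g : dghom Y Z i => cp l g f).
Proof.
rewrite /cp => a x y; case: eqP => e; last by rewrite scaler0 addr0.
exact: dgcomp_linearl.
Qed.

Lemma cp_linearr X Y Z i j l (g : dghom Y Z i) :
  linear (fun f : dghom X Y j => cp l g f).
Proof.
rewrite /cp => a x y; case: eqP => e; last by rewrite scaler0 addr0.
exact: dgcomp_linearr.
Qed.

Lemma cp0l X Y Z i j l (f : dghom X Y j) : cp l (0 : dghom Y Z i) f = 0.
Proof. by have [] := linear_props (@cp_linearl X Y Z i j l f). Qed.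
Lemma cpNl X Y Z i j l (g : dghom Y Z i) (f : dghom X Y j) : cp l (- g) f = - cp l g f.
Proof. by have [_ h _ _] := linear_props (@cp_linearl X Y Z i j l f); exact: h. Qed.
Lemma cpDl X Y Z i j l (g h : dghom Y Z i) (f : dghom X Y j) :
  cp l (g + h) f = cp l g f + cp l h f.
Proof. by have [_ _ e _] := linear_props (@cp_linearl X Y Z i j l f); exact: e. Qed.
Lemma cpBl X Y Z i j l (g h : dghom Y Z i) (f : dghom X Y j) :
  cp l (g - h) f = cp l g f - cp l h f.
Proof. by rewrite cpDl cpNl. Qed.
Lemma cpZl X Y Z i j l a (g : dghom Y Z i) (f : dghom X Y j) :
  cp l (a *: g) f = a *: cp l g f.
Proof. by have [_ _ _ h] := linear_props (@cp_linearl X Y Z i j l f); exact: h. Qed.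
Lemma cp_suml X Y Z i j l (f : dghom X Y j) (I : Type) (r : seq I) (P : pred I)
    (F : I -> dghom Y Z i) :
  cp l (\sum_(u <- r | P u) F u) f = \sum_(u <- r | P u) cp l (F u) f.
Proof.
by apply: (big_morph (fun g => cp l g f)) => [x y|]; [exact: cpDl | exact: cp0l].
Qed.

Lemma cp0r X Y Z i j l (g : dghom Y Z i) : cp l g (0 : dghom X Y j) = 0.
Proof. by have [] := linear_props (@cp_linearr X Y Z i j l g). Qed.
Lemma cpNr X Y Z i j l (g : dghom Y Z i) (f : dghom X Y j) : cp l g (- f) = - cp l g f.
Proof. by have [_ h _ _] := linear_props (@cp_linearr X Y Z i j l g); exact: h. Qed.
Lemma cpDr X Y Z i j l (g : dghom Y Z i) (f h : dghom X Y j) :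
  cp l g (f + h) = cp l g f + cp l g h.
Proof. by have [_ _ e _] := linear_props (@cp_linearr X Y Z i j l g); exact: e. Qed.
Lemma cpBr X Y Z i j l (g : dghom Y Z i) (f h : dghom X Y j) :
  cp l g (f - h) = cp l g f - cp l g h.
Proof. by rewrite cpDr cpNr. Qed.
Lemma cpZr X Y Z i j l a (g : dghom Y Z i) (f : dghom X Y j) :
  cp l g (a *: f) = a *: cp l g f.
Proof. by have [_ _ _ h] := linear_props (@cp_linearr X Y Z i j l g); exact: h. Qed.
Lemma cp_sumr X Y Z i j l (g : dghom Y Z i) (I : Type) (r : seq I) (P : pred I)
    (F : I -> dghom X Y j) :
  cp l g (\sum_(u <- r | P u) F u) = \sum_(u <- r | P u) cp l g (F u).
Proof. by apply: (big_morph (cp l g)) => [x y|]; [exact: cpDr | exact: cp0r]. Qed.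

(** Both sides vanish when [l] is not the total degree, so only the inner degrees have to match. *)
Lemma cpA X Y Z T a b c ab bc l (h : dghom Z T a) (g : dghom Y Z b) (f : dghom X Y c) :
  a + b = ab -> b + c = bc -> cp l (cp ab h g) f = cp l h (cp bc g f).
Proof.
move=> e1 e2; rewrite (cpE e1) (cpE e2) /cp.
case: eqP => e3; case: eqP => e4 //; first exact: dgcompA.
- by case: e4; rewrite -e2 addrA e1.
- by case: e3; rewrite -e1 -addrA e2.
Qed.

Lemma cp1l X Y i (f : dghom X Y i) : cp i (dgid Y) f = f.
Proof. by rewrite (cpE (add0r i)) dgcomp1l. Qed.
Lemma cp1r X Y i (f : dghom X Y i) : cp i f (dgid X) = f.
Proof. by rewrite (cpE (addr0 i)) dgcomp1r. Qed.

Lemma dd_cp X Y Z i j l i' j' l' (g : dghom Y Z i) (f : dghom X Y j) :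
  i + j = l -> l + 1 = l' -> i + 1 = i' -> j + 1 = j' ->
  dd l' (cp l g f) = cp l' (dd i' g) f + (-1) ^+ `|i|%N *: cp l' g (dd j' f).
Proof.
move=> e el ei ej.
have e1 : i' + j = l' by lia.
have e2 : i + j' = l' by lia.
by rewrite (cpE e) (ddE el) (dg_leibniz e el ei ej e1 e2) (ddE ei) (ddE ej) !(cpE e1) (cpE e2).
Qed.

Lemma dd_id X j : dd j (dgid X) = 0.
Proof. by rewrite /dd; case: eqP => // e; case: j / e; exact: dg_d1. Qed.

Lemma dec_eq (T : Type) (x y : T) : {x = y} + {x <> y}.
Proof. exact: excluded_middle_informative. Qed.

(* [f] seen as an element of another hom module, zero if this makes no sense *)
Definition hc X Y i X' Y' j (f : dghom X Y i) : dghom X' Y' j :=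
  match dec_eq X X', dec_eq Y Y', dec_eq i j with
  | left e1, left e2, left e3 =>
      eq_rect X (fun U => dghom U Y' j) (eq_rect Y (fun V => dghom X V j)
        (eq_rect i (fun l => dghom X Y l) f j e3) Y' e2) X' e1
  | _, _, _ => 0
  end.

Lemma hc_id X Y i (f : dghom X Y i) : hc X Y i f = f.
Proof.
rewrite /hc; case: (dec_eq X X) => // e1; case: (dec_eq Y Y) => // e2.
case: (dec_eq i i) => // e3.
by rewrite (proof_irrelevance _ e1 erefl) (proof_irrelevance _ e2 erefl)
  (proof_irrelevance _ e3 erefl).
Qed.

Lemma hc0 X Y i X' Y' j : hc X' Y' j (0 : dghom X Y i) = 0.
Proof.
rewrite /hc; case: dec_eq => // e1; case: dec_eq => // e2; case: dec_eq => // e3.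
by subst.
Qed.

Lemma hcZ X Y i X' Y' j a (f : dghom X Y i) : hc X' Y' j (a *: f) = a *: hc X' Y' j f.
Proof.
rewrite /hc; case: dec_eq => e1; rewrite ?scaler0 //; case: dec_eq => e2; rewrite ?scaler0 //.
by case: dec_eq => e3; rewrite ?scaler0 //; subst.
Qed.
End Comp.
End TotalOperations.

Lemma signE (k : comPzRingType) (V : lmodType k) (a b : nat) (x : V) :
  (-1) ^+ a *: ((-1) ^+ b *: x) = (-1) ^+ (a + b) *: x.
Proof. by rewrite scalerA exprD. Qed.

Lemma sign_odd (k : comPzRingType) (V : lmodType k) (a b : nat) (x : V) :
  odd a = odd b -> (-1) ^+ a *: x = (-1) ^+ b *: x.
Proof. by move=> e; rewrite -signr_odd e signr_odd. Qed.

Lemma sign_oddN (k : comPzRingType) (V : lmodType k) (a b : nat) (x : V) :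
  odd a = ~~ odd b -> (-1) ^+ a *: x = - ((-1) ^+ b *: x).
Proof.
move=> e; rewrite -[in LHS]signr_odd e -[in RHS]signr_odd; case: (odd b) => /=.
  by rewrite expr0 expr1 scale1r scaleN1r opprK.
by rewrite expr0 expr1 scale1r scaleN1r.
Qed.

Lemma signK (k : comPzRingType) (V : lmodType k) (a : nat) (x : V) :
  (-1) ^+ a *: ((-1) ^+ a *: x) = x.
Proof. by rewrite signE addnn -signr_odd odd_double expr0 scale1r. Qed.

(** * Monotone maps given by functions on natural numbers *)

Definition mono_on (m n : nat) (f : nat -> nat) : Prop :=
  (forall i j, (i <= j)%N -> (j <= m)%N -> (f i <= f j)%N) /\ (f m <= n)%N.

(** A running maximum cut off at [n] is monotone for every [f]. This makes [mkd] total, so that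
    identities between simplicial operators reduce to identities between functions on [nat], which
    [lia] decides. *)
Lemma mkd_homo (m n : nat) (f : nat -> nat) (i j : 'I_m.+1) : (i <= j)%N ->
  ((inord (minn n (\max_(u < i.+1) f u)) : 'I_n.+1) <=
   (inord (minn n (\max_(u < j.+1) f u)) : 'I_n.+1))%N.
Proof.
move=> h; rewrite !inordK ?ltnS ?geq_minl // leq_min geq_minl /=.
apply: leq_trans (geq_minr _ _) _; apply/bigmax_leqP => u _.
by apply: (leq_bigmax (Ordinal (leq_trans (ltn_ord u) (h : (i.+1 <= j.+1)%N)))).
Qed.

(* The map [i |-> f i] for [f] monotone; the definition makes sense without proof *)
Definition mkd_def (m n : nat) (f : nat -> nat) : dmap m n := Dmap (@mkd_homo m n f).
Fact mkd_key : unit. Proof. by []. Qed.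
(** Locking keeps simplification from opening the running maximum. *)
Definition mkd := locked_with mkd_key mkd_def.

Lemma dcompE l m n (a : dmap m n) (b : dmap l m) i : dcomp a b i = a (b i).
Proof. by []. Qed.

Lemma mkdE m n f (i : 'I_m.+1) : mono_on m n f -> mkd m n f i = f i :> nat.
Proof.
move=> [h1 h2]; have hi := ltn_ord i; rewrite ltnS in hi.
have -> : mkd m n f i = minn n (\max_(u < i.+1) f u) :> nat.
  by rewrite /mkd unlock /= inordK // ltnS geq_minl.
have -> : \max_(u < i.+1) f u = f i.
  apply/eqP; rewrite eqn_leq; apply/andP; split.
    by apply/bigmax_leqP => u _; apply: h1 => //; rewrite -ltnS.
  exact: (leq_bigmax (ord_max : 'I_i.+1)).
by apply/minn_idPr; apply: leq_trans (h1 _ _ hi (leqnn m)) h2.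
Qed.

Lemma mkd_eq m n f g : (forall i, (i <= m)%N -> f i = g i) -> mkd m n f = mkd m n g.
Proof.
move=> e; apply: dmap_eq => i; rewrite /mkd unlock /=; congr (inord (minn _ _)); apply: eq_bigr => u _.
by apply: e; have := ltn_ord u; have := ltn_ord i; lia.
Qed.

Lemma dmap_mkd m n (a : dmap m n) (f : nat -> nat) : (forall i : 'I_m.+1, a i = f i :> nat) ->
  a = mkd m n f.
Proof.
move=> e; have hm : mono_on m n f.
  split=> [i j hij hj|].
    have hi : (i < m.+1)%N by lia.
    have := @dfun_homo _ _ a (Ordinal hi) (Ordinal (hj : (j < m.+1)%N)) hij.
    by rewrite !e.
  by rewrite -(e ord_max); exact: leq_ord.
by apply: dmap_eq => i; apply: val_inj; rewrite [LHS]e -(mkdE i hm).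
Qed.

Lemma dmap_mkdE m n (a : dmap m n) : a = mkd m n (fun i => a (inord i)).
Proof. by apply: dmap_mkd => i; rewrite inord_val. Qed.

Lemma mono_comp l m n f g : mono_on m n f -> mono_on l m g -> mono_on l n (f \o g).
Proof.
move=> [f1 f2] [g1 g2]; split=> [i j hij hj|] /=.
  apply: f1; first exact: g1.
  by apply: leq_trans (g1 _ _ hj (leqnn l)) g2.
by apply: leq_trans (f1 _ _ g2 (leqnn m)) f2.
Qed.

Lemma mkd_comp l m n f g : mono_on m n f -> mono_on l m g ->
  dcomp (mkd m n f) (mkd l m g) = mkd l n (f \o g).
Proof.
move=> hf hg; apply: dmap_mkd => i.
by rewrite [LHS]mkdE // (mkdE i hg).
Qed.

(** Composites of these operators are composites of functions on [nat], so the simplicial identities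
    need no separate proof. *)
Definition sb (K : sset) n m f (x : K n) : K m := act (mkd m n f) x.

Lemma sb_sb (K : sset) n m l f g (x : K n) : mono_on m n f -> mono_on l m g ->
  sb l g (sb m f x) = sb l (f \o g) x.
Proof. by move=> hf hg; rewrite /sb -act_comp mkd_comp. Qed.

Lemma sb_eq (K : sset) n m f g (x : K n) : (forall i, (i <= m)%N -> f i = g i) ->
  sb m f x = sb m g x.
Proof. by move=> e; rewrite /sb (mkd_eq _ e). Qed.

Lemma sb_id (K : sset) n f (x : K n) : (forall i, (i <= n)%N -> f i = i) -> sb n f x = x.
Proof.
move=> e; rewrite -[RHS]act_id; congr act; symmetry; apply: dmap_mkd => i.
by rewrite e // -ltnS.
Qed.

Lemma sfun_sb (K L : sset) (p : smap K L) n m f (x : K n) : p m (sb m f x) = sb m f (p n x).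
Proof. exact: sfun_act. Qed.

Ltac mono := split; [intros ? ? ? ?|]; rewrite /= /bump /=; lia.

(* Reflexive decision procedure for identities in an abelian group *)
Inductive zexpr := ZAtom of nat | ZAdd of zexpr & zexpr | ZOpp of zexpr | ZZero.

Fixpoint zeval (V : zmodType) (env : seq V) (e : zexpr) : V :=
  match e with
  | ZAtom i => nth 0 env i
  | ZAdd a b => zeval env a + zeval env b
  | ZOpp a => - zeval env a
  | ZZero => 0
  end.

Fixpoint zcoef (e : zexpr) (i : nat) : int :=
  match e with
  | ZAtom j => if j == i then 1 else 0
  | ZAdd a b => zcoef a i + zcoef b i
  | ZOpp a => - zcoef a i
  | ZZero => 0
  end.

(** An expression depends only on its integer coefficients at the atoms, which a computation can
    compare. *)
Lemma zevalE (V : zmodType) (env : seq V) e :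
  zeval env e = \sum_(i < size env) nth 0 env i *~ zcoef e i.
Proof.
elim: e => [j|a IHa b IHb|a IHa|] /=.
- case: (ltnP j (size env)) => hj.
    rewrite (bigD1 (Ordinal hj)) //= eqxx big1 ?addr0 // => i hi.
    by rewrite ifN // eq_sym; apply: contraNneq hi => e; apply/eqP/val_inj.
  rewrite nth_default // big1 // => i _; rewrite ifN // neq_ltn.
  by rewrite (leq_trans (ltn_ord i)) ?orbT.
- by rewrite IHa IHb -big_split; apply: eq_bigr => i _; rewrite mulrzDr.
- by rewrite IHa -sumrN; apply: eq_bigr => i _; rewrite mulrNz.
- by rewrite big1.
Qed.

Lemma zeval_eq (V : zmodType) (env : seq V) a b :
  all (fun i => zcoef a i == zcoef b i) (iota 0 (size env)) -> zeval env a = zeval env b.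
Proof.
move=> /allP h; rewrite !zevalE; apply: eq_bigr => i _.
by rewrite (eqP (h i _)) // mem_iota /= add0n.
Qed.

(** Multiples of one vector count as the same atom once their scalars unify, even if they differ
    syntactically. *)
Ltac zsame a t := first [constr_eq a t |
  lazymatch a with (?r *: ?x)%R => lazymatch t with (?s *: ?y)%R =>
    constr_eq x y; unify r s end end].
Ltac zmem t l := lazymatch l with
  | nil => constr:(false)
  | ?a :: ?r => match constr:(tt) with
                | _ => let _ := match constr:(tt) with _ => zsame a t end in constr:(true)
                | _ => zmem t r
                end
  end.
Ltac zatoms l t := lazymatch t with
  | (?x + ?y)%R => let l1 := zatoms l x in zatoms l1 y
  | (- ?x)%R => zatoms l x
  | 0%R => l
  | _ => let b := zmem t l in lazymatch b with true => l | false => constr:(t :: l) end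
  end.
Ltac zindex t l := match l with
  | ?a :: ?r => let _ := match constr:(tt) with _ => zsame a t end in constr:(O)
  | ?a :: ?r => let n := zindex t r in constr:(S n)
  end.
Ltac zreify l t := lazymatch t with
  | (?x + ?y)%R => let a := zreify l x in let b := zreify l y in constr:(ZAdd a b)
  | (- ?x)%R => let a := zreify l x in constr:(ZOpp a)
  | 0%R => constr:(ZZero)
  | _ => let n := zindex t l in constr:(ZAtom n)
  end.
Ltac zmodule := lazymatch goal with |- @eq ?V ?x ?y =>
  let l := zatoms (@nil V) x in let l := zatoms l y in
  let a := zreify l x in let b := zreify l y in
  change (zeval l a = zeval l b); apply: zeval_eq; vm_compute; reflexivity end.

(** Strict maps are the nondegenerate faces of a standard simplex; only these carry free data in a
    simplex of the nerve. *)
Definition dstrict (m n : nat) (a : dmap m n) : bool :=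
  [forall i : 'I_m.+1, forall j : 'I_m.+1, (i < j)%N ==> (a i < a j)%N].

Lemma dstrictP m n (a : dmap m n) :
  reflect (forall i j : 'I_m.+1, (i < j)%N -> (a i < a j)%N) (dstrict a).
Proof.
apply: (iffP forallP) => [h i j hij|h i]; last by apply/forallP => j; apply/implyP; exact: h.
by have /forallP/(_ j)/implyP := h i; apply.
Qed.

Lemma dstrict_comp l m n (a : dmap m n) (b : dmap l m) :
  dstrict a -> dstrict b -> dstrict (dcomp a b).
Proof. by move=> /dstrictP ha /dstrictP hb; apply/dstrictP => i j hij; apply/ha/hb. Qed.

Lemma dstrict_compr l m n (a : dmap m n) (b : dmap l m) :
  dstrict (dcomp a b) -> dstrict b.
Proof.
move=> /dstrictP h; apply/dstrictP => i j hij; rewrite ltnNge; apply/negP => hji.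
by have := h i j hij; rewrite ltnNge /= (dfun_homo a hji).
Qed.

Lemma dstrict_mkd l m f : mono_on l m f ->
  (forall i j, (i < j)%N -> (j <= l)%N -> (f i < f j)%N) -> dstrict (mkd l m f).
Proof.
move=> hf h; apply/dstrictP => i j hij; rewrite !mkdE //; apply: h => //.
by rewrite -ltnS.
Qed.

(** * Chains and monotone maps *)

(* a chain [a <= s_1 <= ... <= b] as a map, and conversely *)
Definition chd (n m : nat) (a : 'I_n.+1) (s : seq 'I_n.+1) (b : 'I_n.+1) : dmap m.+1 n :=
  mkd m.+1 n (fun i => nth b (a :: rcons s b) i).

Definition dseq (n m : nat) (J : dmap m.+1 n) : seq 'I_n.+1 :=
  [seq J (inord i.+1) | i <- iota 0 m].

Lemma chain_nth_mono (n m : nat) (a : 'I_n.+1) s b : wchain m a s b ->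
  mono_on m.+1 n (fun i => nth b (a :: rcons s b) i).
Proof.
move=> /andP[/eqP sz /(pathP b) hp]; split; last exact: leq_ord.
have step i : (i <= m)%N -> (nth b (a :: rcons s b) i <= nth b (a :: rcons s b) i.+1)%N.
  by move=> hi; apply: hp; rewrite size_rcons sz ltnS.
move=> i j; elim: j => [|j IH]; first by case: i.
rewrite leq_eqVlt => /predU1P[->//|hij] hj.
by apply: leq_trans (IH _ _) (step _ _); lia.
Qed.

Lemma chdE (n m : nat) (a : 'I_n.+1) s b (i : 'I_m.+2) : wchain m a s b ->
  chd m a s b i = nth b (a :: rcons s b) i.
Proof. by move=> h; apply: val_inj; rewrite [LHS](mkdE i (chain_nth_mono h)). Qed.

Lemma strict_chd (n m : nat) (a : 'I_n.+1) s b : wchain m a s b ->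
  strict_chain a s b = dstrict (chd m a s b).
Proof.
move=> h; have sz : size s = m by case/andP: h => /eqP.
apply/idP/idP.
  rewrite /strict_chain strict_pathE => hp.
  have hs : sorted ltn (map val (a :: rcons s b)) by [].
  apply/dstrictP => i j hij; rewrite !chdE //.
  have si : size (map val (a :: rcons s b)) = m.+2 by rewrite size_map /= size_rcons sz.
  rewrite -!(nth_map b 0%N val) -?[size _](size_map val) ?si ?ltn_ord //.
  by apply: (sorted_ltn_nth ltn_trans) => //; rewrite inE si.
move=> /dstrictP hd; rewrite /strict_chain; apply/(pathP b) => i hi.
rewrite size_rcons sz ltnS in hi.
have := @hd (inord i) (inord i.+1); rewrite !chdE // !inordK ?ltnS //; last by lia.
by apply.
Qed.

Lemma dseq_nth (n m : nat) (J : dmap m.+1 n) x i : (i < m)%N ->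
  nth x (dseq J) i = J (inord i.+1).
Proof. by move=> hi; rewrite (nth_map 0%N) ?size_iota // nth_iota. Qed.

Lemma dseq_nthS (n m : nat) (J : dmap m.+1 n) x i : (i <= m)%N ->
  nth x (rcons (dseq J) (J ord_max)) i = J (inord i.+1).
Proof.
move=> hi; rewrite nth_rcons size_map size_iota; case: ltnP => him; first exact: dseq_nth.
have -> : i = m by lia.
by rewrite eqxx; congr (J _); apply: val_inj; rewrite /= inordK.
Qed.

Lemma dchain (n m : nat) (J : dmap m.+1 n) : wchain m (J ord0) (dseq J) (J ord_max).
Proof.
rewrite /wchain size_map size_iota eqxx /=; apply/(pathP (J ord0)) => i.
rewrite size_rcons size_map size_iota ltnS => hi.
rewrite dseq_nthS //; case: i hi => [|i] hi /=; first exact: dfun_homo.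
rewrite dseq_nthS; last by lia.
by apply: dfun_homo; rewrite !inordK; lia.
Qed.

Lemma chd_dseq (n m : nat) (J : dmap m.+1 n) : chd m (J ord0) (dseq J) (J ord_max) = J.
Proof.
apply: dmap_eq => i; rewrite chdE ?dchain //; case: i => [[|i] hi] /=.
  by congr (J _); apply: val_inj.
by rewrite dseq_nthS //; congr (J _); apply: val_inj; rewrite /= inordK.
Qed.

Lemma dseq_chd (n m : nat) (a : 'I_n.+1) s b : wchain m a s b ->
  [/\ chd m a s b ord0 = a, dseq (chd m a s b) = s & chd m a s b ord_max = b].
Proof.
move=> h; have sz : size s = m by case/andP: h => /eqP.
split; rewrite ?chdE //=; last by rewrite nth_rcons sz ltnn eqxx.
apply: (@eq_from_nth _ a) => [|i]; rewrite size_map size_iota // => hi.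
rewrite dseq_nth // chdE // inordK /=; last by lia.
by rewrite nth_rcons sz hi; apply: set_nth_default; rewrite sz.
Qed.

Section ChainOps.
Variables (n m : nat) (a : 'I_n.+1) (s : seq 'I_n.+1) (b : 'I_n.+1).
Hypothesis h : wchain m.+1 a s b.
Variable j : 'I_m.+1.

(** Entry [j] of the chain is vertex [j + 1] of the face, whence [bump j.+1]. With the next two
    lemmas, the three chains in [nerve_rhs] become an inner face, a back face and a front face. *)
Lemma chd_face : chd m a (take j s ++ drop j.+1 s) b =
  dcomp (chd m.+1 a s b) (mkd m.+1 m.+2 (bump j.+1)).
Proof.
have sz : size s = m.+1 by case/andP: h => /eqP.
have hj := ltn_ord j.
apply: dmap_eq => i; rewrite /= chdE ?(wchain_face j h) // chdE //.
rewrite (mkdE i); last by mono.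
case: i => [[|i] hi] //=; rewrite /bump ltnS.
rewrite rcons_cat nth_cat size_takel; last by rewrite sz; lia.
case: (leqP j i) => hji; rewrite ?add1n ?add0n /=.
  rewrite nth_rcons size_drop nth_rcons sz nth_drop addSn subnKC //.
  have -> : (i - j < m.+1 - j.+1)%N = (i.+1 < m.+1)%N by lia.
  by case: ifP => // _; case: ifP; case: ifP.
by rewrite nth_take // nth_rcons sz; case: ifP => //; lia.
Qed.

Lemma chd_drop : chd (m - j) (nth a s j) (drop j.+1 s) b =
  dcomp (chd m.+1 a s b) (mkd (m - j).+1 m.+2 (addn j.+1)).
Proof.
have sz : size s = m.+1 by case/andP: h => /eqP.
have hj := ltn_ord j.
apply: dmap_eq => i; rewrite /= chdE ?(wchain_drop j h) // chdE //.
rewrite (mkdE i) /=; last by mono.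
case: i => [[|i] hi] /=.
  by rewrite addn0 nth_rcons sz hj; apply: set_nth_default; rewrite sz.
rewrite !nth_rcons size_drop sz nth_drop addSn addnS.
have -> : (i < m.+1 - j.+1)%N = ((j + i).+1 < m.+1)%N by lia.
by case: ifP => // _; case: ifP; case: ifP.
Qed.

Lemma chd_take : chd j a (take j s) (nth a s j) =
  dcomp (chd m.+1 a s b) (mkd j.+1 m.+2 id).
Proof.
have sz : size s = m.+1 by case/andP: h => /eqP.
have hj := ltn_ord j.
apply: dmap_eq => i; rewrite /= chdE ?(wchain_take j h) // chdE //.
rewrite (mkdE i) /=; last by mono.
case: i => [[|i] hi] //=.
rewrite !nth_rcons size_takel ?sz; last by lia.
rewrite ltnS leq_eqVlt ltnS in hi.
case/predU1P: hi => [[->]|hi]; first by rewrite ltnn if_same hj; apply: set_nth_default; rewrite sz.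
rewrite hi nth_take //; have -> : (i < m.+1)%N by lia.
by apply: set_nth_default; rewrite sz; lia.
Qed.
End ChainOps.

(** Carrying an isomorphism with the nerve, instead of the nerve itself, also covers the opposite of
    a nerve, through the nerve of [dgop A]. *)
Record nerve_iso (k : comPzRingType) (C : sset) (A : dgcat k) := NerveIso {
  nphi : smap C (dg_nerve A);
  npsi : smap (dg_nerve A) C;
  nphiK : forall n (x : C n), npsi n (nphi n x) = x;
  npsiK : forall n (x : dg_nerve A n), nphi n (npsi n x) = x }.

Lemma hc_nm (k : comPzRingType) (A : dgcat k) n (x : nerve_simplex A n) m m' a a' s s' b b'
    (h : wchain m a s b) (h' : wchain m' a' s' b') X Y i :
  m = m' -> a = a' -> s = s' -> b = b' -> hc X Y i (nm x h) = hc X Y i (nm x h').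
Proof. by move=> *; subst; rewrite (bool_irrelevance h h'). Qed.

Lemma dd_hc (k : comPzRingType) (A : dgcat k) (X Y X' Y' : A) i i' j (f : dghom X Y i) :
  X = X' -> Y = Y' -> i = i' -> dd j (hc X' Y' i' f) = hc X' Y' j (dd j f).
Proof. by move=> *; subst; rewrite !hc_id. Qed.

Lemma hcD (k : comPzRingType) (A : dgcat k) (X Y X' Y' : A) i j (f g : dghom X Y i) :
  hc X' Y' j (f + g) = hc X' Y' j f + hc X' Y' j g.
Proof.
rewrite /hc; case: dec_eq => e1; rewrite ?addr0 //; case: dec_eq => e2; rewrite ?addr0 //.
by case: dec_eq => e3; rewrite ?addr0 //; subst.
Qed.

Lemma hcB (k : comPzRingType) (A : dgcat k) (X Y X' Y' : A) i j (f g : dghom X Y i) :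
  hc X' Y' j (f - g) = hc X' Y' j f - hc X' Y' j g.
Proof. by rewrite hcD -scaleN1r hcZ scaleN1r. Qed.

Lemma hc_sum (k : comPzRingType) (A : dgcat k) (X Y X' Y' : A) i j (T : Type)
    (r : seq T) (P : pred T) (F : T -> dghom X Y i) :
  hc X' Y' j (\sum_(u <- r | P u) F u) = \sum_(u <- r | P u) hc X' Y' j (F u).
Proof. by apply: big_morph; [exact: hcD | exact: hc0]. Qed.

Lemma hc_cp (k : comPzRingType) (A : dgcat k) (X Y Z X' Y' Z' : A) i j l
    (g : dghom Y Z i) (f : dghom X Y j) : X = X' -> Y = Y' -> Z = Z' ->
  hc X' Z' l (cp l g f) = cp l (hc Y' Z' i g) (hc X' Y' j f).
Proof. by move=> *; subst; rewrite !hc_id. Qed.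

(** * Vertices and components of the simplices of the nerve *)

Section Interface.
Variables (k : comPzRingType) (A : dgcat k) (C : sset) (I : nerve_iso C A).

Definition nsx n (x : C n) : nerve_simplex A n := nphi I n x.
Definition ob (x : C 0) : A := nv (nsx x) ord0.
Definition obv n (x : C n) (i : nat) : A := ob (sb 0 (fun=> i) x).

(* the component [f_I] of a simplex for its full chain of vertices *)
Definition mr m (x : C m) (X Y : A) (i : int) : dghom X Y i :=
  match m return C m -> dghom X Y i with
  | 0 => fun=> 0
  | m'.+1 => fun x => hc X Y i (nm (nsx x) (dchain (did m'.+1)))
  end x.

Lemma nsx_act m n (a : dmap m n) (x : C n) : nsx (act a x) = nerve_act a (nsx x).
Proof. exact: (sfun_act (nphi I) a x). Qed.

Lemma nsx_inj n : injective (@nsx n).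
Proof. by move=> x y e; rewrite -(nphiK I x) -(nphiK I y); congr (npsi I n _). Qed.

Lemma nsx_surj n (x : nerve_simplex A n) : exists y : C n, nsx y = x.
Proof. by exists (npsi I n x); exact: (npsiK I). Qed.

Lemma obvE n (x : C n) i : (i <= n)%N -> obv x i = nv (nsx x) (inord i).
Proof.
move=> hi; rewrite /obv /ob /sb nsx_act /=; congr (nv _ _); apply: val_inj => /=.
by rewrite mkdE ?inordK //; mono.
Qed.

Lemma obv_act m n (a : dmap m n) (x : C n) i : (i <= m)%N ->
  obv (act a x) i = obv x (a (inord i)).
Proof.
move=> hi; rewrite /obv /sb -act_comp; congr (ob (act _ _)).
apply: dmap_mkd => u; rewrite dcompE.
by congr (nat_of_ord (a _)); apply: val_inj; rewrite /= inordK // mkdE //; mono.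
Qed.

Lemma obv_sb m n f (x : C n) i : mono_on m n f -> (i <= m)%N ->
  obv (sb m f x) i = obv x (f i).
Proof. by move=> hf hi; rewrite /sb obv_act // mkdE // inordK. Qed.

Lemma obv0 (x : C 0) i : obv x i = ob x.
Proof.
rewrite /obv /sb; congr ob; rewrite -[RHS]act_id; congr act.
exact: dmap0_irr.
Qed.

(** A 0-simplex carries no data beyond its object: the conditions on units and repetitions force
    every component. *)
Lemma ob_inj : injective ob.
Proof.
move=> x y e; apply: nsx_inj; move: e; rewrite /ob; case: (nsx x) (nsx y).
move=> P F F1 F2 F3 F4 [Q G G1 G2 G3 G4] /= e.
have eP : P = Q by apply: functional_extensionality_dep => i; rewrite !ord1.
subst Q; apply: nerve_simplex_eq => m a s b h.
have ea : a = b by rewrite !ord1.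
subst b; case: m h => [|m] h.
  have es : s = [::] by case/andP: h => /nilP.
  by subst s; rewrite F1 G1.
have hs : ~~ strict_chain a s a.
  by case: s h => // c s _; rewrite /strict_chain /= ltnNge !ord1.
by rewrite F2 ?G2.
Qed.

Lemma mrE m (x : C m.+1) X Y i :
  mr x X Y i = hc X Y i (nm (nsx x) (dchain (did m.+1))).
Proof. by []. Qed.

Lemma mr_act m n (J : dmap m.+1 n) (x : C n) X Y i :
  mr (act J x) X Y i = hc X Y i (nm (nsx x) (dchain J)).
Proof.
rewrite /mr nsx_act /=; apply: hc_nm => //.
by rewrite /dseq -map_comp.
Qed.

Lemma mr_id n (x : C n) (J : dmap 1 n) X i : J ord0 = J ord_max -> X = obv x (J ord0) ->
  i = 0 -> mr (act J x) X X i = hc X X i (dgid X).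
Proof.
move=> e -> ->; rewrite mr_act obvE ?leq_ord // inord_val.
have h : wchain 0 (J ord0) [::] (J ord0) by rewrite /wchain /= leqnn.
by rewrite (hc_nm _ (dchain J) h) // (nm_id _ h).
Qed.

Lemma mr_deg m n (x : C n) (J : dmap m n) X Y i : (2 <= m)%N -> ~~ dstrict J ->
  mr (act J x) X Y i = 0.
Proof.
case: m J => [|[|m]] // J _ hJ; rewrite mr_act nm_degen ?hc0 //.
by rewrite (strict_chd (dchain J)) chd_dseq.
Qed.

Lemma big_ord_pos (V : zmodType) m (F : nat -> V) :
  \sum_(w < m.+1 | (0 < w)%N) F w = \sum_(j < m) F j.+1.
Proof.
rewrite big_mkcond big_ord_recl /= add0r; apply: eq_bigr => j _.
by rewrite /bump.
Qed.

(** The boundary formula of the nerve on the full chain of vertices, with [w] an interior vertex.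
    For an edge the sum is empty, which gives closedness. *)
Lemma mr_d m (x : C m) X Y i : X = obv x 0 -> Y = obv x m -> i = 1 - m%:Z ->
  dd (i + 1) (mr x X Y i) = \sum_(w < m | (0 < w)%N) (-1) ^+ (m - w) *:
    (mr (sb m.-1 (bump w) x) X Y (i + 1) -
     cp (i + 1) (mr (sb (m - w) (addn w) x) (obv x w) Y (1 - (m - w)%N%:Z))
       (mr (sb w id x) X (obv x w) (1 - w%:Z))).
Proof.
move=> -> -> ->; case: m x => [|[|m]] x.
- by rewrite dd0 big_ord0.
- rewrite big1; last by move=> [[|w] hw].
  rewrite mrE dd_hc //; last first.
  - by rewrite obvE //; congr (nv _ _); apply: val_inj; rewrite /= inordK.
  - by rewrite obvE //; congr (nv _ _); apply: val_inj; rewrite /= inordK.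
  have h := nm_closed_weak (nsx x) (dchain (did 1)).
  rewrite (_ : 1 - 1%:Z + 1 = - 0%N%:Z + 1) // (ddE (erefl (- 0%N%:Z + 1))).
  by rewrite h hc0.
rewrite [mr x _ _ _]mrE.
have e0 : nv (nsx x) (did m.+2 ord0) = obv x 0.
  by rewrite obvE //; congr (nv _ _); apply: val_inj; rewrite /= inordK.
have em : nv (nsx x) (did m.+2 ord_max) = obv x m.+2.
  by rewrite obvE //; congr (nv _ _); apply: val_inj; rewrite /= inordK.
rewrite dd_hc //; last by lia.
rewrite (_ : 1 - m.+2%:Z + 1 = - m%:Z); last by lia.
rewrite (ddE (nerve_deg m)) nm_d_weak /nerve_rhs.
rewrite (big_ord_pos m.+1 (fun w => (-1) ^+ (m.+2 - w) *:
    (mr (sb m.+2.-1 (bump w) x) (obv x 0) (obv x m.+2) (- m%:Z) -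
     cp (- m%:Z) (mr (sb (m.+2 - w) (addn w) x) (obv x w) (obv x m.+2) (1 - (m.+2 - w)%N%:Z))
       (mr (sb w id x) (obv x 0) (obv x w) (1 - w%:Z))))).
rewrite hc_sum; apply: eq_bigr => j _; have hj := ltn_ord j.
rewrite hcZ subSS; congr (_ *: _); rewrite hcB; congr (_ - _).
  rewrite /sb mr_act; apply: hc_nm => //.
  - by apply: val_inj; rewrite /= mkdE //; mono.
  - apply: (@eq_from_nth _ ord0).
      by rewrite size_cat size_takel ?size_drop ?size_map ?size_iota; lia.
    move=> u; rewrite size_cat size_takel ?size_drop ?size_map ?size_iota; last by lia.
    move=> hu; rewrite dseq_nth; last by lia.
    rewrite nth_cat size_takel ?size_map ?size_iota; last by lia.
    apply: val_inj; rewrite [RHS]mkdE; last by mono.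
    rewrite inordK; last by lia.
    rewrite /bump; case: ltnP => huj.
      by rewrite nth_take // dseq_nth /= ?inordK; lia.
    by rewrite nth_drop dseq_nth /= ?inordK; lia.
  - by apply: val_inj; rewrite /= mkdE /bump /=; [lia | mono].
have en : nth (did m.+2 ord0) (dseq (did m.+2)) j = inord j.+1 by rewrite dseq_nth.
have eo : nv (nsx x) (nth (did m.+2 ord0) (dseq (did m.+2)) j) = obv x j.+1.
  by rewrite obvE ?en //; lia.
rewrite -(cpE (nerve_deg_comp j)) (hc_cp _ _ _ e0 eo em).
rewrite (_ : (m.+1 - j)%N = (m - j).+1); last by lia.
rewrite (_ : 1 - (m - j).+1%:Z = - (m - j)%N%:Z); last by lia.
rewrite (_ : 1 - j.+1%:Z = - j%:Z); last by lia.
rewrite /sb !mr_act; congr cp; apply: hc_nm => //.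
- by rewrite en; apply: val_inj; rewrite /= mkdE ?addn0 ?inordK //; [lia | mono].
- apply: (@eq_from_nth _ ord0); first by rewrite size_drop !size_map !size_iota; lia.
  move=> u; rewrite size_drop size_map size_iota => hu.
  rewrite nth_drop !dseq_nth; [|lia|lia].
  by apply: val_inj; rewrite [RHS]mkdE /= ?inordK; [lia | lia | lia | mono].
- by apply: val_inj; rewrite /= mkdE /=; [lia | mono].
- by apply: val_inj; rewrite /= mkdE //; mono.
- apply: (@eq_from_nth _ ord0); first by rewrite size_takel !size_map !size_iota; lia.
  move=> u; rewrite size_takel ?size_map ?size_iota; last by lia.
  move=> hu; rewrite nth_take // !dseq_nth; [|lia|lia].
  by apply: val_inj; rewrite [RHS]mkdE /= ?inordK; [ | lia | lia | mono].
- by rewrite en; apply: val_inj; rewrite /= mkdE /= ?inordK //; [lia | mono].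
Qed.
(** Only the components on strict faces are free; all others are identities or zero. *)
Lemma simplex_ext n (x y : C n) :
  (forall i, (i <= n)%N -> obv x i = obv y i) ->
  (forall l (J : dmap l n) X Y i, dstrict J -> (0 < l)%N -> X = obv x (J ord0) ->
    Y = obv x (J ord_max) -> i = 1 - l%:Z -> mr (act J x) X Y i = mr (act J y) X Y i) ->
  x = y.
Proof.
move=> eo em; apply: nsx_inj.
have {}eo (i : 'I_n.+1) : nv (nsx x) i = nv (nsx y) i.
  by have := eo i (leq_ord i); rewrite !obvE ?leq_ord // inord_val.
have {}em m (J : dmap m.+1 n) : dstrict J ->
    nm (nsx x) (dchain J) = hc _ _ _ (nm (nsx y) (dchain J)).
  move=> hJ; rewrite -[LHS]hc_id -!mr_act; apply: em => //.
  - by rewrite obvE ?leq_ord // inord_val.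
  - by rewrite obvE ?leq_ord // inord_val.
  - by lia.
case: (nsx x) (nsx y) eo em => P F F1 F2 F3 F4 [Q G G1 G2 G3 G4] /= eo em.
have eP : P = Q by apply: functional_extensionality_dep => i; exact: eo.
subst Q; apply: nerve_simplex_eq => m a s b h.
have [hs|hs] := boolP (strict_chain a s b); last first.
  case: m h => [|m] h; last by rewrite F2 ?G2.
  have es : s = [::] by case/andP: h => /nilP.
  subst s; have ea : a = b.
    move: hs h; rewrite /strict_chain /wchain /= !andbT => h1 h2.
    by apply: val_inj; apply/eqP; rewrite eqn_leq h2 leqNgt.
  by subst b; rewrite F1 G1.
have [e1 e2 e3] := dseq_chd h.
have := @em m (chd m a s b); rewrite -(strict_chd h) => /(_ hs).
move: (dchain _); rewrite e1 e2 e3 => h' e.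
by rewrite (bool_irrelevance h h') e hc_id.
Qed.

(** [M] is given for all objects and degrees, but only its values at the right ones on strict faces
    matter. Extended by identities and zeros it satisfies the axioms, because the chains occurring
    in [nerve_rhs] for a strict chain are again strict. *)
Lemma simplex_exists N (P : 'I_N.+1 -> A)
    (M : forall l, dmap l N -> forall X Y i, dghom X Y i) :
  (forall m (J : dmap m N) X Y i, dstrict J -> (0 < m)%N -> X = P (J ord0) ->
    Y = P (J ord_max) -> i = 1 - m%:Z ->
    dd (i + 1) (M m J X Y i) = \sum_(w < m | (0 < w)%N) (-1) ^+ (m - w) *:
    (M m.-1 (dcomp J (mkd m.-1 m (bump w))) X Y (i + 1) -
     cp (i + 1) (M (m - w)%N (dcomp J (mkd (m - w) m (addn w))) (P (J (inord w))) Y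
                   (1 - (m - w)%N%:Z))
       (M w (dcomp J (mkd w m id)) X (P (J (inord w))) (1 - w%:Z)))) ->
  exists x : C N, (forall a : 'I_N.+1, obv x a = P a) /\
    (forall m (J : dmap m N) X Y i, dstrict J -> (0 < m)%N -> X = P (J ord0) ->
      Y = P (J ord_max) -> i = 1 - m%:Z -> mr (act J x) X Y i = M m J X Y i).
Proof.
move=> hM.
pose F m a s b (h : @wchain N m a s b) : dghom (P a) (P b) (- m%:Z) :=
  if strict_chain a s b then M m.+1 (chd m a s b) (P a) (P b) (- m%:Z)
  else if m is 0 then hc (P a) (P b) (- m%:Z) (dgid (P a)) else 0.
have FE m a s b (h : @wchain N m a s b) : strict_chain a s b ->
    F m a s b h = M m.+1 (chd m a s b) (P a) (P b) (- m%:Z) by rewrite /F => ->.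
have F1 a (h : wchain 0 a [::] a) : F _ _ _ _ h = dgid (P a).
  by rewrite /F /strict_chain /= ltnn /= hc_id.
have F2 m a s b (h : wchain m.+1 a s b) : ~~ strict_chain a s b -> F _ _ _ _ h = 0.
  by rewrite /F => /negbTE ->.
have F3 a s b (h : wchain 0 a s b) : strict_chain a s b -> cocycle (F _ _ _ _ h).
  move=> hs; rewrite FE // /cocycle -ddE.
  have [e1 _ e3] := dseq_chd h; rewrite (strict_chd h) in hs.
  rewrite (@hM 1 (chd 0 a s b)) ?e1 ?e3 //.
  by rewrite big1 //; move=> [[|w] hw].
have F4 m a s b (h : wchain m.+1 a s b) : strict_chain a s b ->
    cd (nerve_deg m) (F _ _ _ _ h) = nerve_rhs F h.
  move=> hs; rewrite FE // -ddE.
  have [e1 _ e3] := dseq_chd h; have hs' := hs; rewrite (strict_chd h) in hs'.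
  have sz : size s = m.+1 by case/andP: (h) => /eqP.
  have eJ (j : 'I_m.+1) : nth a s j = chd m.+1 a s b (inord j.+1).
    have hj := ltn_ord j; rewrite chdE // inordK /=; last by lia.
    by rewrite nth_rcons sz hj; apply: set_nth_default; rewrite sz.
  have := @hM m.+2 (chd m.+1 a s b) (P a) (P b) (- m.+1%:Z) hs' isT.
  rewrite e1 e3 (_ : - m.+1%:Z + 1 = - m%:Z); last by lia.
  move=> ->//; last by lia.
  rewrite (big_ord_pos m.+1 (fun w => (-1) ^+ (m.+2 - w) *:
    (M m.+1 (dcomp (chd m.+1 a s b) (mkd m.+1 m.+2 (bump w))) (P a) (P b) (- m%:Z) -
     cp (- m%:Z) (M (m.+2 - w)%N (dcomp (chd m.+1 a s b) (mkd (m.+2 - w) m.+2 (addn w)))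
         (P (chd m.+1 a s b (inord w))) (P b) (1 - (m.+2 - w)%N%:Z))
       (M w (dcomp (chd m.+1 a s b) (mkd w m.+2 id)) (P a) (P (chd m.+1 a s b (inord w)))
         (1 - w%:Z))))).
  apply: eq_bigr => j _; have hj := ltn_ord j; rewrite subSS.
  congr (_ *: (_ - _)).
    rewrite FE -?(chd_face h) // (strict_chd (wchain_face j h)) (chd_face h).
    by apply: dstrict_comp => //; apply: dstrict_mkd; [mono | rewrite /bump => ? ?; lia].
  rewrite -(cpE (nerve_deg_comp j)) !FE; last first.
  - rewrite (strict_chd (wchain_drop j h)) (chd_drop h).
    by apply: dstrict_comp => //; apply: dstrict_mkd; [mono | move=> ? ?; lia].
  - rewrite (strict_chd (wchain_take j h)) (chd_take h).
    by apply: dstrict_comp => //; apply: dstrict_mkd; [mono | move=> ? ?; lia].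
  rewrite (chd_drop h) (chd_take h) -eJ.
  rewrite (_ : (m.+1 - j)%N = (m - j).+1); last by lia.
  rewrite (_ : 1 - (m - j).+1%:Z = - (m - j)%N%:Z); last by lia.
  by rewrite (_ : 1 - j.+1%:Z = - j%:Z); last by lia.
have [x ex] := nsx_surj (NerveSimplex F1 F2 F3 F4).
exists x; split=> [a|m J X Y i hJ hm eX eY ei].
  by rewrite obvE ?leq_ord // ex /= inord_val.
case: m J hJ hm eX eY ei => // m J hJ _ eX eY ei.
have {}ei : i = - m%:Z by lia.
subst i X Y; rewrite mr_act ex.
by rewrite hc_id [LHS] FE ?chd_dseq // (strict_chd (dchain J)) chd_dseq.
Qed.
End Interface.

(** * The opposite of the nerve *)

Lemma nerve_iso_bij (k : comPzRingType) (C : sset) (A : dgcat k) (phi : smap C (dg_nerve A)) :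
  (forall n, injective (phi n)) -> (forall n y, exists x, phi n x = y) ->
  exists I : nerve_iso C A, nphi I = phi.
Proof.
move=> inj surj.
pose psi n y := sval (constructive_indefinite_description _ (surj n y)).
have psiK n y : phi n (psi n y) = y by rewrite /psi; case: constructive_indefinite_description.
have psiA m n (a : dmap m n) y : psi m (act a y) = act a (psi n y).
  by apply: inj; rewrite psiK sfun_act psiK.
unshelve eexists (@NerveIso k C A phi (SMap psiA) _ _) => //.
by move=> n x; apply: inj; rewrite [LHS]psiK.
Qed.

Definition nerve_iso_id (k : comPzRingType) (A : dgcat k) : nerve_iso (dg_nerve A) A.
Proof.
pose i : smap (dg_nerve A) (dg_nerve A) := @SMap _ _ (fun n x => x) (fun _ _ _ _ => erefl).
exact: (@NerveIso k (dg_nerve A) A i i (fun _ _ => erefl) (fun _ _ => erefl)).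
Defined.

Lemma triS n : 'C(n.+1, 2) = ('C(n, 2) + n)%N.
Proof. by rewrite binS bin1. Qed.

(** The cross term [a * b] is the exponent of the Koszul sign in [dgop_comp]; this is why the
    reversal sign is quadratic in the number of interior vertices. *)
Lemma triD a b : 'C(a + b, 2) = ('C(a, 2) + 'C(b, 2) + a * b)%N.
Proof. by elim: b => [|b IH]; rewrite ?addn0 ?muln0 ?addn0 // addnS !triS IH mulnS; lia. Qed.

Lemma cp_op (k : comPzRingType) (A : dgcat k) (X Y Z : A) i j l
    (g : dghom Z Y i) (f : dghom Y X j) :
  @cp k (dgop A) X Y Z i j l g f = (-1) ^+ (`|i| * `|j|)%N *: cp l f g.
Proof.
rewrite {1}/cp; case: eqP => e; last first.
  by rewrite /cp; case: eqP => [e'|_]; [case: e; rewrite addrC | rewrite scaler0].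
by rewrite [LHS]/= /dgop_comp (cpE (etrans (addrC j i) e)).
Qed.

Lemma sum_rev_pos (V : zmodType) m (F : nat -> V) :
  \sum_(w < m | (0 < w)%N) F w = \sum_(w < m | (0 < w)%N) F (m - w)%N.
Proof.
case: m => [|m]; first by rewrite !big_ord0.
rewrite big_ord_pos (big_ord_pos m (fun w => F (m.+1 - w)%N)) (reindex_inj rev_ord_inj) /=.
by apply: eq_bigr => j _; congr F; have := ltn_ord j; lia.
Qed.

Lemma dstrict_rev m n (a : dmap m n) : dstrict (drev a) = dstrict a.
Proof.
have H m' n' (b : dmap m' n') : dstrict b -> dstrict (drev b).
  move=> /dstrictP h; apply/dstrictP => i j hij /=.
  have := h (rev_ord j) (rev_ord i); rewrite /= => hh.
  have := ltn_ord (b (rev_ord i)); have := ltn_ord (b (rev_ord j)).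
  have := ltn_ord i; have := ltn_ord j; lia.
apply/idP/idP; last exact: H.
by move/H; congr dstrict; apply: dmap_eq => i; rewrite /= !rev_ordK.
Qed.

Lemma drev_comp l m n (a : dmap m n) (b : dmap l m) : drev (dcomp a b) = dcomp (drev a) (drev b).
Proof. by apply: dmap_eq => i; rewrite /= rev_ordK. Qed.

Lemma drev_mkd m n f : mono_on m n f ->
  drev (mkd m n f) = mkd m n (fun i => n - f (m - i))%N.
Proof.
by move=> hf; apply: dmap_mkd => i; rewrite /= mkdE //= !subSS.
Qed.

Lemma drev_ends m n (J : dmap m n) :
  (n - drev J ord0 = J ord_max)%N /\ (n - drev J ord_max = J ord0)%N.
Proof.
split; rewrite /= subSS subKn ?leq_ord //; congr (nat_of_ord (J _)); apply: val_inj.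
  by rewrite /= subSS subn0.
by rewrite /= subnn.
Qed.

Section OpIso.
Variables (k : comPzRingType) (A : dgcat k) (C : sset) (I : nerve_iso C A).

(* reversing a chain with [m] interior vertices introduces the sign [(-1)^C(m, 2)] *)
Definition op_pred n (x : C n) (y : dg_nerve (dgop A) n) : Prop :=
  (forall i, (i <= n)%N -> obv (nerve_iso_id (dgop A)) y i = obv I (x : C n) (n - i)) /\
  (forall m (J : dmap m n) (X Y : dgop A) i, X = obv I (x : C n) (n - J ord0) ->
    Y = obv I (x : C n) (n - J ord_max) -> i = 1 - m%:Z ->
    mr (nerve_iso_id (dgop A)) (act J y) X Y i =
    (-1) ^+ 'C(m.-1, 2) *: mr I (act (drev J) (x : C n)) Y X i).

(** Reversal replaces [(-1)^(m - w)] by [(-1)^w], a change of parity [m]. For a face it is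
    compensated by [C(m - 1, 2) - C(m - 2, 2)], for a composite by [triD] together with the Koszul
    sign. *)
Lemma op_d n (x : C n) m (J : dmap m n) (X Y : dgop A) i : (0 < m)%N ->
  X = obv I (x : C n) (n - J ord0) -> Y = obv I (x : C n) (n - J ord_max) -> i = 1 - m%:Z ->
  dd (i + 1) ((-1) ^+ 'C(m.-1, 2) *: mr I (act (drev J) x) Y X i : dghom X Y i) =
  \sum_(w < m | (0 < w)%N) (-1) ^+ (m - w) *:
    (((-1) ^+ 'C(m.-2, 2) *: mr I (act (drev (dcomp J (mkd m.-1 m (bump w)))) x) Y X (i + 1)
       : dghom X Y (i + 1)) -
     cp (i + 1) ((-1) ^+ 'C((m - w).-1, 2) *:
         mr I (act (drev (dcomp J (mkd (m - w) m (addn w)))) x) Y (obv I x (n - J (inord w)))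
           (1 - (m - w)%N%:Z) : dghom (obv I x (n - J (inord w)) : dgop A) Y _)
       ((-1) ^+ 'C(w.-1, 2) *: mr I (act (drev (dcomp J (mkd w m id))) x)
          (obv I x (n - J (inord w))) X (1 - w%:Z) : dghom X (obv I x (n - J (inord w)) : dgop A) _)).
Proof.
move=> hm eX eY ei.
have e0 : Y = obv I (act (drev J) (x : C n)) 0.
  rewrite obv_act // eY /=; congr obv; rewrite subSS.
  by congr (_ - _)%N; congr (nat_of_ord (J _)); apply: val_inj; rewrite /= inordK //; lia.
have em : X = obv I (act (drev J) x) m.
  rewrite obv_act // eX /=; congr obv; rewrite subSS.
  by congr (_ - _)%N; congr (nat_of_ord (J _)); apply: val_inj; rewrite /= inordK //; lia.
rewrite ddZ [X in _ *: X](@mr_d k A C I m (act (drev J) (x : C n)) Y X i e0 em ei).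
rewrite (sum_rev_pos m (fun w => (-1) ^+ (m - w) *:
   (mr I (sb m.-1 (bump w) (act (drev J) x)) Y X (i + 1) -
    cp (i + 1) (mr I (sb (m - w) (addn w) (act (drev J) x)) (obv I (act (drev J) x) w) X
       (1 - (m - w)%N%:Z)) (mr I (sb w id (act (drev J) x)) Y (obv I (act (drev J) x) w)
       (1 - w%:Z))))).
rewrite scaler_sumr; apply: eq_bigr => w hw; have hwm := ltn_ord w.
rewrite (_ : (m - (m - w) = w)%N); last by lia.
rewrite cp_op cpZl cpZr /sb -!act_comp !drev_comp.
rewrite drev_mkd; last by mono.
rewrite drev_mkd; last by mono.
rewrite drev_mkd; last by mono.
rewrite (@mkd_eq m.-1 m (bump (m - w)) (fun u => m - bump w (m.-1 - u))%N); last first.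
  by move=> u hu; rewrite /bump; lia.
rewrite (@mkd_eq w m (addn (m - w)) (fun u => m - (w - u))%N); last by move=> u hu; lia.
rewrite (@mkd_eq (m - w) m id (fun u => m - (w + (m - w - u)))%N); last by move=> u hu; lia.
have -> : obv I (act (drev J) x) (m - w) = obv I (x : C n) (n - J (inord w)).
  rewrite obv_act; last by lia.
  rewrite /= subSS; congr (obv _ _ (_ - _)); congr (nat_of_ord (J _)).
  by apply: val_inj; rewrite /= !inordK; lia.
rewrite !scalerBr !signE; congr (_ - _).
  apply: sign_odd.
  have [u eu] : exists u, m = u.+2 by exists (m.-2); lia.
  have -> : m.-1 = u.+1 by lia.
  rewrite /=.
  by rewrite triS; lia.
apply: sign_odd.
have [a ea] : exists a, w = a.+1 :> nat by exists w.-1; lia.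
have [b eb] : exists b, (m - w)%N = b.+1 by exists (m - w).-1; lia.
rewrite eb ea (_ : m.-1 = (a + b).+1); last by lia.
rewrite (_ : absz (1 - b.+1%:Z) = b); last by lia.
rewrite (_ : absz (1 - a.+1%:Z) = a); last by lia.
by rewrite triS triD /= mulnC; lia.
Qed.

Lemma op_exists n (x : C n) : exists y, op_pred x y.
Proof.
have [|y [yo ym]] := @simplex_exists k (dgop A) _ (nerve_iso_id (dgop A)) n
  (fun a => obv I (x : C n) (n - a))
  (fun m J X Y i => (-1) ^+ 'C(m.-1, 2) *: mr I (act (drev J) (x : C n)) Y X i).
  by move=> m J X Y i _; exact: op_d.
exists y; split=> [i hi|m J X Y i eX eY ei].
  rewrite -[i in obv _ _ i](@inordK n) ?ltnS // yo inordK //.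
have [hJ|hJ] := boolP (dstrict J).
  case: m J hJ eX eY ei => [|m] J hJ eX eY ei; first by rewrite scaler0.
  by apply: ym.
case: m J hJ eX eY ei => [|[|m]] J hJ eX eY ei; first by rewrite scaler0.
  have e : J ord0 = J ord_max.
    apply: val_inj; apply/eqP; rewrite eqn_leq dfun_homo //= leqNgt; apply: contra hJ => h.
    apply/dstrictP => u v huv; have [-> ->] : u = ord0 /\ v = ord_max; last by [].
    by split; apply: val_inj; move: huv; case: u v => [[|[|u]] hu] [[|[|v]] hv].
  have eXY : Y = X by rewrite eX eY e.
  clear eY; subst Y; rewrite bin_small // expr0 scale1r (mr_id (I := I) (J := drev J)) //; last first.
  - rewrite eX /= subSS; congr obv; rewrite e.
    by congr (_ - _)%N; congr (nat_of_ord (J _)); apply: val_inj.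
  - apply: val_inj; rewrite /= !subSS.
    rewrite (_ : rev_ord ord0 = ord_max); last exact: val_inj.
    rewrite (_ : rev_ord ord_max = ord0); last exact: val_inj.
    by rewrite e.
  rewrite (mr_id (I := nerve_iso_id (dgop A)) (J := J)) //; last by rewrite yo -eX.
  by rewrite (_ : i = 0) ?ei // !hc_id.
rewrite (mr_deg (nerve_iso_id (dgop A)) y (J := J)) //.
by rewrite (mr_deg I x (J := drev J)) ?scaler0 // dstrict_rev.
Qed.

Lemma op_unique n (x : C n) y z : op_pred x y -> op_pred x z -> y = z.
Proof.
move=> [yo ym] [zo zm]; apply: (simplex_ext (I := nerve_iso_id (dgop A))).
  by move=> i hi; rewrite yo ?zo.
move=> l J X Y i hJ hl eX eY ei.
have hX : X = obv I x (n - J ord0) by rewrite eX yo // leq_ord.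
have hY : Y = obv I x (n - J ord_max) by rewrite eY yo // leq_ord.
by rewrite ym ?zm.
Qed.

Lemma op_inj n (x x' : C n) y : op_pred x y -> op_pred x' y -> x = x'.
Proof.
move=> [yo ym] [zo zm].
have eo i : (i <= n)%N -> obv I x i = obv I x' i.
  by move=> hi; rewrite -[i](@subKn i n) // -yo ?leq_subr // zo ?leq_subr.
apply: (simplex_ext (I := I)) => // l J X Y i hJ hl eX eY ei.
have [k1 k0] := drev_ends J.
have hy := ym l (drev J) Y X i; have hz := zm l (drev J) Y X i.
rewrite !k0 !k1 in hy hz.
have hX : X = obv I x' (J ord0) by rewrite eX eo // leq_ord.
have hY : Y = obv I x' (J ord_max) by rewrite eY eo // leq_ord.
have kJ : drev (drev J) = J by apply: dmap_eq => u; rewrite /= !rev_ordK.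
have := etrans (esym (hy eY eX ei)) (hz hY hX ei); rewrite kJ => /(congr1 (fun v => (-1) ^+ 'C(l.-1, 2) *: v)).
by rewrite !signK.
Qed.

End OpIso.

Lemma cp_opop (k : comPzRingType) (A : dgcat k) (X Y Z : A) i j l
    (g : dghom Y Z i) (f : dghom X Y j) : @cp k (dgop (dgop A)) X Y Z i j l g f = cp l g f.
Proof. by rewrite !cp_op mulnC signK. Qed.

Section OpIso2.
Variables (k : comPzRingType) (A : dgcat k) (C : sset) (I : nerve_iso C A).

(** The construction is applied a second time, over [dgop A]. It yields a candidate whose components
    compose in [dgop (dgop A)], where composition agrees with that of [A] by [cp_opop]. *)
Lemma op_surj n (y : dg_nerve (dgop A) n) : exists x : C n, op_pred I x y.
Proof.
pose I' := nerve_iso_id (dgop A).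
have [|x [xo xm]] := @simplex_exists k A _ I n (fun a => obv I' y (n - a))
  (fun m J X Y i => (-1) ^+ 'C(m.-1, 2) *: mr I' (act (drev J) y) Y X i).
  move=> m J X Y i _ hm eX eY ei.
  have := @op_d _ _ _ I' n y m J X Y i hm eX eY ei; rewrite /= => ->.
  by apply: eq_bigr => w _; rewrite cp_opop.
have [z hz] := op_exists I x; exists x; suff -> : y = z by [].
have [zo zm] := hz.
have eo i : (i <= n)%N -> obv I' y i = obv I x (n - i).
  by move=> hi; rewrite -[(n - i)%N](@inordK n) ?ltnS ?leq_subr // xo inordK ?ltnS ?leq_subr // subKn.
apply: (simplex_ext (I := I')) => [i hi|l J X Y i hJ hl eX eY ei].
  by rewrite eo // zo.
have hX : X = obv I x (n - J ord0) by rewrite eX eo // leq_ord.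
have hY : Y = obv I x (n - J ord_max) by rewrite eY eo // leq_ord.
have [k0 k1] := drev_ends J.
have kJ : drev (drev J) = J by apply: dmap_eq => u; rewrite /= !rev_ordK.
have := xm l (drev J) Y X i; rewrite k0 k1 dstrict_rev kJ => /(_ hJ hl eY eX ei) e.
by rewrite (zm l J X Y i hX hY ei) e signK.
Qed.

Definition op_fun n (x : C n) : dg_nerve (dgop A) n :=
  sval (constructive_indefinite_description _ (op_exists I x)).

Lemma op_funP n (x : C n) : op_pred I x (op_fun x).
Proof. by rewrite /op_fun; case: constructive_indefinite_description. Qed.

Lemma op_fun_act m n (a : dmap m n) (x : C n) :
  op_fun (act (drev a) x) = act a (op_fun x).
Proof.
apply: op_unique; first exact: op_funP.
have [o h] := op_funP x; split=> [i hi|l J X Y i eX eY ei].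
  rewrite !obv_act ?leq_subr // o ?leq_ord //; apply: (congr1 (obv I x)); rewrite /= subSS.
  congr (_ - _)%N; congr (nat_of_ord (a _)); apply: val_inj.
  by rewrite /= !inordK; lia.
rewrite -!act_comp -drev_comp; apply: h => //; rewrite ?eX ?eY obv_act ?leq_subr //; apply: (congr1 (obv I x)).
- rewrite /= subSS; congr (_ - _)%N; congr (nat_of_ord (a _)); apply: val_inj.
  by rewrite /= !inordK; have := ltn_ord (J ord0); lia.
- rewrite /= subSS; congr (_ - _)%N; congr (nat_of_ord (a _)); apply: val_inj.
  by rewrite /= !inordK; have := ltn_ord (J ord_max); lia.
Qed.

(** The sign stays explicit because squares are later compared with their opposites component by
    component; it is trivial for simplices of dimension at most 2. *)
Lemma nerve_iso_op : exists I' : nerve_iso (sset_op C) (dgop A),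
  (forall x : C 0, ob I' x = ob I x) /\
  (forall m (x : C m) (X Y : A) i, X = obv I x 0 -> Y = obv I x m -> i = 1 - m%:Z ->
    mr I' (x : sset_op C m) Y X i = (-1) ^+ 'C(m.-1, 2) *: mr I x X Y i).
Proof.
pose phi : smap (sset_op C) (dg_nerve (dgop A)) :=
  @SMap (sset_op C) (dg_nerve (dgop A)) op_fun (fun m n a x => op_fun_act a x).
have [I' eI'] : exists I', nphi I' = phi.
  apply: nerve_iso_bij => [n x x' e|n y].
    by apply: op_inj (op_funP x) _; rewrite [op_fun x]e; exact: op_funP.
  by have [x hx] := op_surj y; exists x; apply: op_unique hx; exact: op_funP.
have obE n (x : C n) : nsx I' (x : sset_op C n) = op_fun x by rewrite /nsx eI'.
exists I'; split=> [x|m x X Y i eX eY ei].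
  have [o _] := op_funP x; rewrite /ob obE.
  by have := o 0 isT; rewrite !obv0.
have [o h] := op_funP x.
have := h m (did m) Y X i; rewrite act_id.
rewrite (_ : (m - did m ord0)%N = m) ?subn0 // (_ : (m - did m ord_max)%N = 0%N) ?subnn //.
move=> /(_ eY eX ei); rewrite (_ : drev (did m) = did m) ?act_id; last first.
  by apply: dmap_eq => u; rewrite /= rev_ordK.
move=> <-; case: m x {eX eY ei o h} => // m x.
by rewrite !mrE obE.
Qed.
End OpIso2.

(** * Cochains with values in a diagram *)

(** Two vertices can be removed in either order: removing [w] and then [u < w] is paired with
    removing [u] and then [w - 1]. *)
Lemma sum_pairs (V : zmodType) l (G : nat -> nat -> V) :
  \sum_(w < l) \sum_(u < l.-1) G w u =
  \sum_(w < l) \sum_(u < l | (u < w)%N) (G w u + G u w.-1).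
Proof.
transitivity (\sum_(w < l) (\sum_(u < l | (u < w)%N) G w u + \sum_(u < l | (w < u)%N) G w u.-1)).
  apply: eq_bigr => w _; have hw := ltn_ord w.
  rewrite -(big_mkord (fun u => u < w)%N) -(big_mkord (fun u => w < u)%N (fun u => G w u.-1)).
  rewrite -(big_mkord xpredT).
  rewrite (@big_cat_nat _ _ _ w 0 l.-1) //=; last by lia.
  congr (_ + _).
    rewrite (@big_cat_nat _ _ _ w 0 l) //=; last by lia.
    rewrite [X in _ = _ + X]big1_seq ?addr0; last first.
      by move=> u /andP[h1]; rewrite mem_index_iota; lia.
    by rewrite big_mkcond [RHS]big_mkcond; apply: eq_big_nat => u hu; rewrite (_ : (u < w)%N).
  rewrite (@big_cat_nat _ _ _ w.+1 0 l) //=.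
  rewrite [X in _ = X + _]big1_seq ?add0r; last first.
    by move=> u /andP[h1]; rewrite mem_index_iota; lia.
  rewrite big_add1 [RHS]big_mkcond; apply: eq_big_nat => u hu /=.
  by rewrite ltnS (_ : (w <= u)%N) //; lia.
rewrite big_split /=.
have -> : \sum_(w < l) \sum_(u < l | (w < u)%N) G w u.-1 =
    \sum_(w < l) \sum_(u < l | (u < w)%N) G u w.-1.
  under eq_bigr => w _ do rewrite big_mkcond.
  by rewrite exchange_big /=; apply: eq_bigr => w _; rewrite [RHS]big_mkcond.
by rewrite -big_split /=; apply: eq_bigr => w _; rewrite big_split.
Qed.

(** A vertex and an offset are replaced by the pair of vertices they determine. *)
Lemma sum_shift (V : zmodType) l (H : nat -> nat -> V) :
  \sum_(w < l) \sum_(v < l - w | (0 < v)%N) H w v =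
  \sum_(w < l) \sum_(u < l | (u < w)%N) H u (w - u)%N.
Proof.
transitivity (\sum_(w < l) \sum_(u < l | (w < u)%N) H w (u - w)%N).
  apply: eq_bigr => w _; have hw := ltn_ord w.
  rewrite -(big_mkord (fun v => 0 < v)%N (H w)) -(big_mkord (fun u => w < u)%N (fun u => H w (u - w)%N)).
  rewrite (@big_cat_nat _ _ _ w 0 l) //=; last by lia.
  rewrite [X in _ = X + _]big1_seq ?add0r; last first.
    by move=> u /andP[h1]; rewrite mem_index_iota; lia.
  transitivity (\sum_(0 + w <= u < l | (w < u)%N) H w (u - w)%N); last by rewrite add0n.
  by rewrite big_addn; apply: eq_big => [u|u hu]; [lia | rewrite addnK].
under eq_bigr => w _ do rewrite big_mkcond.
rewrite exchange_big /=; apply: eq_bigr => w _.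
by rewrite [RHS]big_mkcond.
Qed.

Lemma sum_widen (V : zmodType) l (H : nat -> nat -> V) :
  \sum_(w < l) \sum_(u < w) H w u = \sum_(w < l) \sum_(u < l | (u < w)%N) H w u.
Proof.
by apply: eq_bigr => w _; rewrite (big_ord_widen l (H w)) // ltnW.
Qed.

Section Cochains.
Variables (k : comPzRingType) (A : dgcat k) (C : sset) (I : nerve_iso C A).
Variables (K : sset) (p : smap K C) (W : A).

(* Families with [c l t] in [Hom(W, X)] for [X] the last vertex of [t]; the target
   object and the degree are arguments. *)
Definition coch := forall l, K l -> forall Y i, dghom W Y i.
Implicit Types c : coch.

Definition oK l (t : K l) (w : nat) : A := obv I (p l t) w.
Definition mK l (t : K l) X Y i : dghom X Y i := mr I (p l t) X Y i.

(** The right-hand side of the boundary formula for the join of an apex at [W] with [t]: vertex [w]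
    of [t] is the interior vertex [w + 1] of the join, so that [w = 0] occurs as well. A cochain of
    total degree [e] has its value on an [l]-simplex in degree [e - l]. *)
Definition cR c l (t : K l) Y i : dghom W Y i :=
  \sum_(w < l) (-1) ^+ (l - w) *:
    (c l.-1 (sb l.-1 (bump w) t) Y i -
     cp i (mK (sb (l - w) (addn w) t) (oK t w) Y (1 - (l - w)%N%:Z))
       (c w (sb w id t) (oK t w) (i - 1 + (l - w)%N%:Z))).

(* the sign makes [cD] square to zero in every degree *)
Definition cD c : coch := fun l t Y i =>
  (-1) ^+ l *: (dd i (c l t Y (i - 1)) - cR c t Y i).

Lemma oK_sb m l f (t : K l) i : mono_on m l f -> (i <= m)%N -> oK (sb m f t) i = oK t (f i).
Proof. by move=> hf hi; rewrite /oK sfun_sb obv_sb. Qed.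

Lemma mK_d l (t : K l) X Y i : X = oK t 0 -> Y = oK t l -> i = 1 - l%:Z ->
  dd (i + 1) (mK t X Y i) = \sum_(w < l | (0 < w)%N) (-1) ^+ (l - w) *:
    (mK (sb l.-1 (bump w) t) X Y (i + 1) -
     cp (i + 1) (mK (sb (l - w) (addn w) t) (oK t w) Y (1 - (l - w)%N%:Z))
       (mK (sb w id t) X (oK t w) (1 - w%:Z))).
Proof.
by move=> eX eY ei; rewrite [LHS]mr_d //; apply: eq_bigr => w _; rewrite /mK !sfun_sb.
Qed.

(** [X1] collects the double faces and cancels in pairs. [X2] (a face inside the morphism), [X3] (a
    triple composite) and [X4] (a face inside the cochain) each occur twice with opposite signs,
    [X2] and [X3] once through the Maurer-Cartan equation of the diagram. *)
Lemma cD_cD c l (t : K l) Y i : Y = oK t l -> cD (cD c) t Y i = 0.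
Proof.
move=> eY; rewrite {1}/cD {1}/cD ddZ ddB dd_dd sub0r.
pose q w := mK (sb (l - w) (addn w) t) (oK t w) Y (1 - (l - w)%N%:Z).
pose e w := i - 1 + (l - w)%N%:Z.
pose a w := c w (sb w id t) (oK t w) (e w - 1).
pose Rf w := cR c (sb l.-1 (bump w) t) Y i.
pose Rt w := cR c (sb w id t) (oK t w) (e w).
pose dq w := dd (1 - (l - w)%N%:Z + 1) (q w).
have dR : dd i (cR c t Y (i - 1)) = \sum_(w < l) ((-1) ^+ (l - w) *:
    (dd i (c l.-1 (sb l.-1 (bump w) t) Y (i - 1)) - cp i (dq w) (a w)) +
    cp i (q w) (dd (e w) (a w))).
  rewrite dd_sum; apply: eq_bigr => w _; have hw := ltn_ord w.
  rewrite ddZ ddB -[LHS]addr0 -/(q w).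
  rewrite (_ : i - 1 - 1 + (l - w)%N%:Z = e w - 1); last by rewrite /e; lia.
  rewrite -/(a w) (@dd_cp _ _ _ _ _ _ _ _ (1 - (l - w)%N%:Z + 1) (e w) i) //; try by rewrite /e; lia.
  rewrite addr0 opprD addrA scalerDr; congr (_ + _).
  rewrite scalerN signE (@sign_oddN _ _ _ 0%N) ?opprK ?expr0 ?scale1r //.
  by lia.
have RD : cR (cD c) t Y i = \sum_(w < l) ((-1) ^+ (l - w) *: ((-1) ^+ l.-1 *:
    (dd i (c l.-1 (sb l.-1 (bump w) t) Y (i - 1)) - Rf w) -
    cp i (q w) ((-1) ^+ w *: (dd (e w) (a w) - Rt w)))) by [].
(* The terms with a differential of a value of [c] match between [dR] and [RD]; [Z] is what is
   left. *)
suff Z : \sum_(w < l) ((-1) ^+ (l - w) *: Rf w + cp i (q w) (Rt w) -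
    (-1) ^+ (l - w) *: cp i (dq w) (a w)) = 0.
  have -> : cR (cD c) t Y i = (-1) ^+ l *: - dd i (cR c t Y (i - 1)).
    rewrite -[X in _ *: X]add0r -Z dR RD -sumrB scaler_sumr; apply: eq_bigr => w _.
    have hw := ltn_ord w.
    rewrite !(cpZr, cpBr, scalerBr, scalerDr, scalerN) !signE.
    rewrite (@sign_oddN _ _ (l - w + l.-1) (l + (l - w)) (dd _ _)); last by lia.
    rewrite (@sign_oddN _ _ (l - w + l.-1) (l + (l - w)) (Rf w)); last by lia.
    rewrite subnK; last by lia.
    zmodule.
  by rewrite subrr scaler0.
pose X1 w u := c l.-2 (sb l.-2 (bump w \o bump u) t) Y i.
pose X2 w u := cp i (mK (sb (l - u).-1 (bump w \o addn u) t) (oK t u) Y (2 - (l - u)%N%:Z))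
  (c u (sb u id t) (oK t u) (e u - 1)).
pose X3 w u := cp i (q w) (cp (e w) (mK (sb (w - u) (addn u) t) (oK t u) (oK t w)
  (1 - (w - u)%N%:Z)) (c u (sb u id t) (oK t u) (e u - 1))).
pose X4 w u := cp i (q w) (c w.-1 (sb w.-1 (bump u) t) (oK t w) (e w)).
pose sg (w u : nat) (x : dghom W Y i) := (-1) ^+ (w + u) *: x.
rewrite sumrB big_split /=.
have -> : \sum_(w < l) (-1) ^+ (l - w) *: Rf w =
    \sum_(w < l) \sum_(u < l | (u < w)%N) sg w u (X2 w u - X4 w u).
  pose G w u := (-1) ^+ (l - w) *: ((-1) ^+ (l.-1 - u) *:
    (c l.-2 (sb l.-2 (bump u) (sb l.-1 (bump w) t)) Y i -
     cp i (mK (sb (l.-1 - u) (addn u) (sb l.-1 (bump w) t)) (oK (sb l.-1 (bump w) t) u) Y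
             (1 - (l.-1 - u)%N%:Z))
       (c u (sb u id (sb l.-1 (bump w) t)) (oK (sb l.-1 (bump w) t) u)
             (i - 1 + (l.-1 - u)%N%:Z)))).
  transitivity (\sum_(w < l) \sum_(u < l.-1) G w u).
    by apply: eq_bigr => w _; rewrite scaler_sumr.
  rewrite sum_pairs; apply: eq_bigr => w _; apply: eq_bigr => u huw; have hw := ltn_ord w.
  have -> : G w u = sg w u (X2 w u - X1 w u).
    rewrite /G sb_sb; [|mono|mono]; rewrite sb_sb; [|mono|mono]; rewrite sb_sb; [|mono|mono].
    rewrite oK_sb; [|mono|lia].
    have -> : bump w u = u :> nat by rewrite /bump; lia.
    rewrite signE /sg (@sign_oddN _ _ _ (w + u)); last by lia.
    rewrite -scalerN opprB; congr (_ *: (_ - _)).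
    rewrite /X2 (_ : (l.-1 - u = (l - u).-1)%N); last by lia.
    rewrite (_ : 1 - (l - u).-1%:Z = 2 - (l - u)%N%:Z); last by lia.
    rewrite (_ : i - 1 + (l - u).-1%:Z = e u - 1); last by rewrite /e; lia.
    by rewrite (@sb_eq _ _ u (bump w \o id) id) // => v hv; rewrite /= /bump; lia.
  have -> : G u w.-1 = sg w u (X1 w u - X4 w u).
    rewrite /G sb_sb; [|mono|mono]; rewrite sb_sb; [|mono|mono]; rewrite sb_sb; [|mono|mono].
    rewrite oK_sb; [|mono|lia].
    have -> : bump u w.-1 = w :> nat by rewrite /bump; lia.
    rewrite signE /sg (@sign_odd _ _ _ (w + u)); last by lia.
    congr (_ *: (_ - _)).
      rewrite (@sb_eq _ _ _ (bump u \o bump w.-1) (bump w \o bump u)) // => v hv.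
      by rewrite /= /bump; lia.
    rewrite /X4 /q (_ : (l.-1 - w.-1 = l - w)%N); last by lia.
    rewrite (@sb_eq _ _ _ (bump u \o addn w.-1) (addn w)); last first.
      by move=> v hv; rewrite /= /bump; lia.
    rewrite (@sb_eq _ _ _ (bump u \o id) (bump u)) //.
  by rewrite /sg -scalerDr; congr (_ *: _); zmodule.
have -> : \sum_(w < l) cp i (q w) (Rt w) =
    \sum_(w < l) \sum_(u < l | (u < w)%N) sg w u (X4 w u - X3 w u).
  rewrite -(sum_widen l (fun w u => sg w u (X4 w u - X3 w u))); apply: eq_bigr => w _; rewrite cp_sumr; apply: eq_bigr => u _.
  have hw := ltn_ord w; have hu := ltn_ord u.
  rewrite cpZr cpBr /sg (@sign_odd _ _ _ (w + u)); last by lia.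
  congr (_ *: (_ - _)).
    by rewrite sb_sb; [|mono|mono].
  rewrite sb_sb; [|mono|mono]; rewrite sb_sb; [|mono|mono].
  rewrite oK_sb; [|mono|lia].
  rewrite /X3 (_ : e w - 1 + (w - u)%N%:Z = e u - 1); last by rewrite /e; lia.
  by [].
have -> : \sum_(w < l) (-1) ^+ (l - w) *: cp i (dq w) (a w) =
    \sum_(w < l) \sum_(u < l | (u < w)%N) sg w u (X2 w u - X3 w u).
  pose H w v := (-1) ^+ (l - w) *: cp i ((-1) ^+ (l - w - v) *:
    (mK (sb (l - w).-1 (bump v) (sb (l - w) (addn w) t)) (oK t w) Y (1 - (l - w)%N%:Z + 1) -
     cp (1 - (l - w)%N%:Z + 1) (mK (sb (l - w - v) (addn v) (sb (l - w) (addn w) t))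
        (oK (sb (l - w) (addn w) t) v) Y (1 - (l - w - v)%N%:Z))
       (mK (sb v id (sb (l - w) (addn w) t)) (oK t w) (oK (sb (l - w) (addn w) t) v)
         (1 - v%:Z)))) (a w).
  transitivity (\sum_(w < l) \sum_(v < l - w | (0 < v)%N) H w v).
    apply: eq_bigr => w _; have hw := ltn_ord w.
    rewrite /dq mK_d //; last first.
    - by rewrite oK_sb; [rewrite eY; congr oK; lia | mono | lia].
    - by rewrite oK_sb; [rewrite addn0 | mono | lia].
    by rewrite cp_suml scaler_sumr.
  rewrite sum_shift; apply: eq_bigr => w _; apply: eq_bigr => u huw; have hw := ltn_ord w.
  rewrite /H cpZl signE /sg (@sign_odd _ _ _ (w + u)); last by lia.
  rewrite sb_sb; [|mono|mono]; rewrite sb_sb; [|mono|mono]; rewrite sb_sb; [|mono|mono].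
  rewrite oK_sb; [|mono|lia].
  rewrite (_ : (u + (w - u) = w)%N); last by lia.
  rewrite (_ : (l - u - (w - u) = l - w)%N); last by lia.
  congr (_ *: _); rewrite cpBl; congr (_ - _).
    rewrite /X2 /a (_ : 1 - (l - u)%N%:Z + 1 = 2 - (l - u)%N%:Z); last by lia.
    rewrite (@sb_eq _ _ _ (addn u \o bump (w - u)) (bump w \o addn u)) // => v hv.
    by rewrite /= /bump; lia.
  rewrite (@cpA _ _ _ _ _ _ _ _ _ _ (e w)); [|lia|rewrite /e; lia].
  rewrite (@sb_eq _ _ _ (addn u \o addn (w - u)) (addn w)); last first.
    by move=> v hv; rewrite /=; lia.
  by rewrite (@sb_eq _ _ _ (addn u \o id) (addn u)).
rewrite -big_split -sumrB big1 // => w _; rewrite -big_split -sumrB big1 // => u _.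
by rewrite /sg /= -scalerDr -scalerBr -[RHS](scaler0 _ ((-1) ^+ (w + u))); congr (_ *: _); zmodule.
Qed.
End Cochains.

(** * Degenerate simplices and normalized cochains *)

Lemma not_strict_mkd m n f a : mono_on m n f -> (a < m)%N -> f a = f a.+1 ->
  ~~ dstrict (mkd m n f).
Proof.
move=> hf ha e; apply/negP => /dstrictP /(_ (inord a) (inord a.+1)).
by rewrite !mkdE // !inordK ?ltnS // ?e ?ltnn; [move=> /(_ (leqnn _)) | exact: ltnW].
Qed.

Lemma not_strict_ex m n (J : dmap m n) : ~~ dstrict J ->
  exists2 a, (a < m)%N & J (inord a) = J (inord a.+1).
Proof.
move=> hJ; have [/existsP[a /eqP e]|] := boolP [exists a : 'I_m, J (inord a) == J (inord a.+1)].
  by exists a.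
rewrite negb_exists => /forallP h; case/negP: hJ; apply/dstrictP => i j hij.
have step a : (a < m)%N -> (J (inord a) < J (inord a.+1))%N.
  move=> ha; have := h (Ordinal ha); rewrite /= => ne.
  rewrite ltn_neqAle dfun_homo ?andbT; first by rewrite val_eqE.
  by rewrite !inordK // ltnS ltnW.
suff H b : (i + b.+1 <= m)%N -> (J i < J (inord (i + b.+1)))%N.
  have := H (j - i).-1; rewrite (_ : (i + (j - i).-1.+1 = j)%N); last by lia.
  by rewrite inord_val; apply; rewrite -ltnS.
elim: b => [|b IH] hb; first by rewrite addn1 -{1}(inord_val i); apply: step; lia.
by rewrite addnS; apply: ltn_trans (IH _) (step _ _); lia.
Qed.

Lemma degenerate_sb (K : sset) m n f a (x : K n) : mono_on m n f -> (a < m)%N ->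
  f a = f a.+1 -> degenerate (sb m f x).
Proof.
case: m => // m hf ha e; exists m, (mkd m.+1 m (fun i => i - (a < i))%N).
have hg : mono_on m n (f \o bump a.+1) by apply: mono_comp hf _; mono.
exists (sb m (f \o bump a.+1) x); split => //.
rewrite -/(sb _ _ _) sb_sb //; last by mono.
apply: sb_eq => i hi /=; case: (ltngtP a i) => [h|h|<-]; rewrite /bump ?subn0.
- by case: (eqVneq i a.+1) => [->|ne]; [rewrite -e; congr f; lia | congr f; lia].
- by congr f; lia.
- by congr f; lia.
Qed.

Lemma degenerate_act (K : sset) m n (J : dmap m n) (x : K n) :
  ~~ dstrict J -> degenerate (act J x).
Proof.
case/not_strict_ex => a ha e.
rewrite (dmap_mkdE J); apply: (@degenerate_sb _ _ _ _ a) => //.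
  split=> [i j hij hj|]; last exact: leq_ord.
  by apply: dfun_homo; rewrite !inordK //; lia.
by rewrite e.
Qed.

(** A monotone map to a smaller ordinal repeats a value at two consecutive vertices, so it factors
    through the corresponding elementary degeneracy. *)
Lemma degenerateP (K : sset) n (x : K n) : degenerate x ->
  exists l u (e : n = l.+1) (y : K l), (u <= l)%N /\
    x = sb n (fun i => i - (u < i))%N y.
Proof.
case=> m [a [y [hm ->]]]; clear x.
have hJ : ~~ dstrict a.
  apply/negP => /dstrictP h.
  have H i : (i <= n)%N -> (i <= a (inord i))%N.
    elim: i => // i IH hi; apply: leq_ltn_trans (IH (ltnW hi)) (h _ _ _).
    by rewrite !inordK // ltnS ltnW.
  by have := H n (leqnn n); have := ltn_ord (a (inord n)); lia.
case: n a hm hJ => [|n] a hm hJ; first by have [] := not_strict_ex hJ.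
have [u hu e] := not_strict_ex hJ.
exists n, u, erefl, (sb n (bump u) (act a y)); split => //.
rewrite sb_sb; [|mono|mono]; rewrite [in RHS](dmap_mkdE a) -/(sb _ _ y) [in LHS](dmap_mkdE a).
have ha : mono_on n.+1 m (fun i => a (inord i)).
  split=> [i j hij hj|]; last exact: leq_ord.
  by apply: dfun_homo; rewrite !inordK //; lia.
rewrite sb_sb //; last by mono.
apply: sb_eq => i hi /=; case: (eqVneq i u) => [->|ne].
  by rewrite e; congr (nat_of_ord (a (inord _))); rewrite /bump; lia.
by congr (nat_of_ord (a (inord _))); rewrite /bump; lia.
Qed.

Section CochainCalculus.
Variables (k : comPzRingType) (A : dgcat k) (C : sset) (I : nerve_iso C A).
Variables (K : sset) (p : smap K C).
Local Notation oK := (oK I p).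
Local Notation mK := (mK I p).

(** Cochains have values at all objects and degrees; only those at the last vertex of a strict face,
    in the degree fitting [i], enter the differential. *)
Lemma cD_ext (W : A) (c c' : coch K W) l (t : K l) Y i : Y = oK t l ->
  (forall l' (J : dmap l' l) Z j, dstrict J -> Z = oK (act J t) l' ->
    j = i - 1 + (l - l')%N%:Z -> c l' (act J t) Z j = c' l' (act J t) Z j) ->
  cD I p c t Y i = cD I p c' t Y i.
Proof.
move=> eY h; rewrite /cD /cR; congr (_ *: (dd _ _ - _)).
  have := h l (did l) Y (i - 1); rewrite act_id subnn addr0; apply => //; exact/dstrictP.
apply: eq_bigr => w _; have hw := ltn_ord w; congr (_ *: (_ - _)).
  apply: h; last by lia.
  - by apply: dstrict_mkd; [mono | rewrite /bump => ? ?; lia].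
  - rewrite -/(sb _ _ t) oK_sb; [|mono|lia]; rewrite eY; congr oK; rewrite /bump; lia.
congr cp; apply: h; [|by rewrite -/(sb _ _ t) oK_sb //; mono|by []].
by apply: dstrict_mkd; [mono | move=> ? ?; lia].
Qed.

Lemma cDB (W : A) (c c' : coch K W) l (t : K l) Y i :
  cD I p (fun l t Y i => c l t Y i - c' l t Y i) t Y i = cD I p c t Y i - cD I p c' t Y i.
Proof.
rewrite /cD /cR -scalerBr; congr (_ *: _); rewrite ddB.
have -> : forall u v x y : dghom W Y i, u - v - (x - y) = u - x - (v - y).
  by move=> u v x y; zmodule.
congr (_ - _); rewrite -sumrB; apply: eq_bigr => w _; rewrite -scalerBr; congr (_ *: _).
by rewrite cpBr; zmodule.
Qed.

Lemma cD0 (W : A) l (t : K l) Y i : cD I p (fun l t Y i => 0 : dghom W Y i) t Y i = 0.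
Proof.
rewrite /cD /cR dd0 big1 ?subr0 ?scaler0 // => w _.
by rewrite cp0r subr0 scaler0.
Qed.

Lemma cDD (W : A) (c c' : coch K W) l (t : K l) Y i :
  cD I p (fun l t Y i => c l t Y i + c' l t Y i) t Y i = cD I p c t Y i + cD I p c' t Y i.
Proof.
have e := cDB c (fun l t Y i => 0 - c' l t Y i) t Y i.
rewrite (cDB (fun _ _ _ _ => 0) c' t Y i) cD0 sub0r opprK in e; rewrite -e; congr (cD I p _ t Y i).
do 4 (apply: functional_extensionality_dep => ?).
by rewrite sub0r opprK.
Qed.

(* composition of a cochain with a morphism of degree [a] *)
Definition ccp (W W' : A) a (c : coch K W) (f : dghom W' W a) : coch K W' :=
  fun l t Y i => cp i (c l t Y (i - a)) f.

(** Leibniz rule. With [i = 1 + a - l] the value of [c] being differentiated has degree [- l], and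
    its Koszul sign cancels the factor [(-1)^l] of [cD]. *)
Lemma cD_ccp (W W' : A) a (c : coch K W) (f : dghom W' W a) l (t : K l) Y i :
  i = 1 + a - l%:Z ->
  cD I p (ccp c f) t Y i = ccp (cD I p c) f t Y i + ccp c (dd (a + 1) f) t Y i.
Proof.
move=> ei; rewrite /ccp {1}/cD {1}/cR.
rewrite (@dd_cp _ _ _ _ _ _ _ _ (i - a) (a + 1) i) //; try by lia.
have -> : \sum_(w < l) (-1) ^+ (l - w) *: (cp i (c l.-1 (sb l.-1 (bump w) t) Y (i - a)) f -
     cp i (mK (sb (l - w) (addn w) t) (oK t w) Y (1 - (l - w)%N%:Z))
       (cp (i - 1 + (l - w)%N%:Z) (c w (sb w id t) (oK t w) (i - 1 + (l - w)%N%:Z - a)) f)) =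
    cp i (cR I p c t Y (i - a)) f.
  rewrite /cR cp_suml; apply: eq_bigr => w _; have hw := ltn_ord w.
  rewrite cpZl cpBl; congr (_ *: (_ - _)).
  rewrite (@cpA _ _ _ _ _ _ _ _ _ _ (i - 1 + (l - w)%N%:Z)); [|lia|lia].
  by rewrite (_ : i - a - 1 + (l - w)%N%:Z = i - 1 + (l - w)%N%:Z - a); last by lia.
rewrite addrAC -cpBl scalerDr signE -cpZl; congr (_ + _).
  by rewrite (_ : i - 1 - a = i - a - 1); last by lia.
rewrite (@sign_odd _ _ _ 0%N) ?expr0 ?scale1r; last by lia.
by rewrite (_ : i - 1 - a = i - (a + 1)); last by lia.
Qed.

Definition cnormal (W : A) (c : coch K W) : Prop :=
  forall l (t : K l) Y i, degenerate t -> c l t Y i = 0.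

Lemma mK_deg m n (x : K n) f a X Y i : mono_on m n f -> (a < m)%N -> (2 <= m)%N ->
  f a = f a.+1 -> mK (sb m f x) X Y i = 0.
Proof.
move=> hf ha hm e; rewrite /mK sfun_sb /sb mr_deg //.
exact: not_strict_mkd ha e.
Qed.

(** If [t] repeats its vertex [u] at position [u + 1], all faces but those omitting [u] and [u + 1]
    are degenerate, and these two are equal with opposite signs. When the last vertex is repeated,
    [u + 1] is outside the sum; the partner is then the composite with the degenerate last edge, an
    identity. *)
Lemma cD_normal (W : A) (c : coch K W) l (t : K l) Y i : cnormal c -> Y = oK t l ->
  degenerate t -> cD I p c t Y i = 0.
Proof.
move=> hc eY ht; rewrite /cD hc // dd0 sub0r.
have [l' [u [e [s [hu et]]]]] := degenerateP ht; subst l.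
rewrite /cR; pose F w := (-1) ^+ (l'.+1 - w) *: (c l' (sb l' (bump w) t) Y i -
     cp i (mK (sb (l'.+1 - w) (addn w) t) (oK t w) Y (1 - (l'.+1 - w)%N%:Z))
       (c w (sb w id t) (oK t w) (i - 1 + (l'.+1 - w)%N%:Z))).
have F0 w : (w <= l')%N -> w != u -> w != u.+1 -> F w = 0.
  move=> hw n1 n2; rewrite /F hc; last first.
    rewrite et sb_sb; [|mono|mono].
    case: (ltnP w u) => hwu.
      by apply: (@degenerate_sb _ _ _ _ u.-1); [mono|lia|rewrite /= /bump; lia].
    by apply: (@degenerate_sb _ _ _ _ u); [mono|lia|rewrite /= /bump; lia].
  case: (ltnP w u) => hwu.
    rewrite {2}et sb_sb; [|mono|mono].
    by rewrite (@mK_deg _ _ _ _ (u - w)) ?cp0l ?subrr ?scaler0 //; [mono|lia|lia|rewrite /=; lia].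
  rewrite (hc w) ?cp0r ?subrr ?scaler0 // et sb_sb; [|mono|mono].
  by apply: (@degenerate_sb _ _ _ _ u); [mono|lia|rewrite /=; lia].
have Fs w : (w = u \/ w = u.+1) -> (w <= l')%N -> sb l' (bump w) t = s.
  move=> hw hwl; rewrite et sb_sb; [|mono|mono].
  by apply: sb_id => j hj; rewrite /= /bump; case: hw => ->; lia.
rewrite -(big_mkord xpredT F).
suff -> : \sum_(0 <= w < l'.+1) F w = 0 by rewrite oppr0 scaler0.
case: (ltnP u l') => hul.
  rewrite (@big_cat_nat _ _ _ u) //=; last by lia.
  rewrite big1_seq ?add0r; last first.
    by move=> w /andP[_]; rewrite mem_index_iota => hw; apply: F0; lia.
  rewrite big_ltn; last by lia.
  rewrite big_ltn; last by lia.
  rewrite big1_seq ?addr0; last first.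
    by move=> w /andP[_]; rewrite mem_index_iota => hw; apply: F0; lia.
  rewrite /F (Fs u (or_introl erefl) hu) (Fs u.+1 (or_intror erefl) hul).
  rewrite {2}et sb_sb; [|mono|mono].
  rewrite (@mK_deg _ _ _ _ 0%N) ?cp0l ?subr0; [|mono|lia|lia|rewrite /=; lia].
  rewrite (hc u.+1) ?cp0r ?subr0; last first.
    by rewrite et sb_sb; [apply: (@degenerate_sb _ _ _ _ u); [mono|lia|rewrite /=; lia]|mono|mono].
  rewrite (@sign_oddN _ _ (l'.+1 - u) (l'.+1 - u.+1)); last by lia.
  by rewrite addNr.
have {hu}hul : u = l' by lia.
subst u; rewrite big_nat_recr //= big1_seq ?add0r; last first.
  by move=> w /andP[_]; rewrite mem_index_iota => hw; apply: F0; lia.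
rewrite /F (Fs l' (or_introl erefl) (leqnn l')).
rewrite (_ : (l'.+1 - l' = 1)%N); last by lia.
rewrite (_ : i - 1 + 1%N%:Z = i); last by lia.
have es : sb l' id t = s.
  by rewrite et sb_sb; [apply: sb_id => j hj; rewrite /=; lia | mono | mono].
have eo : oK t l' = Y.
  rewrite eY et !oK_sb //; [|mono|mono].
  by congr oK; lia.
rewrite es eo.
have -> : mK (sb 1 (addn l') t) Y Y (1 - 1%N%:Z) = dgid Y.
  rewrite {1}et sb_sb; [|mono|mono]; rewrite /mK sfun_sb /sb.
  have hm : mono_on 1 l' ((fun v => v - (l' < v))%N \o addn l') by mono.
  rewrite mr_id ?hc_id //.
    by apply: val_inj; rewrite [LHS]mkdE // [RHS]mkdE //=; lia.
  by rewrite mkdE // -eo et oK_sb //; [congr obv; rewrite /=; lia | mono].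
by rewrite cp1l subrr scaler0.
Qed.
End CochainCalculus.

(** * Cones over a simplex *)

Definition jn m n (J : dmap m n) (u : nat) : nat := J (inord u).

Lemma jn_mono m n (J : dmap m n) u v : (u <= v)%N -> (v <= m)%N -> (jn J u <= jn J v)%N.
Proof. by move=> h1 h2; apply: dfun_homo; rewrite !inordK //; lia. Qed.

Lemma jn_le m n (J : dmap m n) u : (jn J u <= n)%N.
Proof. exact: leq_ord. Qed.

Lemma jn_strict m n (J : dmap m n) u v : dstrict J -> (u < v)%N -> (v <= m)%N ->
  (jn J u < jn J v)%N.
Proof. by move=> /dstrictP h h1 h2; apply: h; rewrite !inordK //; lia. Qed.

Lemma strict_jn m n (J : dmap m n) :
  (forall u v, (u < v)%N -> (v <= m)%N -> (jn J u < jn J v)%N) -> dstrict J.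
Proof.
move=> h; apply/dstrictP => i j hij; have := h i j hij; rewrite /jn !inord_val.
by apply; rewrite -ltnS.
Qed.

Lemma jn_mkd m n f u : mono_on m n f -> (u <= m)%N -> jn (mkd m n f) u = f u.
Proof. by move=> hf hu; rewrite /jn mkdE // inordK. Qed.

Lemma jn_comp l m n (a : dmap m n) (b : dmap l m) u :
  jn (dcomp a b) u = jn a (jn b u).
Proof. by rewrite /jn dcompE inord_val. Qed.

Lemma dmap_jn m n (J J' : dmap m n) : (forall u, (u <= m)%N -> jn J u = jn J' u) -> J = J'.
Proof.
move=> h; apply: dmap_eq => i; apply: val_inj.
by have := h i; rewrite /jn inord_val; apply; rewrite -ltnS.
Qed.

Lemma jn0 m n (J : dmap m n) : J ord0 = jn J 0 :> nat.
Proof. by rewrite /jn; congr (nat_of_ord (J _)); apply: val_inj; rewrite /= inordK. Qed.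

Lemma jnm m n (J : dmap m n) : J ord_max = jn J m :> nat.
Proof. by rewrite /jn; congr (nat_of_ord (J _)); apply: val_inj; rewrite /= inordK. Qed.

Lemma jn_monoon m n (J : dmap m n) : mono_on m n (jn J).
Proof. by split=> [u v|]; [exact: jn_mono | exact: jn_le]. Qed.

(** The simplex [z] as a diagram of shape [std N], so that the cochain calculus applies to the faces
    of [z]. *)
Definition yo (C : sset) N (z : C N) : smap (std N) C :=
  @SMap (std N) C (fun l (J : dmap l N) => act J z) (fun m n a J => act_comp J a z).

Definition consf l N (J : dmap l N) (u : nat) : nat := if u is v.+1 then (jn J v).+1 else 0.

(* [0 * J] for [J] a face of the face opposite to the vertex 0 *)
Definition dcons l N (J : dmap l N) : dmap l.+1 N.+1 := mkd l.+1 N.+1 (consf J).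

Lemma consf_mono l N (J : dmap l N) : mono_on l.+1 N.+1 (consf J).
Proof.
split=> [[|u] [|v] //= h1 h2|] /=; last by rewrite ltnS jn_le.
by rewrite ltnS; apply: jn_mono.
Qed.

Lemma jn_cons l N (J : dmap l N) u : (u <= l.+1)%N -> jn (dcons J) u = consf J u.
Proof. by move=> h; rewrite jn_mkd //; exact: consf_mono. Qed.

Lemma obv_jn (k : comPzRingType) (A : dgcat k) (C : sset) (I : nerve_iso C A) m n
  (J : dmap m n) (x : C n) i : (i <= m)%N -> obv I (act J x) i = obv I x (jn J i).
Proof. exact: obv_act. Qed.

Lemma mr_congr (k : comPzRingType) (A : dgcat k) (C : sset) (I : nerve_iso C A) m n
    (J J' : dmap m n) (x : C n) X Y i :
  (forall u, (u <= m)%N -> jn J u = jn J' u) -> mr I (act J x) X Y i = mr I (act J' x) X Y i.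
Proof. by move=> h; rewrite (dmap_jn h). Qed.

Lemma coch_congr (k : comPzRingType) (A : dgcat k) N (W : A) (c : coch (std N) W) m
    (J J' : dmap m N) Y i :
  (forall u, (u <= m)%N -> jn J u = jn J' u) -> c m J Y i = c m J' Y i.
Proof. by move=> h; rewrite (dmap_jn h). Qed.

Section Cone.
Variables (k : comPzRingType) (A : dgcat k) (C : sset) (I : nerve_iso C A).
Variables (N : nat) (z : C N) (w : C 0) (c : coch (std N) (ob I w)).
Local Notation oz := (oK I (yo z)).

Lemma oz_jn l (J : dmap l N) u : (u <= l)%N -> oz (J : std N l) u = obv I z (jn J u).
Proof. exact: obv_jn. Qed.

Definition strict_cocycle :=
  forall l (J : std N l) Y i, dstrict (J : dmap l N) -> Y = oz J l -> i = 1 - l%:Z ->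
    cD I (yo z) c J Y i = 0.

(** The faces of the new simplex through vertex 0, apart from the vertex itself, are the joins of 0
    with the faces [J] of [z], and their Maurer-Cartan equation is [cD c = 0] on [J]. The faces
    avoiding vertex 0 are faces of [z]. *)
Lemma cone_exists : strict_cocycle ->
  exists x : C N.+1, [/\ sb N (bump 0) x = z, sb 0 (fun=> 0) x = w &
    forall l (J : dmap l N) Y i, dstrict J -> Y = obv I z (jn J l) -> i = - l%:Z ->
      mr I (act (dcons J) x) (ob I w) Y i = c (J : std N l) Y i].
Proof.
move=> hco.
pose P (a : nat) := if a is b.+1 then obv I z b else ob I w.
(* [tl] strips vertex 0 from a face starting there, [dn] only renumbers a face of [z]; both shift
   the vertices down by one. *)
pose tl m (J : dmap m N.+1) : dmap m.-1 N := mkd m.-1 N (fun u => (jn J u.+1).-1).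
pose dn m (J : dmap m N.+1) : dmap m N := mkd m N (fun u => (jn J u).-1).
have tlE m (J : dmap m N.+1) u : (0 < m)%N -> (u <= m.-1)%N -> jn (tl m J) u = (jn J u.+1).-1.
  move=> hm hu; rewrite jn_mkd //; split=> [u1 v h h'|].
    by have := @jn_mono _ _ J u1.+1 v.+1; lia.
  by have := jn_le J m.-1.+1; lia.
have dnE m (J : dmap m N.+1) u : (u <= m)%N -> jn (dn m J) u = (jn J u).-1.
  move=> hu; rewrite jn_mkd //; split=> [u1 v h h'|].
    by have := @jn_mono _ _ J u1 v; lia.
  by have := jn_le J m; lia.
pose M m (J : dmap m N.+1) (X Y : A) i : dghom X Y i :=
  if jn J 0 == 0%N then hc X Y i (c (tl m J : std N m.-1) Y i)
  else mr I (act (dn m J) z) X Y i.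
have [|x [xo xm]] := @simplex_exists _ _ _ I N.+1 (fun a => P a) M.
  move=> m J X Y i hJ hm eX eY ei.
  have [J0|J0] := eqVneq (jn J 0) 0%N; last first.
    have -> : M m J X Y i = mr I (act (dn m J) z) X Y i by rewrite /M (negbTE J0).
    have Jp u : (u <= m)%N -> (0 < jn J u)%N.
      by move=> hu; have := @jn_mono _ _ J 0 u isT hu; lia.
    have PE u : (u <= m)%N -> P (jn J u) = obv I z (jn J u).-1.
      by move=> hu; rewrite -{1}(prednK (Jp u hu)).
    rewrite mr_d //; last first.
    - by rewrite obv_jn // dnE // eY jnm PE.
    - by rewrite obv_jn // dnE // eX jn0 PE.
    apply: eq_bigr => v hv; have hvm := ltn_ord v.
    have hv1 := Jp v (ltnW hvm).
    have mb : mono_on m.-1 m (bump v) by mono.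
    have mt : mono_on (m - v) m (addn v) by mono.
    have mi : mono_on v m id by mono.
    have eo : P (J (inord v)) = obv I (act (dn m J) z) v by rewrite obv_jn 1?ltnW // dnE ?PE 1?ltnW.
    congr (_ *: (_ - _)).
      rewrite /M jn_comp jn_mkd // (_ : bump v 0 = 0%N); last by rewrite /bump; lia.
      rewrite (negbTE J0) /sb -act_comp; apply: mr_congr => u hu.
      rewrite jn_comp jn_mkd // !dnE //; last by rewrite /bump; lia.
      by rewrite jn_comp jn_mkd.
    rewrite eo; congr cp.
      rewrite /M jn_comp jn_mkd // addn0 (negbTE (lt0n_neq0 hv1)) /sb -act_comp.
      apply: mr_congr => u hu; rewrite jn_comp jn_mkd // !dnE //; last by lia.
      by rewrite jn_comp jn_mkd.
    rewrite /M jn_comp jn_mkd // (negbTE J0) /sb -act_comp.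
    apply: mr_congr => u hu; rewrite jn_comp jn_mkd // !dnE //; last by lia.
    by rewrite jn_comp jn_mkd.
  case: m J hJ hm J0 eX eY ei => // l J hJ _ J0 eX eY ei.
  have Jp u : (u <= l)%N -> (0 < jn J u.+1)%N.
    by move=> hu; have := @jn_strict _ _ J 0 u.+1 hJ isT hu; lia.
  have PE u : (u <= l)%N -> P (jn J u.+1) = obv I z (jn J u.+1).-1.
    by move=> hu; rewrite -{1}(prednK (Jp u hu)).
  have {}eX : X = ob I w by rewrite eX jn0 J0.
  have Jt u : (u <= l)%N -> jn (tl l.+1 J) u = (jn J u.+1).-1 by move=> hu; rewrite tlE.
  have hJt : dstrict (tl l.+1 J).
    apply: strict_jn => u v huv hv; rewrite /= in hv; rewrite !Jt //; last by lia.
    by have := @jn_strict _ _ J u.+1 v.+1 hJ huv hv; have := Jp u; lia.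
  have {}eY : Y = oz (tl l.+1 J : std N l) l by rewrite oz_jn // Jt // -PE // eY jnm.
  have := hco _ (tl l.+1 J) _ _ hJt eY (erefl _); rewrite /cD => /(congr1 (fun v => (-1) ^+ l *: v)).
  rewrite signK scaler0 => /eqP; rewrite subr_eq0 => /eqP; rewrite /cR /=.
  rewrite (_ : 1 - l%:Z = i + 1); last by lia.
  rewrite (_ : i + 1 - 1 = i); last by lia.
  subst X; rewrite /M J0 eqxx hc_id /= => ->.
  rewrite (big_ord_pos l (fun v => (-1) ^+ (l.+1 - v) *:
     ((if jn (dcomp J (mkd l l.+1 (bump v))) 0 == 0%N
      then hc (ob I w) Y (i + 1) (c (tl l (dcomp J (mkd l l.+1 (bump v))) : std N l.-1) Y (i + 1))
      else mr I (act (dn l (dcomp J (mkd l l.+1 (bump v)))) z) (ob I w) Y (i + 1)) -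
     cp (i + 1)
       (if jn (dcomp J (mkd (l.+1 - v) l.+1 (addn v))) 0 == 0%N
        then hc (P (J (inord v))) Y (1 - (l.+1 - v)%N%:Z)
          (c (tl (l.+1 - v)%N (dcomp J (mkd (l.+1 - v) l.+1 (addn v))) : std N (l.+1 - v).-1) Y (1 - (l.+1 - v)%N%:Z))
        else mr I (act (dn (l.+1 - v)%N (dcomp J (mkd (l.+1 - v) l.+1 (addn v)))) z) (P (J (inord v))) Y
          (1 - (l.+1 - v)%N%:Z))
       (if jn (dcomp J (mkd v l.+1 id)) 0 == 0%N
        then hc (ob I w) (P (J (inord v))) (1 - v%:Z) (c (tl v (dcomp J (mkd v l.+1 id)) : std N v.-1) (P (J (inord v))) (1 - v%:Z))
        else mr I (act (dn v (dcomp J (mkd v l.+1 id))) z) (ob I w) (P (J (inord v)))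
          (1 - v%:Z))))).
  apply: eq_bigr => v _; have hv := ltn_ord v.
  have mb : mono_on l l.+1 (bump v.+1) by mono.
  have mt : mono_on (l - v) l.+1 (addn v.+1) by mono.
  have mi : mono_on v.+1 l.+1 id by mono.
  have mb' : mono_on l.-1 l (bump v) by mono.
  have mt' : mono_on (l - v) l (addn v) by mono.
  have mi' : mono_on v l id by mono.
  rewrite subSS; congr (_ *: (_ - _)).
    rewrite jn_comp jn_mkd //= J0 eqxx hc_id /sb.
    apply: coch_congr => u hu /=.
    rewrite jn_comp jn_mkd // Jt; last by rewrite /bump; lia.
    rewrite tlE; [|lia|lia]; rewrite jn_comp jn_mkd //; last by lia.
    by congr (jn J _).-1; rewrite /bump; lia.
  have eo : P (J (inord v.+1)) = oz (tl l.+1 J : std N l) v.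
    rewrite oz_jn // 1?ltnW // Jt 1?ltnW // -PE 1?ltnW //.
  rewrite eo (_ : 1 - v.+1%:Z = i + (l - v)%N%:Z); last by lia.
  congr cp.
    rewrite jn_comp jn_mkd // addn0 ifN; last by rewrite -lt0n; apply: Jp; exact: ltnW.
    rewrite /mK; apply: mr_congr => u hu.
    rewrite jn_comp jn_mkd // Jt; last by lia.
    by rewrite dnE // jn_comp jn_mkd.
  rewrite jn_comp jn_mkd //= J0 eqxx.
  rewrite hc_id /sb; apply: coch_congr => u hu.
  rewrite jn_comp jn_mkd // Jt; last by lia.
  by rewrite (tlE v.+1) // jn_comp jn_mkd.
have xoP u : (u <= N.+1)%N -> obv I x u = P u.
  by move=> hu; have := xo (inord u); rewrite inordK.
have dE l (J : dmap l N) u : (u <= l)%N -> jn (tl l.+1 (dcons J)) u = jn J u.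
  by move=> hu; rewrite tlE // jn_cons.
have Md l (J : dmap l N) Y i : dstrict J -> Y = obv I z (jn J l) -> i = - l%:Z ->
    mr I (act (dcons J) x) (ob I w) Y i = c (J : std N l) Y i.
  move=> hJ eY ei; rewrite xm //.
  - rewrite /M jn_cons // hc_id; apply: coch_congr => u hu; exact: dE.
  - apply: strict_jn => u v huv hv; rewrite !jn_cons //; last by lia.
    by case: u v huv hv => [|u] [|v] //= huv hv; rewrite ltnS; apply: jn_strict.
  - by rewrite jn0 jn_cons.
  - by rewrite jnm jn_cons.
  - by rewrite ei; lia.
have mb : mono_on N N.+1 (bump 0) by mono.
exists x; split => //.
- apply: (simplex_ext (I := I)) => [u hu|l J X Y i hJ hl eX eY ei].
    by rewrite obv_sb // /bump leq0n add1n xoP.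
  have mJ : mono_on l N.+1 (fun u => (jn J u).+1) by split=> [u v h1 h2|]; rewrite ltnS ?jn_le ?jn_mono.
  have jE u : (u <= l)%N -> jn (dcomp (mkd N N.+1 (bump 0)) J) u = (jn J u).+1.
    by move=> hu; rewrite jn_comp jn_mkd ?jn_le.
  rewrite /sb -act_comp xm //.
  + rewrite /M jE //=; apply: mr_congr => u hu; by rewrite dnE // jE.
  + by apply: dstrict_comp => //; apply: dstrict_mkd => //; rewrite /bump => ? ?; lia.
  + by rewrite dcompE mkdE // eX obv_sb ?leq_ord // xoP // /bump leq0n add1n ltnS leq_ord.
  + by rewrite dcompE mkdE // eY obv_sb ?leq_ord // xoP // /bump leq0n add1n ltnS leq_ord.
- by apply: (ob_inj (I := I)); exact: xoP 0%N isT.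
Qed.
End Cone.

(** * Gluing simplices along facets *)

Lemma act_jn_eq (C : sset) n l (a b : dmap l n) (y : C n) :
  (forall u, (u <= l)%N -> jn a u = jn b u) -> act a y = act b y.
Proof. by move=> h; rewrite (dmap_jn h). Qed.

(* Gluing facets [x i], [i] in [V], of an [(N + 1)]-simplex; the facet opposite to the
   vertex 0 is [x 0], so that what remains is a cochain on it. *)
Section Facets.
Variables (k : comPzRingType) (A : dgcat k) (C : sset) (I : nerve_iso C A).
Variables (N : nat) (V : pred nat) (x : nat -> C N) (w : C 0).
Hypothesis V0 : V 0.
Hypothesis compat : forall i j, (i < j)%N -> (j <= N.+1)%N -> V i -> V j -> (0 < N)%N ->
  sb N.-1 (bump j.-1) (x i) = sb N.-1 (bump i) (x j).
Hypothesis vert : forall i, (0 < i)%N -> (i <= N.+1)%N -> V i -> sb 0 (fun=> 0%N) (x i) = w.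
Local Notation z := (x 0).
Local Notation oz := (oK I (yo z)).
Local Notation cDz := (cD I (yo z)).

(** [J] lives in the facet opposite to vertex 0, whose vertex [i] is vertex [i + 1] of the whole
    simplex. The condition says that the join of 0 with [J] lies in the prescribed facet
    [x (i + 1)]. *)
Definition missb l (J : dmap l N) (i : nat) : bool :=
  [&& (i <= N)%N, V i.+1 & [forall u, J u != i :> nat]].

Lemma missbP l (J : dmap l N) i :
  reflect [/\ (i <= N)%N, V i.+1 & forall u, (u <= l)%N -> jn J u != i] (missb J i).
Proof.
apply: (iffP and3P) => [[h1 h2 /forallP h3]|[h1 h2 h3]]; split=> //.
  by move=> u hu; exact: h3.
apply/forallP => u; have := h3 u; rewrite /jn inord_val; apply; by rewrite -ltnS.
Qed.

(** The number, inside the facet omitting [i + 1], of the vertex [v + 1] of the whole simplex, for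
    [v] different from [i]. *)
Definition skipf (i v : nat) : nat := v.+1 - (i < v)%N.

Definition sgf l (J : dmap l N) (i u : nat) : nat :=
  if u is v.+1 then skipf i (jn J v) else 0.

Definition sg l (J : dmap l N) (i : nat) : dmap l.+1 N := mkd l.+1 N (sgf J i).

Lemma sgf_mono l (J : dmap l N) i : missb J i -> mono_on l.+1 N (sgf J i).
Proof.
move=> /missbP[h1 h2 h3]; split=> [[|u] [|v] //= huv hv|] /=; rewrite /skipf.
  by have := @jn_mono _ _ J u v huv hv; lia.
by have := h3 l (leqnn l); have := jn_le J l; lia.
Qed.

Lemma jn_sg l (J : dmap l N) i u : missb J i -> (u <= l.+1)%N -> jn (sg J i) u = sgf J i u.
Proof. by move=> hm hu; rewrite jn_mkd //; exact: sgf_mono. Qed.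

Lemma miss_pos l (J : dmap l N) i : missb J i -> (0 < N)%N.
Proof.
move=> /missbP[h1 h2 h3]; by move: (jn J 0) (h3 0 isT) (jn_le J 0) => t; lia.
Qed.

(** A face omitting both vertices lies in the common face of the two facets, where [compat]
    applies. *)
Lemma facet_indep l (J : dmap l N) i j : missb J i -> missb J j ->
  act (sg J i) (x i.+1) = act (sg J j) (x j.+1).
Proof.
wlog hij : i j / (i < j)%N.
  move=> H hi hj; case: (ltngtP i j) => [h|h|-> //]; first exact: H.
  by symmetry; apply: H.
move=> hi hj; have hN := miss_pos hi.
have /missbP[i1 i2 i3] := hi; have /missbP[j1 j2 j3] := hj.
pose f u := if u is v.+1 then ((jn J v).+1 - (i < jn J v) - (j < jn J v))%N else 0%N.
have hf : mono_on l.+1 N.-1 f.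
  split=> [[|u] [|v] //= huv hv|] /=; first by have := @jn_mono _ _ J u v huv hv; lia.
  by have := i3 l (leqnn l); have := j3 l (leqnn l); have := jn_le J l; lia.
have E i' j' : missb J i' -> (forall u, (u <= l.+1)%N -> bump j' (f u) = sgf J i' u) ->
    act (sg J i') (x i'.+1) = sb l.+1 f (sb N.-1 (bump j') (x i'.+1)).
  move=> hi' h; rewrite sb_sb //; last first.
    by split=> [u v|]; rewrite /bump; lia.
  apply: act_jn_eq => u hu; rewrite jn_sg // jn_mkd //= ?h //.
  have := sgf_mono hi'; rewrite /mono_on => -[m1 m2]; split=> [u' v' h1 h2|].
    by rewrite /comp !h ?m1 //; lia.
  by rewrite /comp h.
rewrite (E i j) //; last first.
  move=> [|u] hu /=; rewrite /bump /skipf; first by lia.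
  by have := i3 u hu; have := j3 u hu; lia.
rewrite (E j i.+1) //; last first.
  move=> [|u] hu /=; rewrite /bump /skipf; first by lia.
  by have := i3 u hu; have := j3 u hu; lia.
by rewrite (compat (i := i.+1) (j := j.+1)) //.
Qed.

Lemma facet_tail l (J : dmap l N) i : missb J i ->
  act J z = sb l (fun u => skipf i (jn J u)) (x i.+1).
Proof.
move=> hi; have hN := miss_pos hi; have /missbP[i1 i2 i3] := hi.
pose f u := (jn J u - (i < jn J u))%N.
have hf : mono_on l N.-1 f.
  split=> [u v huv hv|]; rewrite /f; first by have := jn_mono J huv hv; lia.
  by have := i3 l (leqnn l); have := jn_le J l; lia.
have m1 : mono_on N.-1 N (bump i) by split=> [u v|]; rewrite /bump; lia.
have m2 : mono_on N.-1 N (bump 0) by split=> [u v|]; rewrite /bump; lia.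
transitivity (sb l f (sb N.-1 (bump i) z)).
  rewrite sb_sb //; apply: act_jn_eq => u hu; rewrite jn_mkd //; last exact: mono_comp m1 hf.
  by rewrite /= /f /bump; have := i3 u hu; lia.
rewrite (compat (i := 0%N) (j := i.+1)) // sb_sb //.
by apply: sb_eq => u hu; rewrite /= /f /bump /skipf; lia.
Qed.

(** The components already prescribed, extended by 0 to the faces that lie in no given facet. The
    choice of a facet is harmless by [facet_indep]. *)
Definition facet_coch : coch (std N) (ob I w) := fun l J Y d =>
  if [pick i : 'I_N.+1 | missb (J : dmap l N) i] is Some i
  then mr I (act (sg J i) (x i.+1)) (ob I w) Y d else 0.

Lemma facet_cochE l (J : dmap l N) i Y d : missb J i ->
  facet_coch (J : std N l) Y d = mr I (act (sg J i) (x i.+1)) (ob I w) Y d.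
Proof.
move=> hi; rewrite /facet_coch; case: pickP => [j hj|/(_ (inord i))].
  by rewrite (facet_indep hj hi).
by rewrite inordK ?hi //; case/missbP: hi.
Qed.

Lemma facet_coch0 l (J : dmap l N) Y d : (forall i, ~~ missb J i) ->
  facet_coch (J : std N l) Y d = 0.
Proof. by move=> h; rewrite /facet_coch; case: pickP => // i; rewrite (negbTE (h i)). Qed.

Lemma miss_comp l m (J : dmap l N) (b : dmap m l) i : missb J i -> missb (dcomp J b) i.
Proof.
move=> /missbP[h1 h2 h3]; apply/missbP; split=> // u hu; rewrite jn_comp; apply: h3.
exact: jn_le.
Qed.

(** Inside a prescribed facet this is the Maurer-Cartan equation of that facet. *)
Lemma facet_cD l (J : dmap l N) i Y d : missb J i -> Y = oz (J : std N l) l ->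
  d = 1 - l%:Z -> cDz facet_coch (J : std N l) Y d = 0.
Proof.
move=> hi eY ed; have hN := miss_pos hi; have /missbP[i1 i2 i3] := hi.
rewrite /cD (facet_cochE _ _ hi).
have e0 : ob I w = obv I (act (sg J i) (x i.+1)) 0.
  by rewrite obv_jn // jn_sg //= -(vert (i := i.+1)).
have oE u : (u <= l)%N -> obv I (act (sg J i) (x i.+1)) u.+1 = oz (J : std N l) u.
  move=> hu; rewrite oz_jn // -(obv_jn I J z hu) (facet_tail hi) obv_jn // jn_sg //=.
  rewrite obv_sb //; split=> [u' v huv hv|]; rewrite /skipf.
    by have := jn_mono J huv hv; lia.
  by have := i3 l (leqnn l); have := jn_le J l; lia.
have eY' : Y = obv I (act (sg J i) (x i.+1)) l.+1 by rewrite oE.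
have := mr_d e0 eY' (i := d - 1); rewrite subrK => ->; last by lia.
rewrite [X in X - _](_ : _ = cR I (yo z) facet_coch (J : std N l) Y d) ?subrr ?scaler0 //.
rewrite (big_ord_pos l (fun v => (-1) ^+ (l.+1 - v) *:
     (mr I (sb l (bump v) (act (sg J i) (x i.+1))) (ob I w) Y d -
      cp d (mr I (sb (l.+1 - v) (addn v) (act (sg J i) (x i.+1)))
         (obv I (act (sg J i) (x i.+1)) v) Y (1 - (l.+1 - v)%N%:Z))
        (mr I (sb v id (act (sg J i) (x i.+1))) (ob I w) (obv I (act (sg J i) (x i.+1)) v)
           (1 - v%:Z))))).
apply: eq_bigr => v _; have hv := ltn_ord v.
rewrite subSS oE ?(ltnW hv) //; congr (_ *: (_ - _)).
  rewrite (facet_cochE _ _ (miss_comp (mkd l.-1 l (bump v)) hi)) /sb -act_comp.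
  case: l J hi eY ed i3 e0 oE eY' v hv => [|l] J hi eY ed i3 e0 oE eY' v hv; first by case: v hv.
  apply: mr_congr => u hu.
  rewrite jn_comp jn_mkd //; last by mono.
  rewrite jn_sg //; last by rewrite /bump; lia.
  rewrite jn_sg //; last exact: miss_comp.
  case: u hu => [|u] hu //=; rewrite jn_comp jn_mkd //; last by mono.
  have e : bump v.+1 u.+1 = (bump v u).+1 by rewrite /bump; lia.
  by rewrite e.
rewrite (_ : 1 - v.+1%:Z = d - 1 + (l - v)%N%:Z); last by lia.
congr cp.
  rewrite /mK /sb -act_comp.
  have hi' := miss_comp (mkd (l - v) l (addn v)) hi.
  rewrite [yo _ _ _](facet_tail hi') /sb; apply: mr_congr => u hu.
  have /missbP[_ _ h3] := hi'.
  rewrite jn_mkd //; last first.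
    split=> [u' v' h h'|]; rewrite /skipf.
      by have := jn_mono (dcomp J (mkd (l - v) l (addn v))) h h'; lia.
    by have := h3 _ (leqnn _); have := jn_le (dcomp J (mkd (l - v) l (addn v))) (l - v); lia.
  rewrite jn_comp jn_mkd //; last by mono.
  rewrite jn_sg //; last by lia.
  by rewrite jn_comp jn_mkd //; mono.
rewrite (facet_cochE _ _ (miss_comp (mkd v l id) hi)) /sb -act_comp.
apply: mr_congr => u hu; rewrite jn_comp jn_mkd //; last by mono.
rewrite jn_sg //; last by lia.
rewrite jn_sg //; last exact: miss_comp.
by case: u hu => [|u] hu //=; rewrite jn_comp jn_mkd //; mono.
Qed.

(** [g] supplies the missing components. On a face inside a given facet the equation already holds
    by [facet_cD], so it is required on uncovered faces only. *)
Lemma facet_glue (g : coch (std N) (ob I w)) :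
  (forall l (J : dmap l N) i Y d, missb J i -> g l (J : std N l) Y d = 0) ->
  (forall l (J : dmap l N) Y d, dstrict J -> (forall i, ~~ missb J i) ->
    Y = oz (J : std N l) l -> d = 1 - l%:Z ->
    cDz g (J : std N l) Y d = - cDz facet_coch (J : std N l) Y d) ->
  exists X : C N.+1, [/\ forall i, (i <= N.+1)%N -> V i -> sb N (bump i) X = x i,
    sb 0 (fun=> 0%N) X = w &
    forall l (J : dmap l N) Y d, dstrict J -> (forall i, ~~ missb J i) ->
      Y = obv I z (jn J l) -> d = - l%:Z ->
      mr I (act (dcons J) X) (ob I w) Y d = g l (J : std N l) Y d].
Proof.
move=> g0 gD.
pose c : coch (std N) (ob I w) := fun l J Y d => facet_coch J Y d + g l J Y d.
have cE l (J : dmap l N) i Y d : missb J i ->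
    c l J Y d = mr I (act (sg J i) (x i.+1)) (ob I w) Y d.
  by move=> hi; rewrite /c (g0 _ _ _ _ _ hi) addr0 (facet_cochE _ _ hi).
have [|X [X0 Xw Xc]] := cone_exists (I := I) (z := z) (w := w) (c := c).
  move=> l J Y d hJ eY ed; rewrite cDD.
  have [[i hi]|hn] := excluded_middle_informative (exists i, missb (J : dmap l N) i).
    rewrite (facet_cD hi) // add0r.
    rewrite (cD_ext (c' := fun _ _ _ _ => 0)) ?cD0 //.
    by move=> l' J' Z j _ _ _; rewrite (g0 _ _ i) //; exact: miss_comp.
  rewrite gD // ?subrr // => i; apply/negP => hi; case: hn; by exists i.
exists X; split=> // [i hi Vi|l J Y d hJ hn eY ed]; last by rewrite Xc // /c facet_coch0 // add0r.
case: i hi Vi => [|i] hi Vi; first exact: X0.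
have mb : mono_on N N.+1 (bump i.+1) by mono.
have vX u : (u <= N)%N -> obv I X u.+1 = obv I z u.
  by move=> hu; rewrite -X0 obv_sb //; mono.
have v0 (y : C N) : obv I y 0 = ob I (sb 0 (fun=> 0%N) y) by [].
have vN n (y : C n) : obv I y 0 = ob I (sb 0 (fun=> 0%N) y) by [].
have vx u : (u <= N)%N -> obv I (x i.+1) u = obv I X (bump i.+1 u).
  case: u => [|u] hu; first by rewrite /bump /= !vN vert // Xw.
  have m1 : mono_on N.-1 N (bump 0) by split=> [? ?|]; rewrite /bump; lia.
  have m2 : mono_on N.-1 N (bump i) by split=> [? ?|]; rewrite /bump; lia.
  have -> : obv I (x i.+1) u.+1 = obv I (sb N.-1 (bump 0) (x i.+1)) u.
    by rewrite obv_sb //; lia.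
  rewrite -(compat (i := 0%N) (j := i.+1)) //; last by lia.
  rewrite obv_sb //=; last by lia.
  rewrite -vX; last by rewrite /bump; lia.
  by congr obv; rewrite /bump; lia.
apply: (simplex_ext (I := I)) => [u hu|l J Y Z d hJ hl eY eZ ed].
  by rewrite obv_sb // vx.
case: l J hJ hl eY eZ ed => // l J hJ _ eY eZ ed.
rewrite /sb -act_comp.
have bJ u : (u <= l.+1)%N -> jn (dcomp (mkd N N.+1 (bump i.+1)) J) u = bump i.+1 (jn J u).
  by move=> hu; rewrite jn_comp jn_mkd ?jn_le.
have [J0|J0] := eqVneq (jn J 0) 0%N; last first.
  (* the face does not meet the vertex 0, hence lies in the facet [x 0] *)
  have Jp u : (u <= l.+1)%N -> (0 < jn J u)%N.
    by move=> hu; have := @jn_mono _ _ J 0 u isT hu; lia.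
  have hN : (0 < N)%N by have := Jp 0 isT; have := jn_le J 0; lia.
  pose f u := (jn J u).-1.
  have mf : mono_on l.+1 N.-1 f.
    split=> [u v h h'|]; rewrite /f; first by have := jn_mono J h h'; lia.
    by have := jn_le J l.+1; lia.
  have m1 : mono_on N.-1 N (bump 0) by split=> [? ?|]; rewrite /bump; lia.
  have m2 : mono_on N.-1 N (bump i) by split=> [? ?|]; rewrite /bump; lia.
  have -> : act J (x i.+1) = sb l.+1 f (sb N.-1 (bump 0) (x i.+1)).
    rewrite sb_sb //; apply: act_jn_eq => u hu; rewrite jn_mkd //; last exact: mono_comp m1 mf.
    by rewrite /= /f /bump; have := Jp u hu; lia.
  rewrite -(compat (i := 0%N) (j := i.+1)) // -X0.
  have m3 : mono_on N N.+1 (bump 0) by mono.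
  rewrite sb_sb // sb_sb //; last exact: mono_comp m2 mf.
  have m4 := mono_comp m3 (mono_comp m2 mf).
  rewrite /sb; apply: mr_congr => u hu; rewrite bJ // jn_mkd //.
  by rewrite /= /f /bump; have := Jp u hu; lia.
have Jp u : (u <= l)%N -> (0 < jn J u.+1)%N.
  by move=> hu; have := @jn_strict _ _ J 0 u.+1 hJ isT hu; lia.
pose f u := (bump i.+1 (jn J u.+1)).-1.
have mf : mono_on l N f.
  split=> [u v h h'|]; rewrite /f /bump; first by have := @jn_mono _ _ J u.+1 v.+1 h h'; lia.
  by have := jn_le J l.+1; lia.
pose J' := mkd l N f.
have jJ' u : (u <= l)%N -> jn J' u = f u by move=> hu; rewrite jn_mkd.
have hJ' : dstrict J'.
  apply: strict_jn => u v huv hv; rewrite !jJ' //; last by lia.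
  by have := @jn_strict _ _ J u.+1 v.+1 hJ huv hv; rewrite /f /bump; have := Jp u; lia.
have hm : missb J' i.
  apply/missbP; split=> // u hu; rewrite jJ' // /f /bump; by have := Jp u hu; lia.
have eYw : Y = ob I w by rewrite eY jn0 J0 obv_sb // [bump _ _]/= vN Xw.
clear eY; subst Y.
have -> : mr I (act (dcomp (mkd N N.+1 (bump i.+1)) J) X) (ob I w) Z d =
    mr I (act (dcons J') X) (ob I w) Z d.
  apply: mr_congr => u hu; rewrite bJ // jn_cons //.
  case: u hu => [|u] hu; first by rewrite J0.
  by rewrite /= jJ' // /f /bump; have := Jp u hu; lia.
rewrite Xc //; last by lia.
  rewrite (cE _ _ _ _ _ hm); apply: mr_congr => u hu.
  rewrite jn_sg //; case: u hu => [|u] hu; first by rewrite J0.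
  by rewrite /= jJ' // /f /skipf /bump; have := Jp u hu; lia.
rewrite eZ jnm jJ' // /f obv_sb ?jn_le // -vX; last first.
  by rewrite /bump; have := jn_le J l.+1; lia.
by congr obv; rewrite /bump; have := Jp l (leqnn l); lia.
Qed.
End Facets.

Section FacetsOfMap.
Variables (C : sset) (N : nat) (P : forall j, std N.+1 j -> Prop).
Variable hP : forall m j (a : dmap m j) (x : std N.+1 j), P x -> P (act a x : std N.+1 m).
Variables (u : smap (sset_sub hP) C) (V : pred nat).
Hypothesis PV : forall i, (i <= N.+1)%N -> V i -> P (mkd N N.+1 (bump i) : std N.+1 N).
Hypothesis VP : forall j (a : std N.+1 j), P a ->
  exists i, [/\ (i <= N.+1)%N, V i & forall v, (v <= j)%N -> jn (a : dmap j N.+1) v != i].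

Lemma smap_sub_eq j (a b : sset_sub hP j) : proj1_sig a = proj1_sig b -> u j a = u j b.
Proof. by move=> e; rewrite (sig_eq e). Qed.

(** A union of facets is determined by its facets. [d] is a default value at the indices whose facet
    does not belong to the subset. *)
Lemma facets_of_map (d : C N) : exists x : nat -> C N,
  [/\ forall i j b, (i <= N.+1)%N -> V i -> proj1_sig b = mkd N N.+1 (bump i) :> std N.+1 N ->
        j = i -> x j = u N b,
      forall i j, (i < j)%N -> (j <= N.+1)%N -> V i -> V j -> (0 < N)%N ->
        sb N.-1 (bump j.-1) (x i) = sb N.-1 (bump i) (x j) &
      forall X : C N.+1, (forall i, (i <= N.+1)%N -> V i -> sb N (bump i) X = x i) ->
        fills u X].
Proof.
pose x i := match excluded_middle_informative (P (mkd N N.+1 (bump i) : std N.+1 N)) with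
  | left h => u N (exist _ _ h) | right _ => d end.
have xE i b : (i <= N.+1)%N -> V i -> proj1_sig b = mkd N N.+1 (bump i) :> std N.+1 N ->
    x i = u N b.
  move=> hi Vi e; rewrite /x; case: excluded_middle_informative => [h|]; last by have := PV hi Vi.
  exact: smap_sub_eq.
have mb i : mono_on N N.+1 (bump i) by mono.
exists x; split=> [i j b hi Vi e ->|i j hij hj Vi Vj hN|X hX j a]; first exact: xE.
  have hi : (i <= N.+1)%N by lia.
  rewrite (xE i (exist _ _ (PV hi Vi))) // (xE j (exist _ _ (PV hj Vj))) // /sb -!sfun_act.
  have m1 w : mono_on N.-1 N (bump w) by split=> [? ?|]; rewrite /bump; lia.
  apply: smap_sub_eq; rewrite /= !mkd_comp //; apply: mkd_eq => v hv /=; rewrite /bump; lia.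
case: a => a ha; have [i [hi Vi hm]] := VP ha; rewrite /=.
pose f v := (jn (a : dmap j N.+1) v - (i < jn (a : dmap j N.+1) v))%N.
have mf : mono_on j N f.
  split=> [v v' h h'|]; rewrite /f; first by have := jn_mono (a : dmap j N.+1) h h'; lia.
  by have := hm _ (leqnn j); have := jn_le (a : dmap j N.+1) j; lia.
have ea : a = act (mkd j N f) (mkd N N.+1 (bump i) : std N.+1 N) :> std N.+1 j.
  rewrite /= mkd_comp //; apply: dmap_jn => v hv; rewrite jn_mkd //; last exact: mono_comp (mb i) mf.
  by rewrite /= /f /bump; have := hm v hv; lia.
transitivity (sb j f (x i)).
  by rewrite -(hX i hi Vi) sb_sb // /sb -(mkd_comp (mb i) mf) -[dcomp _ _]ea.
rewrite (xE i (exist _ _ (PV hi Vi))) // /sb -sfun_act; apply: smap_sub_eq.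
by rewrite [RHS]ea.
Qed.
End FacetsOfMap.

Lemma strict_id N l (J : dmap l N) : dstrict J -> (forall i, (i <= N)%N ->
  exists2 u, (u <= l)%N & jn J u = i) -> l = N /\ forall u, (u <= l)%N -> jn J u = u.
Proof.
move=> hJ hs.
have ge u : (u <= l)%N -> (u <= jn J u)%N.
  elim: u => // u IH hu; have := @jn_strict _ _ J u u.+1 hJ (leqnn _) hu; have := IH (ltnW hu); lia.
have le u : (u <= l)%N -> (jn J u <= u)%N.
  elim: u => [|u IH] hu.
    have [v hv e] := hs 0%N isT; have := @jn_mono _ _ J 0%N v isT hv; lia.
  have [v hv e] := hs u.+1 (leq_trans hu (leq_trans (ge l (leqnn l)) (jn_le J l))).
  have : (u < v)%N.
    by rewrite ltnNge; apply/negP => h; have := jn_mono J h (ltnW hu); have := IH (ltnW hu); lia.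
  by move=> h; have := jn_mono J h hv; lia.
have e u : (u <= l)%N -> jn J u = u by move=> hu; have := ge u hu; have := le u hu; lia.
split=> //; have [v hv ev] := hs N (leqnn N); rewrite e // in ev.
have := ge l (leqnn l); have := jn_le J l; lia.
Qed.

Lemma hitP N (V : pred nat) l (J : dmap l N) i : ~~ missb V J i -> (i <= N)%N -> V i.+1 ->
  exists2 u, (u <= l)%N & jn J u = i.
Proof.
rewrite /missb => h hi Vi; move: h; rewrite hi Vi /= negb_forall => /existsP[u].
by rewrite negbK => /eqP e; exists u; [rewrite -ltnS | rewrite /jn inord_val].
Qed.

Lemma hit_missN N (V : pred nat) l (J : dmap l N) i u : (u <= l)%N -> jn J u = i ->
  ~~ missb V J i.
Proof. by move=> hu e; apply/negP => /missbP[_ _ /(_ u hu)]; rewrite e eqxx. Qed.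

Lemma facets_vertex (C : sset) N (V : pred nat) (x : nat -> C N) i j :
  (forall i j, (i < j)%N -> (j <= N.+1)%N -> V i -> V j -> (0 < N)%N ->
    sb N.-1 (bump j.-1) (x i) = sb N.-1 (bump i) (x j)) -> (0 < N)%N ->
  (0 < i)%N -> (i <= N.+1)%N -> V i -> (0 < j)%N -> (j <= N.+1)%N -> V j ->
  sb 0 (fun=> 0%N) (x i) = sb 0 (fun=> 0%N) (x j).
Proof.
move=> xc hN; wlog hij : i j / (i < j)%N.
  move=> H i0 hi Vi j0 hj Vj; case: (ltngtP i j) => [h|h|-> //]; first exact: H.
  by symmetry; apply: H.
move=> i0 hi Vi j0 hj Vj; have := congr1 (sb 0 (fun=> 0%N)) (xc i j hij hj Vi Vj hN).
have m1 v : mono_on N.-1 N (bump v) by split=> [? ?|]; rewrite /bump; lia.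
have m2 : mono_on 0 N.-1 (fun=> 0%N) by [].
rewrite !sb_sb // => e; transitivity (sb 0 (bump j.-1 \o (fun=> 0%N)) (x i)).
  by apply: sb_eq => v hv; rewrite /= /bump; lia.
by rewrite e; apply: sb_eq => v hv; rewrite /= /bump; lia.
Qed.

(** * Inner horns *)

Section Horn.
Variables (k : comPzRingType) (A : dgcat k) (C : sset) (I : nerve_iso C A).

(** The only faces outside the horn are the whole simplex and the facet opposite to [i]. The top
    component is taken to be 0, and the component of the missing facet is solved from the equation
    of the whole simplex, in which it occurs with an invertible sign because [i] is not the last
    vertex. That [i] is not 0 makes the facet opposite to 0 available. *)
Lemma nerve_quasicategory : is_quasicategory C.
Proof.
move=> n i /andP[i0 iN] u.
case: n i i0 iN u => [|N] i i0 iN u; first by lia.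
have hN : (0 < N)%N by lia.
pose V : pred nat := fun j => j != i :> nat.
have mb j : mono_on N N.+1 (bump j) by mono.
have PV j : (j <= N.+1)%N -> V j -> in_horn i (mkd N N.+1 (bump j) : std N.+1 N).
  move=> hj Vj; exists (inord j).
    by move=> e; move: Vj; rewrite /V -e inordK // eqxx.
  move=> v e; have := mkdE v (mb j); rewrite e inordK // /bump; lia.
have VP j (a : std N.+1 j) : in_horn i a ->
    exists l, [/\ (l <= N.+1)%N, V l & forall v, (v <= j)%N -> jn (a : dmap j N.+1) v != l].
  case=> l hl ha; exists l; split; first exact: leq_ord.
    by apply/eqP => e; apply: hl; apply: val_inj.
  by move=> v hv; apply/eqP => e; apply: (ha (inord v)); apply: val_inj.
have V0 : V 0%N by rewrite /V; lia.
have [x [xE xc xf]] := facets_of_map u PV VP (u N (exist _ _ (PV 0%N isT V0))).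
(* Vertex 0 of the filler is read off any given facet other than facet 0. *)
have [v1 [hv1 hv1' Vv1]] : exists v1, [/\ (0 < v1)%N, (v1 <= N.+1)%N & V v1].
  case: (eqVneq (i : nat) 1%N) => e; [exists 2 | exists 1%N]; rewrite /V; split=> //; lia.
pose w := sb 0 (fun=> 0%N) (x v1).
have vert j : (0 < j)%N -> (j <= N.+1)%N -> V j -> sb 0 (fun=> 0%N) (x j) = w.
  by move=> j0 hj Vj; apply: facets_vertex xc _ _ _ _ _ _ _.
(* The facet opposite to vertex 0 starts at vertex 1, so its vertex [k0] is vertex [i] of the whole
   simplex. *)
pose k0 := i.-1; have ek : (i : nat) = k0.+1 by rewrite /k0; lia.
pose e Y d : dghom (ob I w) Y d := cD I (yo (x 0)) (facet_coch I V x w) (did N : std N N) Y d.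
pose isf l (J : dmap l N) := (l.+1 == N) && [forall v, J v == bump k0 v :> nat].
have isfP l (J : dmap l N) : isf l J -> l.+1 = N /\ forall v, (v <= l)%N -> jn J v = bump k0 v.
  move=> /andP[/eqP h1 /forallP h2]; split=> // v hv; rewrite /jn (eqP (h2 _)) inordK //.
(* The sign undoes the factors [(-1)^N] of [cD] and [(-1)^(N - k0)] of the face [k0], so that [cD g]
   is [- e] on the whole simplex. *)
pose g : coch (std N) (ob I w) := fun l J Y d =>
  if isf l J then (-1) ^+ (N + (N - k0)) *: e Y d else 0.
have g0 l (J : dmap l N) j Y d : missb V J j -> g l J Y d = 0.
  move=> /missbP[h1 h2 h3]; rewrite /g; case: ifP => // /isfP[el eJ].
  have [hj|hj] : (j < k0)%N \/ (k0 < j)%N by move: h2; rewrite /V; lia.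
    by have := h3 j; rewrite eJ ?eqxx //= /bump; lia.
  by have := h3 j.-1; rewrite eJ //= /bump; lia.
have isfF : isf N.-1 (mkd N.-1 N (bump k0)).
  apply/andP; split; first by lia.
  apply/forallP => v; rewrite mkdE //.
  by split=> [? ?|]; rewrite /bump; lia.
have g1 Y d : g N (did N) Y d = 0 by rewrite /g ifN // /isf; lia.
have gF Y d : g N.-1 (mkd N.-1 N (bump k0)) Y d = (-1) ^+ (N + (N - k0)) *: e Y d.
  by rewrite /g isfF.
have eE Y d : e Y d = cD I (yo (x 0)) (facet_coch I V x w) (did N : std N N) Y d by [].
clearbody g e.
have nmiss l (J : dmap l N) : dstrict J -> (forall j, ~~ missb V J j) ->
    (l = N /\ forall v, (v <= l)%N -> jn J v = v) \/ isf l J.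
  move=> hJ hm.
  have hit j : (j <= N)%N -> j != k0 -> exists2 v, (v <= l)%N & jn J v = j.
    by move=> hj nj; apply: (hitP (hm j)) => //; rewrite /V ek.
  have [[v hv ev]|hk] := excluded_middle_informative (exists2 v, (v <= l)%N & jn J v = k0).
    by left; apply: strict_id => // j hj; case: (eqVneq j k0) => [->|]; [exists v | exact: hit].
  right; pose f v := (jn J v - (k0 < jn J v))%N.
  have nk v : (v <= l)%N -> jn J v != k0 by move=> hv; apply/eqP => ev; apply: hk; exists v.
  have mf : mono_on l N.-1 f.
    split=> [v v' h h'|]; rewrite /f; first by have := jn_mono J h h'; lia.
    by have := nk _ (leqnn l); have := jn_le J l; lia.
  have sf : dstrict (mkd l N.-1 f).
    apply: dstrict_mkd => // v v' h h'; rewrite /f.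
    by have := jn_strict hJ h h'; have := nk v; have := nk v' h'; lia.
  have [el ef] : l = N.-1 /\ forall v, (v <= l)%N -> jn (mkd l N.-1 f) v = v.
    apply: strict_id => // j hj; have [||v hv ev] := @hit (bump k0 j).
    - by rewrite /bump; lia.
    - by rewrite /bump; lia.
    by exists v; rewrite // jn_mkd // /f ev /bump; lia.
  apply/andP; split; first by lia.
  apply/forallP => v; have hv : (v <= l)%N by rewrite -ltnS.
  have := ef v hv; rewrite jn_mkd // /f; have := nk v hv; rewrite /jn inord_val /bump; lia.
have eoz : oK I (yo (x 0)) (did N : std N N) N = obv I (x 0) N.
  by rewrite oz_jn // /jn inordK.
have gid Y : Y = obv I (x 0) N -> cD I (yo (x 0)) g (did N : std N N) Y (1 - N%:Z) =
    - e Y (1 - N%:Z).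
  move=> eY; rewrite /cD g1 dd0 sub0r /cR.
  have hk : (k0 < N)%N by lia.
  rewrite (bigD1 (Ordinal hk)) //= big1 ?addr0; last first.
    move=> v; rewrite -val_eqE /= => nv; have hv := ltn_ord v.
    rewrite (g0 _ _ v); last first.
      apply/missbP; split; [by lia|by rewrite /V ek|move=> t ht].
      rewrite jn_comp jn_mkd //; last by split=> [? ?|]; rewrite /bump; lia.
      by rewrite /jn inordK /= /bump; lia.
    rewrite (g0 _ _ N) ?cp0r ?subrr ?scaler0 //.
    apply/missbP; split; [by []|by rewrite /V; lia|move=> t ht].
    rewrite jn_comp jn_mkd //; last by mono.
    by rewrite /jn inordK /=; lia.
  rewrite [g k0 _ _ _](g0 _ _ N) ?cp0r ?subr0; last first.
    apply/missbP; split; [by []|by rewrite /V; lia|move=> t ht].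
    rewrite jn_comp jn_mkd //; last by mono.
    by rewrite /jn inordK /=; lia.
  rewrite /sb /= (_ : dcomp _ _ = mkd N.-1 N (bump k0)) ?gF; last exact: dmap_eq.
  rewrite signE scalerN signE (@sign_odd _ _ _ 0%N) ?expr0 ?scale1r //.
  by rewrite !oddD; case: (odd N); case: (odd _).
have [X [Xf _ _]] : exists X : C N.+1, [/\ forall j, (j <= N.+1)%N -> V j -> sb N (bump j) X = x j,
    sb 0 (fun=> 0%N) X = w &
    forall l (J : dmap l N) Y d, dstrict J -> (forall i, ~~ missb V J i) ->
      Y = obv I (x 0) (jn J l) -> d = - l%:Z ->
      mr I (act (dcons J) X) (ob I w) Y d = g l (J : std N l) Y d].
  apply: facet_glue => //.
  move=> l J Y d hJ hm eY ed; case: (nmiss l J hJ hm) => [[el eJ]|hf].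
    subst l; have -> : J = did N by apply: dmap_jn => v hv; rewrite eJ // /jn inordK.
    by subst d; rewrite -eE; apply: gid; rewrite eY oz_jn // eJ.
  have [el eJ] := isfP _ _ hf.
  (* the equation for the other face follows from [D (D c) = 0] on the whole simplex *)
  pose c : coch (std N) (ob I w) := fun l J Y d => facet_coch I V x w J Y d + g l J Y d.
  suff : cD I (yo (x 0)) c J Y d = 0.
    by rewrite cDD => /eqP; rewrite addrC addr_eq0 => /eqP.
  have eY' : Y = obv I (x 0) N.
    by rewrite eY oz_jn // eJ // /bump; congr obv; lia.
  have ez l' (J' : dmap l' N) j Z d' : missb V J' j -> Z = oK I (yo (x 0)) (J' : std N l') l' ->
      d' = 1 - l'%:Z -> cD I (yo (x 0)) c J' Z d' = 0.
    move=> hj eZ ed'; rewrite cDD (facet_cD _ xc vert hj) // add0r.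
    rewrite (cD_ext (c' := fun _ _ _ _ => 0)) ?cD0 //.
    by move=> l'' J'' Z' j' _ _ _; rewrite (g0 _ _ j) //; exact: miss_comp.
  have c1 : cD I (yo (x 0)) c (did N : std N N) Y (1 - N%:Z) = 0 by rewrite cDD gid // eE subrr.
  have := @cD_cD _ _ _ I _ (yo (x 0)) _ c N (did N : std N N) Y d; rewrite eoz => /(_ eY').
  clearbody c; rewrite {1}/cD (_ : d - 1 = 1 - N%:Z); last by lia.
  rewrite c1 dd0 sub0r /cR.
  have hk : (k0 < N)%N by lia.
  rewrite (bigD1 (Ordinal hk)) //= big1 ?addr0; last first.
    move=> v; rewrite -val_eqE /= => nv; have hv := ltn_ord v.
    rewrite (ez _ _ v); last first.
    - by lia.
    - rewrite oz_jn // jn_comp jn_mkd //; last by split=> [? ?|]; rewrite /bump; lia.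
      by rewrite /jn inordK /= /bump ?eY'; [congr obv|]; lia.
    - apply/missbP; split; [by lia|by rewrite /V ek|move=> t ht].
      rewrite jn_comp jn_mkd //; last by split=> [? ?|]; rewrite /bump; lia.
      by rewrite /jn inordK /= /bump; lia.
    rewrite (ez _ _ N) ?cp0r ?subrr ?scaler0 //; last first.
    - by lia.
    - by rewrite !oz_jn // ?jn_comp ?jn_mkd //; [mono | lia].
    apply/missbP; split; [by []|by rewrite /V; lia|move=> t ht].
    rewrite jn_comp jn_mkd //; last by mono.
    by rewrite /jn inordK /=; lia.
  rewrite [@cD _ _ _ _ _ _ _ c k0 _ _ _](ez _ _ N) ?cp0r ?subr0 //; last first.
  - by lia.
  - by rewrite !oz_jn // ?jn_comp ?jn_mkd //; [mono | lia].
  - apply/missbP; split; [by []|by rewrite /V; lia|move=> t ht].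
    rewrite jn_comp jn_mkd //; last by mono.
    by rewrite /jn inordK /=; lia.
  rewrite scalerN signE => /(congr1 (fun y => - ((-1) ^+ (N + (N - k0)) *: y))).
  rewrite scalerN opprK signK scaler0 oppr0 => <-.
  have ef : (l = N.-1)%N by lia.
  subst l; rewrite /sb; apply: (coch_congr (cD I (yo (x 0)) c)) => v hv.
  rewrite eJ // jn_comp jn_mkd //; last by split=> [? ?|]; rewrite /bump; lia.
  by rewrite /jn inordK //= /bump; lia.
by exists X; apply: xf.
Qed.
End Horn.

(** * Boundaries of simplices *)

Lemma bump_mono N i : mono_on N N.+1 (bump i).
Proof. by mono. Qed.

Lemma bump_mono' N i : (0 < N)%N -> mono_on N.-1 N (bump i).
Proof. by move=> h; split=> [? ?|]; rewrite /bump; lia. Qed.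

Lemma in_boundaryP n j (a : std n j) : in_boundary a <->
  exists i, (i <= n)%N /\ forall v, (v <= j)%N -> jn (a : dmap j n) v != i.
Proof.
split=> [[i h]|[i [hi h]]].
  exists i; split=> [|v hv]; first exact: leq_ord.
  by apply/eqP => e; apply: (h (inord v)); apply: val_inj.
exists (inord i) => v e; have := h v; rewrite /jn inord_val e inordK ?eqxx //.
by move=> /(_ (leq_ord v)).
Qed.

Lemma face_boundary N i : (i <= N.+1)%N -> in_boundary (mkd N N.+1 (bump i) : std N.+1 N).
Proof.
move=> hi; apply/in_boundaryP; exists i; split=> // v hv.
by rewrite jn_mkd //; [rewrite /bump; lia | exact: bump_mono].
Qed.

Definition compat_facets (D : sset) N (x : nat -> D N) : Prop :=
  forall i j, (i < j)%N -> (j <= N.+1)%N -> (0 < N)%N ->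
    sb N.-1 (bump j.-1) (x i) = sb N.-1 (bump i) (x j).

Lemma boundary_facets (D : sset) N (u : smap (boundary N.+1) D) : exists x : nat -> D N,
  [/\ forall i (hi : (i <= N.+1)%N), x i = u N (exist _ _ (face_boundary hi)),
      compat_facets x &
      forall X : D N.+1, (forall i, (i <= N.+1)%N -> sb N (bump i) X = x i) -> fills u X].
Proof.
have [|||x [xE xc xf]] := @facets_of_map D N _ _ u predT.
- by move=> i hi _; exact: face_boundary.
- by move=> j a /in_boundaryP[i [hi h]]; exists i.
- exact: (u N (exist _ _ (face_boundary (leq0n N.+1)))).
exists x; split=> [i hi|i j hij hj|X hX]; first by apply: (xE i).
  exact: xc.
by apply: xf => i hi _; exact: hX.
Qed.

(** Each simplex of the boundary omits some vertex and is sent to its image in that facet; [indep]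
    makes the choice of the vertex irrelevant. *)
Lemma boundary_map (D : sset) N (x : nat -> D N) : compat_facets x ->
  exists u : smap (boundary N.+1) D,
    forall i (a : boundary N.+1 N), (i <= N.+1)%N ->
      proj1_sig a = mkd N N.+1 (bump i) :> std N.+1 N -> u N a = x i.
Proof.
move=> xc.
pose pr j (a : dmap j N.+1) i := mkd j N (fun v => jn a v - (i < jn a v))%N.
pose missed j (a : dmap j N.+1) i := (i <= N.+1)%N /\ forall v, (v <= j)%N -> jn a v != i.
have mpr j (a : dmap j N.+1) i : missed j a i ->
    mono_on j N (fun v => jn a v - (i < jn a v))%N.
  move=> [hi hm]; split=> [v v' h h'|]; first by have := jn_mono a h h'; lia.
  by have := hm j (leqnn j); have := jn_le a j; lia.
have jpr j (a : dmap j N.+1) i v : missed j a i -> (v <= j)%N ->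
    jn (pr j a i) v = (jn a v - (i < jn a v))%N.
  by move=> hm hv; rewrite jn_mkd //; exact: mpr.
have indep j (a : dmap j N.+1) i i' : missed j a i -> missed j a i' ->
    act (pr j a i) (x i) = act (pr j a i') (x i').
  wlog hii : i i' / (i < i')%N.
    move=> H hi hi'; case: (ltngtP i i') => [h|h|-> //]; first exact: H.
    by symmetry; apply: H.
  move=> hi hi'; have [i1 i2] := hi; have [i1' i2'] := hi'.
  have hN : (0 < N)%N.
    by move: (jn a 0) (i2 0%N isT) (i2' 0%N isT) (jn_le a 0) => t; lia.
  pose f v := (jn a v - (i < jn a v) - (i' < jn a v))%N.
  have mf : mono_on j N.-1 f.
    split=> [v v' h h'|]; rewrite /f; first by have := jn_mono a h h'; lia.
    by have := i2 j (leqnn j); have := i2' j (leqnn j); have := jn_le a j; lia.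
  have -> : act (pr j a i) (x i) = sb j f (sb N.-1 (bump i'.-1) (x i)).
    rewrite sb_sb //; last exact: bump_mono'.
    apply: act_jn_eq => v hv; rewrite jpr // jn_mkd //; last exact: mono_comp (bump_mono' _ hN) mf.
    by rewrite /= /f /bump; have := i2 v hv; have := i2' v hv; lia.
  have -> : act (pr j a i') (x i') = sb j f (sb N.-1 (bump i) (x i')).
    rewrite sb_sb //; last exact: bump_mono'.
    apply: act_jn_eq => v hv; rewrite jpr // jn_mkd //; last exact: mono_comp (bump_mono' _ hN) mf.
    by rewrite /= /f /bump; have := i2 v hv; have := i2' v hv; lia.
  by rewrite xc.
have miss_ex j (a : boundary N.+1 j) : exists i, missed j (proj1_sig a) i.
  by case: a => a /= /in_boundaryP.
pose ch j (a : boundary N.+1 j) := sval (constructive_indefinite_description _ (miss_ex j a)).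
have chP j a : missed j (proj1_sig a) (ch j a).
  by rewrite /ch; case: constructive_indefinite_description.
pose u j (a : boundary N.+1 j) : D j := act (pr j (proj1_sig a) (ch j a)) (x (ch j a)).
have uA m j (b : dmap m j) (a : boundary N.+1 j) : u m (act b a) = act b (u j a).
  have h := chP j a; have h' : missed m (proj1_sig (act b a)) (ch j a).
    by case: h => h1 h2; split=> // v hv; rewrite /= jn_comp; apply: h2; exact: jn_le.
  rewrite /u (indep _ _ _ _ (chP m (act b a)) h') -act_comp; apply: act_jn_eq => v hv.
  by rewrite jn_comp !jpr ?jn_le //= jn_comp.
exists (SMap uA) => i a hi ea; rewrite /= /u.
have h : missed N (proj1_sig a) i.
  by split=> // v hv; rewrite ea jn_mkd //; [rewrite /bump; lia | exact: bump_mono].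
rewrite (indep _ _ _ _ (chP N a) h) -[RHS]act_id; apply: act_jn_eq => v hv.
rewrite jpr // ea jn_mkd //; last exact: bump_mono.
by rewrite /jn inordK // /bump; lia.
Qed.

Lemma jn_dsum m' m j' j (a : dmap m' m) (b : dmap j' j) u : (u <= m' + j'.+1)%N ->
  jn (dsum a b) u = if (u <= m')%N then jn a u else (m.+1 + jn b (u - m'.+1))%N.
Proof.
move=> hu; rewrite /jn /= /dsum_fun; case: splitP => v /=.
  rewrite inordK //= => e; have := ltn_ord v; rewrite -e ltnS => ->.
  by congr (nat_of_ord (a _)); apply: val_inj; rewrite /= inordK // e.
rewrite inordK //= => e; rewrite ifN; last by lia.
by congr (_ + nat_of_ord (b _))%N; apply: val_inj; rewrite /= inordK //; have := ltn_ord v; lia.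
Qed.

Lemma jn_dinl m j u : (u <= m)%N -> jn (dinl m j) u = u.
Proof. by move=> hu; rewrite /jn /= inordK. Qed.

Lemma jn_dinr m j u : (u <= j)%N -> jn (dinr m j) u = (m.+1 + u)%N.
Proof. by move=> hu; rewrite /jn /= inordK. Qed.

Lemma jn_dconst m n (i : 'I_n.+1) u : jn (dconst m i) u = i.
Proof. by []. Qed.

Lemma jn_did n u : (u <= n)%N -> jn (did n) u = u.
Proof. by move=> hu; rewrite /jn inordK. Qed.

(** * Changing the components of a simplex *)

Section Modify.
Variables (k : comPzRingType) (A : dgcat k) (C : sset) (I : nerve_iso C A).

(* top components of the faces of [Z] containing the vertex 0 *)
Definition zcoch N (Z : C N.+1) (W : A) : coch (std N) W := fun l J Y d =>
  mr I (act (dcons (J : dmap l N)) Z) W Y d.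

Lemma zcoch_cD N (Z : C N.+1) l (J : dmap l N) W Y d : W = obv I Z 0 ->
  Y = oK I (yo (sb N (bump 0) Z)) (J : std N l) l -> d = 1 - l%:Z ->
  cD I (yo (sb N (bump 0) Z)) (zcoch Z W) (J : std N l) Y d = 0.
Proof.
move=> eW eY ed; rewrite /cD {1}/zcoch.
have oE u : (u <= l)%N -> obv I (act (dcons J) Z) u.+1 = oK I (yo (sb N (bump 0) Z)) (J : std N l) u.
  move=> hu; rewrite oz_jn // obv_jn // jn_cons //= obv_sb ?jn_le //; exact: bump_mono.
have e0 : W = obv I (act (dcons J) Z) 0 by rewrite obv_jn // jn_cons.
have eY' : Y = obv I (act (dcons J) Z) l.+1 by rewrite oE.
have := mr_d e0 eY' (i := d - 1); rewrite subrK => ->; last by lia.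
rewrite [X in X - _](_ : _ = cR I (yo (sb N (bump 0) Z)) (zcoch Z W) (J : std N l) Y d)
  ?subrr ?scaler0 //.
rewrite (big_ord_pos l (fun v => (-1) ^+ (l.+1 - v) *:
     (mr I (sb l (bump v) (act (dcons J) Z)) W Y d -
      cp d (mr I (sb (l.+1 - v) (addn v) (act (dcons J) Z))
         (obv I (act (dcons J) Z) v) Y (1 - (l.+1 - v)%N%:Z))
        (mr I (sb v id (act (dcons J) Z)) W (obv I (act (dcons J) Z) v) (1 - v%:Z))))).
apply: eq_bigr => v _; have hv := ltn_ord v.
rewrite subSS oE ?(ltnW hv) //; congr (_ *: (_ - _)).
  rewrite /zcoch /sb -act_comp.
  case: l J eY ed oE e0 eY' v hv => [|l] J eY ed oE e0 eY' v hv; first by case: v hv.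
  apply: mr_congr => u hu.
  rewrite jn_comp jn_mkd //; last by mono.
  rewrite jn_cons; last by rewrite /bump; lia.
  rewrite jn_cons //; case: u hu => [|u] hu //=; rewrite jn_comp jn_mkd //; last by mono.
  by have -> : bump v.+1 u.+1 = (bump v u).+1 by rewrite /bump; lia.
rewrite (_ : 1 - v.+1%:Z = d - 1 + (l - v)%N%:Z); last by lia.
congr cp.
  rewrite /mK [yo _ _ _]/= /sb -!act_comp; apply: mr_congr => u hu.
  rewrite jn_comp jn_mkd //; last by mono.
  rewrite jn_cons; last by lia.
  rewrite jn_comp (jn_mkd (bump_mono N 0)) ?jn_le //.
  by rewrite jn_comp jn_mkd //; mono.
rewrite /zcoch /sb -act_comp; apply: mr_congr => u hu.
rewrite jn_comp jn_mkd //; last by mono.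
rewrite jn_cons; last by lia.
rewrite jn_cons //; case: u hu => [|u] hu //=; rewrite jn_comp jn_mkd //; mono.
Qed.

(** The new cochain is that of [Z] plus [g]. As [zcoch] is closed and [cD] additive, [g] only has to
    be closed, and only on the uncovered faces. *)
Lemma simplex_modify N (Z : C N.+1) (W := ob I (sb 0 (fun=> 0%N) Z)) (V : pred nat)
    (g : coch (std N) W) : V 0%N ->
  (forall l (J : dmap l N) i Y d, missb V J i -> g l (J : std N l) Y d = 0) ->
  (forall l (J : dmap l N) Y d, dstrict J -> (forall i, ~~ missb V J i) ->
    Y = obv I Z (jn J l).+1 -> d = 1 - l%:Z ->
    cD I (yo (sb N (bump 0) Z)) g (J : std N l) Y d = 0) ->
  exists X : C N.+1, [/\ forall i, (i <= N.+1)%N -> V i -> sb N (bump i) X = sb N (bump i) Z,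
    forall i, (i <= N.+1)%N -> sb 0 (fun=> i) X = sb 0 (fun=> i) Z &
    forall l (J : dmap l N) Y d, dstrict J ->
      Y = obv I Z (jn J l).+1 -> d = - l%:Z ->
      mr I (act (dcons J) X) W Y d = mr I (act (dcons J) Z) W Y d + g l (J : std N l) Y d].
Proof.
move=> V0 g0 gD; have mb := bump_mono N.
have oz l (J : dmap l N) u : (u <= l)%N -> oK I (yo (sb N (bump 0) Z)) (J : std N l) u =
    obv I Z (jn J u).+1.
  by move=> hu; rewrite oz_jn // obv_sb ?jn_le.
pose c : coch (std N) W := fun l J Y d => zcoch Z W J Y d + g l J Y d.
have [|X [X0 Xw Xc]] := cone_exists (I := I) (z := sb N (bump 0) Z) (w := sb 0 (fun=> 0%N) Z) (c := c).
  move=> l J Y d hJ eY ed; rewrite cDD zcoch_cD // add0r.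
  have [[i hi]|hn] := excluded_middle_informative (exists i, missb V (J : dmap l N) i).
    rewrite (cD_ext (c' := fun _ _ _ _ => 0)) ?cD0 //.
    by move=> l' J' Z' j _ _ _; rewrite (g0 _ _ i) //; exact: miss_comp.
  rewrite gD //; first by move=> i; apply/negP => hi; case: hn; exists i.
  by rewrite eY oz.
have Xc' l (J : dmap l N) Y d : dstrict J -> Y = obv I Z (jn J l).+1 -> d = - l%:Z ->
    mr I (act (dcons J) X) W Y d = c l J Y d.
  by move=> hJ eY ed; rewrite Xc // eY obv_sb ?jn_le.
have Xv i : (i <= N.+1)%N -> sb 0 (fun=> i) X = sb 0 (fun=> i) Z.
  case: i => [|i] hi; first exact: Xw.
  have := congr1 (sb 0 (fun=> i)) X0; rewrite !sb_sb //; by split.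
exists X; split=> // i hi Vi.
case: i hi Vi => [|i] hi Vi; first exact: X0.
have Xo u : (u <= N.+1)%N -> obv I X u = obv I Z u by move=> hu; rewrite /obv Xv.
apply: (simplex_ext (I := I)) => [u hu|l J Y Z' d hJ hl eY eZ ed].
  by rewrite !obv_sb // Xo // /bump; lia.
case: l J hJ hl eY eZ ed => // l J hJ _ eY eZ ed.
rewrite /sb -!act_comp.
have bJ u : (u <= l.+1)%N -> jn (dcomp (mkd N N.+1 (bump i.+1)) J) u = bump i.+1 (jn J u).
  by move=> hu; rewrite jn_comp jn_mkd ?jn_le.
have [J0|J0] := eqVneq (jn J 0) 0%N; last first.
  have Jp u : (u <= l.+1)%N -> (0 < jn J u)%N.
    by move=> hu; have := @jn_mono _ _ J 0 u isT hu; lia.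
  pose f u := (bump i.+1 (jn J u)).-1.
  have mf : mono_on l.+1 N f.
    split=> [u v h h'|]; rewrite /f /bump; first by have := jn_mono J h h'; lia.
    by have := jn_le J l.+1; lia.
  have H (y : C N.+1) : act (dcomp (mkd N N.+1 (bump i.+1)) J) y = sb l.+1 f (sb N (bump 0) y).
    rewrite sb_sb //; apply: act_jn_eq => u hu; rewrite bJ // jn_mkd //.
    by rewrite /= /f /bump; have := Jp u hu; lia.
  by rewrite !H X0.
have Jp u : (u <= l)%N -> (0 < jn J u.+1)%N.
  by move=> hu; have := @jn_strict _ _ J 0 u.+1 hJ isT hu; lia.
pose f u := (bump i.+1 (jn J u.+1)).-1.
have mf : mono_on l N f.
  split=> [u v h h'|]; rewrite /f /bump; first by have := @jn_mono _ _ J u.+1 v.+1 h h'; lia.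
  by have := jn_le J l.+1; lia.
pose J' := mkd l N f.
have jJ' u : (u <= l)%N -> jn J' u = f u by move=> hu; rewrite jn_mkd.
have hJ' : dstrict J'.
  apply: strict_jn => u v huv hv; rewrite !jJ' //; last by lia.
  by have := @jn_strict _ _ J u.+1 v.+1 hJ huv hv; rewrite /f /bump; have := Jp u; lia.
have hm : missb V J' i.
  apply/missbP; split=> // u hu; rewrite jJ' // /f /bump; by have := Jp u hu; lia.
have eYw : Y = W by rewrite eY jn0 J0 obv_sb // [bump _ _]/= Xo.
clear eY; subst Y.
have H (y : C N.+1) : act (dcomp (mkd N N.+1 (bump i.+1)) J) y = act (dcons J') y.
  apply: act_jn_eq => u hu; rewrite bJ // jn_cons //.
  case: u hu => [|u] hu; first by rewrite J0.
  by rewrite /= jJ' // /f /bump; have := Jp u hu; lia.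
rewrite !H Xc' //; [by rewrite /c (g0 _ _ _ _ _ hm) addr0| |by lia].
rewrite eZ jnm obv_sb ?jn_le // Xo; last by rewrite /bump; have := jn_le J l.+1; lia.
by congr obv; rewrite jJ' // /f /bump; have := Jp l (leqnn l); lia.
Qed.
End Modify.

Lemma cocycleE (k : comPzRingType) (M : cplx k) i (x : M i) : cocycle x <-> dd (i + 1) x = 0.
Proof. by rewrite /cocycle -ddE. Qed.

Lemma cohomE (k : comPzRingType) (M : cplx k) i (x y : M i) :
  cohomologous x y <-> exists z : M (i - 1), dd i z = x - y.
Proof. by split=> -[z hz]; exists z; rewrite (ddE (subrK 1 i)) in hz *. Qed.

Section CochainSupport.
Variables (k : comPzRingType) (A : dgcat k) (C : sset) (I : nerve_iso C A).
Variables (K : sset) (p : smap K C) (W : A).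

(** Without contributions from proper faces only the differential of the Hom complex remains. *)
Lemma cD_proper (c : coch K W) l (t : K l) Y i : Y = oK I p t l ->
  (forall l' (J : dmap l' l) Z j, (l' < l)%N -> dstrict J -> Z = oK I p (act J t) l' ->
    j = i - 1 + (l - l')%N%:Z -> c l' (act J t) Z j = 0) ->
  cD I p c t Y i = (-1) ^+ l *: dd i (c l t Y (i - 1)).
Proof.
move=> eY h; rewrite /cD /cR big1 ?subr0 // => w _; have hw := ltn_ord w.
rewrite h; last first.
- by lia.
- rewrite -/(sb _ _ t) oK_sb; [|mono|lia]; rewrite eY; congr oK; rewrite /bump; lia.
- by apply: dstrict_mkd; [mono | rewrite /bump => ? ?; lia].
- by lia.
rewrite h ?cp0r ?subrr ?scaler0 //.
- by apply: dstrict_mkd; [mono | move=> ? ?; lia].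
- by rewrite -/(sb _ _ t) oK_sb //; mono.
Qed.
End CochainSupport.

Lemma dinlE m j : dinl m j = mkd m (m + j.+1) id.
Proof. by apply: dmap_jn => u hu; rewrite jn_dinl // jn_mkd //; mono. Qed.

Lemma dinrE m j : dinr m j = mkd j (m + j.+1) (addn m.+1).
Proof. by apply: dmap_jn => u hu; rewrite jn_dinr // jn_mkd //; mono. Qed.

Lemma dsum_bump m j i : (i <= m.+1)%N ->
  dsum (mkd m m.+1 (bump i)) (did j) = mkd (m + j.+1) (m.+1 + j.+1) (bump i).
Proof.
move=> hi; apply: dmap_jn => u hu; rewrite jn_dsum // [RHS]jn_mkd //; last by mono.
case: leqP => h; first by rewrite jn_mkd //; mono.
by rewrite jn_did; [rewrite /bump; lia | lia].
Qed.

Lemma sb_const (C : sset) m n f (x : C 0) : sb m f (const_simplex n x) = const_simplex m x.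
Proof. by rewrite /sb /const_simplex -act_comp; congr act; exact: dmap0_irr. Qed.

Lemma act_const (C : sset) m n (a : dmap m n) (x : C 0) :
  act a (const_simplex n x) = const_simplex m x.
Proof. by rewrite /const_simplex -act_comp; congr act; exact: dmap0_irr. Qed.

(** * The obstruction to filling a boundary *)

Section Boundary.
Variables (k : comPzRingType) (A : dgcat k) (C : sset) (I : nerve_iso C A).

Section Glue.
Variables (N : nat) (x : nat -> C N) (w : C 0).
Hypothesis xc : compat_facets x.
Hypothesis vert : forall i, (0 < i)%N -> (i <= N.+1)%N -> sb 0 (fun=> 0%N) (x i) = w.
Local Notation Y := (obv I (x 0%N) N).

(** When all facets are given, the whole simplex is the only uncovered face; this is the defect in
    its equation when the top component is 0. *)
Definition obstruction d : dghom (ob I w) Y d :=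
  cD I (yo (x 0%N)) (facet_coch I predT x w) (did N : std N N) Y d.

Lemma did_last : Y = oK I (yo (x 0%N)) (did N : std N N) N.
Proof. by rewrite oz_jn // jn_did. Qed.

Lemma proper_miss l (J : dmap l N) : dstrict J -> (l < N)%N -> exists i, missb predT J i.
Proof.
move=> hJ hl; apply: NNPP => h.
have [e _] : l = N /\ forall u, (u <= l)%N -> jn J u = u; last by lia.
apply: strict_id => // i hi; apply: (@hitP N predT) => //.
by apply/negP => hm; apply: h; exists i.
Qed.

Lemma xcT i j : (i < j)%N -> (j <= N.+1)%N -> predT i -> predT j -> (0 < N)%N ->
  sb N.-1 (bump j.-1) (x i) = sb N.-1 (bump i) (x j).
Proof. by move=> hij hj _ _; exact: xc. Qed.

Lemma vertT i : (0 < i)%N -> (i <= N.+1)%N -> predT i -> sb 0 (fun=> 0%N) (x i) = w.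
Proof. by move=> i0 hi _; exact: vert. Qed.

(** On proper faces [cD] of the prescribed cochain vanishes by [facet_cD], so [cD_cD] on the whole
    simplex reduces to closedness of its value there. *)
Lemma obstruction_closed d : d = 1 - N%:Z -> dd (d + 1) (obstruction d) = 0.
Proof.
move=> ed; have := @cD_cD _ _ _ I _ (yo (x 0%N)) _ (facet_coch I predT x w) N (did N : std N N)
  Y (d + 1) did_last.
rewrite cD_proper ?addrK; [|exact: did_last|].
  by move=> /(congr1 (fun v => (-1) ^+ N *: v)); rewrite signK scaler0.
move=> l J Z j hl hJ eZ ej.
have hJ' : dstrict (dcomp (did N) J) by rewrite (_ : dcomp _ _ = J) //; exact: dmap_eq.
have [i hi] := proper_miss hJ' hl.
by apply: (facet_cD isT xcT vertT hi); [| lia].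
Qed.

Lemma boundary_glue d (v : dghom (ob I w) Y (d - 1)) : d = 1 - N%:Z ->
  (-1) ^+ N *: dd d v = - obstruction d ->
  exists X : C N.+1, (forall i, (i <= N.+1)%N -> sb N (bump i) X = x i) /\
    mr I X (ob I w) Y (d - 1) = v.
Proof.
move=> ed hv.
pose cov l (J : dmap l N) := [forall i : 'I_N.+1, ~~ missb predT J i].
pose g : coch (std N) (ob I w) := fun l J Z j => if cov l J then hc (ob I w) Z j v else 0.
have covP l (J : dmap l N) : reflect (forall i, ~~ missb predT J i) (cov l J).
  apply: (iffP forallP) => h i; last exact: h.
  have [hi|hi] := leqP i N; first by have := h (inord i); rewrite inordK.
  by apply/negP => /missbP[]; lia.
have g0 l (J : dmap l N) i Z j : missb predT J i -> g l J Z j = 0.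
  by move=> hi; rewrite /g; case: covP => // /(_ i); rewrite hi.
have top l (J : dmap l N) : dstrict J -> (forall i, ~~ missb predT J i) ->
    l = N /\ forall u, (u <= l)%N -> jn J u = u.
  by move=> hJ hm; apply: strict_id => // i hi; apply: (hitP (hm i)).
have cid : cov N (did N).
  apply/covP => i; have [hi|hi] := leqP i N; last by apply/negP => /missbP[]; lia.
  by apply: (@hit_missN _ _ _ _ _ i) => //; rewrite jn_did.
have [l J Z j hJ hm eZ ej|X [Xf Xw Xc]] := facet_glue (I := I) (V := predT) isT xcT vertT g0.
  have [el eJ] := top l J hJ hm; subst l.
  have {}eJ : J = did N by apply: dmap_jn => u hu; rewrite eJ // jn_did.
  subst J; rewrite -did_last in eZ; subst Z j; rewrite -ed in hv *.
  rewrite -[RHS]hv cD_proper; [|exact: did_last|].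
    by rewrite /g cid hc_id.
  move=> l J' Z' j' hl hJ' eZ' ej'.
  have hJ'' : dstrict (dcomp (did N) J') by rewrite (_ : dcomp _ _ = J') //; exact: dmap_eq.
  by have [i hi] := proper_miss hJ'' hl; exact: g0 hi.
exists X; split=> [i hi|]; first exact: Xf.
have eX : act (dcons (did N)) X = X.
  rewrite -[RHS]act_id; apply: act_jn_eq => u hu; rewrite jn_did // jn_cons //.
  by case: u hu => [|u] hu //=; rewrite jn_did.
have := Xc N (did N) Y (d - 1); rewrite eX /g cid hc_id => -> //.
- by apply/dstrictP.
- exact/covP.
- by rewrite jn_did.
- by lia.
Qed.
End Glue.
End Boundary.

Lemma vertexE (C : sset) n (i : 'I_n.+1) (x : C n) : vertex i x = sb 0 (fun=> i) x.
Proof.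
rewrite /vertex /sb; congr act; apply: dmap_jn => u hu.
by rewrite jn_mkd //; split=> //; exact: leq_ord.
Qed.

Lemma sb00 (C : sset) f (x : C 0) : sb 0 f x = x.
Proof. by rewrite /sb -[RHS]act_id; congr act; exact: dmap0_irr. Qed.

Lemma sum_pos1 (V : zmodType) (F : 'I_2 -> V) : \sum_(w < 2 | (0 < w)%N) F w = F ord_max.
Proof.
rewrite big_mkcond big_ord_recr big_ord1 /= add0r.
by [].
Qed.

Lemma const_simplex0 (C : sset) (x : C 0) : const_simplex 0 x = x.
Proof. by rewrite /const_simplex -[RHS]act_id; congr act; exact: dmap0_irr. Qed.

Lemma boundary_last (D : sset) N (u : smap (boundary N.+1) D) (v : boundary N.+1 0)
    (a : boundary N.+1 N) : (proj1_sig v : dmap 0 N.+1) ord0 = ord_max ->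
  proj1_sig a = mkd N N.+1 (bump 0) :> std N.+1 N -> u 0%N v = sb 0 (fun=> N) (u N a).
Proof.
move=> hv ha; rewrite /sb -sfun_act; apply: smap_sub_eq; rewrite /= ha.
have m1 : mono_on 0 N (fun=> N) by [].
rewrite (mkd_comp (bump_mono N 0) m1); apply: dmap_jn => t; rewrite leqn0 => /eqP ->.
rewrite (jn_mkd (mono_comp (bump_mono N 0) m1)) //.
by rewrite -jn0 hv.
Qed.

Lemma fills_face (D : sset) N (u : smap (boundary N.+1) D) (X : D N.+1) i (x : D N) :
  (forall a : boundary N.+1 N, (i <= N.+1)%N ->
      proj1_sig a = mkd N N.+1 (bump i) :> std N.+1 N -> u N a = x) ->
  fills u X -> (i <= N.+1)%N -> sb N (bump i) X = x.
Proof.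
move=> hu hX hi; rewrite -(hu (exist _ _ (face_boundary hi)) hi erefl).
by rewrite -(hX N (exist _ _ (face_boundary hi))).
Qed.

(** * Edges and terminal objects *)

Section Edges.
Variables (k : comPzRingType) (A : dgcat k) (C : sset) (I : nerve_iso C A).

Lemma obstruction0 (x : nat -> C 0) (w : C 0) d : obstruction I x w d = 0.
Proof.
rewrite /obstruction (cD_ext (c' := fun _ _ _ _ => 0)) ?cD0 //.
  by rewrite oz_jn // jn_did // /obv.
move=> l J Z j _ _ _; rewrite facet_coch0 // => i; apply/negP => /missbP[h1 h2 h3].
have := h3 0%N isT; have -> : jn (act J (did 0 : std 0 0) : dmap l 0) 0 = 0%N.
  by apply/eqP; rewrite -leqn0; exact: jn_le.
by have -> : i = 0%N by lia.
Qed.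

(** The sign in [boundary_glue] is absorbed into [e], so that a top component is just a primitive of
    [e]. *)
Lemma facets_fill N (x : nat -> C N) : compat_facets x ->
  exists e : dghom (obv I (x 1%N) 0) (obv I (x 0%N) N) (1 - N%:Z),
    dd (1 - N%:Z + 1) e = 0 /\ forall v, dd (1 - N%:Z) v = e ->
    exists X : C N.+1, (forall i, (i <= N.+1)%N -> sb N (bump i) X = x i) /\
      mr I X (obv I (x 1%N) 0) (obv I (x 0%N) N) (1 - N%:Z - 1) = v.
Proof.
move=> xc; pose w := sb 0 (fun=> 0%N) (x 1%N).
have vert i : (0 < i)%N -> (i <= N.+1)%N -> sb 0 (fun=> 0%N) (x i) = w.
  move=> i0 hi; case: (posnP N) => hN; first by congr (sb 0 _ (x _)); lia.
  by apply: (@facets_vertex _ N predT) => // ? ? ? ? _ _; exact: xc.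
exists (- ((-1) ^+ N *: obstruction I x w (1 - N%:Z))); split.
  by rewrite ddN ddZ (obstruction_closed I xc vert) // scaler0 oppr0.
move=> v hv; have [|X [hX hm]] := boundary_glue xc vert (v := v) erefl.
  by rewrite hv scalerN signK.
by exists X.
Qed.

Lemma edge_exists (x y : C 0) (f : dghom (ob I x) (ob I y) 0) : dd 1 f = 0 ->
  exists e : C 1, [/\ src e = x, tgt e = y & mr I e (ob I x) (ob I y) 0 = f].
Proof.
move=> hf; pose F i : C 0 := if i is 0 then y else x.
have Fc : compat_facets F by [].
have vert i : (0 < i)%N -> (i <= 1)%N -> sb 0 (fun=> 0%N) (F i) = x by case: i => // i; rewrite sb00.
have ey : obv I (F 0%N) 0 = ob I y by rewrite /obv sb00.
have [|X [hX hm]] := @boundary_glue _ _ _ I 0 F x Fc vert 1 (hc _ _ (1 - 1) f) erefl.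
  rewrite obstruction0 oppr0 expr0 scale1r.
  by rewrite dd_hc // hf hc0.
exists X; split.
- by rewrite /src vertexE -[RHS](hX 1%N isT); apply: sb_eq => u; case: u.
- by rewrite /tgt vertexE -[RHS](hX 0%N isT); apply: sb_eq => u; case: u.
by move: hm; rewrite ey hc_id.
Qed.

Lemma mr_edge_id (x : C 0) n f X : X = ob I x -> mono_on 1 n f ->
  mr I (sb 1 f (const_simplex n x)) X X 0 = dgid X.
Proof.
move=> -> hf; rewrite sb_const /const_simplex mr_id ?hc_id //.
  by rewrite /obv sb00.
Qed.

Lemma mr_d2 (x : C 2) X Y Z : X = obv I x 0 -> Y = obv I x 1 -> Z = obv I x 2 ->
  dd 0 (mr I x X Z (-1)) =
  cp 0 (mr I (sb 1 (bump 0) x) Y Z 0) (mr I (sb 1 (bump 2) x) X Y 0) -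
  mr I (sb 1 (bump 1) x) X Z 0.
Proof.
move=> eX eY eZ; have := mr_d eX eZ (i := -1); rewrite (_ : -1 + 1 = 0) // => ->//.
rewrite sum_pos1; change (nat_of_ord (ord_max : 'I_2)) with 1%N.
rewrite expr1 scaleN1r opprB -eY; congr (cp _ _ _ - _).
by rewrite (@sb_eq _ _ 1 id (bump 2)) // => -[|[|u]].
Qed.

(** Fill the triangle with edges [f], the zero morphism and the identity of [z]; the component of
    the filling on the whole triangle is the null-homotopy. *)
Lemma terminal_null (z : C 0) X (f : dghom X (ob I z) 0) : terminal z -> dd 1 f = 0 ->
  exists h : dghom X (ob I z) (-1), dd 0 h = f.
Proof.
move=> hz hf; have [x ex] : exists x : C 0, ob I x = X.
  have [|x [xo _]] := @simplex_exists _ _ _ I 0 (fun=> X) (fun _ _ _ _ _ => 0).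
    by move=> m J X' Y' i /dstrictP hJ hm; have := hJ ord0 ord_max hm; rewrite !ord1.
  by exists x; have := xo ord0; rewrite obv0.
subst X.
have [e [es et em]] := edge_exists hf.
have [|e0 [e0s e0t e0m]] := @edge_exists x z 0; first exact: dd0.
pose F i : C 1 := match i with 0 => const_simplex 1 z | 1 => e0 | _ => e end.
have Fc : compat_facets F.
  move=> [|[|i]] [|[|[|j]]] // _ _ _ /=.
  - by rewrite sb_const const_simplex0 -[LHS]e0t /tgt vertexE; apply: sb_eq => -[].
  - by rewrite sb_const const_simplex0 -[LHS]et /tgt vertexE; apply: sb_eq => -[].
  - transitivity (src e0); first by rewrite /src vertexE; apply: sb_eq => -[].
    by rewrite e0s -es /src vertexE; apply: sb_eq => -[].
have [u hu] := boundary_map Fc.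
have [|X hX] := hz 1%N u.
  move=> v hv; rewrite (boundary_last (a := exist _ _ (face_boundary (leq0n 2))) u hv) //.
  by rewrite (hu 0%N) //= sb_const const_simplex0.
have Xf i : (i <= 2)%N -> sb 1 (bump i) X = F i.
  by move=> hi; apply: fills_face hX hi => a; exact: hu.
have X2 : sb 1 (bump 2) X = e := Xf 2 isT.
have X1 : sb 1 (bump 1) X = e0 := Xf 1%N isT.
have o0 : ob I x = obv I X 0.
  rewrite /obv -es /src vertexE -X2 sb_sb; [by congr ob; apply: sb_eq => -[] | by mono | by mono].
have o1 : ob I z = obv I X 1.
  rewrite /obv -et /tgt vertexE -X2 sb_sb; [by congr ob; apply: sb_eq => -[] | by mono | by mono].
have o2 : ob I z = obv I X 2.
  rewrite /obv -e0t /tgt vertexE -X1 sb_sb; [by congr ob; apply: sb_eq => -[] | by mono | by mono].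
exists (mr I X (ob I x) (ob I z) (-1)).
rewrite (mr_d2 o0 o1 o2) X1 X2 Xf // e0m subr0 em.
have := @mr_edge_id z 1 id (ob I z) erefl; rewrite sb_const => -> //.
by rewrite cp1l.
Qed.

(** The obstruction is a cocycle with target [z], so composing it with the contraction [s] gives a
    primitive. *)
Lemma null_terminal (z : C 0) (s : dghom (ob I z) (ob I z) (-1)) : dd 0 s = dgid _ ->
  terminal z.
Proof.
move=> hs n u hu; have [x [xE xc xf]] := boundary_facets u.
have [e [he hX]] := facets_fill xc.
have eY : obv I (x 0%N) n = ob I z.
  have hb : in_boundary (dconst 0 ord_max : std n.+1 0).
    by apply/in_boundaryP; exists 0%N; split=> // v hv; rewrite jn_dconst.
  rewrite /obv -(hu (exist _ _ hb)) // (xE 0%N (leq0n _)); congr ob; symmetry.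
  exact: boundary_last.
move: e he hX; rewrite eY => e he hX.
have [X [Xf _]] : exists X : C n.+1, (forall i, (i <= n.+1)%N -> sb n (bump i) X = x i) /\
    mr I X (obv I (x 1%N) 0) (ob I z) (1 - n%:Z - 1) = cp (1 - n%:Z - 1) s e.
  apply: hX; rewrite (@dd_cp _ _ _ _ _ _ _ _ 0 (1 - n%:Z + 1)) ?hs ?he ?cp0r ?scaler0 ?addr0 ?cp1l //.
  - by lia.
  - by lia.
by exists X; apply: xf.
Qed.
End Edges.

Arguments mr : simpl never.
Arguments obv : simpl never.
Arguments sb : simpl never.

(** * Mapping spaces *)

Lemma faces_compat (C : sset) N (Z : C N.+1) : compat_facets (fun i => sb N (bump i) Z).
Proof.
move=> i j hij hj hN.
rewrite !sb_sb; try exact: bump_mono; try exact: bump_mono'.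
by apply: sb_eq => v hv; rewrite /= /bump; lia.
Qed.

Definition pv (C : sset) (E : C 0) j (s : C j) m (x : pinch E s m) : C (m + j.+1)%N :=
  proj1_sig x.

Lemma pinch_face (C : sset) (E : C 0) j (s : C j) m (x : pinch E s m.+1) i : (i <= m.+1)%N ->
  pv (sb m (bump i) x) = sb (m + j.+1) (bump i) (pv x).
Proof. by move=> hi; rewrite /sb /pv /= dsum_bump. Qed.

Lemma pinch_inl (C : sset) (E : C 0) j (s : C j) m (x : pinch E s m) l f :
  mono_on l m f -> sb l f (pv x) = const_simplex l E.
Proof.
move=> hf; case: x => x [h1 h2]; rewrite /pv /=.
have -> : sb l f (x : C (m + j.+1)%N) = sb l f (act (dinl m j) x : C m).
  rewrite dinlE -/(sb _ _ _) sb_sb //; split=> [? ?|]; lia.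
by rewrite h1 sb_const.
Qed.

Lemma pinch_inr (C : sset) (E : C 0) j (s : C j) m (x : pinch E s m) l f :
  mono_on l j f -> sb l (addn m.+1 \o f) (pv x) = sb l f s.
Proof.
move=> hf; case: x => x [h1 h2]; rewrite /pv /= -h2 dinrE -/(sb _ _ _) sb_sb //.
by mono.
Qed.

Lemma covP N (V : pred nat) l (J : dmap l N) :
  reflect (forall i, ~~ missb V J i) [forall i : 'I_N.+1, ~~ missb V J i].
Proof.
apply: (iffP forallP) => h i; last exact: h.
have [hi|hi] := leqP i N; first by have := h (inord i); rewrite inordK.
by apply/negP => /missbP[]; lia.
Qed.

Lemma const_sb (C : sset) l n f (x : C n) : (f 0%N <= n)%N ->
  const_simplex l (sb 0 f x) = sb l (fun=> f 0%N) x.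
Proof.
move=> hf; have -> : sb 0 f x = sb 0 (fun=> f 0%N) x by apply: sb_eq => -[|//].
have -> (y : C 0) : const_simplex l y = sb l (fun=> 0%N) y.
  by apply: act_jn_eq => u hu; rewrite jn_dconst // jn_mkd.
by rewrite sb_sb //; split.
Qed.

Lemma in_pinchE (C : sset) (E : C 0) j (s : C j) m (x : C (m + j.+1)%N) :
  in_pinch E s x <-> sb m id x = const_simplex m E /\ sb j (addn m.+1) x = s.
Proof. by rewrite /in_pinch dinlE dinrE. Qed.

Section Difference.
Variables (k : comPzRingType) (A : dgcat k) (C : sset) (I : nerve_iso C A).

(** The two simplices share the facet opposite to vertex 0, hence the later factor of every
    composite; the difference of the two quadratic equations is therefore linear. *)
Lemma mr_dB m (X Z : C m.+1) P Q (i : int) :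
  sb m (bump 0) X = sb m (bump 0) Z -> sb 0 (fun=> 0%N) X = sb 0 (fun=> 0%N) Z ->
  P = obv I Z 0 -> Q = obv I Z m.+1 -> i = - m%:Z ->
  dd (i + 1) (mr I X P Q i - mr I Z P Q i) =
  \sum_(w < m.+1 | (0 < w)%N) (-1) ^+ (m.+1 - w) *:
    (mr I (sb m (bump w) X) P Q (i + 1) - mr I (sb m (bump w) Z) P Q (i + 1) -
     cp (i + 1) (mr I (sb (m.+1 - w) (addn w) Z) (obv I Z w) Q (1 - (m.+1 - w)%N%:Z))
       (mr I (sb w id X) P (obv I Z w) (1 - w%:Z) - mr I (sb w id Z) P (obv I Z w) (1 - w%:Z))).
Proof.
move=> e0 ev eP eQ ei.
have back l f : mono_on l m f -> sb l (S \o f) X = sb l (S \o f) Z.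
  have E : forall y : C m.+1, mono_on l m f -> sb l (S \o f) y = sb l f (sb m (bump 0) y).
    by move=> y hf; rewrite sb_sb //; exact: bump_mono.
  by move=> hf; rewrite !E // e0.
have ov u : (u <= m.+1)%N -> obv I X u = obv I Z u.
  by case: u => [|u] hu; rewrite /obv ?ev // (back 0%N (fun=> u)).
rewrite ddB !mr_d ?ov //; try by lia.
rewrite -sumrB; apply: eq_bigr => w hw; have hw2 := ltn_ord w.
rewrite -scalerBr; congr (_ *: _); rewrite (ov w (ltnW hw2)).
rewrite (@sb_eq _ _ _ (addn w) (S \o addn w.-1)); last by move=> u _ /=; lia.
rewrite (@sb_eq _ _ _ (addn w) (S \o addn w.-1) Z); last by move=> u _ /=; lia.
have hb : mono_on (m.+1 - w) m (addn w.-1) by split=> [u v h1 h2|]; lia.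
rewrite (back _ _ hb).
by rewrite cpBr !opprD !opprK addrACA.
Qed.

(** Front faces lie in the last facet, where [X] and [Z] agree, so all composites cancel and only
    the facet [v] contributes. *)
Lemma mr_dB1 m (X Z : C m.+1) P Q (i : int) v : (0 < v)%N -> (v < m.+1)%N ->
  (forall w, (w <= m.+1)%N -> w != v -> sb m (bump w) X = sb m (bump w) Z) ->
  P = obv I Z 0 -> Q = obv I Z m.+1 -> i = - m%:Z ->
  dd (i + 1) (mr I X P Q i - mr I Z P Q i) =
  (-1) ^+ (m.+1 - v) *:
    (mr I (sb m (bump v) X) P Q (i + 1) - mr I (sb m (bump v) Z) P Q (i + 1)).
Proof.
move=> v0 hv h eP eQ ei.
have hm : sb m (bump m.+1) X = sb m (bump m.+1) Z by apply: h => //; lia.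
have fr w : (w <= m)%N -> sb w id X = sb w id Z.
  move=> hw; have E (y : C m.+1) : sb w id y = sb w id (sb m (bump m.+1) y).
    rewrite sb_sb; [|exact: bump_mono|by split].
    by apply: sb_eq => u; rewrite /= /bump; lia.
  by rewrite E hm -E.
rewrite mr_dB //; [|by apply: h => //; lia|].
  rewrite (bigD1 (Ordinal hv)) //= fr // subrr cp0r subr0 big1 ?addr0 // => w /andP[w0 w1].
  rewrite h ?subrr ?fr ?subrr ?cp0r ?subrr ?scaler0 //; have := ltn_ord w; lia.
have E (y : C m.+1) : sb 0 (fun=> 0%N) y = sb 0 (fun=> 0%N) (sb m (bump m.+1) y).
  by rewrite sb_sb //; exact: bump_mono.
by rewrite E hm -E.
Qed.

(** A cochain concentrated on the whole simplex is closed as soon as its value is. *)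
Lemma simplex_top N (Z : C N.+1) W Y (r : dghom W Y (- N%:Z)) :
  W = obv I Z 0 -> Y = obv I Z N.+1 -> dd (1 - N%:Z) r = 0 ->
  exists X : C N.+1, [/\ forall i, (i <= N.+1)%N -> sb N (bump i) X = sb N (bump i) Z,
    forall i, (i <= N.+1)%N -> sb 0 (fun=> i) X = sb 0 (fun=> i) Z &
    mr I X W Y (- N%:Z) = mr I Z W Y (- N%:Z) + r].
Proof.
move=> eW eY hr.
pose g : coch (std N) (ob I (sb 0 (fun=> 0%N) Z)) := fun l J Z' j =>
  if [forall i : 'I_N.+1, ~~ missb predT (J : dmap l N) i] then hc _ Z' j r else 0.
have g0 l (J : dmap l N) i Z' j : missb predT J i -> g l (J : std N l) Z' j = 0.
  by move=> hi; rewrite /g; case: covP => // /(_ i); rewrite hi.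
have hid : [forall i : 'I_N.+1, ~~ missb predT (did N) i].
  apply/covP => i; have [hi|hi] := leqP i N; last by apply/negP => /missbP[]; lia.
  by apply: (@hit_missN _ _ _ _ _ i) => //; rewrite jn_did.
have oY : Y = oK I (yo (sb N (bump 0) Z)) (did N : std N N) N.
  by rewrite oz_jn // jn_did // obv_sb //; exact: bump_mono.
have [|l J Y' d hJ hm eY' ed|X [X1 X2 X3]] := @simplex_modify _ _ _ I N Z predT g isT.
- by move=> l J i Z' j hi; exact: g0 hi.
- have [el eJ] : l = N /\ forall u, (u <= l)%N -> jn J u = u.
    by apply: strict_id => // i hi; apply: (hitP (hm i)).
  subst l; have {}eJ : J = did N by apply: dmap_jn => u hu; rewrite eJ // jn_did.
  subst J; rewrite jn_did // -eY in eY'; subst Y' d.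
  rewrite cD_proper //; last first.
    move=> l' J' Z' j' hl hJ' eZ' ej'.
    have hJ'' : dstrict (dcomp (did N) J') by rewrite (_ : dcomp _ _ = J') //; exact: dmap_eq.
    by have [i hi] := proper_miss hJ'' hl; exact: g0 hi.
  rewrite /g hid dd_hc //; last by lia.
  by rewrite hr hc0 scaler0.
exists X; split=> [i hi|i hi|]; [exact: X1|exact: X2|].
have eX (y : C N.+1) : act (dcons (did N)) y = y.
  rewrite -[RHS]act_id; apply: act_jn_eq => u hu; rewrite jn_did // jn_cons //.
  by case: u hu => [|u] hu //=; rewrite jn_did.
have := X3 N (did N) Y (- N%:Z); rewrite !eX /g hid; subst W; rewrite hc_id => -> //.
  exact/dstrictP.
by rewrite jn_did.
Qed.

(** The added cochain lives on the whole simplex and on the facet opposite to the last vertex. Its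
    closedness is the relation between [s] and [r], through composition with the last edge. *)
Lemma simplex_top_last N (Z : C N.+2) W Y T (r : dghom W Y (- N%:Z)) (s : dghom W T (- N.+1%:Z)) :
  W = obv I Z 0 -> Y = obv I Z N.+1 -> T = obv I Z N.+2 -> dd (1 - N%:Z) r = 0 ->
  dd (- N%:Z) s = cp (- N%:Z) (mr I (sb 1 (addn N.+1) Z) Y T 0) r ->
  exists X : C N.+2, [/\ forall i, (i <= N.+1)%N -> sb N.+1 (bump i) X = sb N.+1 (bump i) Z,
    forall i, (i <= N.+2)%N -> sb 0 (fun=> i) X = sb 0 (fun=> i) Z,
    mr I (sb N.+1 (bump N.+2) X) W Y (- N%:Z) = mr I (sb N.+1 (bump N.+2) Z) W Y (- N%:Z) + r &
    mr I X W T (- N.+1%:Z) = mr I Z W T (- N.+1%:Z) + s].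
Proof.
move=> eW eY eT hr hs; pose V (i : nat) := i != N.+2.
pose cov l (J : dmap l N.+1) := [forall i : 'I_N.+2, ~~ missb V J i].
pose g : coch (std N.+1) (ob I (sb 0 (fun=> 0%N) Z)) := fun l J Z' j =>
  if cov l J then (if jn J l == N.+1 then hc _ Z' j s else hc _ Z' j r) else 0.
have g0 l (J : dmap l N.+1) i Z' j : missb V J i -> g l (J : std N.+1 l) Z' j = 0.
  by move=> hi; rewrite /g /cov; case: covP => // /(_ i); rewrite hi.
have covid : cov N.+1 (did N.+1).
  apply/covP => i; have [hi|hi] := leqP i N.+1; last by apply/negP => /missbP[]; lia.
  by apply: (@hit_missN _ _ _ _ _ i) => //; rewrite jn_did.
pose fr := mkd N N.+1 id.
have jfr u : (u <= N)%N -> jn fr u = u by move=> hu; rewrite jn_mkd //; mono.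
have covfr : cov N fr.
  apply/covP => i; have [hi|hi] := leqP i N; last by apply/negP => /missbP[]; rewrite /V; lia.
  by apply: (@hit_missN _ _ _ _ _ i) => //; rewrite jfr.
have sid : dstrict (did N.+1) by apply/dstrictP.
have sfr : dstrict fr by apply: dstrict_mkd => //; mono.
have cases l (J : dmap l N.+1) : dstrict J -> (forall i, ~~ missb V J i) ->
    (l = N.+1 \/ l = N) /\ forall u, (u <= l)%N -> jn J u = u.
  move=> hJ hm; have hit i : (i <= N)%N -> exists2 u, (u <= l)%N & jn J u = i.
    by move=> hi; apply: (hitP (hm i)); rewrite /V; lia.
  have [hl1|hl1] := leqP (jn J l) N.
    have mJ : mono_on l N (jn J) by split=> // u v h h'; exact: jn_mono.
    have jJh u : (u <= l)%N -> jn (mkd l N (jn J)) u = jn J u by move=> hu; rewrite jn_mkd.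
    have [||e1 e2] := @strict_id N l (mkd l N (jn J)).
    - by apply: strict_jn => u v huv hv; rewrite !jJh //; [exact: jn_strict | lia].
    - by move=> i hi; have [u hu eu] := hit i hi; exists u; rewrite ?jJh.
    by split; [right | move=> u hu; rewrite -jJh // e2].
  have [|e1 e2] := strict_id hJ; last by split; [left|].
  move=> i; rewrite leq_eqVlt => /predU1P[->|hi]; last exact: hit.
  by exists l => //; have := jn_le J l; lia.
have mi l' (J' : dmap l' N.+1) Z' j (i : nat) : (i <= N)%N -> (forall u, (u <= l')%N -> jn J' u != i) ->
    g l' (J' : std N.+1 l') Z' j = 0.
  by move=> hi hh; apply: (g0 _ _ i); apply/missbP; split=> //; rewrite ?/V; lia.
have gs d : g N.+1 (did N.+1 : std N.+1 N.+1) T d = hc _ T d s by rewrite /g covid jn_did // eqxx.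
have gr d : g N (fr : std N.+1 N) Y d = hc _ Y d r.
  by rewrite /g covfr jfr // (_ : N == N.+1 = false) //; lia.
have [|l J Y' d hJ hm eY' ed|X [X1 X2 X3]] := @simplex_modify _ _ _ I N.+1 Z V g isT.
- by move=> l J i Z' j hi; exact: g0 hi.
- have [[el|el] eJ] := cases l J hJ hm; subst l.
    have {}eJ : J = did N.+1 by apply: dmap_jn => u hu; rewrite eJ // jn_did.
    subst J; rewrite jn_did // -eT in eY'; subst Y' d.
    rewrite /cD gs dd_hc //; last by lia.
    rewrite /cR big_ord_recr big1 /=; last first.
      move=> w _; have hw := ltn_ord w.
      rewrite (mi N _ _ _ w); [|lia|].
        rewrite (mi w _ _ _ N) ?cp0r ?subrr ?scaler0 // => u hu.
        by rewrite jn_comp ?jn_mkd ?jn_did //; try mono; lia.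
      move=> u hu; rewrite jn_comp ?jn_mkd ?jn_did //; try mono; rewrite /bump; lia.
    have fE f : (forall u, (u <= N)%N -> f u = u) -> dcomp (did N.+1) (mkd N N.+1 f) = fr.
      move=> hf; have mf : mono_on N N.+1 f by split=> [v w h h'|]; rewrite !hf //; lia.
      apply: dmap_jn => u hu; rewrite jfr // jn_comp // jn_mkd // hf //.
      by rewrite jn_did //; lia.
    have hN : (N.+1 - N)%N = 1%N by lia.
    rewrite (mi N _ _ _ N) //; last first.
      move=> u hu; rewrite jn_comp ?jn_mkd ?jn_did //; try mono; rewrite /bump; lia.
    have eP : oK I (yo (sb N.+1 (bump 0) Z)) (did N.+1 : std N.+1 N.+1) N = Y.
      by rewrite oz_jn // jn_did // obv_sb //; exact: bump_mono.
    rewrite eP hN.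
    rewrite [X in g N X _ _](_ : _ = fr); last by exact: fE.
    rewrite gr add0r.
    have E1 : 1 - N.+1%:Z = - N%:Z by lia.
    have E2 : - N%:Z - 1 + 1%:Z = - N%:Z by lia.
    rewrite E1 E2 -[ob I _]/(obv I Z 0) -eW !hc_id hs /mK sub0r expr1 scaleN1r opprK.
    rewrite [X in _ - cp _ (mr I X _ _ _) _](_ : _ = sb 1 (addn N.+1) Z) ?subrr ?scaler0 //.
    rewrite /= /sb -!act_comp; apply: act_jn_eq => u hu.
    rewrite jn_comp // jn_comp // (@jn_mkd 1 N.+1 (addn N)) //; last by mono.
    rewrite jn_did; last by lia.
    rewrite (jn_mkd (bump_mono _ _)); last by lia.
    by rewrite (@jn_mkd 1 N.+2) //; mono.
  have {}eJ : J = fr by apply: dmap_jn => u hu; rewrite eJ // jfr.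
  subst J; rewrite jfr // -eY in eY'; subst Y' d.
  rewrite cD_proper.
  - rewrite gr dd_hc //; last by lia.
    by rewrite hr hc0 scaler0.
  - by rewrite oz_jn // jfr // obv_sb.
  - move=> l' J' Z' j hl hJ' eZ' ej'.
    have [i /missbP[hi _ hm']] := proper_miss hJ' hl.
    apply: (mi l' (dcomp fr J') _ _ i hi) => u hu; rewrite jn_comp // jfr ?jn_le //; exact: hm'.
exists X; split=> [i hi|i hi||]; [by apply: X1 => //; rewrite /V; lia|exact: X2| |].
- have eX (y : C N.+2) : act (dcons fr) y = sb N.+1 (bump N.+2) y.
    apply: act_jn_eq => u hu; rewrite jn_cons // (jn_mkd (bump_mono _ _)) //.
    case: u hu => [|u] hu //=; rewrite jfr // /bump; lia.
  have := X3 N fr Y (- N%:Z); rewrite !eX gr; subst W; rewrite hc_id => -> //.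
  by rewrite jfr.
have eX (y : C N.+2) : act (dcons (did N.+1)) y = y.
  rewrite -[RHS]act_id; apply: act_jn_eq => u hu; rewrite jn_did // jn_cons //.
  by case: u hu => [|u] hu //=; rewrite jn_did.
have := X3 N.+1 (did N.+1) T (- N.+1%:Z); rewrite !eX gs; subst W; rewrite hc_id => -> //.
by rewrite jn_did.
Qed.
End Difference.

Section MappingSpaces.
Variables (k : comPzRingType) (A : dgcat k) (C : sset) (I : nerve_iso C A).

Lemma ob_surj (X : A) : exists x : C 0, ob I x = X.
Proof.
have [|x [xo _]] := @simplex_exists _ _ _ I 0 (fun=> X) (fun _ _ _ _ _ => 0).
  by move=> m J X' Y' i /dstrictP hJ hm; have := hJ ord0 ord_max hm; rewrite !ord1.
by exists x; have := xo ord0; rewrite obv0.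
Qed.

(** A boundary in the mapping space, completed by the constant facet opposite to the last vertex, is
    a boundary in [C] of one dimension more. Its obstruction is a cocycle of degree
    [1 - N = - (m + 1)] in the Hom complex, which is at most [- n]. *)
Lemma map_space_truncated n (X Y : C 0) : (0 < n)%N -> dg_truncated n A ->
  truncated (n%:Z - 1) (map_space X Y).
Proof.
move=> hn hA m; case: m => [|[|m]] hm; [by lia|by lia|] => u.
have [x' [_ xc' xf']] := boundary_facets u.
pose N := (m.+1 + 1)%N.
pose x i : C N := if (i <= m.+2)%N then pv (x' i) else const_simplex _ X.
have xE i : (i <= m.+2)%N -> x i = pv (x' i) by rewrite /x => ->.
have xl : x m.+3 = const_simplex N X by rewrite /x ltnn.
have xc : compat_facets x.
  move=> i j hij hj _; have hi : (i <= m.+2)%N by rewrite /N in hj; lia.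
  have [hj2|hj2] := leqP j m.+2.
    rewrite !xE //; have := xc' i j hij hj2 isT => /(congr1 (@pv _ _ _ _ _)).
    by rewrite !pinch_face //; lia.
  have -> : j = m.+3 by rewrite /N in hj; lia.
  rewrite xl sb_const xE // (@sb_eq _ _ _ (bump m.+2) id) ?(pinch_inl (m := m.+1)) //.
    by mono.
  by move=> v; rewrite /N /= /bump; lia.
have x0v : sb 0 (fun=> N) (x 0%N) = Y.
  rewrite xE // -[RHS](sb00 id Y) -(pinch_inr (x' 0%N) (l := 0) (f := id)) //.
  by apply: sb_eq => v; rewrite /N /=; lia.
have [e [he hX]] := facets_fill I xc.
have [v hv] : exists v : dghom (obv I (x 1%N) 0) (obv I (x 0%N) N) (1 - N%:Z - 1), dd (1 - N%:Z) v = e.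
  have hle : 1 - N%:Z <= - n%:Z by rewrite /N; lia.
  have := hA _ _ _ hle e (proj2 (cocycleE e) he); move/cohomE => [v hv].
  by exists v; rewrite hv subr0.
have [F [hF _]] := hX v hv.
have Fp : in_pinch (m := m.+2) X Y F.
  split; last first.
    rewrite dinrE -x0v -hF // sb_sb //.
    by rewrite -/(sb _ _ _); apply: sb_eq => t; rewrite /N /= /bump; lia.
  rewrite dinlE -/(sb _ _ _); transitivity (sb m.+2 id (sb N (bump m.+3) F)).
    rewrite sb_sb; [|exact: bump_mono|rewrite /N; mono].
    by apply: sb_eq => t; rewrite /N /= /bump; lia.
  by rewrite hF ?xl ?sb_const // /N; lia.
have ff : fills u (exist _ F Fp : pinch X Y m.+2).
  apply: xf' => i hi; apply: sig_eq.
  by rewrite [LHS](pinch_face (m := m.+1) (exist _ F Fp : pinch X Y m.+2)) //= -[RHS]xE // -hF // /N; lia.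
by exists (exist _ F Fp).
Qed.

(** A cocycle [r] is added to the top component of facet 1 of a simplex [Z] degenerate on the zero
    edge. The new boundary is filled by [F]. As facet 1 is neither the first nor the last, [mr_dB1]
    applies to [F] and [Z], and their difference is a primitive of [r] up to sign. *)
Lemma map_space_truncatedE n : (0 < n)%N -> (forall X Y : C 0, truncated (n%:Z - 1) (map_space X Y)) ->
  dg_truncated n A.
Proof.
move=> hn hC X Y i hdeg r; rewrite cocycleE cohomE subr0 => hr.
have [x0 ex0] := ob_surj X; have [y0 ey0] := ob_surj Y; subst X Y.
have [m em] : exists m, i = - (m + 1)%N%:Z by exists (absz (- 1 - i)%R); lia.
subst i; pose N := (m + 1)%N.
have [|e0 [es et e0m]] := @edge_exists _ _ _ I x0 y0 0; first exact: dd0.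
(* All vertices but the last go to the source [x0]. *)
pose q u := (u - m.+2)%N.
have mq : mono_on N.+2 1 q by rewrite /q /N; mono.
pose Z : C N.+2 := sb N.+2 q e0.
have mb i : mono_on N.+1 N.+2 (bump i) by exact: bump_mono.
have Zc l f : mono_on l N.+2 f -> (f l <= m.+2)%N -> sb l f Z = const_simplex l x0.
  move=> hf hl; rewrite /Z sb_sb // -es /src vertexE const_sb //; apply: sb_eq => u hu.
  by have := hf.1 u l hu (leqnn l); rewrite /q /=; lia.
have Zv i : (i <= m.+2)%N -> sb 0 (fun=> i) Z = x0.
  by move=> h; rewrite Zc ?const_simplex0 //; split=> //; rewrite /N; lia.
have Zl f : f 0%N = m.+3 -> sb 0 f Z = y0.
  move=> hf; have mf : mono_on 0 N.+2 f by split=> [[|i] [|j] // _ _|]; rewrite ?leqnn // hf /N; lia.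
  rewrite /Z sb_sb // -et /tgt vertexE; apply: sb_eq => -[|//] _.
  by rewrite /= hf /q; lia.
have eX : ob I x0 = obv I (sb N.+1 (bump 1) Z) 0 by rewrite obv_sb // /obv Zv.
have eY : ob I y0 = obv I (sb N.+1 (bump 1) Z) N.+1.
  by rewrite obv_sb // /obv Zl // /N /bump; lia.
have [|R [Rf Rv Rt]] := simplex_top (r := r) eX eY.
  have E : 1 - N%:Z = - (m + 1)%N%:Z + 1 by rewrite /N; lia.
  rewrite E; exact: hr.
pose y i : C N.+1 := if i == 1%N then R else sb N.+1 (bump i) Z.
have yf i a : (a <= N.+1)%N -> sb N (bump a) (y i) = sb N (bump a) (sb N.+1 (bump i) Z).
  by move=> ha; rewrite /y; case: eqP => // ->; exact: Rf.
have yv i f : (f 0 <= N.+1)%N -> sb 0 f (y i) = sb 0 f (sb N.+1 (bump i) Z).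
  move=> hf; rewrite /y; case: eqP => // ->.
  by rewrite (@sb_eq _ _ _ f (fun=> f 0%N)) 1?Rv // => [|[|//] //]; apply: sb_eq => -[|//].
have yp i : (i <= m.+2)%N -> in_pinch (m := m.+1) x0 y0 (y i).
  move=> hi; apply/in_pinchE; split; last first.
    rewrite -(Zl (bump i \o addn m.+2)); last by rewrite /= /bump; lia.
    rewrite yv; last by rewrite /N; lia.
    rewrite sb_sb //; last by split=> [u v h1 h2|]; rewrite /N; lia.
  have E (z : C N.+1) : sb m.+1 id z = sb m.+1 id (sb N (bump N.+1) z).
    rewrite sb_sb; [|exact: bump_mono|rewrite /N; mono].
    by apply: sb_eq => u; rewrite /N /= /bump; lia.
  rewrite E yf // -E sb_sb //; last by rewrite /N; mono.
  rewrite Zc // => [|/=]; last by rewrite /bump; lia.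
  by apply: mono_comp (mb i) _; rewrite /N; mono.
pose x' i : map_space x0 y0 m.+1 :=
  if excluded_middle_informative (in_pinch (m := m.+1) x0 y0 (y i)) is left h
  then exist _ (y i) h else exist _ (y 0%N) (yp 0%N isT).
have xE i : (i <= m.+2)%N -> pv (x' i) = y i.
  by move=> hi; rewrite /x'; case: excluded_middle_informative => // h; case: (h (yp i hi)).
have x'c : compat_facets x'.
  move=> i j hij hj _; apply: sig_eq.
  have hi : (i <= m.+2)%N by lia.
  rewrite [LHS](pinch_face (m := m)) ?[RHS](pinch_face (m := m)) ?xE //; try lia.
  rewrite !yf; try by rewrite /N; lia.
  by apply: (faces_compat Z hij); rewrite /N; lia.
have [u hu] := boundary_map x'c.
have [|F' hF'] := hC x0 y0 m.+2 _ u; first by lia.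
pose F : C N.+2 := pv F'.
have Ff i : (i <= m.+2)%N -> sb N.+1 (bump i) F = y i.
  move=> hi; rewrite -[LHS](pinch_face (m := m.+1) F' hi) -xE //.
  by rewrite (fills_face _ hF' hi (x := x' i)) // => a ha; exact: hu.
have F3 : sb N.+1 (bump m.+3) F = sb N.+1 (bump m.+3) Z.
  rewrite Zc //; last by rewrite /bump /N; lia.
  rewrite (@sb_eq _ _ _ (bump m.+3) id); last by move=> u0; rewrite /bump /N; lia.
  have E l : l = m.+2 -> sb l id F = const_simplex l x0 by move=> ->; exact: (pinch_inl F').
  by apply: E; rewrite /N; lia.
have eX2 : ob I x0 = obv I Z 0 by rewrite /obv Zv.
have eY2 : ob I y0 = obv I Z N.+2 by rewrite /obv Zl // /N; lia.
have eN : - (m + 1)%N%:Z - 1 = - N.+1%:Z by rewrite /N; lia.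
have := @mr_dB1 _ _ _ I N.+1 F Z _ _ _ 1%N isT isT _ eX2 eY2 eN; rewrite subrK => E.
exists ((-1) ^+ N.+1 *: (mr I F (ob I x0) (ob I y0) (- (m + 1)%N%:Z - 1)
  - mr I Z (ob I x0) (ob I y0) (- (m + 1)%N%:Z - 1))).
rewrite ddZ E => [|w hw1 hw2]; last first.
  have [hw|hw] := leqP w m.+2; last by have -> : w = m.+3 by rewrite /N in hw1; lia.
  by rewrite Ff // /y (negPf hw2).
by rewrite subSS subn0 signK Ff // /y eqxx [mr I R _ _ _]Rt addrAC subrr add0r.
Qed.
End MappingSpaces.

(** * Monomorphisms and truncated morphisms *)

Lemma dstrict_did N : dstrict (did N).
Proof. exact/dstrictP. Qed.

Section LastVertex.
Variables (k : comPzRingType) (A : dgcat k) (C : sset) (I : nerve_iso C A).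
Variables (N : nat) (z : C N.+1) (W : A).
Local Notation fr := (mkd N N.+1 id).

Lemma jn_front u : (u <= N)%N -> jn fr u = u.
Proof. by move=> hu; rewrite jn_mkd //; mono. Qed.

Lemma strict_front : dstrict fr.
Proof. by apply: dstrict_mkd => //; mono. Qed.

Lemma strict_cover_last (V : pred nat) l (J : dmap l N.+1) :
  (forall i, (i <= N)%N -> V i.+1) -> dstrict J -> (forall i, ~~ missb V J i) ->
  (l = N.+1 \/ l = N) /\ forall u, (u <= l)%N -> jn J u = u.
Proof.
move=> hV hJ hm; have hit i : (i <= N)%N -> exists2 u, (u <= l)%N & jn J u = i.
  by move=> hi; apply: (hitP (hm i)); [lia | exact: hV].
have [hl1|hl1] := leqP (jn J l) N.
  have mJ : mono_on l N (jn J) by split=> // u v h h'; exact: jn_mono.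
  have jJh u : (u <= l)%N -> jn (mkd l N (jn J)) u = jn J u by move=> hu; rewrite jn_mkd.
  have [||e1 e2] := @strict_id N l (mkd l N (jn J)).
  - by apply: strict_jn => u v huv hv; rewrite !jJh //; [exact: jn_strict | lia].
  - by move=> i hi; have [u hu eu] := hit i hi; exists u; rewrite ?jJh.
  by split; [right | move=> u hu; rewrite -jJh // e2].
have [|e1 e2] := strict_id hJ; last by split; [left|].
  move=> i; rewrite leq_eqVlt => /predU1P[->|hi]; last exact: hit.
  by exists l => //; have := jn_le J l; lia.
Qed.

Variable c : coch (std N.+1) W.

(** The cochain lives on the whole simplex and on the face omitting the last vertex; [b] is its
    total degree. *)
Definition vanishes_missing (b : int) : Prop := forall l (J : dmap l N.+1) Z j i,
  dstrict J -> (i <= N)%N -> (forall u, (u <= l)%N -> jn J u != i) ->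
  Z = obv I z (jn J l) -> j = b - l%:Z -> c (J : std N.+1 l) Z j = 0.

(** Such a cochain is a pair of values, on the front face and on the whole simplex. With [cD_front],
    its differential is that of the mapping cone of composition with the last edge. *)
Lemma cD_did b d T Y : vanishes_missing b -> T = obv I z N.+1 -> Y = obv I z N ->
  d = b - N%:Z -> cD I (yo z) c (did N.+1 : std N.+1 N.+1) T d =
  (-1) ^+ N.+1 *: (dd d (c (did N.+1 : std N.+1 N.+1) T (d - 1)) -
    cp d (mr I (sb 1 (addn N) z) Y T 0) (c (fr : std N.+1 N) Y d)).
Proof.
move=> h0 eT eY ed; rewrite /cD /cR big_ord_recr big1 ?add0r; last first.
  move=> w _; change (nat_of_ord (widen_ord (leqnSn N) w)) with (nat_of_ord w).
  have hw := ltn_ord w.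
  rewrite (h0 N _ _ _ w); first last.
  - by lia.
  - rewrite eT; congr obv; rewrite jn_comp jn_mkd ?jn_did //; try mono; rewrite /bump; lia.
  - move=> u hu; rewrite jn_comp jn_mkd ?jn_did //; try mono; rewrite /bump; lia.
  - by lia.
  - by apply: dstrict_mkd; [mono | rewrite /bump => ? ?; lia].
  rewrite (h0 w _ _ _ N) ?cp0r ?subrr ?scaler0 //; first last.
  - by lia.
  - have hw' : (w <= N.+1)%N by lia.
    rewrite oz_jn // jn_did //.
    by congr obv; rewrite jn_comp jn_mkd ?jn_did //; try mono; lia.
  - by move=> u hu; rewrite jn_comp jn_mkd ?jn_did //; try mono; lia.
  - by apply: dstrict_mkd; [mono | move=> ? ?; lia].
change (nat_of_ord (ord_max : 'I_N.+1)) with N; rewrite subSnn expr1.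
rewrite (h0 N (dcomp (did N.+1) (mkd N N.+1 (bump N))) _ _ N) //; first last.
- rewrite eT; congr obv; rewrite jn_comp jn_mkd ?jn_did //; try mono; rewrite /bump; lia.
- move=> u hu; rewrite jn_comp jn_mkd ?jn_did //; try mono; rewrite /bump; lia.
- by apply: dstrict_mkd; [mono | rewrite /bump => ? ?; lia].
have eP : oK I (yo z) (did N.+1 : std N.+1 N.+1) N = Y.
  by rewrite oz_jn // jn_did.
have E : dcomp (did N.+1) (mkd N N.+1 id) = fr by apply: dmap_eq.
rewrite eP (_ : sb N id (did N.+1 : std N.+1 N.+1) = fr) //.
rewrite (_ : d - 1 + 1%N%:Z = d); last by lia.
rewrite [X in _ - X]add0r sub0r scaleN1r opprK; congr (_ *: (_ - _)).
rewrite /mK [X in mr I X](_ : _ = sb 1 (addn N) z) //.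
transitivity (act (dcomp (did N.+1) (mkd 1 N.+1 (addn N))) z); first by [].
apply: act_jn_eq => u hu.
by rewrite jn_comp jn_did //; have := jn_le (mkd 1 N.+1 (addn N)) u; lia.
Qed.

Lemma cD_front b d Y : vanishes_missing b -> Y = obv I z N -> d = b - N%:Z + 1 ->
  cD I (yo z) c (fr : std N.+1 N) Y d = (-1) ^+ N *: dd d (c (fr : std N.+1 N) Y (d - 1)).
Proof.
move=> h0 eY ed; rewrite cD_proper //; first by rewrite oz_jn // jn_front.
move=> l J Z j hl hJ eZ ej; have [i /missbP[hi _ hm]] := proper_miss hJ hl.
apply: (h0 l _ _ _ i) => //.
- by apply: dstrict_comp hJ; exact: strict_front.
- by move=> u hu; rewrite jn_comp jn_front ?jn_le //; exact: hm.
- by rewrite eZ oz_jn // jn_comp.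
- by lia.
Qed.
End LastVertex.

Section TruncatedMorphism.
Variables (k : comPzRingType) (A : dgcat k) (C : sset) (I : nerve_iso C A).

(** Acyclicity, in degrees at most [- n], of the mapping cone of composition with [phi]; the long
    exact sequence translates it into the definition of [n_mono]. *)
Definition cone_exact n (X Y : A) (phi : dghom X Y 0) : Prop :=
  forall W (i j : int), i + 1 = j -> i <= - n%:Z ->
  forall (r : dghom W X j) (s : dghom W Y i), dd (j + 1) r = 0 -> dd j s = cp j phi r ->
  exists (a : dghom W X i) (b : dghom W Y (i - 1)), dd j a = r /\ dd i b = cp i phi a - s.

Lemma postcompE (W X Y : A) (f : closed0 X Y) i u : postcomp W f i u = cp i (c0 f) u.
Proof. by rewrite /= -cpE. Qed.

Lemma n_mono_cone n X Y (f : closed0 X Y) : n_mono n f <-> cone_exact n (c0 f).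
Proof.
have fd : dd 1 (c0 f) = 0 := proj1 (cocycleE _) (c0_closed f).
split=> [h W i j eij hi r s hr hs|h W].
  have [h1 h2] := h W.
  have ei : i = j - 1 by lia.
  subst i; have hj : H_inj (postcomp W f) j.
    have [e|ne] := eqVneq j (- n%:Z + 1); first by rewrite e.
    by have [] := h2 j; [lia|].
  have [] := hj r 0.
  - exact/cocycleE.
  - by apply/cocycleE; rewrite dd0.
  - by apply/cohomE; exists s; rewrite !postcompE cp0r subr0.
  move=> a0 ha0; rewrite -ddE subr0 in ha0.
  have fa0 : dd j (cp (j - 1) (c0 f) a0) = cp j (c0 f) r.
    rewrite (dd_cp (i' := 1) (j' := j) _ _ (add0r _)) //; try lia.
    by rewrite fd cp0l add0r expr0 scale1r ha0.
  have [_ h3] := h2 (j - 1) hi.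
  have [|a1 ha1 /cohomE[b hb]] := h3 (s - cp (j - 1) (c0 f) a0).
    by apply/cocycleE; rewrite subrK ddB hs fa0 subrr.
  move/cocycleE: ha1; rewrite subrK => ha1.
  exists (a0 + a1), b; split; first by rewrite ddD ha0 ha1 addr0.
  by rewrite hb postcompE cpDr; zmodule.
have inj j : j - 1 <= - n%:Z -> H_inj (postcomp W f) j.
  move=> hj x y /cocycleE hx /cocycleE hy /cohomE[s hs]; apply/cohomE.
  rewrite !postcompE -cpBr in hs.
  have [||a [b [ha _]]] := h W (j - 1) j (subrK _ _) hj (x - y) s => //.
    by rewrite ddB hx hy subrr.
  by exists a.
split; first by apply: inj; lia.
move=> i hi; split; first by apply: inj; lia.
move=> s /cocycleE hs.
have [||a [b [ha hb]]] := h W i (i + 1) erefl hi 0 s; first by rewrite dd0.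
  by rewrite hs cp0r.
by exists a; [exact/cocycleE | apply/cohomE; exists b; rewrite postcompE].
Qed.

Section Fiber.
Variable f : C 1.
Local Notation phi := (mr I f (ob I (src f)) (ob I (tgt f)) 0).

Definition fv E (b : map_space E (tgt f) 0) m (x : fiber (post_comp E f) b m) : C (m + 2)%N :=
  pv (proj1_sig x).

Lemma fiber_face E (b : map_space E (tgt f) 0) m (x : fiber (post_comp E f) b m.+1) i :
  (i <= m.+1)%N -> fv (sb m (bump i) x) = sb (m + 2) (bump i) (fv x).
Proof. by move=> hi; rewrite /fv -pinch_face. Qed.

(** The last two vertices of the simplex underlying [x] are the ends of [f]. Lying over [b] means
    that omitting the source of [f] leaves a degeneration of [b]. *)
Lemma in_fiberE E (b : map_space E (tgt f) 0) m (x : pinch E f m) :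
  in_fiber (post_comp E f) b x <->
  sb (m + 1) (bump m.+1) (pv x) = sb (m + 1) (fun u => u - m)%N (pv b : C 1).
Proof.
have e1 : dsum (did m) (dconst 0 (ord_max : 'I_2)) = mkd (m + 1) (m + 2) (bump m.+1).
  apply: dmap_jn => u hu; rewrite jn_dsum // [RHS]jn_mkd //; last by mono.
  by case: leqP => h; rewrite ?jn_did ?jn_dconst //= /bump; lia.
have e2 : dsum (dconst m (ord0 : 'I_1)) (did 0) = mkd (m + 1) (0 + 1) (fun u => u - m)%N.
  apply: dmap_jn => u hu; rewrite jn_dsum // [RHS]jn_mkd //; last by mono.
  by case: leqP => h; rewrite ?jn_did ?jn_dconst //=; lia.
rewrite /in_fiber; split=> [/(congr1 (@pv _ _ _ _ _))|h].
  by rewrite /pv /= e1 e2.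
by apply: sig_eq; rewrite /= e1 e2.
Qed.

Lemma fiber_compat E (b : map_space E (tgt f) 0) m (x x' : fiber (post_comp E f) b m) i j :
  (0 < m)%N -> (i <= m)%N -> (j <= m)%N -> sb m.-1 (bump j) x = sb m.-1 (bump i) x' ->
  sb (m + 2).-1 (bump j) (fv x) = sb (m + 2).-1 (bump i) (fv x').
Proof.
case: m x x' => // m x x' _ hi hj /(congr1 (@fv _ _ _)).
by rewrite !fiber_face.
Qed.
End Fiber.
End TruncatedMorphism.

Section FillLast.
Variables (k : comPzRingType) (A : dgcat k) (C : sset) (I : nerve_iso C A).
Variables (n M : nat) (y : nat -> C M.+1) (E : C 0).
Let V (i : nat) := (i <= M.+1)%N.
Hypothesis yc : forall i j, (i < j)%N -> (j <= M.+1)%N ->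
  sb M (bump j.-1) (y i) = sb M (bump i) (y j).
Hypothesis vert : forall i, (i <= M.+1)%N -> (0 < i)%N -> sb 0 (fun=> 0%N) (y i) = E.
Local Notation P := (obv I (y 0%N) M).
Local Notation Q := (obv I (y 0%N) M.+1).

(** An outer horn: only the facet opposite to the last vertex is missing. The uncovered faces are
    that facet and the whole simplex, so the obstruction is a cocycle of the mapping cone of the
    last edge, and [cone_exact] provides both missing components. *)
Lemma fill_last : (n <= M)%N -> cone_exact n (mr I (sb 1 (addn M) (y 0%N)) P Q 0) ->
  exists X : C M.+2, forall i, (i <= M.+1)%N -> sb M.+1 (bump i) X = y i.
Proof.
move=> hn hf; have V0 : V 0 by [].
have hV i : (i <= M)%N -> V i.+1 by [].
have yc' i j : (i < j)%N -> (j <= M.+2)%N -> V i -> V j -> (0 < M.+1)%N ->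
    sb M.+1.-1 (bump j.-1) (y i) = sb M.+1.-1 (bump i) (y j).
  by move=> hij _ _ Vj _; exact: yc.
have vt i : (0 < i)%N -> (i <= M.+2)%N -> V i -> sb 0 (fun=> 0%N) (y i) = E.
  by move=> h1 _ h2; exact: vert.
pose c := facet_coch I V y E.
pose om : coch (std M.+1) (ob I E) := cD I (yo (y 0%N)) c.
have om0 : vanishes_missing I (y 0%N) om 1.
  move=> l J Z j i hJ hi hm eZ ej.
  have hi' : missb V J i by apply/missbP; split=> //; lia.
  by apply: (facet_cD V0 yc' vt hi') => //; rewrite oz_jn.
pose fr := mkd M M.+1 id.
have hD l (J : std M.+1 l) Z d : Z = oK I (yo (y 0%N)) J l ->
    cD I (yo (y 0%N)) om J Z d = 0 by move=> eZ; exact: cD_cD.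
have h1 := cD_front om0 (erefl P) (d := 1 - M%:Z + 1) erefl.
have h2 := cD_did om0 (erefl Q) (erefl P) (d := 1 - M%:Z) erefl.
rewrite hD ?oz_jn ?jn_front // in h1.
rewrite hD ?oz_jn ?jn_did // in h2.
rewrite addrK in h1.
move/(congr1 (fun v => (-1) ^+ M *: v)): h1; rewrite scaler0 signK => h1.
move/(congr1 (fun v => (-1) ^+ M.+1 *: v)): h2; rewrite scaler0 signK => h2.
have eij : 1 - M%:Z - 1 + 1 = 1 - M%:Z by rewrite subrK.
have hin : 1 - M%:Z - 1 <= - n%:Z by lia.
(* The factor [(-1)^(M + 1)] is the one in [cD_did]. *)
have [||a [b [ha hb]]] := hf (ob I E) _ _ eij hin ((-1) ^+ M.+1 *: om M fr P (1 - M%:Z))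
  ((-1) ^+ M.+1 *: om M.+1 (did M.+1) Q (1 - M%:Z - 1)).
- by rewrite ddZ -h1 scaler0.
- by rewrite ddZ cpZr; congr (_ *: _); apply/eqP; rewrite -subr_eq0 -h2.
pose g : coch (std M.+1) (ob I E) := fun l J Z j =>
  if [forall i : 'I_M.+2, ~~ missb V (J : dmap l M.+1) i] then
    (if jn (J : dmap l M.+1) l == M.+1 then hc _ Z j b else hc _ Z j a) else 0.
have g0 l (J : dmap l M.+1) i Z j : missb V J i -> g l (J : std M.+1 l) Z j = 0.
  by move=> hi; rewrite /g; case: covP => // /(_ i); rewrite hi.
have gv e : vanishes_missing I (y 0%N) g e.
  move=> l J Z j i hJ hi hm eZ ej; by apply: (g0 _ _ i); apply/missbP; split=> //; lia.
have gb d : g M.+1 (did M.+1) Q d = hc _ Q d b.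
  rewrite /g jn_did // eqxx; case: covP => // -[] i; apply/negP => /missbP[h3 h4] /(_ i h3).
  by rewrite jn_did // eqxx.
have ga d : g M fr P d = hc _ P d a.
  rewrite /g jn_front // (_ : M == M.+1 = false); last by lia.
  case: covP => // -[] i; apply/negP => /missbP[h3 h4 h5].
  have h6 : (i <= M)%N by rewrite /V in h4; lia.
  by have := h5 i h6; rewrite jn_front // eqxx.
have [|l J Z d hJ hm eZ ed|X [X1 _ _]] := facet_glue V0 yc' vt (g := g).
- by move=> l J i Z d hi; exact: g0 hi.
- have [[el|el] eJ] := strict_cover_last hV hJ hm; subst l.
    have {}eJ : J = did M.+1 by apply: dmap_jn => u hu; rewrite eJ // jn_did.
    subst J.
    rewrite oz_jn ?jn_did // in eZ; subst Z; have e1 : d = 1 - M%:Z - 1 by lia.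
    clear ed; subst d.
    rewrite (cD_did (gv 0) (erefl Q) (erefl P)); last by lia.
    rewrite [X in _ *: X](_ : _ = - ((-1) ^+ M.+1 *: om M.+1 (did M.+1) Q (1 - M%:Z - 1))).
      by rewrite scalerN signK.
    rewrite gb ga !hc_id hb; zmodule.
  have {}eJ : J = fr by apply: dmap_jn => u hu; rewrite eJ // jn_front.
  subst J.
  rewrite oz_jn ?jn_front // in eZ; subst Z; rewrite ed.
  rewrite (cD_front (gv 0) (erefl P)); last by lia.
  by rewrite ga hc_id ha exprS mulN1r scaleNr scalerN signK.
by exists X => i hi; apply: X1 => //; lia.
Qed.
End FillLast.

Section TruncatedMorphism2.
Variables (k : comPzRingType) (A : dgcat k) (C : sset) (I : nerve_iso C A).
Variable f : C 1.
Local Notation phi := (mr I f (ob I (src f)) (ob I (tgt f)) 0).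

Lemma fill_last_eq n N M (y : nat -> C N) (E : C 0) : N = M.+1 ->
  (forall i j, (i < j)%N -> (j <= M.+1)%N -> sb N.-1 (bump j.-1) (y i) = sb N.-1 (bump i) (y j)) ->
  (forall i, (i <= M.+1)%N -> (0 < i)%N -> sb 0 (fun=> 0%N) (y i) = E) ->
  (n <= M)%N -> sb 1 (addn M) (y 0%N) = f -> cone_exact n phi ->
  exists X : C N.+1, forall i, (i <= M.+1)%N -> sb N (bump i) X = y i.
Proof.
move=> eN; subst N => yc vert hn ef hf; apply: (fill_last (I := I) yc vert hn).
have -> : obv I (y 0%N) M = ob I (src f).
  by rewrite /obv /src vertexE -ef sb_sb; [congr ob; apply: sb_eq => u _; rewrite /= addn0|mono|mono].
have -> : obv I (y 0%N) M.+1 = ob I (tgt f).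
  by rewrite /obv /tgt vertexE -ef sb_sb; [congr ob; apply: sb_eq => u _; rewrite /= addn1|mono|mono].
by rewrite ef.
Qed.

(** In dimension [m + 3], the facets [0, ..., m + 1] come from the boundary in the fiber and the
    facet omitting the source of [f] from [b]. Only the facet omitting the target of [f] is missing,
    which is the situation of [fill_last]. *)
Lemma cone_truncated n : (0 < n)%N -> cone_exact n phi -> truncated_morphism (n%:Z - 2) f.
Proof.
move=> hn hf E b m hm u; case: m hm u => [|m] hm u; first by lia.
have [x' [_ xc' xf']] := boundary_facets u.
pose N := (m + 2)%N.
pose yl : C N := sb N (fun u => u - m.+1)%N (pv b : C 1).
pose y i : C N := if (i <= m.+1)%N then fv (x' i) else yl.
have yE i : (i <= m.+1)%N -> y i = fv (x' i) by rewrite /y => ->.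
have ylE : y m.+2 = yl by rewrite /y ltnn.
have yf i : (i <= m.+1)%N -> sb 1 (addn m.+1) (y i) = f.
  by move=> hi; rewrite yE // -[RHS](@sb_id _ _ id) // -(pinch_inr (proj1_sig (x' i))).
have yb i : (i <= m.+1)%N -> sb (m + 1) (bump m.+1) (y i) = sb (m + 1) (fun u => u - m)%N (pv b : C 1).
  by move=> hi; rewrite yE //; apply/in_fiberE; exact: (proj2_sig (x' i)).
have yi i : (i <= m.+1)%N -> sb m id (y i) = const_simplex m E.
  by move=> hi; rewrite yE // -(pinch_inl (proj1_sig (x' i)) (l := m) (f := id)).
have [|||||F hF] := @fill_last_eq n N m.+1 y E _ _ _ _ _ hf.
- by rewrite /N; lia.
- move=> i j hij hj; have hi : (i <= m.+1)%N by lia.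
  have eN : N.-1 = (m + 1)%N by rewrite /N; lia.
  have [hj2|hj2] := leqP j m.+1.
    have [em|m0] := posnP m.
      rewrite (@sb_eq _ _ _ _ (addn m.+1)) => [|v hv]; last by rewrite em /bump; lia.
      rewrite [RHS](@sb_eq _ _ _ _ (addn m.+1)) => [|v hv]; last by rewrite em /bump; lia.
      have E1 : N.-1 = 1%N by rewrite /N; lia.
      by rewrite E1 !yf.
    by rewrite !yE //; apply: fiber_compat => //; [lia|lia|exact: xc'].
  have -> : j = m.+2 by lia.
  rewrite ylE eN yb // /yl sb_sb; [|rewrite /N; mono|rewrite /N; mono].
  by apply: sb_eq => v hv; rewrite /= /bump; lia.
- move=> i hi _; have [hi2|hi2] := leqP i m.+1.
    have := congr1 (sb 0 (fun=> 0%N)) (yi i hi2); rewrite sb_const const_simplex0 sb_sb //; rewrite /N; mono.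
  have -> : i = m.+2 by lia.
  rewrite ylE sb_sb //; last by rewrite /N; mono.
  rewrite -[RHS](const_simplex0 E) -(pinch_inl b (l := 0) (f := fun=> 0%N)) //.
- by lia.
- exact: yf.
have F2 : sb N (bump m.+2) F = yl by rewrite hF.
have Fp : in_pinch (m := m.+1) E f F.
  apply/in_pinchE; split; last first.
    rewrite -(yf 0%N) // -hF // sb_sb; [|exact: bump_mono|rewrite /N; mono].
    by apply: sb_eq => v hv; rewrite /= /bump; lia.
  have := pinch_inl b (l := m.+1) (f := fun=> 0%N) => <- //.
  transitivity (sb m.+1 id yl); last first.
    rewrite /yl sb_sb; [|rewrite /N; mono|rewrite /N; mono].
    by apply: sb_eq => v hv; rewrite /=; lia.
  rewrite -F2 sb_sb; [|exact: bump_mono|rewrite /N; mono].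
  by apply: sb_eq => v hv; rewrite /= /bump; lia.
pose F' : pinch E f m.+1 := exist _ F Fp.
have Ff : in_fiber (post_comp E f) b F'.
  have H K : K = N -> sb K (bump m.+2) F = sb K (fun u => u - m.+1)%N (pv b : C 1) by move=> ->.
  by apply/in_fiberE; apply: H; rewrite /N; lia.
exists (exist _ F' Ff); apply: xf' => i hi; apply: sig_eq; apply: sig_eq.
by rewrite -[LHS]/(fv _) fiber_face // -[RHS]/(fv _) -yE //; apply: hF; lia.
Qed.

Lemma simplex_top_last_eq K N (Z : C K) W Y T (r : dghom W Y (- N%:Z)) (s : dghom W T (- N.+1%:Z)) :
  K = N.+2 ->
  W = obv I Z 0 -> Y = obv I Z N.+1 -> T = obv I Z N.+2 -> dd (1 - N%:Z) r = 0 ->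
  dd (- N%:Z) s = cp (- N%:Z) (mr I (sb 1 (addn N.+1) Z) Y T 0) r ->
  exists X : C K, [/\ forall i, (i <= N.+1)%N -> sb N.+1 (bump i) X = sb N.+1 (bump i) Z,
    forall i, (i <= N.+2)%N -> sb 0 (fun=> i) X = sb 0 (fun=> i) Z,
    mr I (sb N.+1 (bump N.+2) X) W Y (- N%:Z) = mr I (sb N.+1 (bump N.+2) Z) W Y (- N%:Z) + r &
    mr I X W T (- N.+1%:Z) = mr I Z W T (- N.+1%:Z) + s].
Proof. by move=> eK; subst K; exact: simplex_top_last. Qed.

Lemma mr_dB1_eq K m (X Z : C K) P Q (i : int) v : K = m.+1 -> (0 < v)%N -> (v < m.+1)%N ->
  (forall w, (w <= m.+1)%N -> w != v -> sb m (bump w) X = sb m (bump w) Z) ->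
  P = obv I Z 0 -> Q = obv I Z m.+1 -> i = - m%:Z ->
  dd (i + 1) (mr I X P Q i - mr I Z P Q i) =
  (-1) ^+ (m.+1 - v) *:
    (mr I (sb m (bump v) X) P Q (i + 1) - mr I (sb m (bump v) Z) P Q (i + 1)).
Proof. by move=> eK; subst K; exact: mr_dB1. Qed.

Lemma cone_zero (E : C 0) : exists D : C 2, sb 1 (bump 0) D = f /\ sb 0 (fun=> 0%N) D = E.
Proof.
have [|D [h1 h2 _]] := cone_exists (I := I) (z := f) (w := E) (c := fun _ _ _ _ => 0).
  by move=> l J Y i _ eY _; rewrite cD0.
by exists D.
Qed.

(** The pair [(r, s)] is added to facet [m + 1] of a simplex [Z] degenerate on a cone over [f] with
    zero components: [r] on the face ending at the source of [f], [s] on the whole facet. The new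
    boundary, in the fiber over the zero edge [b], is filled by [F]; the differences of [F] and [Z]
    on the last facet and at the top give the required pair. *)
Lemma truncated_cone n : (0 < n)%N -> truncated_morphism (n%:Z - 2) f -> cone_exact n phi.
Proof.
move=> hn hf W i j eij hin r s hr hs.
have [E eE] := ob_surj I W; subst W.
have [m em] : exists m, i = - m.+1%:Z by exists (absz (- 1 - i)%R); lia.
have ej : j = - m%:Z by lia.
subst i; clear eij; subst j; have [D [D0 DE]] := cone_zero E.
(* The vertices [0, ..., m + 1] go to the apex [E], the last two to the ends of [f]. *)
pose q u := (u - m.+1)%N.
pose K := (m + 2)%N.
have mq : mono_on K.+1 2 q by rewrite /q /K; mono.
have mb i : mono_on K K.+1 (bump i) by exact: bump_mono.
pose Z : C K.+1 := sb K.+1 q D.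
have Zc l g : mono_on l K.+1 g -> (g l <= m.+1)%N -> sb l g Z = const_simplex l E.
  move=> hg hl; rewrite /Z sb_sb // -DE const_sb //; apply: sb_eq => u hu.
  by have := hg.1 u l hu (leqnn l); rewrite /q /=; lia.
have Zf g : g 0%N = m.+2 -> g 1%N = m.+3 -> sb 1 g Z = f.
  move=> g0 g1; have mg : mono_on 1 K.+1 g.
    by split=> [[|[|u]] [|[|v]] // _ _|]; rewrite ?leqnn ?g0 ?g1 // /K; lia.
  rewrite /Z sb_sb // -D0; apply: sb_eq => -[|[|u]] // _; rewrite /q /= ?g0 ?g1 /bump; lia.
have Zb l g : mono_on l K.+1 g -> sb l g Z = sb l (q \o g) D by move=> hg; rewrite /Z sb_sb.
have fs v : v = m.+2 -> ob I (src f) = obv I Z v.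
  move=> ->; rewrite /obv /src vertexE -(Zf (addn m.+2)) ?sb_sb //; try (rewrite /K; mono); try lia.
  by congr ob; apply: sb_eq => u _; rewrite /= addn0.
have ft v : v = m.+3 -> ob I (tgt f) = obv I Z v.
  move=> ->; rewrite /obv /tgt vertexE -(Zf (addn m.+2)) ?sb_sb //; try (rewrite /K; mono); try lia.
  by congr ob; apply: sb_eq => u _; rewrite /= addn1.
clearbody Z.
pose bD : C 1 := sb 1 (bump 1) D.
have bp : in_pinch (m := 0) E (tgt f) bD.
  apply/in_pinchE; split.
    rewrite const_simplex0 -DE /bD sb_sb; [|mono|mono].
    by apply: sb_eq => -[].
  rewrite /tgt vertexE -D0 /bD !sb_sb; [|mono|mono|mono|mono].
  by apply: sb_eq => -[].
pose b : map_space E (tgt f) 0 := exist _ bD bp.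
pose Z1 := sb K (bump m.+1) Z.
have [||||||R [Rf Rv Rr Rs]] := @simplex_top_last_eq K m Z1 _ _ _ r s.
- by rewrite /K; lia.
- by rewrite obv_sb // /obv Zc ?const_simplex0.
- by rewrite obv_sb //; [apply: fs; rewrite /bump; lia | rewrite /K; lia].
- by rewrite obv_sb //; [apply: ft; rewrite /bump; lia | rewrite /K; lia].
- by rewrite (_ : 1 - m%:Z = - m%:Z + 1) //; lia.
- rewrite hs /Z1 sb_sb ?Zf //=; try (rewrite /bump; lia). by rewrite /K; mono.
pose y i : C K := if i == m.+1 then R else sb K (bump i) Z.
have yf i a : (a <= m.+1)%N -> sb m.+1 (bump a) (y i) = sb m.+1 (bump a) (sb K (bump i) Z).
  by move=> ha; rewrite /y; case: eqP => // ->; exact: Rf.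
have yf2 i g : g 0%N = m.+1 -> g 1%N = m.+2 -> sb 1 g (y i) = sb 1 g (sb K (bump i) Z).
  move=> g0 g1; have E1 (x : C K) : sb 1 g x = sb 1 (addn m) (sb m.+1 (bump 0) x).
    rewrite sb_sb; [|rewrite /K; mono|mono].
    by apply: sb_eq => -[|[|u]] // _; rewrite /= ?g0 ?g1 /bump; lia.
  by rewrite !E1 yf.
have yb i : sb (m + 1) (bump m.+1) (y i) = sb (m + 1) (bump m.+1) (sb K (bump i) Z).
  have -> : (m + 1)%N = m.+1 by lia.
  exact: yf.
have yp i : (i <= m.+1)%N -> in_pinch (m := m) E f (y i).
  move=> hi; apply/in_pinchE; split; last first.
    by rewrite yf2 ?sb_sb ?Zf //=; try (rewrite /bump; lia); rewrite /K; mono.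
  have E1 (x : C K) : sb m id x = sb m id (sb m.+1 (bump m.+1) x).
    rewrite sb_sb; [|rewrite /K; mono|mono].
    by apply: sb_eq => u hu; rewrite /= /bump; lia.
  rewrite E1 yf // -E1 sb_sb ?Zc //=; try (rewrite /bump; lia); rewrite /K; mono.
have bE : forall i (h : (i <= m.+1)%N), in_fiber (post_comp E f) b (exist _ (y i) (yp i h) : pinch E f m).
  move=> i h; apply/in_fiberE; rewrite /pv /= yb sb_sb ?Zb /bD ?sb_sb; try (rewrite /K; mono); try mono.
  by apply: sb_eq => u hu; rewrite /q /= /bump; lia.
pose x' i : fiber (post_comp E f) b m :=
  if @idP (i <= m.+1)%N is ReflectT h then exist _ (exist _ (y i) (yp i h) : pinch E f m) (bE i h)
  else exist _ (exist _ (y 0%N) (yp 0%N isT) : pinch E f m) (bE 0%N isT).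
have xE i : (i <= m.+1)%N -> fv (x' i) = y i.
  by move=> hi; rewrite /x'; case: {-}_ / idP => // /(_ hi).
have x'c : compat_facets x'.
  move=> i j hij hj m0; apply: sig_eq; apply: sig_eq.
  have [m' em] : exists m', m = m'.+1 by exists m.-1; lia.
  have H (x : fiber (post_comp E f) b m) a : (a <= m)%N ->
      pv (proj1_sig (sb m.-1 (bump a) x)) = sb (m.-1 + 2) (bump a) (fv x).
    clear -em => ha; subst m; exact: fiber_face.
  rewrite [LHS]H ?[RHS]H ?xE; try lia.
  have H2 L : L = m.+1 -> sb L (bump j.-1) (y i) = sb L (bump i) (y j).
    move=> ->; rewrite !yf; try lia.
    have H3 : forall L', L' = m.+1 -> sb L' (bump j.-1) (sb K (bump i) Z) = sb L' (bump i) (sb K (bump j) Z).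
      move=> L' eL; have := faces_compat Z hij; rewrite (_ : K.-1 = L'); last by rewrite /K; lia.
      by apply; rewrite /K; lia.
    exact: H3.
  by apply: H2; lia.
have [u hu] := boundary_map x'c.
have [|F' hF'] := hf E b m.+1 _ u; first by lia.
pose F : C K.+1 := fv F'.
have Ff i : (i <= m.+1)%N -> sb K (bump i) F = y i.
  move=> hi; rewrite -[LHS](fiber_face F' hi) -xE //.
  by rewrite (fills_face _ hF' hi (x := x' i)) // => a ha; exact: hu.
have F2 : sb K (bump m.+2) F = sb K (bump m.+2) Z.
  have := proj2_sig F'; move/in_fiberE; rewrite -[pv _]/(F) -[(m.+1 + 1)%N]/((m + 1).+1).
  have -> : (m + 1).+1 = K by rewrite /K; lia.
  move=> ->; rewrite /pv /= /bD Zb ?sb_sb; try (rewrite /K; mono); try mono.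
  by apply: sb_eq => v hv; rewrite /q /= /bump; lia.
have FZ0 : sb K (bump 0) F = sb K (bump 0) Z by rewrite Ff.
have FZv : sb 0 (fun=> 0%N) F = sb 0 (fun=> 0%N) Z.
  by have := congr1 (sb 0 (fun=> 0%N)) F2; rewrite !sb_sb //; rewrite /K; mono.
have oE : ob I E = obv I Z 0.
  by rewrite /obv Zc ?const_simplex0 //; split; rewrite // /K; lia.
have oS := fs _ erefl; have oT := ft _ erefl.
pose FL := sb K (bump m.+3) F; pose ZL := sb K (bump m.+3) Z.
pose a d := mr I FL (ob I E) (ob I (src f)) d - mr I ZL (ob I E) (ob I (src f)) d.
pose be d := mr I F (ob I E) (ob I (tgt f)) d - mr I Z (ob I E) (ob I (tgt f)) d.
have ha : dd (- m%:Z) (a (- m.+1%:Z)) = - r.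
  have eK : K = m.+2 by rewrite /K; lia.
  have fc (x : C K.+1) w : (w <= m.+2)%N ->
      sb m.+1 (bump w) (sb K (bump m.+3) x) = sb m.+1 (bump m.+2) (sb K (bump w) x).
    move=> hw; rewrite !sb_sb; try (by rewrite eK; exact: bump_mono); try (rewrite /K; mono).
    by apply: sb_eq => v hv; rewrite /= /bump; lia.
  have hLv : (m.+1 <= K)%N by rewrite /K; lia.
  have e1 : ob I E = obv I ZL 0 by rewrite /ZL obv_sb //= oE.
  have e2 : ob I (src f) = obv I ZL m.+2.
    by rewrite /ZL obv_sb //; [apply: fs; rewrite /bump; lia | rewrite /K; lia].
  have := @mr_dB1_eq K m.+1 FL ZL _ _ (- m.+1%:Z) m.+1 eK isT (leqnn _) _ e1 e2 erefl.
  have -> : - m.+1%:Z + 1 = - m%:Z by lia.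
  move=> ->.
    rewrite !fc // !Ff // /y eqxx [mr I (sb _ _ R) _ _ _]Rr addrAC subrr add0r.
    by rewrite subSnn expr1 scaleN1r.
  move=> w hw hn'; rewrite !fc //.
  have [hw1|hw1] := leqP w m.+1; first by rewrite Ff // /y (negPf hn').
  have -> : w = m.+2 by lia.
  by rewrite F2.
have hbe : dd (- m.+1%:Z) (be (- m.+1%:Z - 1)) = s + cp (- m.+1%:Z) phi (a (- m.+1%:Z)).
  have e3 : - m.+1%:Z - 1 = - K%:Z by rewrite /K; lia.
  have oT' : ob I (tgt f) = obv I Z K.+1 by apply: ft; rewrite /K; lia.
  have oS' : obv I Z K = ob I (src f) by symmetry; apply: fs; rewrite /K; lia.
  have := mr_dB FZ0 FZv oE oT' e3; rewrite subrK => ->.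
  have hu1 : (m.+1 < K.+1)%N by rewrite /K; lia.
  have fE w (x : C K.+1) : (w <= m.+1)%N -> sb w id x = sb w id (sb K (bump m.+2) x).
    move=> hw; rewrite sb_sb; [|exact: bump_mono|rewrite /K; mono].
    by apply: sb_eq => v hv; rewrite /= /bump; lia.
  rewrite (bigD1 (Ordinal hu1)) //= (bigD1 (Ordinal (ltnSn K))) /=; last first.
    by rewrite -val_eqE /K /=; apply/andP; split; lia.
  rewrite big1 ?addr0.
    rewrite fE // F2 -fE // subrr cp0r subr0 Ff // /y eqxx [mr I R _ _ _]Rs.
    rewrite -/Z1 addrAC subrr add0r (_ : (K.+1 - m.+1 = 2)%N); last by rewrite /K; lia.
    have EK (x : C K.+1) : sb K (bump K) x = sb K (bump m.+2) x.
      by apply: sb_eq => v _; rewrite /bump /K; lia.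
    rewrite !EK F2 subrr sub0r subSnn sqrrN expr1n scale1r expr1 scaleN1r opprK oS'.
    have e4 : 1 - K%:Z = - m.+1%:Z by rewrite /K; lia.
    rewrite e4 (Zf (addn K)); [|rewrite /K; lia|rewrite /K; lia].
    have FE (x : C K.+1) : sb K id x = sb K (bump m.+3) x.
      by apply: sb_eq => v hv; rewrite /bump /K in hv *; lia.
    by rewrite !FE.
  move=> w /andP[/andP[w0 w1] w2]; rewrite -val_eqE /= in w1; rewrite -val_eqE /= in w2.
  have hw := ltn_ord w; have eK : K = m.+2 by rewrite /K; lia.
  have hw' : (w <= m.+2)%N by rewrite -eK -ltnS.
  have hw2 : (w <= m.+1)%N by rewrite -ltnS ltn_neqAle -eK w2 -ltnS hw.
  by rewrite fE // F2 -fE // subrr cp0r Ff // /y (negPf w1) !subrr scaler0.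
(* Facet [m + 1] enters the boundary of the last facet with sign -1, whence the negated
   witnesses. *)
exists (- a (- m.+1%:Z)), (- be (- m.+1%:Z - 1)); split; first by rewrite ddN ha opprK.
by rewrite ddN hbe cpNr opprD addrC.
Qed.
End TruncatedMorphism2.

(** * Cochains on joins *)

Lemma strict_cover_join n j l (J : dmap l (n + j.+1)) : dstrict J ->
  (forall i, (i <= n)%N -> exists2 u, (u <= l)%N & jn J u = i) ->
  (l = n /\ forall u, (u <= l)%N -> jn J u = jn (dinl n j) u) \/
  exists l2, l = (n + l2.+1)%N /\ exists J2 : dmap l2 j, dstrict J2 /\
    forall u, (u <= l)%N -> jn J u = jn (dsum (did n) J2) u.
Proof.
move=> hJ hit.
have ge u : (u <= l)%N -> (u <= jn J u)%N.
  elim: u => // u IH hu; have := @jn_strict _ _ J u u.+1 hJ (leqnn _) hu; have := IH (ltnW hu); lia.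
have eqi i : (i <= n)%N -> (i <= l)%N /\ jn J i = i.
  elim/ltn_ind: i => i IH hi; have [u0 hu0 e0] := hit i hi.
  have h1 := ge u0 hu0; have [e|ne] := eqVneq u0 i; first by split; [rewrite -e | rewrite -{1}e].
  have lt : (u0 < i)%N by lia.
  by have [_] := IH u0 lt (leq_trans (ltnW lt) hi); lia.
have hnl := (eqi n (leqnn n)).1.
have [e|ne] := eqVneq l n.
  by left; split=> // u hu; rewrite jn_dinl ?(eqi u _).2 //; lia.
right; exists (l - n.+1)%N; split; first by lia.
pose f u := (jn J (u + n.+1) - n.+1)%N.
have gt u : (u + n.+1 <= l)%N -> (n < jn J (u + n.+1))%N by move=> h; have := ge _ h; lia.
have mf : mono_on (l - n.+1) j f.
  split=> [u v h h'|]; rewrite /f; first by have := @jn_mono _ _ J (u + n.+1) (v + n.+1); lia.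
  by have := jn_le J (l - n.+1 + n.+1); lia.
exists (mkd (l - n.+1) j f); split.
  apply: dstrict_mkd => // u v huv hv; rewrite /f.
  by have := @jn_strict _ _ J (u + n.+1) (v + n.+1) hJ; have := gt u; have := gt v; lia.
move=> u hu; rewrite jn_dsum; last by lia.
case: leqP => h; first by rewrite jn_did // (eqi u h).2.
rewrite jn_mkd //; last by lia.
by rewrite /f subnK // subnKC // (leq_trans h) // ge.
Qed.

Lemma dsum_strict n j l (J : dmap l j) : dstrict J -> dstrict (dsum (did n) J).
Proof.
move=> hJ; apply: strict_jn => u v huv hv; rewrite !jn_dsum //; last by lia.
case: (leqP u n) => h1; case: (leqP v n) => h2; rewrite ?jn_did //; [lia|lia|].
by rewrite ltn_add2l; apply: jn_strict => //; lia.
Qed.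

Lemma dinl_strict n j : dstrict (dinl n j).
Proof. by apply: strict_jn => u v huv hv; rewrite !jn_dinl //; lia. Qed.

Lemma mr_congr_eq (k : comPzRingType) (A : dgcat k) (C : sset) (I : nerve_iso C A) m m' N
    (J : dmap m N) (J' : dmap m' N) (x : C N) X Y i : m = m' ->
  (forall u, (u <= m)%N -> jn J u = jn J' u) -> mr I (act J x) X Y i = mr I (act J' x) X Y i.
Proof. by move=> e; subst m'; exact: mr_congr. Qed.

Lemma coch_congr_eq (k : comPzRingType) (A : dgcat k) N (W : A) (c : coch (std N) W) m m'
    (J : dmap m N) (J' : dmap m' N) Y i : m = m' ->
  (forall u, (u <= m)%N -> jn J u = jn J' u) -> c m J Y i = c m' J' Y i.
Proof. by move=> e; subst m'; exact: coch_congr. Qed.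

Section JoinCochains.
Variables (k : comPzRingType) (A : dgcat k) (C : sset) (I : nerve_iso C A).
Variables (n j : nat) (z : C (n + j.+1)%N) (W : A).

(** The cochain lives on the faces containing the whole first factor: that factor and its joins with
    faces of [std j]. [b] is its total degree. *)
Definition join_vanish (c : coch (std (n + j.+1)) W) (b : int) : Prop :=
  forall l (J : dmap l (n + j.+1)) Z d i,
  dstrict J -> (i <= n)%N -> (forall u, (u <= l)%N -> jn J u != i) ->
  Z = obv I z (jn J l) -> d = b - l%:Z -> c l (J : std (n + j.+1) l) Z d = 0.

Definition join_tail (c : coch (std (n + j.+1)) W) : coch (std j) W :=
  fun l J Y d => c (n + l.+1)%N (dsum (did n) (J : dmap l j) : std (n + j.+1) _) Y d.

Lemma cD_dinl c b d Y : join_vanish c b -> Y = obv I z n -> d = b - n%:Z + 1 ->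
  cD I (yo z) c (dinl n j : std (n + j.+1) n) Y d =
  (-1) ^+ n *: dd d (c n (dinl n j : std (n + j.+1) n) Y (d - 1)).
Proof.
move=> h0 eY ed; rewrite cD_proper //; first by rewrite oz_jn // jn_dinl.
move=> l J Z e hl hJ eZ ee; have [i /missbP[hi _ hm]] := proper_miss hJ hl.
apply: (h0 l _ _ _ i).
- by apply: (dstrict_comp (a := dinl n j) _ hJ); exact: dinl_strict.
- exact: hi.
- by move=> u hu; rewrite jn_comp jn_dinl ?jn_le //; exact: hm.
- by rewrite eZ oz_jn // jn_comp.
- by lia.
Qed.

(** With [cD_dinl], this identifies such cochains with the total cone of [Hom(W, L)] mapping to
    cochains on the second factor. Terms with [w < n] vanish, [w = n] gives the composite with the
    component of the cone, and [w > n] the differential on the second factor. *)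
Lemma cD_join c b l (J : dmap l j) d Y L : join_vanish c b -> dstrict J ->
  Y = obv I z (n.+1 + jn J l) -> L = obv I z n -> d = b - (n + l)%N%:Z ->
  cD I (yo z) c (dsum (did n) J : std (n + j.+1) (n + l.+1)%N) Y d =
  (-1) ^+ n.+1 *: (cD I (yo (act (dinr n j) z)) (join_tail c) (J : std j l) Y d -
    cp d (mr I (act (dsum (did 0) J) (sb (0 + j.+1) (addn n) z)) L Y (- l%:Z))
      (c n (dinl n j : std (n + j.+1) n) L (d + l%:Z))).
Proof.
move=> h0 hJ eY eL ed.
pose D := dsum (did n) J : std (n + j.+1) (n + l.+1)%N.
have jD u : (u <= n + l.+1)%N -> jn D u = if (u <= n)%N then u else (n.+1 + jn J (u - n.+1))%N.
  by move=> hu; rewrite jn_dsum //; case: leqP => h //; rewrite jn_did.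
have jDs f m u : mono_on m (n + l.+1) f -> (u <= m)%N -> jn (sb m f D : dmap m _) u = jn D (f u).
  by move=> hf hu; rewrite jn_comp jn_mkd.
have mD f m : mono_on m (n + l.+1) f -> (forall u v, (u < v)%N -> (v <= m)%N -> (f u < f v)%N) ->
    dstrict (sb m f D : dmap m _).
  by move=> hf hs; apply: dstrict_comp; [exact: dsum_strict | exact: dstrict_mkd].
have oD w : (w <= n + l.+1)%N -> oK I (yo z) D w = obv I z (jn D w) by move=> hw; rewrite oz_jn.
rewrite -/D {1}/cD /cR.
pose F w := (-1) ^+ (n + l.+1 - w) *: (c (n + l.+1).-1 (sb (n + l.+1).-1 (bump w) D) Y d -
  cp d (mK I (yo z) (sb (n + l.+1 - w) (addn w) D) (oK I (yo z) D w) Y (1 - (n + l.+1 - w)%N%:Z))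
    (c w (sb w id D) (oK I (yo z) D w) (d - 1 + (n + l.+1 - w)%N%:Z))).
rewrite -(big_mkord xpredT F) (@big_cat_nat _ _ _ n) //=; last exact: leq_addr.
rewrite big1_seq ?add0r; last first.
  move=> w /andP[_]; rewrite mem_index_iota => /andP[_ hw]; rewrite /F.
  have m1 : mono_on (n + l.+1).-1 (n + l.+1) (bump w) by mono.
  have m2 : mono_on w (n + l.+1) id by mono.
  rewrite (h0 _ (sb (n + l.+1).-1 (bump w) D) _ _ w); first last.
  - by lia.
  - rewrite jDs // jD; last by rewrite /bump; lia.
    rewrite eY; congr obv; rewrite /bump; case: leqP => h3; first by lia.
    by congr (_ + jn J _)%N; lia.
  - move=> u hu; rewrite jDs // jD; last by rewrite /bump; lia.
    by case: leqP; rewrite /bump; lia.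
  - by lia.
  - by apply: mD => //; rewrite /bump => *; lia.
  rewrite (h0 _ (sb w id D) _ _ n) ?cp0r ?subrr ?scaler0 //; first last.
  - by lia.
  - rewrite oD; last by lia.
    by rewrite jDs.
  - move=> u hu; rewrite jDs // jD /=; last by lia.
    by case: leqP; lia.
  - by apply: mD => // *; lia.
rewrite big_ltn; last by lia.
have -> : F n = (-1) ^+ l *: cp d (mr I (act (dsum (did 0) J) (sb (0 + j.+1) (addn n) z)) L Y (- l%:Z))
      (c n (dinl n j : std (n + j.+1) n) L (d + l%:Z)).
  rewrite /F; have m1 : mono_on (n + l.+1).-1 (n + l.+1) (bump n) by mono.
  rewrite (h0 _ (sb (n + l.+1).-1 (bump n) D) _ _ n) //; first last.
  - by lia.
  - rewrite jDs // jD; last by rewrite /bump; lia.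
    rewrite eY; congr obv; rewrite /bump; case: leqP => h3; first by lia.
    by congr (_ + jn J _)%N; lia.
  - move=> u hu; rewrite jDs // jD; last by rewrite /bump; lia.
    by case: leqP; rewrite /bump; lia.
  - by apply: mD => //; rewrite /bump => *; lia.
  have -> : (n + l.+1 - n = l.+1)%N by lia.
  rewrite oD; last by lia.
  rewrite jD ?leqnn -?eL; last by lia.
  rewrite sub0r scalerN exprS mulN1r scaleNr opprK; congr (_ *: _).
  have -> : 1 - l.+1%:Z = - l%:Z by lia.
  have -> : d - 1 + l.+1%:Z = d + l%:Z by lia.
  have -> : sb n id D = dinl n j :> dmap _ _.
    apply: dmap_jn => u hu; rewrite jDs //; last by mono.
    by rewrite jD ?jn_dinl //=; [rewrite hu | lia].
  congr (cp _ _ _); rewrite /mK /= /sb /= -!act_comp.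
  apply: mr_congr => u hu; rewrite jn_comp (jn_dsum (did n)) ?jn_comp; last first.
    by rewrite jn_mkd //; [lia | mono].
  rewrite jn_mkd //; last by mono.
  rewrite (jn_dsum (did 0)) //; case: u hu => [|u] hu.
    by rewrite addn0 leqnn !jn_did // jn_mkd //; [rewrite addn0 | mono].
  rewrite (_ : (n + u.+1 <= n)%N = false); last by lia.
  rewrite (_ : (u.+1 <= 0)%N = false) // subSS subn0 (_ : (n + u.+1 - n.+1 = u)%N); last by lia.
  have hj := jn_le J u; rewrite [RHS]jn_mkd; [lia | mono | lia].
have -> : \sum_(n.+1 <= i < n + l.+1) F i = \sum_(0 <= i < n + l.+1 - n.+1) F (i + n.+1)%N.
  by rewrite -{1}[n.+1]add0n big_addn.
rewrite (_ : (n + l.+1 - n.+1 = l)%N); last by lia.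
rewrite big_mkord.
have -> : \sum_(i < l) F (i + n.+1)%N = cR I (yo (act (dinr n j) z)) (join_tail c) (J : std j l) Y d.
  apply: eq_bigr => w _; have hw := ltn_ord w; rewrite /F.
  have -> : (n + l.+1 - (w + n.+1) = l - w)%N by lia.
  have eo : oK I (yo z) D (w + n.+1)%N = oK I (yo (act (dinr n j) z)) (J : std j l) w.
    rewrite oD; last by lia.
    rewrite jD; last by lia.
    rewrite [RHS]oz_jn; last by lia.
    rewrite obv_jn ?jn_le // jn_dinr ?jn_le //.
    by case: leqP => h; [lia | congr (obv _ _ (_ + jn _ _)%N); lia].
  have m1 : mono_on (n + l.+1).-1 (n + l.+1) (bump (w + n.+1)) by mono.
  have m2 : mono_on l.-1 l (bump w) by mono.
  have m3 : mono_on w l id by mono.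
  have m4 : mono_on (w + n.+1) (n + l.+1) id by mono.
  have m5 : mono_on (l - w) (n + l.+1) (addn (w + n.+1)) by mono.
  have m6 : mono_on (l - w) l (addn w) by mono.
  rewrite eo; congr (_ *: (_ - _)).
    rewrite /join_tail; apply: coch_congr_eq => [|u hu]; first by lia.
    rewrite jDs // jD; last by rewrite /bump; lia.
    rewrite jn_dsum; last by lia.
    rewrite /bump; case: (leqP u n) => h.
      by rewrite jn_did // (_ : ((w + n.+1 <= u) + u <= n)%N = true) //; lia.
    rewrite (_ : ((w + n.+1 <= u) + u <= n)%N = false); last by lia.
    rewrite jn_comp jn_mkd; [|mono|lia].
    by congr (_ + jn J _)%N; rewrite /bump; lia.
  have -> : c (w + n.+1)%N (sb (w + n.+1) id D) (oK I (yo (act (dinr n j) z)) (J : std j l) w) (d - 1 + (l - w)%N)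
      = join_tail c (sb w id (J : std j l)) (oK I (yo (act (dinr n j) z)) (J : std j l) w) (d - 1 + (l - w)%N).
    rewrite /join_tail; apply: coch_congr_eq => [|u hu]; first by lia.
    rewrite jDs // jD; last by lia.
    rewrite jn_dsum; last by lia.
    case: (leqP u n) => h; first by rewrite jn_did.
    by rewrite jn_comp jn_mkd //; lia.
  congr cp; rewrite /mK /= -act_comp /=; apply: mr_congr => u hu.
  rewrite jDs // jD; last by lia.
  rewrite !jn_comp (jn_mkd m6) // jn_dinr ?jn_le //.
  by case: leqP => h; [lia | congr (_ + jn J _)%N; lia].
rewrite /join_tail /cD scalerBr !scalerDr !scalerN !signE -!scalerN.
rewrite (@sign_odd _ _ (n + l.+1 + l) n.+1); last by lia.
rewrite ![(-1) ^+ (n + l.+1) *: _](@sign_odd _ _ _ (n.+1 + l)); try by lia.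
by rewrite !scalerN opprD addrA addrAC.
Qed.
End JoinCochains.

Lemma cD_pull (k : comPzRingType) (A : dgcat k) (C : sset) (I : nerve_iso C A) N N' (z : C N)
    (B : dmap N' N) W (c : coch (std N) W) l (J : dmap l N') Y d :
  cD I (yo z) c (dcomp B J : std N l) Y d =
  cD I (yo (act B z)) (fun l' (J' : std N' l') => c l' (dcomp B J' : std N l')) (J : std N' l) Y d.
Proof.
have E m f : sb m f (dcomp B J : std N l) = dcomp B (sb m f (J : std N' l)) :> dmap _ _.
  exact: dmap_eq.
rewrite /cD /cR; congr (_ *: (_ - _)); apply: eq_bigr => w _; congr (_ *: (_ - _)).
by rewrite /oK /mK !E /= !act_comp.
Qed.

Section FacetPull.
Variables (k : comPzRingType) (A : dgcat k) (C : sset) (I : nerve_iso C A).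
Variables (N N' n : nat) (x : nat -> C N) (w : C 0) (B : dmap N' N).
Hypothesis B1 : forall u, (u <= n)%N -> (u <= N')%N -> jn B u = u.
Hypothesis B2 : forall u, (n < u)%N -> (u <= N')%N -> (n < jn B u)%N.
Hypothesis nN : (n <= N)%N.
Hypothesis nN' : (n <= N')%N.
Let V (i : nat) := (i <= n.+1)%N.
Hypothesis xc : forall i j, (i < j)%N -> (j <= N.+1)%N -> V i -> V j -> (0 < N)%N ->
  sb N.-1 (bump j.-1) (x i) = sb N.-1 (bump i) (x j).
Variable x' : nat -> C N'.
Hypothesis xE : forall i, (i <= n.+1)%N -> x' i = act B (x i).
Hypothesis xc' : forall i j, (i < j)%N -> (j <= N'.+1)%N -> V i -> V j -> (0 < N')%N ->
  sb N'.-1 (bump j.-1) (x' i) = sb N'.-1 (bump i) (x' j).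

(** [B] fixes the vertices up to [n] and keeps the others beyond [n], so omitting a vertex [i <= n]
    means the same before and after. *)
Lemma missb_pull l (J : dmap l N') i : missb V (dcomp B J) i = missb V J i.
Proof.
apply/missbP/missbP => -[h1 h2 h3]; split; rewrite // ?/V in h2 *; try lia.
  move=> u hu; have := h3 u hu; rewrite jn_comp //; move=> /negP hh; apply/negP => /eqP e; apply: hh; rewrite e B1 //; lia.
move=> u hu; have := h3 u hu; rewrite jn_comp //; have hJ := jn_le J u.
have [h|h] := leqP (jn J u) n; first by rewrite B1.
by have := B2 h hJ; lia.
Qed.

Lemma facet_coch_pull l (J : dmap l N') Y d :
  facet_coch I V x w (dcomp B J : std N l) Y d =
  facet_coch I V x' w (J : std N' l) Y d.
Proof.
have [[i hi]|hn] := excluded_middle_informative (exists i, missb V J i); last first.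
  rewrite !facet_coch0 // => i; apply/negP => hi; apply: hn; exists i => //.
  by rewrite -missb_pull.
have hi' : missb V (dcomp B J) i by rewrite missb_pull.
have V0 : V 0 by [].
have /missbP[_ h2' _] := hi.
rewrite (facet_cochE _ _ V0 xc _ _ hi') (facet_cochE _ _ V0 xc' _ _ hi) xE // -act_comp.
apply: mr_congr => u hu; rewrite jn_comp (jn_sg V0 hi') // (jn_sg V0 hi) //.
have /missbP[h1 h2 h3] := hi; rewrite /V in h2.
case: u hu => [|u] hu; first by rewrite /= B1.
rewrite /= jn_comp // /skipf; have hJ := jn_le J u; have := h3 u hu.
have [h|h] := leqP (jn J u) n; last first.
  have := B2 h hJ => h4 _; have e1 : (i < jn J u)%N by lia.
  have e2 : (i < jn B (jn J u))%N by lia.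
  by rewrite e1 e2 !subSS !subn0.
rewrite B1 // => h4; rewrite B1 //; lia.
Qed.

(** The obstruction on a face containing the vertices up to [n] is that of the restricted facets;
    this is how the obstructions on different joins fit into one cochain. *)
Lemma obstruction_pull Y d : cD I (yo (x 0%N)) (facet_coch I V x w) (B : std N N') Y d =
  cD I (yo (x' 0%N)) (facet_coch I V x' w) (did N' : std N' N') Y d.
Proof.
have -> : (B : std N N') = dcomp B (did N') by exact: dmap_eq.
have E : (fun l' (J' : std N' l') => facet_coch I V x w (dcomp B J' : std N l')) =
    facet_coch I V x' w.
  do 4 (apply: functional_extensionality_dep => ?); exact: facet_coch_pull.
by rewrite cD_pull E xE.
Qed.
End FacetPull.

(** Reduction to a representable shape: the differential at a face of [t] only involves faces of
    [t]. *)
Lemma cD_shape (k : comPzRingType) (A : dgcat k) (C : sset) (I : nerve_iso C A) (K : sset)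
    (p : smap K C) W (c : coch K W) j (t : K j) l (J : dmap l j) Y d :
  cD I (yo (p j t)) (fun l' (J' : std j l') => c l' (act (J' : dmap l' j) t)) (J : std j l) Y d =
  cD I p c (act J t) Y d.
Proof.
have E m f : act (sb m f (J : std j l) : dmap m j) t = sb m f (act J t).
  by rewrite /sb /= act_comp.
rewrite /cD /cR; congr (_ *: (_ - _)); apply: eq_bigr => w _; rewrite -!E.
by rewrite /oK /mK /= !sfun_act.
Qed.

Lemma coch_congr_act (k : comPzRingType) (A : dgcat k) (K : sset) (W : A) (c : coch K W) N
    (x : K N) m m' (J : dmap m N) (J' : dmap m' N) Y i : m = m' ->
  (forall u, (u <= m)%N -> jn J u = jn J' u) -> c m (act J x) Y i = c m' (act J' x) Y i.
Proof. by move=> e; subst m' => h; rewrite (dmap_jn h). Qed.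

(** This serves for naturality: fillings chosen separately for each simplex of a shape fit together,
    because no freedom is left beyond the facets and the components on uncovered faces. *)
Lemma facet_unique (k : comPzRingType) (A : dgcat k) (C : sset) (I : nerve_iso C A) N
    (V : pred nat) (X X' : C N.+1) : V 0 ->
  (forall i, (i <= N.+1)%N -> V i -> sb N (bump i) X = sb N (bump i) X') ->
  sb 0 (fun=> 0%N) X = sb 0 (fun=> 0%N) X' ->
  (forall l (J : dmap l N) Y d, dstrict J -> (forall i, ~~ missb V J i) ->
      Y = obv I X (jn J l).+1 -> d = - l%:Z ->
      mr I (act (dcons J) X) (obv I X 0) Y d = mr I (act (dcons J) X') (obv I X 0) Y d) ->
  X = X'.
Proof.
move=> V0 hf hv ht; have h0 := hf 0%N isT V0.
have ov u : (u <= N.+1)%N -> obv I X u = obv I X' u.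
  case: u => [|u] hu; first by rewrite /obv hv.
  by have := congr1 (fun y => obv I y u) h0; rewrite !obv_sb //; exact: bump_mono.
apply: (simplex_ext (I := I)) => [u hu|l J Y Z d hJ hl eY eZ ed]; first exact: ov.
have [J0|J0] := eqVneq (jn J 0) 0%N; last first.
  have Jp u : (u <= l)%N -> (0 < jn J u)%N.
    by move=> hu; have := @jn_mono _ _ J 0 u isT hu; lia.
  have mf : mono_on l N (fun u => (jn J u).-1).
    split=> [u v h h'|]; first by have := jn_mono J h h'; lia.
    by have := jn_le J l; lia.
  have H (y : C N.+1) : act J y = sb l (fun u => (jn J u).-1) (sb N (bump 0) y).
    rewrite sb_sb //; apply: act_jn_eq => u hu.
    rewrite (jn_mkd (mono_comp (bump_mono _ _) mf)) // /= /bump; have := Jp u hu; lia.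
  by rewrite !H h0.
case: l J hJ hl eY eZ ed J0 => // l J hJ _ eY eZ ed J0.
have Jp u : (u <= l)%N -> (0 < jn J u.+1)%N.
  by move=> hu; have := @jn_strict _ _ J 0 u.+1 hJ isT hu; lia.
pose f u := (jn J u.+1).-1.
have mf : mono_on l N f.
  split=> [u v h h'|]; rewrite /f; first by have := @jn_mono _ _ J u.+1 v.+1 h h'; lia.
  by have := jn_le J l.+1; lia.
pose J' := mkd l N f.
have jJ' u : (u <= l)%N -> jn J' u = f u by move=> hu; rewrite jn_mkd.
have hJ' : dstrict J'.
  apply: dstrict_mkd => // u v huv hvl.
  by have := @jn_strict _ _ J u.+1 v.+1 hJ huv hvl; rewrite /f; have := Jp u; lia.
have H (y : C N.+1) : act J y = act (dcons J') y.
  apply: act_jn_eq => u hu; rewrite jn_cons //.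
  case: u hu => [|u] hu; first by rewrite J0.
  by rewrite /= jJ' // /f; have := Jp u hu; lia.
have eYX : Y = obv I X 0 by rewrite eY jn0 J0.
clear eY; subst Y; rewrite !H.
have [[i hi]|hn] := excluded_middle_informative (exists i, missb V J' i); last first.
  apply: ht => //; [by move=> i; apply/negP => hi; apply: hn; exists i | | by lia].
  by rewrite eZ jnm jJ' // /f prednK ?Jp.
have /missbP[i1 i2 i3] := hi.
have mg : mono_on l.+1 N (fun u => jn (dcons J') u - (i.+1 < jn (dcons J') u))%N.
  split=> [u v h h'|]; first by have := jn_mono (dcons J') h h'; lia.
  have := jn_le (dcons J') l.+1; rewrite jn_cons //=; have := i3 l (leqnn l); have := jn_le J' l; lia.
have HH (y : C N.+1) : act (dcons J') y =
    sb l.+1 (fun u => jn (dcons J') u - (i.+1 < jn (dcons J') u))%N (sb N (bump i.+1) y).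
  rewrite (sb_sb _ (bump_mono _ _) mg); apply: act_jn_eq => u hu.
  rewrite [RHS](jn_mkd (mono_comp (bump_mono _ _) mg)) //.
  rewrite /= /bump jn_cons //; case: u hu => [|u] hu //=; have := i3 u hu; lia.
by rewrite !HH hf.
Qed.

Lemma strict_le m n (a : dmap m n) : dstrict a -> (m <= n)%N.
Proof.
move=> ha; suff h u : (u <= m)%N -> (u <= jn a u)%N by have := h m (leqnn m); have := jn_le a m; lia.
by elim: u => // u IH hu; have := @jn_strict _ _ a u u.+1 ha (leqnn _) hu; have := IH (ltnW hu); lia.
Qed.

Lemma degenerate_std N l (J : dmap l N) : degenerate (J : std N l) -> ~~ dstrict J.
Proof.
case=> m [a [y [hm ->]]]; apply/negP => /= /dstrict_compr /strict_le; lia.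
Qed.

Lemma facet_coch_normal (k : comPzRingType) (A : dgcat k) (C : sset) (I : nerve_iso C A) N
    (V : pred nat) (x : nat -> C N) (w : C 0) : V 0 -> cnormal (facet_coch I V x w).
Proof.
move=> V0 l J Y i hd; have hJ := degenerate_std hd.
have [a ha e] := not_strict_ex hJ.
rewrite /facet_coch; case: pickP => // v hv; rewrite mr_deg //; first by lia.
apply/negP => hs; have := @jn_strict _ _ (sg J v) a.+1 a.+2 hs (leqnn _) ha.
rewrite !(jn_sg V0 hv) //; last by lia.
by rewrite /= /jn e ltnn.
Qed.

Lemma cDZ (k : comPzRingType) (A : dgcat k) (C : sset) (I : nerve_iso C A) (K : sset)
    (p : smap K C) W (c : coch K W) b l (u : K l) Y i :
  cD I p (fun l u Y i => b *: c l u Y i) u Y i = b *: cD I p c u Y i.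
Proof.
rewrite /cD ddZ [RHS]scalerA mulrC -scalerA; congr (_ *: _).
rewrite scalerBr /cR scaler_sumr; congr (_ - _); apply: eq_bigr => v _.
by rewrite cpZr -scalerBr scalerA mulrC -scalerA.
Qed.

Lemma simplex_modify_eq (k : comPzRingType) (A : dgcat k) (C : sset) (I : nerve_iso C A) N
    (Z : C N.+1) W (V : pred nat) (g : coch (std N) W) : W = obv I Z 0 -> V 0%N ->
  (forall l (J : dmap l N) i Y d, missb V J i -> g l (J : std N l) Y d = 0) ->
  (forall l (J : dmap l N) Y d, dstrict J -> (forall i, ~~ missb V J i) ->
    Y = obv I Z (jn J l).+1 -> d = 1 - l%:Z ->
    cD I (yo (sb N (bump 0) Z)) g (J : std N l) Y d = 0) ->
  exists X : C N.+1, [/\ forall i, (i <= N.+1)%N -> V i -> sb N (bump i) X = sb N (bump i) Z,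
    forall i, (i <= N.+1)%N -> sb 0 (fun=> i) X = sb 0 (fun=> i) Z &
    forall l (J : dmap l N) Y d, dstrict J ->
      Y = obv I Z (jn J l).+1 -> d = - l%:Z ->
      mr I (act (dcons J) X) W Y d = mr I (act (dcons J) Z) W Y d + g l (J : std N l) Y d].
Proof. by move=> eW; subst W; exact: simplex_modify. Qed.

(** * Acyclic cones are limits *)

Section Limits.
Variables (k : comPzRingType) (A : dgcat k) (C : sset) (I : nerve_iso C A).
Variables (K : sset) (p : smap K C).

(* The cone [t] on a diagram [p] is a limit when the total cone of the map from
   [Hom(W, L)] to the complex of normalized cochains of [K] is acyclic in degrees <= 0. *)
Definition acyclic_cone (L : A) (lam : coch K L) : Prop :=
  forall W (e e1 : int) (r : dghom W L e1) (rho : coch K W), e <= 0 -> e + 1 = e1 ->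
  dd (e1 + 1) r = 0 -> cnormal rho ->
  (forall l (u : K l) Y i, Y = oK I p u l -> i = e1 - l%:Z ->
     cD I p rho u Y i = cp i (lam l u Y (- l%:Z)) r) ->
  exists (x : dghom W L e) (y : coch K W), [/\ cnormal y, dd e1 x = r &
    forall l (u : K l) Y i, Y = oK I p u l -> i = e - l%:Z ->
     cp i (lam l u Y (- l%:Z)) x - cD I p y u Y i = rho l u Y i].

Definition cone_coch (t : slice p 0) : coch K (ob I (sl_front t)) :=
  fun l u Y i => mr I (sl_join t u) (ob I (sl_front t)) Y i.

Lemma sl_join_sb m n f (s : slice p n) j (u : K j) :
  sl_join (sb m f s) u = act (dsum (mkd m n f) (did j)) (sl_join s u).
Proof. by []. Qed.

Lemma sl_face n (s : slice p n.+1) i j (u : K j) : (i <= n.+1)%N ->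
  sl_join (sb n (bump i) s) u = sb (n + j.+1) (bump i) (sl_join s u).
Proof. by move=> hi; rewrite sl_join_sb dsum_bump. Qed.

Lemma sl_last n (s : slice p n) j (u : K j) :
  sl_join (sb 0 (fun=> n) s) u = sb (0 + j.+1) (addn n) (sl_join s u).
Proof.
rewrite sl_join_sb /sb; congr act; apply: dmap_jn => v hv.
rewrite jn_dsum // [RHS]jn_mkd //; last by mono.
by case: leqP => h; [rewrite jn_mkd //; lia | rewrite jn_did; lia].
Qed.

Lemma sl_join0 (s : slice p 0) j (u : K j) : sb j (bump 0) (sl_join s u : C (0 + j.+1)%N) = p j u.
Proof. by rewrite -(sl_inr s u) dinrE. Qed.

Lemma join_compat n (s : nat -> slice p n) j (u : K j) a b : compat_facets s ->
  (a < b)%N -> (b <= n.+1)%N ->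
  sb (n + j.+1).-1 (bump b.-1) (sl_join (s a) u) = sb (n + j.+1).-1 (bump a) (sl_join (s b) u).
Proof.
case: n s => [|n] s sc hab hb.
  have -> : a = 0%N by lia.
  have -> : b = 1%N by lia.
  by rewrite [LHS]sl_join0 [RHS]sl_join0.
have := congr1 (fun x : slice p n => sl_join x u) (sc a b hab hb isT).
by rewrite !sl_face //; lia.
Qed.

Section Glue.
Variables (n : nat) (s : nat -> slice p n) (t : slice p 0) (w : C 0).
Hypothesis sc : compat_facets s.
Hypothesis slast : sb 0 (fun=> n) (s 0%N) = t.
Hypothesis vert : forall i, (0 < i)%N -> (i <= n.+1)%N -> sb 0 (fun=> 0%N) (sl_front (s i)) = w.
Let V (i : nat) := (i <= n.+1)%N.
(** [fr] and [X0 u] are the given facets [0, ..., n + 1] of the simplices to be found: the front,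
    and its join with each simplex [u] of [K]. *)
Let fr i : C n := sl_front (s i).
Let X0 j (u : K j) i : C (n + j.+1)%N := sl_join (s i) u.
Let L := ob I (sl_front t).
Let W := ob I w.

Let V0 : V 0. Proof. by []. Qed.

Let frc i j : (i < j)%N -> (j <= n.+1)%N -> V i -> V j -> (0 < n)%N ->
  sb n.-1 (bump j.-1) (fr i) = sb n.-1 (bump i) (fr j).
Proof. by move=> hij hj _ _ n0; exact: (congr1 (fun x => sl_front x) (sc hij hj n0)). Qed.

Let X0c j (u : K j) a b : (a < b)%N -> (b <= (n + j.+1).+1)%N -> V a -> V b ->
  (0 < n + j.+1)%N ->
  sb (n + j.+1).-1 (bump b.-1) (X0 u a) = sb (n + j.+1).-1 (bump a) (X0 u b).
Proof. by move=> hab _ _ Vb _; exact: join_compat. Qed.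

Let frv i : (0 < i)%N -> (i <= n.+1)%N -> V i -> sb 0 (fun=> 0%N) (fr i) = w.
Proof. by move=> h1 h2 _; exact: vert. Qed.

Let frX j (u : K j) i : fr i = act (dinl n j) (X0 u i).
Proof. by rewrite /X0 sl_inl. Qed.

Let X0v j (u : K j) i : (0 < i)%N -> (i <= (n + j.+1).+1)%N -> V i ->
  sb 0 (fun=> 0%N) (X0 u i) = w.
Proof.
move=> h1 _ h2; rewrite -(vert h1 h2) -/(fr i) (frX u) dinlE -/(sb _ _ _) sb_sb //.
by mono.
Qed.

Let X0act i j (b : dmap i j) (u : K j) a : X0 (act b u) a = act (dsum (did n) b) (X0 u a).
Proof. exact: sl_nat. Qed.

(** The obstructions [omF] on the front and [om1] on the simplices of [K] form a cocycle of the
    total cone of [acyclic_cone]. *)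
Let omF Y d := cD I (yo (fr 0%N)) (facet_coch I V fr w) (did n : std n n) Y d.
Let om j (u : K j) : coch (std (n + j.+1)) W := cD I (yo (X0 u 0%N)) (facet_coch I V (X0 u) w).
Let om1 : coch K W := fun j u Y d => om u (did (n + j.+1) : std (n + j.+1) _) Y d.
(** Set to 0 at the wrong objects, because normality quantifies over all of them. *)
Let rho : coch K W := fun j u Y d =>
  if excluded_middle_informative (Y = oK I p u j) then om1 u Y d else 0.

Let rhoE j (u : K j) Y d : Y = oK I p u j -> rho u Y d = om1 u Y d.
Proof. by move=> h; rewrite /rho; case: excluded_middle_informative. Qed.

Let om_front j (u : K j) Y d : om u (dinl n j : std (n + j.+1) n) Y d = omF Y d.
Proof.
apply: (@obstruction_pull _ _ _ I _ _ n _ _ (dinl n j)).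
- by move=> v h1 h2; rewrite jn_dinl.
- by move=> v h1 h2; lia.
- by lia.
- by [].
- exact: X0c.
- by move=> i _; exact: frX.
- exact: frc.
Qed.

Let om_join i j (b : dmap i j) (u : K j) Y d :
  om u (dsum (did n) b : std (n + j.+1) (n + i.+1)%N) Y d = om1 (act b u) Y d.
Proof.
apply: (@obstruction_pull _ _ _ I _ _ n _ _ (dsum (did n) b)).
- by move=> v h1 h2; rewrite jn_dsum // h1 jn_did.
- by move=> v h1 h2; rewrite jn_dsum //; case: (leqP v n) => h; lia.
- by lia.
- by lia.
- exact: X0c.
- by move=> a _; exact: X0act.
- exact: X0c.
Qed.

Let om_vanish j (u : K j) : join_vanish I (X0 u 0%N) (om u) 1.
Proof.
move=> l J Z d i hJ hi hm eZ ed.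
have hi' : missb V J i by apply/missbP; split=> //; lia.
by apply: (facet_cD V0 (@X0c j u) (@X0v j u) hi') => //; rewrite oz_jn.
Qed.

Let eL : L = obv I (fr 0%N) n.
Proof. by rewrite /L -slast /=. Qed.

Let lam_join j (u : K j) : sb (0 + j.+1) (addn n) (X0 u 0%N) = sl_join t u.
Proof. by rewrite -slast sl_last. Qed.

Let eLX j (u : K j) : L = obv I (X0 u 0%N) n.
Proof. by rewrite eL (frX u) obv_jn // jn_dinl. Qed.

Let omF_closed : dd (1 - n%:Z + 1) (omF L (1 - n%:Z)) = 0.
Proof.
have := @cD_cD _ _ _ I _ (yo (fr 0%N)) _ (facet_coch I V fr w) n (did n : std n n) L (1 - n%:Z + 1).
rewrite oz_jn // jn_did // => /(_ eL).
rewrite cD_proper ?addrK; [|by rewrite oz_jn // jn_did|].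
  by move=> /(congr1 (fun v => (-1) ^+ n *: v)); rewrite signK scaler0.
move=> l J Z j hl hJ eZ ej.
have hJ' : dstrict (dcomp (did n) J) by rewrite (_ : dcomp _ _ = J) //; exact: dmap_eq.
have [i /missbP[h1 h2 h3]] := proper_miss hJ' hl.
have hi : missb V (dcomp (did n) J) i by apply/missbP; split.
by apply: (facet_cD V0 frc frv hi) => //; lia.
Qed.

(** This is [cD_cD] on the join, read through [cD_join]. *)
Let rho_cD j (u : K j) Y i : Y = oK I p u j -> i = 1 - n%:Z - j%:Z ->
  cD I p rho u Y i = cp i (cone_coch t u Y (- j%:Z)) (omF L (1 - n%:Z)).
Proof.
move=> eY ei; pose z := X0 u 0%N.
have eYz : Y = obv I z (n.+1 + jn (did j) j).
  by rewrite eY /oK -(sl_inr (s 0%N) u) obv_jn // jn_dinr // jn_did.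
have ed : i = 1 - (n + j)%N%:Z by lia.
have := cD_join (@om_vanish j u) (dstrict_did j) eYz (eLX u) ed.
rewrite {1}/om cD_cD; last first.
  rewrite oz_jn // jn_dsum //; case: leqP => h; first by lia.
  by rewrite eYz; congr (obv _ _ (_ + jn _ _)%N); lia.
move/(congr1 (fun v => (-1) ^+ n.+1 *: v)); rewrite scaler0 signK => /esym/eqP; rewrite subr_eq0 => /eqP.
rewrite om_front lam_join dsum_id act_id.
have -> : i + j%:Z = 1 - n%:Z by lia.
move=> <-; rewrite -[u in LHS]act_id -(cD_shape I p rho u (did j)).
rewrite -(sl_inr (s 0%N) u) /join_tail; apply: cD_ext.
  by rewrite eY oz_jn // jn_did // /oK -(sl_inr (s 0%N) u).
move=> l J Z d hJ eZ _.
have eJ : act J (did j : std j j) = J by exact: dmap_eq.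
rewrite eJ in eZ *; rewrite rhoE -?om_join //.
by rewrite eZ /oK /= sfun_act -(sl_inr (s 0%N) u).
Qed.

Let rho_normal : cnormal rho.
Proof.
move=> j u Y d [m [a [y [hm eu]]]]; subst u; rewrite /rho.
case: excluded_middle_informative => // eY; rewrite -om_join.
apply: cD_normal; first exact: facet_coch_normal.
  rewrite eY oz_jn // /oK -(sl_inr (s 0%N) (act a y)) obv_jn // jn_dinr //.
  rewrite -/(X0 _ _) X0act obv_jn; last by lia.
  by congr obv; congr jn; lia.
exists (n + m.+1)%N, (dsum (did n) a), (did (n + m.+1)); split; first by lia.
exact: dmap_eq.
Qed.

Section Tops.
Variables (x : dghom W L (- n%:Z)) (y : coch K W).
Hypothesis yn : cnormal y.

Definition gF : coch (std n) W := fun l J Z d =>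
  if [forall i : 'I_n.+1, ~~ missb V (J : dmap l n) i] then hc W Z d x else 0.

Lemma gF0 l (J : dmap l n) i Z d : missb V J i -> gF (J : std n l) Z d = 0.
Proof.
  by move=> hi; rewrite /gF; case: covP => // /(_ i); rewrite hi.
Qed.

Lemma gFid d : gF (did n : std n n) L d = hc W L d x.
Proof.
  rewrite /gF; case: covP => // -[] i; apply/negP => /missbP[h3 h4] /(_ i h3).
  by rewrite jn_did // eqxx.
Qed.

Lemma top l (J : dmap l n) : dstrict J -> (forall i, ~~ missb V J i) ->
    l = n /\ forall u, (u <= l)%N -> jn J u = u.
Proof.
  by move=> hJ hm; apply: strict_id => // i hi; apply: (hitP (hm i)).
Qed.

Definition tl j l (J : dmap l (n + j.+1)) : dmap (l - n.+1) j :=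
  mkd (l - n.+1) j (fun u => jn J (u + n.+1) - n.+1)%N.

(** The correction is [x] on the front and, on the join of the front with a face of [u], the value
    of [y] at that face, which [tl] recovers. *)
Definition g j (u : K j) : coch (std (n + j.+1)) W := fun l J Z d =>
  if [forall i : 'I_(n + j.+1).+1, ~~ missb V (J : dmap l _) i] then
    (if (l <= n)%N then hc W Z d x else y (act (tl (J : dmap l _)) u) Z d) else 0.

Lemma g0 j (u : K j) l (J : dmap l (n + j.+1)) i Z d : missb V J i -> g u (J : std (n + j.+1) l) Z d = 0.
Proof.
  by move=> hi; rewrite /g; case: covP => // /(_ i); rewrite hi.
Qed.

Lemma covE j l (J : dmap l (n + j.+1)) : (forall i, (i <= n)%N -> exists2 v, (v <= l)%N & jn J v = i) ->
    forall i, ~~ missb V J i.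
Proof.
  move=> h i; apply/negP => /missbP[h1 h2 h3]; have [v hv ev] := h i h2.
  by have := h3 v hv; rewrite ev eqxx.
Qed.

Lemma gdl j (u : K j) Z d : g u (dinl n j : std (n + j.+1) n) Z d = hc W Z d x.
Proof.
  rewrite /g leqnn; case: covP => // -[]; apply: covE => i hi; exists i => //.
  by rewrite jn_dinl.
Qed.

Lemma gds j (u : K j) l2 (J2 : dmap l2 j) Z d :
    g u (dsum (did n) J2 : std (n + j.+1) (n + l2.+1)%N) Z d = y (act J2 u) Z d.
Proof.
  rewrite /g; case: covP => [_|[]]; last first.
    by apply: covE => i hi; exists i; [lia | rewrite jn_dsum ?hi ?jn_did //; lia].
  rewrite (_ : (n + l2.+1 <= n)%N = false); last by lia.
  apply: coch_congr_act => [|v hv]; first by lia.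
  rewrite jn_mkd //.
    rewrite jn_dsum; last by lia.
    by rewrite (_ : (v + n.+1 <= n)%N = false) ?addnK ?addKn //; lia.
  split=> [a b h h'|]; last by have := jn_le (dsum (did n) J2) (n + l2.+1 - n.+1 + n.+1); lia.
  have := @jn_mono _ _ (dsum (did n) J2) (a + n.+1) (b + n.+1); lia.
Qed.

Lemma coverX j l (J : dmap l (n + j.+1)) : (forall i, ~~ missb V J i) ->
    forall i, (i <= n)%N -> exists2 v, (v <= l)%N & jn J v = i.
Proof.
  by move=> hm i hi; apply: (hitP (hm i)); [lia | exact: hi].
Qed.

Lemma gv j (u : K j) b : join_vanish I (X0 u 0%N) (g u) b.
Proof.
move=> l J Z d i hJ hi hm eZ ed; have h : missb V J i by apply/missbP; split=> //; lia.
exact: g0 h.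
Qed.

Definition tops_front (F : C n.+1) : Prop :=
  [/\ forall i, (i <= n.+1)%N -> V i -> sb n (bump i) F = fr i,
      sb 0 (fun=> 0%N) F = w &
      forall l (J : dmap l n) Y d, dstrict J -> (forall i, ~~ missb V J i) ->
      Y = obv I (fr 0%N) (jn J l) -> d = - l%:Z -> mr I (act (dcons J) F) W Y d = gF (J : std n l) Y d].

Definition tops_join j (u : K j) (X : C (n + j.+1).+1) : Prop :=
  [/\ forall i, (i <= n.+1)%N -> sb (n + j.+1) (bump i) X = X0 u i,
      sb 0 (fun=> 0%N) X = w &
      forall l (J : dmap l (n + j.+1)) Y d, dstrict J -> (forall i, ~~ missb V J i) ->
      Y = obv I (X0 u 0%N) (jn J l) -> d = - l%:Z ->
      mr I (act (dcons J) X) W Y d = g u (J : std _ l) Y d].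

(** The fillings are chosen independently for every [u]. Their faces have the same given facets and
    the same components, taken from [x] and [y], so [facet_unique] yields compatibility with the
    front and with all simplicial operators; normality of [y] takes care of the degenerate ones. *)
Lemma assemble_slice : (exists F, tops_front F) -> (forall j (u : K j), exists X, tops_join u X) ->
  exists X : slice p n.+1, (forall i, (i <= n.+1)%N -> sb n (bump i) X = s i) /\
    tops_front (sl_front X) /\ forall j (u : K j), tops_join u (sl_join X u).
Proof.
move=> [F [Ff Fv Ft]] XX.
pose Xf j (u : K j) := proj1_sig (constructive_indefinite_description _ (XX j u)).
have Xs j (u : K j) := proj2_sig (constructive_indefinite_description _ (XX j u)).
rewrite -/(Xf _ _) in Xs.
have Xo j (u : K j) v : (v <= n + j.+1)%N -> obv I (Xf j u) v.+1 = obv I (X0 u 0%N) v.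
  have [h1 _ _] := Xs j u; move=> hv; rewrite -(h1 0%N) // obv_sb //; exact: bump_mono.
have Xw j (u : K j) : obv I (Xf j u) 0 = W by have [_ h2 _] := Xs j u; rewrite /obv h2.
have Xfront j (u : K j) : act (dinl n.+1 j) (Xf j u) = F.
  have [h1 h2 h3] := Xs j u.
  have hfc i : (i <= n.+1)%N -> sb n (bump i) (act (dinl n.+1 j) (Xf j u)) = fr i.
    move=> hi; rewrite (frX u) -h1 // /sb -!act_comp; apply: act_jn_eq => v hv.
    rewrite jn_comp (jn_mkd (bump_mono n i)) // jn_dinl; last by rewrite /bump; lia.
    by rewrite jn_comp jn_dinl // (jn_mkd (bump_mono (n + j.+1) i)) //; lia.
  have hw : sb 0 (fun=> 0%N) (act (dinl n.+1 j) (Xf j u)) = w.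
    rewrite -h2 /sb -act_comp; apply: act_jn_eq => v hv.
    by rewrite jn_comp !jn_mkd // jn_dinl.
  have eW : obv I (act (dinl n.+1 j) (Xf j u)) 0 = W by rewrite /obv hw.
  apply: (@facet_unique _ _ _ I n V) => //.
  - by move=> i hi _; rewrite hfc // Ff.
  - by rewrite hw Fv.
  move=> l J Y d hJ hm eY ed; rewrite eW -act_comp.
  have [el eJ] := top hJ hm; subst l.
  have {}eJ : J = did n by apply: dmap_jn => v hv; rewrite eJ // jn_did.
  subst J; have eYL : Y = L.
    rewrite eY jn_did // eL -(hfc 0%N) // obv_sb //; exact: bump_mono.
  rewrite (@mr_congr _ _ _ I _ _ _ (dcons (dinl n j))); last first.
    move=> v hv; rewrite jn_comp !jn_cons // jn_dinl.
      by case: v hv => [|v] hv //=; rewrite jn_did // jn_dinl.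
    by case: v hv => [|v] hv //=; rewrite jn_did.
  have hcv : forall i, ~~ missb V (dinl n j) i by apply: covE => i hi; exists i => //; rewrite jn_dinl.
  have eY2 : Y = obv I (X0 u 0%N) (jn (dinl n j) n) by rewrite jn_dinl // -eLX.
  rewrite (h3 n (dinl n j) Y d (dinl_strict n j) hcv eY2 ed) gdl eYL Ft ?gFid //.
  by rewrite jn_did // -eL.
have Xnat i j (b : dmap i j) (u : K j) : Xf i (act b u) = act (dsum (did n.+1) b) (Xf j u).
  have [h1 h2 h3] := Xs _ (act b u); have [k1 k2 k3] := Xs _ u.
  have jb v : (v <= (n + i.+1).+1)%N -> jn (dsum (did n.+1) b) v =
      if (v <= n.+1)%N then v else (n.+2 + jn b (v - n.+2))%N.
    by move=> hv; rewrite jn_dsum //; case: (leqP v n.+1) => h //; rewrite jn_did.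
  have jb' v : (v <= n + i.+1)%N -> jn (dsum (did n) b) v =
      if (v <= n)%N then v else (n.+1 + jn b (v - n.+1))%N.
    by move=> hv; rewrite jn_dsum //; case: (leqP v n) => h //; rewrite jn_did.
  have hw : sb 0 (fun=> 0%N) (act (dsum (did n.+1) b) (Xf j u)) = w.
    rewrite -k2 /sb -act_comp; apply: act_jn_eq => v hv.
    by rewrite jn_comp !jn_mkd // jb.
  apply: (@facet_unique _ _ _ I (n + i.+1) V) => //.
  - move=> a _ ha; rewrite h1 // X0act -k1 // /sb -!act_comp; apply: act_jn_eq => v hv.
    have E1 : jn (mkd (n + i.+1) (n + i.+1).+1 (bump a) : dmap (n + i.+1) (n.+1 + i.+1)) v = bump a v.
      exact: (jn_mkd (bump_mono _ _) hv).
    have E2 : (jn (dsum (did n) b) v <= n + j.+1)%N.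
      by rewrite jb' //; case: (leqP v n) => h; [lia | have := jn_le b (v - n.+1); lia].
    transitivity (jn (dsum (did n.+1) b) (bump a v)); last first.
      by rewrite -E1; symmetry; exact: (jn_comp (dsum (did n.+1) b)).
    transitivity (bump a (jn (dsum (did n) b) v)).
      exact: (etrans (jn_comp _ _ _) (jn_mkd (bump_mono _ _) E2)).
    symmetry; rewrite jb; last by rewrite /bump; lia.
    rewrite jb' //.
    rewrite /V in ha; rewrite /bump; case: (leqP v n) => h.
      by rewrite (_ : ((a <= v) + v <= n.+1)%N = true) //; lia.
    rewrite (_ : ((a <= v) + v <= n.+1)%N = false); last by lia.
    rewrite (_ : ((a <= v) + v - n.+2 = v - n.+1)%N); last by lia.
    lia.
  - by rewrite h2 hw.
  move=> l J Y d hJ hm eY ed; rewrite Xw h3 //; last by rewrite -Xo ?jn_le.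
  rewrite -act_comp (@mr_congr _ _ _ I _ _ _ (dcons (dcomp (dsum (did n) b) J))); last first.
    move=> v hv; rewrite jn_comp !jn_cons //; case: v hv => [|v] hv; first by rewrite jb.
    have hJv := jn_le J v; rewrite /= jn_comp jb; last by lia.
    rewrite jb' //; case: (leqP (jn J v) n) => h.
      by rewrite (_ : ((jn J v).+1 <= n.+1)%N = true).
    by rewrite (_ : ((jn J v).+1 <= n.+1)%N = false) ?subSS //; lia.
  have hit := coverX hm.
  have [[el eJ]|[l2 [el [J2 [hJ2 eJ]]]]] := strict_cover_join hJ hit; subst l.
    have {}eJ : J = dinl n i by apply: dmap_jn.
    subst J; have -> : dcomp (dsum (did n) b) (dinl n i) = dinl n j.
      by apply: dmap_jn => v hv; rewrite jn_comp jn_dinl // jb' ?hv ?jn_dinl //; lia.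
    have hcv : forall a, ~~ missb V (dinl n j) a by apply: covE => a ha; exists a => //; rewrite jn_dinl.
    have eY2 : Y = obv I (X0 u 0%N) (jn (dinl n j) n).
      rewrite eY !jn_dinl // Xo; last by lia.
      by rewrite -!eLX.
    by rewrite gdl (k3 n (dinl n j) Y d (dinl_strict n j) hcv eY2 ed) gdl.
  have {}eJ : J = dsum (did n) J2 by apply: dmap_jn.
  subst J; have -> : dcomp (dsum (did n) b) (dsum (did n) J2) = dsum (did n) (dcomp b J2).
    by rewrite -dsum_comp; congr dsum; exact: dmap_eq.
  rewrite gds -act_comp; have [hs|hs] := boolP (dstrict (dcomp b J2)).
    have hcv : forall a, ~~ missb V (dsum (did n) (dcomp b J2)) a.
      by apply: covE => a ha; exists a; [lia | rewrite jn_dsum ?ha ?jn_did //; lia].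
    have eY2 : Y = obv I (X0 u 0%N) (jn (dsum (did n) (dcomp b J2)) (n + l2.+1)).
      rewrite eY Xo ?jn_le // X0act obv_jn ?jn_le // -jn_comp.
      by congr (obv _ _ (jn _ _)); rewrite -dsum_comp; congr dsum; exact: dmap_eq.
    by rewrite (k3 _ _ Y d (dsum_strict n hs) hcv eY2 ed) gds.
  rewrite yn; last exact: degenerate_act.
  rewrite mr_deg //; first by lia.
  apply: contra hs => hs; apply: strict_jn => a a' haa ha'.
  have := @jn_strict _ _ _ (a + n.+2) (a' + n.+2) hs.
  have jc v : (v <= l2)%N -> jn (dcons (dsum (did n) (dcomp b J2))) (v + n.+2) = (n.+2 + jn (dcomp b J2) v)%N.
    move=> hv; rewrite jn_cons; last by lia.
    rewrite [(v + n.+2)%N]addnS /= jn_dsum; last by lia.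
    rewrite (_ : (v + n.+1 <= n)%N = false); last by lia.
    by rewrite addnK.
  rewrite !jc //; lia.
have Xinr j (u : K j) : act (dinr n.+1 j) (Xf j u) = p j u.
  have [h1 _ _] := Xs j u.
  rewrite -(sl_inr (s 0%N) u) -/(X0 u 0%N) -h1 // /sb -act_comp; apply: act_jn_eq => v hv.
  by rewrite jn_comp jn_dinr // (jn_mkd (bump_mono _ _)) jn_dinr //=; rewrite /bump /=; lia.
exists (@SliceSimplex K C p n.+1 F Xf Xnat Xfront Xinr); split; last by split; [split | exact: Xs].
move=> i hi.
apply: slice_simplex_eq => [|j u]; first exact: Ff.
have [h1 _ _] := Xs j u.
by rewrite [LHS]sl_face //= h1.
Qed.
End Tops.

(** Acyclicity applied to the obstruction cocycle gives the missing components [x] and [y]. The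
    factor [(-1)^(n + 1)] compensates the sign in [cD_join]. *)
Lemma glue_slice : acyclic_cone (cone_coch t) ->
  exists X : slice p n.+1, forall i, (i <= n.+1)%N -> sb n (bump i) X = s i.
Proof.
move=> hac.
have e1 : - n%:Z + 1 = 1 - n%:Z by rewrite addrC.
have [||||x [y [yn hx hy]]] := hac W (- n%:Z) (1 - n%:Z) ((-1) ^+ n.+1 *: omF L (1 - n%:Z))
  (fun j u Y d => (-1) ^+ n.+1 *: rho u Y d) _ e1.
- by lia.
- by rewrite ddZ omF_closed scaler0.
- by move=> j u Y d hd; rewrite rho_normal ?scaler0.
- by move=> l u Y i eY ei; rewrite cpZr -rho_cD // cDZ.
have FF : exists F, tops_front x F.
    have [l J Z d hJ hm eZ ed|F [Ff Fv Ft]] := facet_glue V0 frc frv (g := gF x) (@gF0 x).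
    have [el eJ] := top hJ hm; subst l.
    have {}eJ : J = did n by apply: dmap_jn => u hu; rewrite eJ // jn_did.
    subst J; rewrite oz_jn // jn_did // -eL in eZ; subst Z d.
    rewrite cD_proper; [|by rewrite oz_jn // jn_did|]; last first.
      move=> l' J' Z' j' hl hJ' eZ' ej'.
      have hJ'' : dstrict (dcomp (did n) J') by rewrite (_ : dcomp _ _ = J') //; exact: dmap_eq.
      have [i /missbP[h1 h2 h3]] := proper_miss hJ'' hl; have h : missb V (dcomp (did n) J') i by apply/missbP; split.
    exact: gF0 h.
    have e2 : 1 - n%:Z - 1 = - n%:Z by lia.
    by rewrite gFid e2 hc_id hx signE -signr_odd oddD /= addbN addbb expr1 scaleN1r.
  by exists F.
have XX j (u : K j) : exists X, tops_join x y u X.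
  have [l J i Z d|l J Z d hJ hm eZ ed|X [X1 X2 X3]] := facet_glue V0 (@X0c j u) (@X0v j u) (g := g x y u).
  - by move=> h; exact: g0 h.
  - have hit := coverX hm.
    have [[el eJ]|[l2 [el [J2 [hJ2 eJ]]]]] := strict_cover_join hJ hit; subst l.
      have {}eJ : J = dinl n j by apply: dmap_jn.
      subst J; rewrite oz_jn // jn_dinl // -eLX in eZ; subst Z d.
      have e3 : 1 - n%:Z = 0 - n%:Z + 1 by lia.
      rewrite (cD_dinl (@gv x y j u 0) (eLX u) e3).
      have e2 : 1 - n%:Z - 1 = - n%:Z by lia.
      rewrite gdl e2 hc_id hx -[X in _ = - X]/(om u _ L _) om_front.
      by rewrite signE -signr_odd oddD /= addbN addbb expr1 scaleN1r.
    have {}eJ : J = dsum (did n) J2 by apply: dmap_jn.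
    subst J; rewrite -[X in _ = - X]/(om u _ Z d) om_join.
    have eZ1 : Z = oK I p (act J2 u) l2.
      rewrite eZ oz_jn // /oK sfun_act -(sl_inr (s 0%N) u) obv_jn // obv_jn ?jn_le //.
      rewrite jn_dinr ?jn_le // jn_dsum //; case: (leqP (n + l2.+1) n) => h; first by lia.
      by congr (obv _ _ (_ + jn _ _)%N); lia.
    have eZ2 : Z = obv I (X0 u 0%N) (n.+1 + jn J2 l2).
      by rewrite eZ1 /oK sfun_act -(sl_inr (s 0%N) u) obv_jn // obv_jn ?jn_le // jn_dinr ?jn_le.
    have ed2 : d = 0 - (n + l2)%N%:Z by lia.
    rewrite (cD_join (@gv x y j u 0) hJ2 eZ2 (eLX u) ed2) lam_join -sl_nat.
    rewrite gdl (_ : d + l2%:Z = - n%:Z); last by lia.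
    rewrite hc_id.
    have -> : join_tail (g x y u) = (fun l' (J' : std j l') => y l' (act (J' : dmap l' j) u)).
      by do 4 (apply: functional_extensionality_dep => ?); exact: gds.
    rewrite -[act (dinr n j) _]/(act (dinr n j) (sl_join (s 0%N) u)) sl_inr (cD_shape I p y).
    have E := hy l2 (act J2 u) Z d eZ1; rewrite /cone_coch -/L in E.
    rewrite -opprB E; last by lia.
    by rewrite scalerN signK rhoE.
  by exists X; split=> // i hi; apply: X1 => //; lia.
have [X [hX _]] := assemble_slice yn FF XX.
by exists X.
Qed.

(** The pair [(r, c)] is a cocycle of the total cone; adding it to the components on uncovered faces
    does not affect the boundary. *)
Lemma modify_slice (Z : slice p n.+1) (r : dghom W L (- n%:Z)) (c : coch K W) :
  (forall i, (i <= n.+1)%N -> sb n (bump i) Z = s i) -> cnormal c -> dd (1 - n%:Z) r = 0 ->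
  (forall j (u : K j) Y i, Y = oK I p u j -> i = - n%:Z - j%:Z ->
     cD I p c u Y i = cp i (cone_coch t u Y (- j%:Z)) r) ->
  exists R : slice p n.+1, [/\ forall i, (i <= n.+1)%N -> sb n (bump i) R = s i,
    mr I (sl_front R) W L (- n%:Z) = mr I (sl_front Z) W L (- n%:Z) + r &
    forall j (u : K j) Y d, Y = oK I p u j -> d = - (n + j.+1)%N%:Z ->
      mr I (sl_join R u) W Y d = mr I (sl_join Z u) W Y d + c j u Y d].
Proof.
move=> hZ cn hr hc'.
pose x := mr I (sl_front Z) W L (- n%:Z) + r.
pose y : coch K W := fun j u Y d => mr I (sl_join Z u) W Y d + c j u Y d.
have yn : cnormal y.
  move=> j u Y d hu; rewrite /y cn // addr0; case: hu => m [a [v [hm ->]]].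
  rewrite sl_nat mr_deg //; first by lia.
  by apply/negP => /strict_le; lia.
have Zf i : (i <= n.+1)%N -> sb n (bump i) (sl_front Z) = fr i by move=> hi; rewrite /fr -hZ.
have Zj j (u : K j) i : (i <= n.+1)%N -> sb (n + j.+1) (bump i) (sl_join Z u) = X0 u i.
  by move=> hi; rewrite /X0 -hZ // sl_face.
have Zw : sb 0 (fun=> 0%N) (sl_front Z) = w.
  rewrite -(vert (i := n.+1)) // -/(fr _) -Zf // sb_sb //; exact: bump_mono.
have Zjw j (u : K j) : sb 0 (fun=> 0%N) (sl_join Z u) = w.
  by rewrite -Zw -(sl_inl Z u) dinlE -/(sb _ _ _) sb_sb //; mono.
have did_top (N : nat) (X : C N.+1) : act (dcons (did N)) X = X.
  rewrite -[RHS]act_id; apply: act_jn_eq => u hu; rewrite jn_did // jn_cons //.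
  by case: u hu => [|u] hu //=; rewrite jn_did.
have FF : exists F, tops_front x F.
  have [||l J i Z' d hi|l J Y d hJ hm eY ed|F [F1 F2 F3]] :=
    @simplex_modify_eq _ _ _ I n (sl_front Z) W V (gF r) => //.
  - by rewrite /obv Zw.
  - exact: gF0 hi.
  - have [el eJ] := top hJ hm; subst l.
    have {}eJ : J = did n by apply: dmap_jn => u hu; rewrite eJ // jn_did.
    have eY' : Y = L by rewrite eY eJ jn_did // eL -(Zf 0%N) // obv_sb //; exact: bump_mono.
    clear eY; subst J Y d; rewrite Zf //.
    rewrite cD_proper; [|by rewrite oz_jn // jn_did|]; last first.
      move=> l' J' Z' j' hl hJ' eZ' ej'.
      have hJ'' : dstrict (dcomp (did n) J') by rewrite (_ : dcomp _ _ = J') //; exact: dmap_eq.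
      have [i /missbP[h1 h2 h3]] := proper_miss hJ'' hl; have h : missb V (dcomp (did n) J') i by apply/missbP; split.
      exact: gF0 h.
    have e2 : 1 - n%:Z - 1 = - n%:Z by lia.
    by rewrite gFid e2 hc_id hr scaler0.
  exists F; split; [by move=> i hi Vi; rewrite F1 // Zf|by rewrite F2|].
  move=> l J Y d hJ hm eY ed; have [el eJ] := top hJ hm; subst l.
  have {}eJ : J = did n by apply: dmap_jn => u hu; rewrite eJ // jn_did.
  have eY' : Y = L by rewrite eY eJ jn_did.
  rewrite F3 //; last by rewrite eY -(Zf 0%N) // obv_sb ?jn_le //; exact: bump_mono.
  by subst J; clear eY; subst Y d; rewrite !gFid !hc_id did_top.
have [j u|R [hR [[R1 R2 R3] RJ]]] := assemble_slice yn FF.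
  have [||l J i Z' d hi|l J Y d hJ hm eY ed|X [X1 X2 X3]] :=
    @simplex_modify_eq _ _ _ I (n + j.+1) (sl_join Z u) W V (g r c u) => //.
  - by rewrite /obv Zjw.
  - exact: g0 hi.
  - have hit := coverX hm.
    have oX v : (v <= n + j.+1)%N -> obv I (sl_join Z u) v.+1 = obv I (X0 u 0%N) v.
      by move=> hv; rewrite -(Zj _ u 0%N) // obv_sb //; exact: bump_mono.
    rewrite oX ?jn_le // in eY; rewrite Zj //.
    have [[el eJ]|[l2 [el [J2 [hJ2 eJ]]]]] := strict_cover_join hJ hit; subst l.
      have {}eJ : J = dinl n j by apply: dmap_jn.
      subst J; rewrite jn_dinl // -eLX in eY; subst Y d.
      have e2 : 1 - n%:Z - 1 = - n%:Z by lia.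
      have e3 : 1 - n%:Z = 0 - n%:Z + 1 by lia.
      by rewrite (cD_dinl (@gv r c j u 0) (eLX u) e3) gdl e2 hc_id hr scaler0.
    have {}eJ : J = dsum (did n) J2 by apply: dmap_jn.
    subst J; have eZ2 : Y = obv I (X0 u 0%N) (n.+1 + jn J2 l2).
      rewrite eY jn_dsum //; case: (leqP (n + l2.+1) n) => h; first by lia.
      by congr (obv _ _ (_ + jn _ _)%N); lia.
    have eZ1 : Y = oK I p (act J2 u) l2.
      by rewrite eZ2 /oK sfun_act -(sl_inr (s 0%N) u) obv_jn // obv_jn ?jn_le // jn_dinr ?jn_le.
    have ed2 : d = 0 - (n + l2)%N%:Z by lia.
    rewrite (cD_join (@gv r c j u 0) hJ2 eZ2 (eLX u) ed2) lam_join -sl_nat.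
    rewrite gdl (_ : d + l2%:Z = - n%:Z); last by lia.
    rewrite hc_id.
    have -> : join_tail (g r c u) = (fun l' (J' : std j l') => c l' (act (J' : dmap l' j) u)).
      by do 4 (apply: functional_extensionality_dep => ?); exact: gds.
    rewrite -[act (dinr n j) _]/(act (dinr n j) (sl_join (s 0%N) u)) sl_inr (cD_shape I p c).
    have -> := hc' l2 (act J2 u) Y d eZ1; last by lia.
    by rewrite subrr scaler0.
  exists X; split; [by move=> i hi; rewrite X1 ?Zj //; lia|by rewrite X2 ?Zjw|].
  move=> l J Y d hJ hm eY ed.
  have oX v : (v <= n + j.+1)%N -> obv I (sl_join Z u) v.+1 = obv I (X0 u 0%N) v.
    by move=> hv; rewrite -(Zj _ u 0%N) // obv_sb //; exact: bump_mono.
  rewrite X3 ?oX ?jn_le //; have hit := coverX hm.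
  have [[el eJ]|[l2 [el [J2 [hJ2 eJ]]]]] := strict_cover_join hJ hit; subst l.
    have {}eJ : J = dinl n j by apply: dmap_jn.
    subst J; rewrite jn_dinl // -eLX in eY; subst Y d; rewrite !gdl !hc_id /x -(sl_inl Z u).
    congr (_ + _); apply: mr_congr => v hv.
    rewrite jn_dinl // jn_cons //; case: v hv => [|v] hv //=.
    by rewrite jn_dinl.
  have {}eJ : J = dsum (did n) J2 by apply: dmap_jn.
  subst J; rewrite !gds /y sl_nat; congr (_ + _); apply: mr_congr => v hv.
  rewrite jn_cons // (jn_dsum (did n.+1)) //; case: v hv => [|v] hv /=; first by rewrite jn_did.
  rewrite jn_dsum //; case: (leqP v n) => h; first by rewrite !jn_did // ltnS h.
  by rewrite (_ : (v < n.+1)%N = false) ?subSS //; lia.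
exists R; split; first exact: hR.
  by rewrite -[sl_front R]did_top R3 ?gFid ?hc_id ?jn_did //; [exact: dstrict_did|apply/covP; rewrite -/(is_true _); apply/covP => i; apply/negP => /missbP[h1 _ /(_ i h1)]; rewrite jn_did // eqxx].
move=> j u Y d eY ed; have [_ _ K3] := RJ j u.
have eD : dsum (did n) (did j) = did (n + j.+1) := dsum_id n j.
rewrite -[sl_join R u]did_top -eD K3 //.
- by rewrite gds act_id.
- by rewrite eD; exact: dstrict_did.
- by move=> i; apply/negP => /missbP[h1 _ /(_ i h1)]; rewrite eD jn_did // eqxx.
- rewrite eD jn_did // eY /oK -(sl_inr (s 0%N) u) obv_jn // jn_dinr //.
  by congr obv; exact: addSnnS.
Qed.
End Glue.

Theorem acyclic_limit (t : slice p 0) : acyclic_cone (cone_coch t) -> is_limit t.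
Proof.
move=> hac n u hu; have [s [sE sc sf]] := boundary_facets u.
have slast : sb 0 (fun=> n) (s 0%N) = t.
  have hb : in_boundary (dconst 0 ord_max : std n.+1 0).
    by apply/in_boundaryP; exists 0%N; split=> // v hv; rewrite jn_dconst.
  rewrite -(hu (exist _ _ hb)) // (sE 0%N (leq0n _)); symmetry.
  exact: boundary_last.
pose w := sb 0 (fun=> 0%N) (sl_front (s 1%N)).
have vert i : (0 < i)%N -> (i <= n.+1)%N -> sb 0 (fun=> 0%N) (sl_front (s i)) = w.
  move=> i0 hi; case: (posnP n) => hN; first by congr (sb 0 _ (sl_front (s _))); lia.
  apply: (@facets_vertex _ n predT (fun i => sl_front (s i))) => // a b hab hb _ _ n0.
  exact: (congr1 (fun x => sl_front x) (sc a b hab hb n0)).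
have [X hX] := glue_slice sc slast vert hac.
by exists X; apply: sf.
Qed.
End Limits.

(** * Limits have acyclic cones *)

Lemma dcons_miss (C : sset) N (X X' : C N.+1) l (J : dmap l N) i : (i <= N)%N ->
  sb N (bump i.+1) X = sb N (bump i.+1) X' -> (forall u, (u <= l)%N -> jn J u != i) ->
  act (dcons J) X = act (dcons J) X'.
Proof.
move=> hi e hm.
have mg : mono_on l.+1 N (fun u => jn (dcons J) u - (i.+1 < jn (dcons J) u))%N.
  split=> [u v h h'|]; first by have := jn_mono (dcons J) h h'; lia.
  have := jn_le (dcons J) l.+1; rewrite jn_cons //=; have := hm l (leqnn l); have := jn_le J l; lia.
have HH (y : C N.+1) : act (dcons J) y =
    sb l.+1 (fun u => jn (dcons J) u - (i.+1 < jn (dcons J) u))%N (sb N (bump i.+1) y).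
  rewrite (sb_sb _ (bump_mono _ _) mg); apply: act_jn_eq => u hu.
  rewrite [RHS](jn_mkd (mono_comp (bump_mono _ _) mg)) //.
  rewrite /= /bump jn_cons //; case: u hu => [|u] hu //=; have := hm u hu; lia.
by rewrite !HH e.
Qed.

Lemma dcons_did (C : sset) N (X : C N.+1) : act (dcons (did N)) X = X.
Proof.
rewrite -[RHS]act_id; apply: act_jn_eq => u hu; rewrite jn_did // jn_cons //.
by case: u hu => [|u] hu //=; rewrite jn_did.
Qed.

Lemma dcons_comp N N' l (b : dmap N' N) (J : dmap l N') :
  dcomp (dcons b) (dcons J) = dcons (dcomp b J).
Proof.
apply: dmap_jn => u hu; rewrite jn_comp (jn_cons J) // (jn_cons (dcomp b J)) //.
case: u hu => [|u] hu; first by rewrite jn_cons.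
by rewrite jn_cons /= ?ltnS ?jn_le // jn_comp.
Qed.

Lemma dcons_strict N l (J : dmap l N) : dstrict (dcons J) -> dstrict J.
Proof.
move=> hs; apply: strict_jn => a b hab hb.
by have := @jn_strict _ _ _ a.+1 b.+1 hs hab hb; rewrite !jn_cons //=; lia.
Qed.

Lemma dsum0E i j (b : dmap i j) : dsum (did 0) b = dcons b.
Proof.
apply: dmap_jn => u hu; rewrite jn_dsum // jn_cons //.
by case: u hu => [|u] hu; [rewrite jn_did | rewrite /= subSS subn0].
Qed.

Section LimitAcyclic.
Variables (k : comPzRingType) (A : dgcat k) (C : sset) (I : nerve_iso C A).
Variables (K : sset) (p : smap K C).

Lemma mr_dcons_deg N (X : C N.+1) l (J : dmap l N) W Y d : ~~ dstrict J ->
  mr I (act (dcons J) X) W Y d = 0.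
Proof.
move=> hJ; have [a ha _] := not_strict_ex hJ; rewrite mr_deg //; first by lia.
by apply: contra hJ; exact: dcons_strict.
Qed.

Lemma join_normal n (s : slice p n) W : cnormal (fun j (u : K j) Y d => mr I (sl_join s u) W Y d).
Proof.
move=> j u Y d [m [a [v [hm ->]]]]; rewrite sl_nat mr_deg //; first by lia.
by apply/negP => /strict_le; lia.
Qed.

Lemma cone_closed (t : slice p 0) l (u : K l) Y i : Y = oK I p u l -> i = 1 - l%:Z ->
  cD I p (cone_coch I t) u Y i = 0.
Proof.
move=> eY ei; rewrite -[u in LHS]act_id -(cD_shape I p (cone_coch I t) u (did l)).
have -> : (fun l' (J : std l l') => cone_coch I t (act (J : dmap l' l) u)) =
    zcoch I (sl_join t u) (ob I (sl_front t)).
  do 4 (apply: functional_extensionality_dep => ?).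
  by rewrite /cone_coch /zcoch sl_nat dsum0E.
rewrite -(sl_join0 t u) zcoch_cD //.
  rewrite -(sl_inl t u) /obv; congr ob; apply: act_jn_eq => v; rewrite leqn0 => /eqP ->.
  by rewrite jn_dinl // jn_mkd.
by rewrite eY oz_jn // jn_did // sl_join0.
Qed.

(** Each simplex of [K] is joined with the apex by [cone_exists]; [facet_unique] and normality make
    the result natural. *)
Lemma slice_vertex (w : C 0) (c : coch K (ob I w)) : cnormal c ->
  (forall l (u : K l) Y i, Y = oK I p u l -> i = 1 - l%:Z -> cD I p c u Y i = 0) ->
  exists t : slice p 0, sl_front t = w /\ forall l (u : K l) Y d,
    Y = oK I p u l -> d = - l%:Z -> mr I (sl_join t u) (ob I w) Y d = c l u Y d.
Proof.
move=> cn hc'.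
have XX j (u : K j) : exists X : C j.+1, [/\ sb j (bump 0) X = p j u, sb 0 (fun=> 0) X = w &
    forall l (J : dmap l j) Y i, dstrict J -> Y = obv I (p j u) (jn J l) -> i = - l%:Z ->
      mr I (act (dcons J) X) (ob I w) Y i = c l (act J u) Y i].
  have [|X [X1 X2 X3]] := cone_exists (I := I) (z := p j u) (w := w)
      (c := fun l (J : std j l) => c l (act (J : dmap l j) u)); last by exists X.
  move=> l J Y i hJ eY ei; rewrite (cD_shape I p c) hc' //.
  by rewrite eY /oK sfun_act.
pose Xf j (u : K j) := proj1_sig (constructive_indefinite_description _ (XX j u)).
have Xs j (u : K j) := proj2_sig (constructive_indefinite_description _ (XX j u)).
rewrite -/(Xf _ _) in Xs.
have Xw j (u : K j) : obv I (Xf j u) 0 = ob I w by have [_ h _] := Xs j u; rewrite /obv h.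
have Xnat i j (b : dmap i j) (u : K j) : Xf i (act b u) = act (dsum (did 0) b) (Xf j u).
  have [h1 h2 h3] := Xs i (act b u); have [k1 k2 k3] := Xs j u.
  rewrite dsum0E; apply: (@facet_unique _ _ _ I i (pred1 0%N)) => //.
  - move=> a _ /eqP ->; rewrite h1 sfun_act -k1 /sb -!act_comp; apply: act_jn_eq => v hv.
    by rewrite !jn_comp !(jn_mkd (bump_mono _ _)) ?jn_le // jn_cons.
  - rewrite h2 -k2 /sb -act_comp; apply: act_jn_eq => v hv.
    by rewrite jn_comp !(@jn_mkd 0 _ (fun=> 0%N)) // jn_cons.
  move=> l J Y d hJ _ eY ed; rewrite Xw -act_comp dcons_comp.
  have eY2 : Y = obv I (p i (act b u)) (jn J l).
    by rewrite eY -h1 obv_sb ?jn_le //; exact: bump_mono.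
  rewrite h3 // -act_comp; have [hs|hs] := boolP (dstrict (dcomp b J)).
    by rewrite k3 // eY2 sfun_act obv_jn ?jn_le // jn_comp.
  by rewrite mr_dcons_deg // cn //; exact: degenerate_act.
have Xinl j (u : K j) : act (dinl 0 j) (Xf j u) = w.
  have [h1 h2 h3] := Xs j u; rewrite -h2; apply: act_jn_eq => v; rewrite leqn0 => /eqP ->.
  by rewrite jn_dinl // jn_mkd.
have Xinr j (u : K j) : act (dinr 0 j) (Xf j u) = p j u.
  by have [h1 h2 h3] := Xs j u; rewrite -h1 dinrE.
exists (@SliceSimplex K C p 0 w Xf Xnat Xinl Xinr); split=> // l u Y d eY ed.
have [_ _ h3] := Xs l u; rewrite -[sl_join _ u]dcons_did h3 ?act_id //.
  exact: dstrict_did.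
by rewrite jn_did.
Qed.

(** An edge of the slice whose components through the new vertex are all 0, hence with source a zero
    cone: the analogue of a zero morphism to [t]. *)
Lemma slice_cone0 (t : slice p 0) (w : C 0) :
  exists D : slice p 1, sb 0 (fun=> 1%N) D = t /\ sb 0 (fun=> 0%N) (sl_front D) = w.
Proof.
pose zc N (z : C N) (X : C N.+1) := [/\ sb N (bump 0) X = z, sb 0 (fun=> 0) X = w &
    forall l (J : dmap l N) Y i, dstrict J -> Y = obv I z (jn J l) -> i = - l%:Z ->
      mr I (act (dcons J) X) (ob I w) Y i = 0].
have ex N (z : C N) : exists X, zc N z X.
  have [|X [X1 X2 X3]] := cone_exists (I := I) (z := z) (w := w) (c := fun _ _ _ _ => 0).
    by move=> l J Y i _ eY _; rewrite cD0.
  by exists X.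
have zcu N (z : C N) X X' : zc N z X -> zc N z X' -> X = X'.
  move=> [h1 h2 h3] [k1 k2 k3]; apply: (@facet_unique _ _ _ I N (pred1 0%N)) => //.
  - by move=> a _ /eqP ->; rewrite h1 k1.
  - by rewrite h2 k2.
  move=> l J Y d hJ _ eY ed; have eY2 : Y = obv I z (jn J l).
    by rewrite eY -h1 obv_sb ?jn_le //; exact: bump_mono.
  by rewrite /obv h2 h3 // k3.
have zcp N N' (b : dmap N' N) (z : C N) X : zc N z X -> zc N' (act b z) (act (dcons b) X).
  move=> [h1 h2 h3]; split.
  - rewrite -h1 /sb -!act_comp; apply: act_jn_eq => v hv.
    by rewrite !jn_comp !(jn_mkd (bump_mono _ _)) ?jn_le // jn_cons.
  - rewrite -h2 /sb -act_comp; apply: act_jn_eq => v hv.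
    by rewrite jn_comp !(@jn_mkd 0 _ (fun=> 0%N)) // jn_cons.
  move=> l J Y d hJ eY ed; rewrite -act_comp dcons_comp.
  have [hs|hs] := boolP (dstrict (dcomp b J)); last exact: mr_dcons_deg.
  by rewrite h3 // eY obv_jn ?jn_le // jn_comp.
have XX j (u : K j) : exists X, zc (0 + j.+1)%N (sl_join t u) X by exact: ex.
pose Xf j (u : K j) : C (1 + j.+1)%N := proj1_sig (constructive_indefinite_description _ (XX j u)).
have Xs j (u : K j) : zc (0 + j.+1)%N (sl_join t u) (Xf j u).
  exact: (proj2_sig (constructive_indefinite_description _ (XX j u))).
have [F FF] := ex 0%N (sl_front t).
have Xnat i j (b : dmap i j) (u : K j) : Xf i (act b u) = act (dsum (did 1) b) (Xf j u).
  apply: (zcu _ _ _ _ (Xs i (act b u))).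
  have := zcp _ _ (dsum (did 0) b) _ _ (Xs j u); rewrite -sl_nat.
  have -> // : dsum (did 1) b = dcons (dsum (did 0) b) :> dmap _ _.
  apply: dmap_jn => v hv; rewrite (jn_dsum (did 1)) // jn_cons //.
  case: v hv => [|v] hv /=; first by rewrite jn_did.
  have E := @jn_dsum 0 0 i j (did 0) b v hv; rewrite [RHS](congr1 S E).
  by case: v hv {E} => [|v] hv /=; [rewrite !jn_did | rewrite !subSS subn0].
have Xinl j (u : K j) : act (dinl 1 j) (Xf j u) = F.
  apply: (zcu _ (sl_front t)) => //; rewrite -(sl_inl t u).
  have := zcp _ _ (dinl 0 j) _ _ (Xs j u).
  have -> // : dinl 1 j = dcons (dinl 0 j) :> dmap _ _.
  apply: dmap_jn => v hv; rewrite jn_dinl // jn_cons //.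
  by case: v hv => [|v] hv //=; rewrite jn_dinl.
have Xinr j (u : K j) : act (dinr 1 j) (Xf j u) = p j u.
  have [h1 _ _] := Xs j u; rewrite -(sl_inr t u) -h1 /sb -act_comp; apply: act_jn_eq => v hv.
  by rewrite jn_dinr // jn_comp jn_dinr // (jn_mkd (bump_mono _ _)) //= add0n.
exists (@SliceSimplex K C p 1 F Xf Xnat Xinl Xinr); split; last by have [_ h _] := FF.
have [f1 _ _] := FF; apply: slice_simplex_eq => [|j u] /=.
  by rewrite -f1; apply: act_jn_eq => v; rewrite leqn0 => /eqP ->; rewrite !jn_mkd.
have [h1 _ _] := Xs j u; rewrite -h1; apply: act_jn_eq => v hv.
rewrite jn_dsum // [RHS](jn_mkd (bump_mono _ _)) //.
by case: v hv => [|v] hv /=; [rewrite jn_mkd | rewrite jn_did ?subSS ?subn0 //].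
Qed.

(** For [n > 0] this comes from [modify_slice]. For [n = 0] a vertex of the slice has no facets: [r]
    has degree 1 and vanishes by nonpositivity, and [rho] is added to the components of the cone. *)
Lemma perturb_slice n (Z1 : slice p n) t w (e1 : int) (r : dghom (ob I w) (ob I (sl_front t)) e1)
    (rho : coch K (ob I w)) : nonpositive A -> e1 = 1 - n%:Z ->
  sb 0 (fun=> 0%N) (sl_front Z1) = w -> ((0 < n)%N -> sb 0 (fun=> n) Z1 = t) ->
  cnormal rho -> dd (e1 + 1) r = 0 ->
  (forall l (u : K l) Y i, Y = oK I p u l -> i = e1 - l%:Z ->
     cD I p rho u Y i = cp i (cone_coch I t u Y (- l%:Z)) r) ->
  exists R : slice p n,
    [/\ (0 < n)%N -> forall a, (a <= n)%N -> sb n.-1 (bump a) R = sb n.-1 (bump a) Z1,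
      sb 0 (fun=> 0%N) (sl_front R) = w,
      (0 < n)%N -> mr I (sl_front R) (ob I w) (ob I (sl_front t)) e1 =
                   mr I (sl_front Z1) (ob I w) (ob I (sl_front t)) e1 + r
    & forall j (u : K j) Y d, Y = oK I p u j -> d = - (n + j)%N%:Z ->
      mr I (sl_join R u) (ob I w) Y d = mr I (sl_join Z1 u) (ob I w) Y d + rho j u Y d].
Proof.
case: n Z1 => [|n] Z1 hA ee hw ht hn hr hrho.
  have [||R [Rw Rj]] := @slice_vertex w (fun j u Y d => mr I (sl_join Z1 u) (ob I w) Y d + rho j u Y d).
  - by move=> j u Y d hu; rewrite (join_normal Z1 (ob I w)) // hn // addr0.
  - move=> l u Y i eY ei; rewrite cDD hrho //; last by rewrite ei ee; lia.
    have -> : r = 0 by apply: hA; lia.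
    rewrite cp0r addr0; have ew : w = sl_front Z1 by rewrite -hw sb00.
    by have := @cone_closed Z1 l u Y i eY ei; rewrite /cone_coch -ew.
  exists R; split=> //; first by rewrite sb00.
have en : e1 = - n%:Z by lia.
clear ee; subst e1.
have [|||||R [R1 R2 R3]] := @modify_slice _ _ _ I _ _ n (fun i => sb n (bump i) Z1) t w _ _ Z1 r rho _ hn.
- by rewrite -ht // sb_sb //; exact: bump_mono.
- move=> i i0 hi; rewrite -hw; change (sb 0 (fun=> 0%N) (sb n (bump i) (sl_front Z1)) = sb 0 (fun=> 0%N) (sl_front Z1)); rewrite sb_sb //; last exact: bump_mono.
  by apply: sb_eq => v _; rewrite /= /bump; lia.
- by [].
- by have -> : 1 - n%:Z = - n%:Z + 1 by lia.
- by move=> j u Y i eY ei; exact: hrho.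
exists R; split=> //.
- have E := congr1 (fun x : slice p n => sb 0 (fun=> 0%N) (sl_front x)) (R1 n.+1 (leqnn _)).
  have E2 (x : slice p n.+1) : sb 0 (fun=> 0%N) (sl_front (sb n (bump n.+1) x)) = sb 0 (fun=> 0%N) (sl_front x).
    change (sb 0 (fun=> 0%N) (sb n (bump n.+1) (sl_front x)) = sb 0 (fun=> 0%N) (sl_front x)); rewrite sb_sb //; exact: bump_mono.
  by rewrite /= !E2 in E; rewrite E.
- by move=> j u Y d eY ed; apply: R3 => //; lia.
Qed.

Lemma dcons_dsum n i j (b : dmap i j) : dcons (dsum (did n) b) = dsum (did n.+1) b :> dmap _ (n.+1 + j.+1).
Proof.
apply: dmap_jn => v hv; rewrite jn_cons // (jn_dsum (did n.+1)) //.
case: v hv => [|v] hv /=; first by rewrite jn_did.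
rewrite jn_dsum //; case: (leqP v n) => h; first by rewrite !jn_did // ltnS h.
by rewrite (_ : (v < n.+1)%N = false) ?subSS //; lia.
Qed.

Lemma dcons_dinl n j : dcons (dinl n j) = dinl n.+1 j :> dmap _ (n.+1 + j.+1).
Proof.
apply: dmap_jn => v hv; rewrite jn_cons // jn_dinl //.
by case: v hv => [|v] hv //=; rewrite jn_dinl.
Qed.

(** A simplex [Z] of the slice, degenerate on the edge of [slice_cone0], has its facet 1 perturbed
    by the cocycle [(r, rho)]. The limit property fills the new boundary by [F], and the difference
    of [F] and [Z] is a primitive up to the sign [(-1)^n]. *)
Lemma limit_acyclic (t : slice p 0) : nonpositive A -> is_limit t -> acyclic_cone I p (cone_coch I t).
Proof.
move=> hA hlim W0 e e1 r rho he ee hr hn hrho.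
have [w ew] := ob_surj I W0; subst W0.
have [n en] : exists n : nat, e = - n%:Z by exists (absz e); lia.
have ee1 : e1 = 1 - n%:Z by lia.
clear ee; subst e; pose L := ob I (sl_front t).
have [D [D1 D0]] := slice_cone0 t w.
pose q u := (u - n)%N; have mq : mono_on n.+1 1 q by rewrite /q; mono.
have mb i : mono_on n n.+1 (bump i) by exact: bump_mono.
pose Z : slice p n.+1 := sb n.+1 q D.
have Zv i : (i <= n)%N -> sb 0 (fun=> i) (sl_front Z) = w.
  move=> hi; have E : sb 0 (fun=> i) Z = sb 0 (fun=> 0%N) D.
    rewrite /Z sb_sb //; last by split=> //; lia.
    by apply: sb_eq => v _; rewrite /q /=; lia.
  by rewrite -D0; exact: (congr1 (fun x : slice p 0 => sl_front x) E).
have Zt : sb 0 (fun=> n.+1) Z = t.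
  by rewrite /Z sb_sb // -D1; apply: sb_eq => v _; rewrite /q /=; lia.
clearbody Z.
pose Z1 := sb n (bump 1) Z.
have [||R [Rf Rv Rr Rj]] := @perturb_slice n Z1 t w e1 r rho hA ee1 _ _ hn hr hrho.
- rewrite -[sl_front Z1]/(sb n (bump 1) (sl_front Z)) sb_sb // -(Zv 0%N) //.
- by move=> n0; rewrite sb_sb // -Zt; apply: sb_eq => v _; rewrite /= /bump; lia.
pose y i : slice p n := if i == 1%N then R else sb n (bump i) Z.
have yc : compat_facets y.
  move=> i j hij hj n0.
  have yf i' a : (a <= n)%N -> sb n.-1 (bump a) (y i') = sb n.-1 (bump a) (sb n (bump i') Z).
    by move=> ha; rewrite /y; case: eqP => // ->; rewrite Rf.
  by rewrite !yf; try lia; exact: faces_compat.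
have [u hu] := boundary_map yc.
have [v hv|F hF] := hlim n u.
  rewrite (boundary_last (a := exist _ _ (face_boundary (leq0n n.+1))) u hv) // (hu 0%N) // /y /=.
  by rewrite sb_sb // -Zt.
have Ff i : (i <= n.+1)%N -> sb n (bump i) F = y i.
  by move=> hi; apply: fills_face hF hi => a ha; exact: hu.
pose x0 := mr I (sl_front F) (ob I w) L (- n%:Z) - mr I (sl_front Z) (ob I w) L (- n%:Z).
pose y0 : coch K (ob I w) := fun j u Y d => mr I (sl_join F u) (ob I w) Y d - mr I (sl_join Z u) (ob I w) Y d.
have y0n : cnormal y0 by move=> j v Y d h; rewrite /y0 !(join_normal _ (ob I w)) // subrr.
have FZ i : (i <= n.+1)%N -> i != 1%N -> sb n (bump i) F = sb n (bump i) Z.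
  by move=> hi h1; rewrite Ff // /y (negPf h1).
have FZf i : (i <= n.+1)%N -> i != 1%N -> sb n (bump i) (sl_front F) = sb n (bump i) (sl_front Z).
  by move=> hi h1; exact: (congr1 (fun x : slice p n => sl_front x) (FZ i hi h1)).
have FZj i j (v : K j) : (i <= n.+1)%N -> i != 1%N ->
    sb (n + j.+1) (bump i) (sl_join F v) = sb (n + j.+1) (bump i) (sl_join Z v).
  by move=> hi h1; rewrite -!sl_face // FZ.
have vn1 (x : slice p n.+1) : sb 0 (fun=> 0%N) (sl_front (sb n (bump n.+1) x)) = sb 0 (fun=> 0%N) (sl_front x).
  transitivity (sb 0 (fun=> 0%N) (sb n (bump n.+1) (sl_front x))); first by [].
  by rewrite sb_sb.
have Fv0 : sb 0 (fun=> 0%N) (sl_front F) = w.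
  rewrite -vn1 Ff // /y; case: eqP => _; first exact: Rv.
  by rewrite vn1 Zv.
have oW : ob I w = obv I (sl_front Z) 0 by rewrite /obv Zv.
have oL : L = obv I (sl_front Z) n.+1.
  by rewrite /L -Zt.
have hx : dd e1 x0 = (-1) ^+ n *: r.
  have e1n : - n%:Z + 1 = e1 by lia.
  have [n0|n0] := posnP n.
    have r0 : r = 0 by apply: hA; lia.
    have := mr_dB (FZf 0%N isT isT) _ oW oL (i := - n%:Z) erefl; rewrite e1n => ->.
      rewrite r0 scaler0 big1 // => v v0; have := ltn_ord v; lia.
    by rewrite Fv0 Zv.
  have := @mr_dB1 _ _ _ I n (sl_front F) (sl_front Z) _ _ (- n%:Z) 1%N isT n0 FZf oW oL erefl.
  rewrite e1n subSS subn0 => ->; congr (_ *: _).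
  have -> : sb n (bump 1) (sl_front F) = sl_front R.
    exact: (congr1 (fun x : slice p n => sl_front x) (Ff 1%N isT)).
  by rewrite Rr // addrAC subrr add0r.
have hy l (v : K l) Y i : Y = oK I p v l -> i = - n%:Z - l%:Z ->
    cp i (cone_coch I t v Y (- l%:Z)) x0 - cD I p y0 v Y i = (-1) ^+ n *: rho l v Y i.
  move=> eY ei; pose N := (n + l.+1)%N.
  pose X : C N.+1 := sl_join F v; pose Zj : C N.+1 := sl_join Z v.
  pose c : coch (std N) (ob I w) := fun l' J Y d => zcoch I X (ob I w) J Y d - zcoch I Zj (ob I w) J Y d.
  pose P l' (J : dmap l' N) := forall a, (a <= n)%N -> exists2 u, (u <= l')%N & jn J u = a.
  (* The difference cochain [c] is closed on the whole simplex. Its part [dA] on the faces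
     containing the vertices up to [n] is the candidate primitive, to which [cD_join] applies. The
     rest [dB] is nonzero only on faces omitting vertex 0 of facet 0. *)
  pose dA : coch (std N) (ob I w) := fun l' J Y d =>
    if excluded_middle_informative (P l' J) then c l' J Y d else 0.
  pose zs := sb n (bump 0) Z; pose z : C N := sl_join zs v.
  have ez : sb N (bump 0) Zj = z by rewrite /z /zs sl_face.
  have eXz : sb N (bump 0) X = z by rewrite -ez; exact: (FZj 0%N).
  have zst : sb 0 (fun=> n) zs = t.
    by rewrite /zs sb_sb // -Zt; apply: sb_eq => a _; rewrite /= /bump; lia.
  have ozn : L = obv I z n.
    rewrite /L -zst -[sl_front (sb 0 _ zs)]/(sb 0 (fun=> n) (sl_front zs)) -(sl_inl zs v).
    by rewrite /obv dinlE -/(sb _ _ _) sb_sb //; mono.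
  have ozl a : (a <= l)%N -> obv I (p l v) a = obv I z (n.+1 + a).
    by move=> ha; rewrite -(sl_inr zs v) obv_jn // jn_dinr.
  have eYz : Y = obv I z (n.+1 + jn (did l) l) by rewrite jn_did // -ozl.
  have hv : join_vanish I z dA 0.
    move=> l' J Z' d a hJ ha hm eZ ed; rewrite /dA; case: excluded_middle_informative => // h.
    by have [u0 h1 h2] := h a ha; have := hm u0 h1; rewrite h2 eqxx.
  have hXW : sb 0 (fun=> 0%N) X = sb 0 (fun=> 0%N) Zj.
    have E (x : slice p n.+1) : sb 0 (fun=> 0%N) (sl_join x v : C N.+1) = sb 0 (fun=> 0%N) (sl_front x).
      by rewrite -(sl_inl x v) dinlE -/(sb _ _ _) sb_sb //; mono.
    by rewrite /X /Zj !E Fv0 Zv.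
  have oZW : ob I w = obv I Zj 0.
    by rewrite oW -(sl_inl Z v) /obv dinlE -/(sb _ _ _) sb_sb //; mono.
  have cD0 : cD I (yo z) c (did N : std N N) Y i = 0.
    have eY2 : Y = oK I (yo z) (did N : std N N) N.
      by rewrite oz_jn // jn_did // eYz jn_did //; congr obv; rewrite /N; lia.
    have ei2 : i = 1 - N%:Z by rewrite /N; lia.
    rewrite /c cDB -{2}ez zcoch_cD //; last by rewrite ez.
    by rewrite -eXz zcoch_cD ?subrr //; [rewrite /obv hXW | rewrite eXz].
  have ed : i = 0 - (n + l)%N%:Z by lia.
  have cdA := cD_join hv (dstrict_did l) eYz ozn ed.
  have hP1 : P n (dinl n l) by move=> a ha; exists a; rewrite ?jn_dinl.
  have hP2 l2 (J2 : dmap l2 l) : P (n + l2.+1)%N (dsum (did n) J2).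
    by move=> a ha; exists a; [lia | rewrite jn_dsum ?ha ?jn_did //; lia].
  have tdA : join_tail dA = (fun l' (J' : std l l') => y0 l' (act (J' : dmap l' l) v)).
    do 4 (apply: functional_extensionality_dep => ?).
    rewrite /join_tail /dA; case: excluded_middle_informative => // h.
    by rewrite /c /zcoch /y0 /X /Zj !dcons_dsum !sl_nat.
  have dAl d : dA n (dinl n l) L d = mr I (sl_front F) (ob I w) L d - mr I (sl_front Z) (ob I w) L d.
    rewrite /dA; case: excluded_middle_informative => // h.
    by rewrite /c /zcoch /X /Zj !dcons_dinl !sl_inl.
  rewrite tdA -[act (dinr n l) z]/(act (dinr n l) (sl_join zs v)) sl_inr (cD_shape I p y0) dAl in cdA.
  rewrite act_id -[z]/(sl_join zs v) -sl_last zst !dsum_id act_id in cdA.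
  rewrite (_ : i + l%:Z = - n%:Z) in cdA; last by lia.
  rewrite -/x0 -/L in cdA.
  pose dB : coch (std N) (ob I w) := fun l' J Y d => c l' J Y d - dA l' J Y d.
  have dB0 l' (J : dmap l' N) Z' d u0 : (u0 <= l')%N -> jn J u0 = 0%N -> dB l' J Z' d = 0.
    move=> h1 h2; rewrite /dB /dA; case: excluded_middle_informative => h; first by rewrite subrr.
    rewrite subr0; have [a ha] : exists a, (a <= n)%N /\ forall u, (u <= l')%N -> jn J u != a.
      apply: NNPP => hh; apply: h => a ha; apply: NNPP => h3; apply: hh; exists a; split=> // u3 hu3.
      by apply/eqP => e; apply: h3; exists u3.
    have [ha1 ha2] := ha; have a0 : (0 < a)%N.
      by have := ha2 u0 h1; rewrite h2; lia.
    rewrite /c /zcoch (@dcons_miss _ _ X Zj _ J a) ?subrr //; first by rewrite /N; lia.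
    by apply: (FZj a.+1); lia.
  (* Face 0 of facet 0 lies in the perturbed facet 1; it is the only face that contributes, by
     [rho]. *)
  have cdB : cD I (yo z) dB (did N : std N N) Y i = - rho l v Y i.
    have N0 : (0 < N)%N by rewrite /N; lia.
    rewrite /cD (dB0 N (did N) _ _ 0%N) ?jn_did // dd0 sub0r /cR (bigD1 (Ordinal N0)) //=.
    rewrite big1 ?addr0; last first.
      move=> a ha; have han := ltn_ord a; rewrite -val_eqE /= in ha.
      rewrite (dB0 _ (sb N.-1 (bump a) (did N : std N N)) _ _ 0%N) //; last first.
        by rewrite jn_comp jn_mkd ?jn_did //; try mono; rewrite /bump; lia.
      rewrite (dB0 _ (sb a id (did N : std N N)) _ _ 0%N) ?cp0r ?subrr ?scaler0 //.
      by rewrite jn_comp jn_mkd ?jn_did //; mono.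
    rewrite (dB0 _ (sb 0 id (did N : std N N)) _ _ 0%N) ?cp0r ?subr0 //; last first.
      by rewrite jn_comp jn_mkd ?jn_did.
    rewrite subn0 scalerN signK; congr (- _).
    rewrite /dB /dA; case: excluded_middle_informative => h.
      have [u0 h1] := h 0%N isT; rewrite jn_comp jn_mkd ?jn_did //; rewrite /bump; try mono; lia.
    rewrite subr0 /c /zcoch.
    have E (x : C N.+1) : mr I (act (dcons (dcomp (did N) (mkd N.-1 N (bump 0)))) x) (ob I w) Y i =
        mr I (sb N (bump 1) x) (ob I w) Y i.
      apply: mr_congr_eq => [|a ha]; first by rewrite prednK.
      rewrite jn_cons // (jn_mkd (bump_mono _ _)) //; last by lia.
      case: a ha => [|a] ha //=; rewrite jn_comp jn_mkd ?jn_did //; rewrite /bump; try mono; lia.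
    rewrite !E -[sb N (bump 1) X]sl_face // -[sb N (bump 1) Zj]sl_face // Ff //.
    by rewrite Rj //; [rewrite addrAC subrr add0r | lia].
  have := cDB I (yo z) c dA (did N : std N N) Y i; rewrite -/dB cdB cD0 sub0r => /oppr_inj E.
  move: cdA; rewrite -[did (n + l.+1)]/(did N) -E => ->.
  by rewrite signE (@sign_odd _ _ (n + n.+1) 1%N) ?expr1 ?scaleN1r ?opprB //; lia.
exists ((-1) ^+ n *: x0), (fun j v Y d => (-1) ^+ n *: y0 j v Y d); split.
- by move=> j v Y d h; rewrite y0n ?scaler0.
- by rewrite ddZ hx signK.
by move=> l v Y i eY ei; rewrite cpZr cDZ -scalerBr hy // signK.
Qed.
End LimitAcyclic.

(** * Homotopy fibers of maps of nonpositive degree *)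

Section Kernels.
Variables (k : comPzRingType) (A : dgcat k).
Hypothesis hA : nonpositive A.

(* [b] is a universal null-homotopy of [theta] precomposed with a map to [L]: the
   homotopy fiber of the map [theta] of degree [1 - d]. *)
Definition fiber_univ (d : nat) (L Y L' : A) (theta : dghom L Y (1 - d%:Z))
    (a : dghom L' L 0) (b : dghom L' Y (- d%:Z)) : Prop :=
  forall W (e e1 : int), e <= 0 -> e + 1 = e1 ->
  forall (r : dghom W L' e1) (x1 : dghom W L e) (z : dghom W Y (e - d%:Z)),
    dd (e1 + 1) r = 0 -> dd e1 x1 = cp e1 a r ->
    dd (e1 - d%:Z) z = cp (e1 - d%:Z) theta x1 + (-1) ^+ d *: cp (e1 - d%:Z) b r ->
  exists (x : dghom W L' e) (u : dghom W L (e - 1)) (v : dghom W Y (e - d%:Z - 1)),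
    [/\ dd e1 x = r, dd e u = cp e a x - x1 &
      dd (e - d%:Z) v = cp (e - d%:Z) b x - z + (-1) ^+ d *: cp (e - d%:Z) theta u].

Definition fiber_exists (d : nat) : Prop :=
  forall (L Y : A) (theta : dghom L Y (1 - d%:Z)), dd (1 - d%:Z + 1) theta = 0 ->
  exists (L' : A) (a : dghom L' L 0) (b : dghom L' Y (- d%:Z)),
    [/\ dd 1 a = 0, dd (1 - d%:Z) b = cp (1 - d%:Z) theta a & fiber_univ theta a b].

Lemma dd_cpl (X Y Z : A) i j l l' j' (g : dghom Y Z i) (f : dghom X Y j) : dd (i + 1) g = 0 ->
  i + j = l -> l + 1 = l' -> j + 1 = j' ->
  dd l' (cp l g f) = (-1) ^+ `|i|%N *: cp l' g (dd j' f).
Proof. by move=> hg e1 e2 e3; rewrite (dd_cp _ _ e1 e2 erefl e3) hg cp0l add0r. Qed.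

Lemma dd_cpl0 (X Y Z : A) j j' (g : dghom Y Z 0) (f : dghom X Y j) : dd 1 g = 0 ->
  j + 1 = j' -> dd j' (cp j g f) = cp j' g (dd j' f).
Proof. by move=> hg e; rewrite (@dd_cpl _ _ _ 0 j j j' j') // ?expr0 ?scale1r ?add0r. Qed.

Lemma dd_cpr (X Y Z : A) i j l l' i' (g : dghom Y Z i) (f : dghom X Y j) : dd (j + 1) f = 0 ->
  i + j = l -> l + 1 = l' -> i + 1 = i' -> dd l' (cp l g f) = cp l' (dd i' g) f.
Proof. by move=> hf e1 e2 e3; rewrite (dd_cp _ _ e1 e2 e3 erefl) hf cp0r scaler0 addr0. Qed.

(** [theta] has degree 1, hence vanishes, and the fiber is the biproduct of [L] and [Y]. Biproducts
    exist only up to homotopy, so the solution is built in two steps: an element with the right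
    differential, then a cocycle correcting its projections. *)
Lemma fiber_exists0 : H0_additive A -> fiber_exists 0.
Proof.
move=> [_ hb] L Y theta _; have [S [i1 [i2 [p1 [p2 [h11 h22 h12 h21 hs]]]]]] := hb L Y.
have th0 : theta = 0 by apply: hA.
have c1 : dd 1 (c0 p1) = 0 := proj1 (cocycleE _) (c0_closed p1).
have c2 : dd 1 (c0 p2) = 0 := proj1 (cocycleE _) (c0_closed p2).
have d1 : dd 1 (c0 i1) = 0 := proj1 (cocycleE _) (c0_closed i1).
have d2 : dd 1 (c0 i2) = 0 := proj1 (cocycleE _) (c0_closed i2).
exists S, (c0 p1), (c0 p2); split=> //; first by rewrite th0 cp0l.
move=> W e e1 he ee r x1 z0 hr hx1.
(* The degrees [e - 0] and [e1 - 0] are generalized in order to be replaced by [e] and [e1]. *)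
suff H E E1 : E = e -> E1 = e1 -> forall z : dghom W Y E,
    dd E1 z = cp E1 theta x1 + (-1) ^+ 0 *: cp E1 (c0 p2) r ->
    exists (x : dghom W S e) (u : dghom W L (e - 1)) (v : dghom W Y (E - 1)),
    [/\ dd e1 x = r, dd e u = cp e (c0 p1) x - x1 &
      dd E v = cp E (c0 p2) x - z + (-1) ^+ 0 *: cp E theta u].
  by apply: H; lia.
move=> -> -> z; rewrite th0 cp0l add0r expr0 scale1r => hz; clear z0.
move: hs h11 h22 h12 h21; rewrite /comp0 -!(cpE (addr0 0)).
move=> /cohomE[ht hht] /cohomE[al hal] /cohomE[de hde] /cohomE[be hbe] /cohomE[ga hga].
rewrite sub0r in ht hht al hal de hde be hbe ga hga.
rewrite !subr0 in hbe hga.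
(* The homotopy [ht] from the identity to [i1 p1 + i2 p2] repairs the differential. *)
pose x0 := cp e i1 x1 + cp e i2 z - cp e ht r.
have hx0 : dd e1 x0 = r.
  rewrite /x0 ddB ddD !dd_cpl0 // hx1 hz (dd_cpr (i' := 0) _ hr) //; try lia.
  rewrite hht -!(@cpA _ _ _ _ _ _ 0 0 e1 0 e1) ?add0r ?addr0 // cpBl cpDl cp1l opprB.
  by rewrite addrC subrK.
have cl (T : A) (g : dghom S T 0) (m : dghom W T e) : dd 1 g = 0 -> dd e1 m = cp e1 g r ->
    dd e1 (m - cp e g x0) = 0.
  by move=> hg hm; rewrite ddB hm dd_cpl0 // hx0 subrr.
pose m1 := x1 - cp e p1 x0; pose m2 := z - cp e p2 x0.
have hm1 : dd e1 m1 = 0 by exact: cl.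
have hm2 : dd e1 m2 = 0 by exact: cl.
have em1 : cp e (c0 p1) x0 = x1 - m1 by rewrite subKr.
have em2 : cp e (c0 p2) x0 = z - m2 by rewrite subKr.
clearbody m1 m2 x0.
exists (x0 + (cp e i1 m1 + cp e i2 m2)), (cp (e - 1) al m1 + cp (e - 1) be m2),
  (cp (e - 1) de m2 + cp (e - 1) ga m1).
have A0 (X0 Y0 Z0 : A) (g : dghom Y0 Z0 0) (f : dghom X0 Y0 0) (h : dghom W X0 e) :
    cp e g (cp e f h) = cp e (cp 0 g f) h.
  by rewrite (@cpA _ _ _ _ _ _ 0 0 e 0 e) ?add0r.
have hd (X0 Y0 : A) (h : dghom X0 Y0 (-1)) (m : dghom W X0 e) : dd e1 m = 0 ->
    dd e (cp (e - 1) h m) = cp e (dd 0 h) m.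
  by move=> hm; rewrite (dd_cpr (i' := 0)) //; [rewrite -ee in hm; exact: hm | lia | lia].
split.
- by rewrite ddD hx0 ddD !dd_cpl0 // hm1 hm2 !cp0r !addr0.
- rewrite ddD !hd // hal hbe cpBl cp1l !cpDr em1 !A0.
  have key (V : zmodType) (a b m x : V) : a - m + b = x - m + (a + b) - x by zmodule.
  exact: key.
rewrite ?cp0l scaler0 addr0 ddD !hd // hde hga cpBl cp1l !cpDr em2 !A0.
have key (V : zmodType) (a b m x : V) : a - m + b = x - m + (b + a) - x by zmodule.
exact: key.
Qed.

(** Acyclicity in degrees [<= 0] of the cone of [to_fib], in components. *)
Definition lex_cone (X Y Z : A) (T : hcomplex3 X Y Z) : Prop :=
  forall W (e e1 : int), e <= 0 -> e + 1 = e1 ->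
  forall (r : dghom W X e1) (x1 : dghom W Y e) (z : dghom W Z (e - 1)),
    dd (e1 + 1) r = 0 -> dd e1 x1 = cp e1 (c0 (hc_f T)) r ->
    dd e z = cp e (c0 (hc_g T)) x1 + cp e (hc_h T) r ->
  exists (x : dghom W X e) (u : dghom W Y (e - 1)) (v : dghom W Z (e - 1 - 1)),
    [/\ dd e1 x = r, dd e u = cp e (c0 (hc_f T)) x - x1 &
      dd (e - 1) v = - cp (e - 1) (hc_h T) x - z - cp (e - 1) (c0 (hc_g T)) u].

Lemma c0_dd (X Y : A) (f : closed0 X Y) : dd 1 (c0 f) = 0.
Proof. exact: (proj1 (cocycleE _) (c0_closed f)). Qed.

Lemma hc_dd (X Y Z : A) (T : hcomplex3 X Y Z) : dd 0 (hc_h T) = - cp 0 (c0 (hc_g T)) (c0 (hc_f T)).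
Proof. by rewrite (ddE (addNr 1)) hc_d -cpE. Qed.

Lemma fib_dE (Y Z : A) (g : closed0 Y Z) (W : A) i j (e : i + 1 = j) (x : dghom W Y i) (z : dghom W Z (i - 1)) :
  cd (c := fib (postcomp W g)) e (x, z) = (dd j x, - cp (j - 1) (c0 g) x - dd (j - 1) z).
Proof.
rewrite /= /fib_d /= (ctr_comp _ _ (etrans (add0r i) (fib_eq e))) -cpE.
by rewrite (ddE e) (ddE (fib_eq' e)).
Qed.

(** Acyclicity of the cone in degree 0 also involves injectivity in degree 1, which left exactness
    does not state; there [r] vanishes by nonpositivity. *)
Lemma left_exactE (X Y Z : A) (T : hcomplex3 X Y Z) : left_exact T <-> lex_cone T.
Proof.
have tfE W i (u : dghom W X i) : to_fib T W i u = (cp i (c0 (hc_f T)) u, cp (i - 1) (hc_h T) u).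
  by rewrite (cpE (add0r i)) (cpE (addrC (-1) i)).
split=> [hT W e e1 he ee|hT W i hi].
  have -> : e = e1 - 1 by lia.
  move=> r x1 z hr hx1 hz.
  have [x0 hx0] : exists x0 : dghom W X (e1 - 1), dd e1 x0 = r.
    case: (lerP e1 0) => h1; last by exists 0; rewrite dd0 [r]hA.
    have [inj _] := hT W e1 h1.
    have := inj r 0; case.
    - exact/cocycleE.
    - by apply/cocycleE; rewrite dd0.
    - exists ((x1, - z) : fib (postcomp W (hc_g T)) (e1 - 1)).
      rewrite fib_dE !tfE !cp0r ddN opprK hx1 hz.
      congr pair; first by rewrite subr0.
      by rewrite subr0 addrA addNr add0r.
    by move=> x0; rewrite -ddE subr0 => hx; exists x0.
  have he1 : e1 - 1 <= 0 by lia.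
  have [_ sur] := hT W (e1 - 1) he1.
  have dhx : dd (e1 - 1) (cp (e1 - 1 - 1) (hc_h T) x0) =
      - cp (e1 - 1) (cp 0 (c0 (hc_g T)) (c0 (hc_f T))) x0 - cp (e1 - 1) (hc_h T) r.
    rewrite (@dd_cp _ _ _ _ _ _ _ _ 0 e1 _) //; try lia.
    by rewrite hc_dd cpNl hx0 /= expr1 scaleN1r.
  have [] := sur ((x1 - cp (e1 - 1) (c0 (hc_f T)) x0, - z - cp (e1 - 1 - 1) (hc_h T) x0)).
    rewrite /cocycle fib_dE.
    have -> : e1 - 1 + 1 = e1 by lia.
    rewrite ddB hx1 dd_cpl0 ?c0_dd //; last by lia.
    rewrite hx0 subrr; congr pair.
    rewrite ddB ddN hz dhx cpBr (@cpA _ _ _ _ _ _ 0 0 (e1 - 1) 0 (e1 - 1)) ?add0r //.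
    have key (V : zmodType) (a b c : V) : - (a - b) - (- (a + c) - (- b - c)) = 0 by zmodule.
    exact: key.
  move=> x2 /cocycleE hx2 [[u v]]; rewrite fib_dE tfE => E.
  have E1 := congr1 fst E; have E2 := congr1 snd E; rewrite /= in E1 E2.
  have {}E1 : dd (e1 - 1) u = cp (e1 - 1) (c0 (hc_f T)) x2 - (x1 - cp (e1 - 1) (c0 (hc_f T)) x0) := E1.
  have {}E2 : - cp (e1 - 1 - 1) (c0 (hc_g T)) u - dd (e1 - 1 - 1) v =
    cp (e1 - 1 - 1) (hc_h T) x2 - (- z - cp (e1 - 1 - 1) (hc_h T) x0) := E2.
  exists (x0 + x2), u, v; split.
  - have hx2' : dd e1 x2 = 0 by have := hx2; rewrite (_ : e1 - 1 + 1 = e1) //; lia.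
    by rewrite ddD hx0 hx2' addr0.
  - by rewrite E1 cpDr; zmodule.
  have key (V : zmodType) (a b c d f g : V) : - a - b = c - (- f - g) -> b = - (g + c) - f - a.
    by move=> h; have E0 : b = - (- a - b) - a by [zmodule]; rewrite E0 h; zmodule.
  by rewrite cpDr; exact: key.
split.
  move=> x y /cocycleE hx /cocycleE hy [[z1 z2]]; rewrite fib_dE !tfE => E.
  have E1 := congr1 fst E; have E2 := congr1 snd E; rewrite /= in E1 E2.
  have hi1 : i - 1 <= 0 by lia.
  have [|||x' [u [v [hx' _ _]]]] := hT W (i - 1) i hi1 (subrK 1 i) (x - y) z1 (- z2).
  - by rewrite ddB hx hy subrr.
  - by rewrite E1 cpBr.
  - have key (V : zmodType) (a b c d : V) : - a - b = c - d -> - b = a + (c - d).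
      by move=> <-; zmodule.
    by rewrite ddN cpBr; exact: key.
  by apply/cohomE; exists x'.
move=> [y1 y2]; rewrite /cocycle fib_dE => E.
have E1 := congr1 fst E; have E2 := congr1 snd E; rewrite /= addrK in E1 E2.
have [|||x [u [v [hx hu hv]]]] := hT W i (i + 1) hi erefl 0 y1 (- y2).
- by rewrite dd0.
- by rewrite cp0r E1.
- have key (V : zmodType) (a b : V) : - a - b = 0 -> - b = a.
    by move=> h; have E0 : a = - (- a - b) - b by [zmodule]; rewrite E0 h; zmodule.
  by rewrite ddN cp0r addr0; exact: key.
exists x; first exact/cocycleE.
exists (u, v); rewrite fib_dE tfE hu hv; congr pair.
have key (V : zmodType) (a b c : V) : - a - (- b - - c - a) = b - c by zmodule.
exact: key.
Qed.

(** For a map of degree 0 the fiber is the homotopy kernel. The differential of [hc_h] is [- g f],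
    whence the sign of [b]. *)
Lemma fiber_exists1 : (forall (Y Z : A) (g : closed0 Y Z), has_homotopy_kernel g) -> fiber_exists 1.
Proof.
move=> hk L Y theta hth; change (dghom L Y 0 : Type) in theta; change (dd 1 theta = 0) in hth.
have hth' : cocycle theta by apply/cocycleE.
have [X [T [eT /left_exactE hT]]] := hk L Y (Closed0 hth').
have eth : c0 (hc_g T) = theta by rewrite eT.
exists X, (c0 (hc_f T)), (- hc_h T : dghom X Y (-1)); split=> //; first exact: c0_dd.
  change (dd 0 (- hc_h T) = cp 0 theta (c0 (hc_f T))).
  by rewrite ddN hc_dd opprK eth.
move=> W e e1 he ee r x1 z hr hx1 hz.
have {}hz : dd (e1 - 1%:Z) z = cp (e1 - 1%:Z) theta x1 +
  (-1) ^+ 1 *: cp (e1 - 1%:Z) (- hc_h T) r := hz.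
change (exists (x : dghom W X e) (u : dghom W L (e - 1)) (v : dghom W Y (e - 1%:Z - 1)),
    [/\ dd e1 x = r, dd e u = cp e (c0 (hc_f T)) x - x1 &
      dd (e - 1%:Z) v = cp (e - 1%:Z) (- hc_h T) x - z + (-1) ^+ 1 *: cp (e - 1%:Z) theta u]).
have e2 : e1 - 1%:Z = e by lia.
rewrite e2 in hz.
have [|x [u [v [h1 h2 h3]]]] := hT W e e1 he ee r x1 z hr hx1.
  by rewrite [LHS]hz expr1 scaleN1r cpNl opprK eth.
exists x, u, v; split=> //.
by rewrite [LHS]h3 expr1 scaleN1r cpNl eth.
Qed.

(** The homotopy kernel of the zero map from a contractible object to [Y]; its homotopy is the
    universal morphism of degree -1 to [Y]. *)
Lemma loop_exists (O : A) (s : dghom O O (-1)) :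
  (forall (Y Z : A) (g : closed0 Y Z), has_homotopy_kernel g) -> dd 0 s = dgid O ->
  forall Y : A, exists (L : A) (w : dghom L Y (-1)), dd 0 w = 0 /\
    forall W (e e1 : int), e <= 0 -> e + 1 = e1 -> forall (r : dghom W L e1) (z : dghom W Y (e - 1)),
      dd (e1 + 1) r = 0 -> dd e z = cp e w r ->
      exists (x : dghom W L e) (v : dghom W Y (e - 1 - 1)),
        dd e1 x = r /\ dd (e - 1) v = - cp (e - 1) w x - z.
Proof.
move=> hk hs Y; have h0 : cocycle (0 : dghom O Y 0) by apply/cocycleE; rewrite dd0.
have [X [T [eT /left_exactE hT]]] := hk O Y (Closed0 h0).
have e0 : c0 (hc_g T) = 0 by rewrite eT.
exists X, (hc_h T); split; first by rewrite hc_dd e0 cp0l oppr0.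
move=> W e e1 he ee r z hr hz.
have [||x [u [v [h1 h2 h3]]]] := hT W e e1 he ee r (cp e s (cp e1 (c0 (hc_f T)) r)) z hr.
- rewrite (@dd_cpr _ _ _ _ _ _ _ 0) ?hs ?cp1l //; try lia.
  by rewrite dd_cpl0 ?c0_dd // hr cp0r.
- by rewrite hz e0 cp0l add0r.
by exists x, v; rewrite h3 e0 cp0l subr0.
Qed.

(** A map [theta] of degree [- d] lifts through the loop object of [Y] to a map [t'] of degree
    [1 - d], up to a homotopy [eta] with differential [w t' - theta]. The fiber of [t'] also serves
    for [theta], with null-homotopy [- w b' - eta a]. *)
Lemma fiber_existsS (O : A) (s : dghom O O (-1)) d :
  (forall (Y Z : A) (g : closed0 Y Z), has_homotopy_kernel g) -> dd 0 s = dgid O ->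
  (0 < d)%N -> fiber_exists d -> fiber_exists d.+1.
Proof.
move=> hk hs d0 IH L Y theta hth.
have [Om [w [hw lift]]] := loop_exists hk hs Y.
have [|||t' [v0 [ht' hv0]]] := lift L (1 - d%:Z) (1 - d%:Z + 1) _ erefl 0 (hc L Y (1 - d%:Z - 1) (- theta)).
- by lia.
- by rewrite dd0.
- rewrite cp0r; have eq : 1 - d.+1%:Z = 1 - d%:Z - 1 by lia.
  by rewrite -eq hc_id ddN (_ : 1 - d%:Z = 1 - d.+1%:Z + 1) ?hth ?oppr0 //; lia.
have eq : 1 - d%:Z - 1 = 1 - d.+1%:Z by lia.
rewrite eq hc_id in v0 hv0.
have {}hv0 : dd (1 - d.+1%:Z) (- v0) = cp (1 - d.+1%:Z) w t' - theta by rewrite ddN hv0; zmodule.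
move: (- v0) hv0 => eta heta; clear v0.
have [L' [a [b' [ha hb' univ]]]] := IH L Om t' ht'.
pose b := - cp (- d.+1%:Z) w b' - cp (- d.+1%:Z) eta a.
have wC (W : A) j (f : dghom W Om j) l l' j' : l = j - 1 -> l' = l + 1 -> j' = j + 1 ->
    dd l' (cp l w f) = - cp l' w (dd j' f).
  by move=> e1 e2 e3; rewrite (@dd_cpl _ _ _ _ _ _ l' j') ?hw //= ?expr1 ?scaleN1r //; lia.
have eC (W : A) j (f : dghom W L j) l l' j' : l = j - d.+1%:Z -> l' = l + 1 -> j' = j + 1 ->
    dd l' (cp l eta f) = cp l' w (cp (j - d%:Z + 1) t' f) - cp l' theta f
       + (-1) ^+ d.+1 *: cp l' eta (dd j' f).
  move=> e1 e2 e3; rewrite (@dd_cp _ _ _ _ _ _ _ _ (1 - d.+1%:Z) j' _) //; try lia.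
  rewrite heta cpBl (@cpA _ _ _ _ _ _ _ _ _ _ (j - d%:Z + 1)) //; try lia.
  by congr (_ + _); apply: sign_odd; lia.
exists L', a, b; split=> //.
  rewrite /b ddB ddN (wC _ _ _ _ _ (1 - d%:Z)) //; try lia.
  rewrite (eC _ _ _ _ _ 1) //; try lia.
  rewrite ha cp0r scaler0 addr0 hb' opprK (_ : 0 - d%:Z + 1 = 1 - d%:Z); last by lia.
  exact: subKr.
move=> W e e1 he ee r x1 z hr hx1 hz.
have bE l l' j (f : dghom W L' j) : l = j - d.+1%:Z -> l' = j - d%:Z ->
    cp l b f = - cp l w (cp l' b' f) - cp l eta (cp j a f).
  move=> e2 e3; rewrite /b cpBl cpNl (@cpA _ _ _ _ _ _ _ _ _ _ l') //; try lia.
  by rewrite (@cpA _ _ _ _ _ _ _ _ _ _ j) //; lia.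
have sg (X' Y' : A) i (f : dghom X' Y' i) : (-1) ^+ d.+1 *: f = - ((-1) ^+ d *: f).
  by apply: sign_oddN.
pose Psi := cp (e1 - d%:Z) t' x1 + (-1) ^+ d *: cp (e1 - d%:Z) b' r.
have hPsi : dd (e1 - d%:Z + 1) Psi = 0.
  rewrite /Psi ddD ddZ (@dd_cpl _ _ _ _ _ _ _ e1) ?ht' //; try lia.
  rewrite hx1 (@dd_cpr _ _ _ _ _ _ _ (1 - d%:Z)) //; try lia.
  rewrite hb' (@cpA _ _ _ _ _ _ _ _ _ _ e1) ?add0r ?addr0 //.
  by rewrite (@sign_oddN _ _ `|(1 - d%:Z)|%N d) ?addNr //; lia.
have ez : e - d.+1%:Z = e - d%:Z - 1 by lia.
have ez1 : e1 - d.+1%:Z = e - d%:Z by lia.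
rewrite ez ez1 in z hz *.
have [|||z' [ka [hz' hka]]] := lift W (e - d%:Z) (e1 - d%:Z) _ _ Psi (z + cp (e - d%:Z - 1) eta x1) hPsi.
- by lia.
- by lia.
- rewrite ddD hz (eC _ _ _ _ _ e1) //; try lia.
  rewrite hx1 /Psi cpDr cpZr (bE _ (e1 - d%:Z)) //; try lia.
  rewrite (_ : e - d%:Z + 1 = e1 - d%:Z); last by lia.
  rewrite !sg scalerBr scalerN; zmodule.
have [x [u [v' [hx hu hv']]]] := univ W e e1 he ee r x1 z' hr hx1 hz'.
exists x, u, (cp (e - d%:Z - 1 - 1) w v' + ka + (-1) ^+ d *: cp (e - d%:Z - 1 - 1) eta u); split=> //.
rewrite !ddD ddZ (wC _ _ _ _ _ (e - d%:Z)) //; try lia.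
rewrite hv' hka (eC _ _ _ _ _ e) //; try lia.
rewrite (bE _ (e - d%:Z)) //; try lia.
rewrite (_ : e - 1 - d%:Z + 1 = e - d%:Z); last by lia.
rewrite hu !sg scalerDr scalerN signK !cpDr !cpNr !cpZr scalerBr.
zmodule.
Qed.

Lemma fiber_exists_all d : (exists (O : A) (s : dghom O O (-1)), dd 0 s = dgid O) ->
  H0_additive A -> (forall (Y Z : A) (g : closed0 Y Z), has_homotopy_kernel g) -> fiber_exists d.
Proof.
move=> [O [s hs]] hadd hk; elim: d => [|[|d] IH]; first exact: fiber_exists0.
  exact: fiber_exists1.
exact: (fiber_existsS hk hs).
Qed.
End Kernels.

(** * Attaching a simplex to the shape of a diagram *)

Lemma strict_self l (J : dmap l l) : dstrict J -> J = did l.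
Proof.
move=> hJ; apply: dmap_jn => u hu; rewrite jn_did //; apply/eqP; rewrite eqn_leq; apply/andP; split.
  have H w : (w <= l)%N -> (jn J (l - w) <= l - w)%N.
    elim: w => [|w IH] hw; first by rewrite subn0; exact: jn_le.
    have h1 : (jn J (l - w.+1) < jn J (l - w))%N by apply: jn_strict => //; lia.
    have := IH (ltnW hw); lia.
  by have := H (l - u)%N (leq_subr _ _); rewrite subKn.
elim: u hu => // u IH hu.
have h1 : (jn J u < jn J u.+1)%N by exact: jn_strict.
by have := IH (ltnW hu); lia.
Qed.

Section Attach.
Variables (k : comPzRingType) (A : dgcat k) (C : sset) (I : nerve_iso C A).
Variables (K : sset) (p : smap K C).

Definition supp (S : forall l, K l -> Prop) (W : A) (c : coch K W) : Prop :=
  forall l (u : K l) Y i, ~ S l u -> c l u Y i = 0.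

(** The condition of [acyclic_cone] restricted to cochains supported on [S], so that the shape can
    grow one simplex at a time. *)
Definition acyc_on (S : forall l, K l -> Prop) (L : A) (lam : coch K L) : Prop :=
  forall W (e e1 : int) (r : dghom W L e1) (rho : coch K W), e <= 0 -> e + 1 = e1 ->
  dd (e1 + 1) r = 0 -> supp S rho ->
  (forall l (u : K l) Y i, S l u -> Y = oK I p u l -> i = e1 - l%:Z ->
     cD I p rho u Y i = cp i (lam l u Y (- l%:Z)) r) ->
  exists (x : dghom W L e) (y : coch K W), [/\ supp S y, dd e1 x = r &
    forall l (u : K l) Y i, S l u -> Y = oK I p u l -> i = e - l%:Z ->
     cp i (lam l u Y (- l%:Z)) x - cD I p y u Y i = rho l u Y i].

Definition cone_on (S : forall l, K l -> Prop) : Prop :=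
  exists (L : A) (lam : coch K L), [/\ supp S lam,
    forall l (u : K l) Y i, S l u -> Y = oK I p u l -> i = 1 - l%:Z -> cD I p lam u Y i = 0
    & acyc_on S lam].

Definition face_closed (S : forall l, K l -> Prop) : Prop :=
  forall l (u : K l), S l u -> ~ degenerate u /\
    forall l' (J : dmap l' l), (l' < l)%N -> dstrict J -> S l' (act J u) \/ degenerate (act J u).

Lemma cD_local S W (c c' : coch K W) l (u : K l) Y i : face_closed S -> S l u -> Y = oK I p u l ->
  (forall l (u : K l) Y i, S l u \/ degenerate u -> c l u Y i = c' l u Y i) ->
  cD I p c u Y i = cD I p c' u Y i.
Proof.
move=> hS hu eY h; apply: cD_ext => // l' J Z j hJ eZ ej; apply: h.
have := strict_le hJ; rewrite leq_eqVlt => /orP[/eqP el|hl]; last exact: (proj2 (hS _ _ hu)).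
by subst l'; rewrite (strict_self hJ) act_id; left.
Qed.

Section Cell.
Variables (d : nat) (sg : K d).

(** The cochain concentrated at [sg] with value [v]. As the dimension varies, simplices are compared
    as dependent pairs. *)
Definition cell (W Y0 : A) j (v : dghom W Y0 j) : coch K W := fun l u Y i =>
  if excluded_middle_informative (existT (fun n => K n) l u = existT (fun n => K n) d sg)
  then hc W Y i v else 0.

Lemma cellE (W Y0 : A) j (v : dghom W Y0 j) Y i : cell v sg Y i = hc W Y i v.
Proof. by rewrite /cell; case: excluded_middle_informative. Qed.

Lemma cell0 (W Y0 : A) j (v : dghom W Y0 j) l (u : K l) Y i :
  existT (fun n => K n) l u <> existT (fun n => K n) d sg -> cell v u Y i = 0.
Proof. by rewrite /cell; case: excluded_middle_informative. Qed.

Lemma cell_ind (P : forall l, K l -> Prop) : P d sg -> forall l (u : K l),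
  existT (fun n => K n) l u = existT (fun n => K n) d sg -> P l u.
Proof.
move=> h l u e.
exact: (@eq_ind_r _ (existT (fun n => K n) d sg) (fun x => P (projT1 x) (projT2 x)) h
  (existT (fun n => K n) l u) e).
Qed.

Lemma cell_dim l (u : K l) : (l < d)%N -> existT (fun n => K n) l u <> existT (fun n => K n) d sg.
Proof. by move=> h /(congr1 (@projT1 _ _)) /= e; rewrite e ltnn in h. Qed.

Lemma cD_cell (W Y0 : A) j (v : dghom W Y0 j) Y i : Y = oK I p sg d ->
  cD I p (cell v) sg Y i = (-1) ^+ d *: dd i (hc W Y (i - 1) v).
Proof.
move=> eY; rewrite cD_proper // ?cellE // => l' J Z j' hl hJ eZ ej.
by rewrite cell0 //; exact: cell_dim.
Qed.

Variable S : forall l, K l -> Prop.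
Hypotheses (hS : face_closed S) (nd : ~ degenerate sg) (nS : ~ S sg).
Hypothesis hf : forall l' (J : dmap l' d), (l' < d)%N -> dstrict J ->
  S (act J sg) \/ degenerate (act J sg).

Lemma cell_S l (u : K l) : S u \/ degenerate u ->
  existT (fun n => K n) l u <> existT (fun n => K n) d sg.
Proof.
move=> h e; have := @cell_ind (fun l u => ~ (S u \/ degenerate u)) _ l u e; apply=> //.
by case.
Qed.

Lemma cD_cell_S (W Y0 : A) j (v : dghom W Y0 j) l (u : K l) Y i : S u -> Y = oK I p u l ->
  cD I p (cell v) u Y i = 0.
Proof.
move=> hu eY; rewrite -(cD0 I p W u Y i); apply: (@cD_local S W (cell v) (fun _ _ _ _ => 0) _ u Y i hS hu eY) => m w Z i' h.
by rewrite cell0 //; exact: cell_S.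
Qed.

(** [Th], the value of [cD lam] at the new simplex, is a cocycle of degree [1 - d] and obstructs the
    extension of the cone. Over its homotopy fiber [L'] it becomes exact, and the null-homotopy [b]
    is the component of the new cone at [sg]. *)
Lemma attach_cell : fiber_exists A d -> cone_on S ->
  cone_on (fun l u => S u \/ existT (fun n => K n) l u = existT (fun n => K n) d sg).
Proof.
move=> hfib [L [lam [ls lc acy]]]; pose Y0 := oK I p sg d.
pose Th := cD I p lam sg Y0 (1 - d%:Z).
have nlam : cnormal lam.
  by move=> l u Y i hu; apply: ls => hSu; have [nn _] := hS hSu.
have lsg Y i : lam d sg Y i = 0 by exact: ls.
have dTh : dd (2 - d%:Z) Th = 0.
  have := @cD_cD k A C I K p L lam d sg Y0 (2 - d%:Z) erefl.
  rewrite cD_proper //; last first.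
    move=> l' J Z j hl hJ eZ ej; case: (hf hl hJ) => [h|h]; last exact: cD_normal.
    by apply: lc => //; lia.
  rewrite (_ : 2 - d%:Z - 1 = 1 - d%:Z); last by lia.
  by move/(congr1 (fun x => (-1) ^+ d *: x)); rewrite signK scaler0.
(* The sign is that of the Hom differential in [cD_cell], so that the contribution of [b] cancels
   [Th]. *)
have [|L' [a [b [ha hb univ]]]] := hfib L Y0 (- ((-1) ^+ d *: Th)).
  by rewrite ddN ddZ (_ : 1 - d%:Z + 1 = 2 - d%:Z) ?dTh ?scaler0 ?oppr0 //; lia.
pose lam' : coch K L' := fun l u Y i => ccp lam a u Y i + cell b u Y i.
have lam'S l (u : K l) Y i : S u -> lam' l u Y i = cp i (lam l u Y i) a.
  by move=> hu; rewrite /lam' /ccp subr0 cell0 ?addr0 //; apply: cell_S; left.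
have lam'sg : lam' d sg Y0 (- d%:Z) = b.
  by rewrite /lam' /ccp lsg cp0l add0r cellE hc_id.
exists L', lam'; split.
- move=> l u Y i h; rewrite /lam' /ccp ls ?cp0l ?add0r ?cell0 // => hu; apply: h; [by right|by left].
- move=> l u Y i h eY ei; rewrite cDD.
  have -> : cD I p (ccp lam a) u Y i = cp i (cD I p lam u Y i) a.
    rewrite cD_ccp; last by rewrite ei; lia.
    by rewrite /ccp subr0 add0r ha cp0r addr0.
  case: h => [h|h]; first by rewrite lc // cp0l add0r cD_cell_S.
  move: eY ei; move: h.
  apply: (@cell_ind (fun l u => Y = oK I p u l -> i = 1 - l%:Z ->
    cp i (cD I p lam u Y i) a + cD I p (cell b) u Y i = 0)) => eY ei.
  rewrite cD_cell // eY -/Y0 ei -/Th (_ : 1 - d%:Z - 1 = - d%:Z); last by lia.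
  by rewrite hc_id hb cpNl cpZl scalerN signK subrr.
move=> W e e1 r rho he ee hr rs hrho.
(* The part of the data on the old simplices, to which acyclicity of the old cone applies. *)
pose rho1 : coch K W := fun l u Y i => if excluded_middle_informative (S u) then rho l u Y i else 0.
have rho1S l (u : K l) Y i : S u -> rho1 l u Y i = rho l u Y i.
  by rewrite /rho1; case: excluded_middle_informative.
have rho1N l (u : K l) Y i : ~ S u -> rho1 l u Y i = 0.
  by rewrite /rho1; case: excluded_middle_informative.
have Sdeg l (u : K l) : degenerate u -> ~ S u by move=> h /hS[].
have rdeg l (u : K l) Y i : degenerate u -> rho l u Y i = 0.
  move=> h; apply: rs => -[hu|e']; first exact: (Sdeg _ _ h).
  by apply: (@cell_S _ u) => //; right.
have [|||x1 [y1 [y1s hx1 hy1]]] := acy W e e1 (cp e1 a r) rho1 he ee.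
- by rewrite dd_cpl0 // hr cp0r.
- by move=> l u Y i; exact: rho1N.
- move=> l u Y i hu eY ei; rewrite (@cD_local _ _ rho1 rho _ _ _ _ hS) // => [|m w Z i' [h|h]].
  + rewrite hrho //; last by left.
    by rewrite lam'S // (@cpA _ _ _ _ _ _ _ _ _ _ e1) ?addr0 ?add0r.
  + exact: rho1S.
  + by rewrite rho1N ?rdeg //; exact: Sdeg.
have y1n : cnormal y1 by move=> l u Y i h; apply: y1s; exact: Sdeg.
have rE : cD I p rho1 sg Y0 (e1 - d%:Z) + (-1) ^+ d *: dd (e1 - d%:Z) (rho d sg Y0 (e - d%:Z)) =
    cp (e1 - d%:Z) b r.
  have := hrho d sg Y0 (e1 - d%:Z) (or_intror erefl) erefl erefl; rewrite lam'sg => <-.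
  transitivity (cD I p (fun l u Y i => rho1 l u Y i + cell (rho d sg Y0 (e - d%:Z)) u Y i) sg Y0 (e1 - d%:Z)).
    rewrite cDD cD_cell // (_ : e1 - d%:Z - 1 = e - d%:Z) ?hc_id //; lia.
  apply: cD_ext => // l' J Z j hJ eZ ej.
  have := strict_le hJ; rewrite leq_eqVlt => /orP[/eqP el|hl].
    subst l'; rewrite (strict_self hJ) act_id in eZ *; rewrite eZ rho1N // add0r cellE.
    by have -> : j = e - d%:Z by [lia]; rewrite hc_id.
  rewrite cell0 ?addr0; last exact: cell_dim.
  by case: (hf hl hJ) => h; [rewrite rho1S | rewrite rho1N ?rdeg //; exact: Sdeg].
(* What the old solution leaves over at [sg]. Its differential follows from evaluating [cD] on
   [cD y1 - lam x1 + rho1], which vanishes on the proper faces of [sg]. *)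
pose z := rho d sg Y0 (e - d%:Z) + cD I p y1 sg Y0 (e - d%:Z).
have hz : dd (e1 - d%:Z) z = cp (e1 - d%:Z) (- ((-1) ^+ d *: Th)) x1 + (-1) ^+ d *: cp (e1 - d%:Z) b r.
  pose c : coch K W := fun l u Y i => (cD I p y1 u Y i - ccp lam x1 u Y i) + rho1 l u Y i.
  have cS : cD I p c sg Y0 (e1 - d%:Z) = (-1) ^+ d *: dd (e1 - d%:Z) (cD I p y1 sg Y0 (e - d%:Z)).
    rewrite cD_proper //.
      rewrite /c /ccp (_ : e1 - d%:Z - 1 = e - d%:Z); last by lia.
      by rewrite lsg cp0l rho1N // subr0 addr0.
    move=> l' J Z j hl hJ eZ ej; rewrite /c; case: (hf hl hJ) => h; last first.
      rewrite cD_normal // rho1N; last exact: Sdeg.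
      by rewrite /ccp nlam // cp0l subrr addr0.
    rewrite rho1S // -(rho1S _ _ _ _ h) -hy1 //; last by lia.
    rewrite /ccp (_ : j - e = - l'%:Z); last by lia.
    zmodule.
  have cE : cD I p c sg Y0 (e1 - d%:Z) = cD I p rho1 sg Y0 (e1 - d%:Z) - cp (e1 - d%:Z) Th x1.
    rewrite /c cDD cDB cD_cD // cD_ccp; last by lia.
    rewrite /ccp lsg cp0l addr0 (_ : e1 - d%:Z - e = 1 - d%:Z); last by lia.
    by rewrite -/Th; zmodule.
  rewrite /z ddD cpNl cpZl -(signK d (dd _ (cD I p y1 _ _ _))) -cS cE -rE scalerBr scalerDr signK.
  zmodule.
have [x [u [v [hx hu hv]]]] := univ W e e1 he ee r x1 z hr hx1 hz.
exists x, (fun l w Y i => y1 l w Y i + ccp lam u w Y i + cell ((-1) ^+ d *: v) w Y i); split=> //.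
  move=> l w Y i h; rewrite /ccp y1s ?ls ?cp0l ?cell0 ?addr0 // => h'; apply: h; by [left|right].
move=> l w Y i h eY ei; rewrite !cDD.
have -> : cD I p (ccp lam u) w Y i =
    cp i (cD I p lam w Y (1 - l%:Z)) u + cp i (lam l w Y (- l%:Z)) (cp e a x - x1).
  rewrite cD_ccp; last by lia.
  rewrite /ccp (_ : i - (e - 1) = 1 - l%:Z); last by lia.
  rewrite (_ : e - 1 + 1 = e); last by lia.
  by rewrite hu (_ : i - e = - l%:Z) //; lia.
case: h => [h|h].
  rewrite lc // cp0l add0r cD_cell_S // addr0 lam'S // (@cpA _ _ _ _ _ _ _ _ _ _ e) ?addr0 ?add0r //.
  rewrite -(rho1S _ _ _ _ h) -hy1 // cpBr; zmodule.
move: eY ei; move: h.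
apply: (@cell_ind (fun l w => Y = oK I p w l -> i = e - l%:Z ->
  cp i (lam' l w Y (- l%:Z)) x - (cD I p y1 w Y i + (cp i (cD I p lam w Y (1 - l%:Z)) u +
    cp i (lam l w Y (- l%:Z)) (cp e a x - x1)) + cD I p (cell ((-1) ^+ d *: v)) w Y i) = rho l w Y i)).
move=> -> ->; rewrite -/Y0 lam'sg lsg cp0l addr0 -/Th cD_cell // hc_id ddZ signK hv /z.
rewrite cpNl cpZl scalerN signK; zmodule.
Qed.
End Cell.

Lemma cone_empty (O : A) (s : dghom O O (-1)) : dd 0 s = dgid O -> cone_on (fun l u => False).
Proof.
move=> hs; exists O, (fun l u Y i => 0); split=> //.
move=> W e e1 r rho he ee hr _ _; exists (cp e s r), (fun l u Y i => 0); split=> //.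
by rewrite (@dd_cpr _ _ _ _ _ _ _ _ _ 0) ?hs ?cp1l //; lia.
Qed.

Lemma cone_on_limit S : (forall l (u : K l), S l u <-> ~ degenerate u) -> cone_on S -> has_limit p.
Proof.
move=> hS [L [lam [ls lc acy]]].
have [w ew] := ob_surj I L; subst L.
have nlam : cnormal lam by move=> l u Y i h; apply: ls => /hS.
have [|t [et ht]] := @slice_vertex k A C I K p w lam nlam.
  move=> l u Y i eY ei; case: (excluded_middle_informative (degenerate u)) => h.
    exact: cD_normal.
  by apply: lc => //; apply/hS.
subst w; exists t; apply: acyclic_limit => W e e1 r rho he ee hr hn hrho.
have [|| x [y [ys hx hy]]] := acy W e e1 r rho he ee hr.
- move=> l u Y i h; apply: hn; apply: NNPP => h'; exact/h/hS.
- move=> l u Y i hu eY ei; rewrite hrho //; congr (cp _ _ _); exact: ht.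
exists x, y; split=> //; first by move=> l u Y i h; apply: ys => /hS.
move=> l u Y i eY ei; rewrite [cone_coch _ _ _ _ _]ht //.
case: (excluded_middle_informative (degenerate u)) => h; last by apply: hy => //; apply/hS.
rewrite nlam // cp0l cD_normal // ?subr0 ?hn //.
by move=> m w Z j hw; apply: ys => /hS.
Qed.

(** [S N r] consists of the nondegenerate simplices of dimension below [N] and of those of dimension
    [N] in the list [r]. Induction on [r] within a dimension, then on [N], attaches every simplex
    after its faces; the start is the empty diagram, with a contractible apex. *)
Lemma finite_limit (O : A) (s : dghom O O (-1)) : dd 0 s = dgid O ->
  (forall d, fiber_exists A d) -> finite_sset K -> has_limit p.
Proof.
move=> hs hfib [q hq].
pose S N (r : list {n : nat & K n}) : forall l, K l -> Prop := fun l u => ~ degenerate u /\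
  ((l < N)%N \/ (l = N /\ List.In (existT (fun n => K n) l u) r)).
have SC N r : face_closed (S N r).
  move=> l u [h1 h2]; split=> // l' J hl hJ.
  case: (excluded_middle_informative (degenerate (act J u))) => h; first by right.
  by left; split=> //; left; case: h2 => [h2|[h2 _]]; [exact: ltn_trans hl h2 | rewrite -h2].
have Sext T T' : (forall l (u : K l), T l u <-> T' l u) -> cone_on T -> cone_on T'.
  move=> h; suff -> : T = T' by [].
  apply: functional_extensionality_dep => l; apply: functional_extensionality => u.
  exact: propositional_extensionality.
have step N r : cone_on (S N nil) -> cone_on (S N r).
  move=> h0; elim: r => [|[n t] r IH] //.
  case: (excluded_middle_informative (n = N /\ ~ degenerate t /\ ~ S N r n t)) => [[en [nd nS]]|h].
    subst n; apply: Sext (attach_cell (sg := t) (SC N r) nd nS _ (hfib N) IH).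
      move=> l u; split=> [[[h1 h2]|e]|[h1 [h2|[h2 [h3|h3]]]]].
      + by split=> //; case: h2 => [h2|[h2 h3]]; [left | right; split=> //; right].
      + by apply: (cell_ind (sg := t) (P := S N (existT _ N t :: r))) e; split=> //; right; split=> //; left.
      + by left; split=> //; left.
      + by right.
      + by left; split=> //; right.
    move=> l' J hl hJ; case: (excluded_middle_informative (degenerate (act J t))) => h; first by right.
    by left; split=> //; left.
  apply: Sext IH => l u; split=> [[h1 [h2|[h2 h3]]]|[h1 [h2|[h2 [h3|h3]]]]].
  + by split=> //; left.
  + by split=> //; right; split=> //; right.
  + by split=> //; left.
  + apply: NNPP => h4; apply: h; move: h4 h1 h2.
    apply: (cell_ind (sg := u) (P := fun n t => ~ S N r l u -> ~ degenerate u -> l = N ->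
      n = N /\ ~ degenerate t /\ ~ S N r n t)) h3 => //.
  + by split=> //; right.
have base N : cone_on (S N nil).
  elim: N => [|N IH].
    apply: Sext (cone_empty hs) => l u; split=> // -[_ [|[]]] //.
  apply: Sext (step N q IH) => l u; split=> -[h1 h2]; split=> //.
    by left; case: h2 => [h2|[e _]]; [exact: ltnW|rewrite e].
  case: h2 => [|[_ []]]; rewrite ltnS leq_eqVlt => /orP[/eqP e|h]; last by left.
  by right; split=> //; apply: hq.
have [M hM] : exists M, forall x, List.In x q -> (projT1 x < M)%N.
  elim: (q) => [|x r [M IH]]; first by exists 0%N.
  exists (maxn (projT1 x).+1 M) => y [<-|/IH h]; rewrite leq_max; first by rewrite leqnn.
  by rewrite h orbT.
apply: cone_on_limit (base M) => l u; split=> [[]//|h]; split=> //; left.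
by have := hM _ (hq _ _ h).
Qed.
End Attach.

(** * Squares and 3-term complexes *)

Section CospanAlgebra.
Variables (k : comPzRingType) (A : dgcat k).

Definition lex_data (X Y Z : A) (f : dghom X Y 0) (g : dghom Y Z 0) (h : dghom X Z (-1)) : Prop :=
  forall W (e e1 : int), e <= 0 -> e + 1 = e1 ->
  forall (r : dghom W X e1) (x1 : dghom W Y e) (z : dghom W Z (e - 1)),
    dd (e1 + 1) r = 0 -> dd e1 x1 = cp e1 f r -> dd e z = cp e g x1 + cp e h r ->
  exists (x : dghom W X e) (u : dghom W Y (e - 1)) (v : dghom W Z (e - 1 - 1)),
    [/\ dd e1 x = r, dd e u = cp e f x - x1 &
      dd (e - 1) v = - cp (e - 1) h x - z - cp (e - 1) g u].

Lemma left_exact_lex (X Y Z : A) (T : hcomplex3 X Y Z) : nonpositive A ->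
  left_exact T <-> lex_data (c0 (hc_f T)) (c0 (hc_g T)) (hc_h T).
Proof. by move=> hA; exact: left_exactE. Qed.

(** [acyclic_cone] for a cospan [X1 -> X3 <- X2], unfolded on its five nondegenerate simplices:
    [p1], [p2], [p3] are the values at the vertices and [q1], [q2] those at the edges, while [l1],
    [l2], [l3], [m1], [m2] are the components of the cone. *)
Definition acy5 (L X1 X2 X3 : A) (f1 : dghom X1 X3 0) (f2 : dghom X2 X3 0)
    (l1 : dghom L X1 0) (l2 : dghom L X2 0) (l3 : dghom L X3 0) (m1 m2 : dghom L X3 (-1)) : Prop :=
  forall W (e e1 : int) (r : dghom W L e1) (p1 : dghom W X1 e) (p2 : dghom W X2 e)
    (p3 : dghom W X3 e) (q1 q2 : dghom W X3 (e - 1)), e <= 0 -> e + 1 = e1 ->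
    dd (e1 + 1) r = 0 -> dd e1 p1 = cp e1 l1 r -> dd e1 p2 = cp e1 l2 r -> dd e1 p3 = cp e1 l3 r ->
    dd e q1 = cp e f1 p1 - p3 - cp e m1 r -> dd e q2 = cp e f2 p2 - p3 - cp e m2 r ->
  exists (x : dghom W L e) (y1 : dghom W X1 (e - 1)) (y2 : dghom W X2 (e - 1))
    (y3 : dghom W X3 (e - 1)) (t1 t2 : dghom W X3 (e - 1 - 1)),
    [/\ dd e1 x = r, dd e y1 = cp e l1 x - p1, dd e y2 = cp e l2 x - p2 & dd e y3 = cp e l3 x - p3] /\
    dd (e - 1) t1 = q1 - cp (e - 1) m1 x + cp (e - 1) f1 y1 - y3 /\
    dd (e - 1) t2 = q2 - cp (e - 1) m2 x + cp (e - 1) f2 y2 - y3.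

Lemma acy5_sym (L X1 X2 X3 : A) (f1 : dghom X1 X3 0) (f2 : dghom X2 X3 0)
    (l1 : dghom L X1 0) (l2 : dghom L X2 0) (l3 : dghom L X3 0) (m1 m2 : dghom L X3 (-1)) :
  acy5 f1 f2 l1 l2 l3 m1 m2 -> acy5 f2 f1 l2 l1 l3 m2 m1.
Proof.
move=> H W e e1 r p1 p2 p3 q1 q2 he ee hr h1 h2 h3 h4 h5.
have [x [y1 [y2 [y3 [t1 [t2 [[a1 a2 a3 a4] [a5 a6]]]]]]]] := H W e e1 r p2 p1 p3 q2 q1 he ee hr h2 h1 h3 h5 h4.
by exists x, y2, y1, y3, t2, t1.
Qed.

Section Contraction.
Variables (L X1 X2 X3 : A) (f1 : dghom X1 X3 0) (f2 : dghom X2 X3 0)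
    (l1 : dghom L X1 0) (l2 : dghom L X2 0) (l3 : dghom L X3 0) (m1 m2 : dghom L X3 (-1)).
Variable s : dghom X2 X2 (-1).
Hypotheses (hf1 : dd 1 f1 = 0) (hf2 : dd 1 f2 = 0) (hl1 : dd 1 l1 = 0) (hl2 : dd 1 l2 = 0)
  (hl3 : dd 1 l3 = 0) (hm1 : dd 0 m1 = cp 0 f1 l1 - l3) (hm2 : dd 0 m2 = cp 0 f2 l2 - l3)
  (hs : dd 0 s = dgid X2).

(** A null-homotopy of [- f1 l1]: [m1] and [m2] compare the two composites of the square with the
    diagonal [l3], and the composite through [X2] is contracted by [s]. *)
Definition sq_h : dghom L X3 (-1) := m2 - m1 - cp (-1) f2 (cp (-1) s l2).

Let dS W j i i2 (w : dghom W X2 i) : j + 1 = i -> i + 1 = i2 ->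
  dd i (cp j s w) = w - cp i s (dd i2 w).
Proof.
move=> e1 e2; rewrite (@dd_cp _ _ _ _ _ _ _ _ 0 i2) //; try lia.
by rewrite hs cp1l /= expr1 scaleN1r.
Qed.

Let dm1 W j i i2 (w : dghom W L i) : j + 1 = i -> i + 1 = i2 ->
  dd i (cp j m1 w) = cp i f1 (cp i l1 w) - cp i l3 w - cp i m1 (dd i2 w).
Proof.
move=> e1 e2; rewrite (@dd_cp _ _ _ _ _ _ _ _ 0 i2) //; try lia.
by rewrite hm1 cpBl (@cpA _ _ _ _ _ _ _ _ _ _ i) ?add0r //= expr1 scaleN1r.
Qed.

Let hE W i i' (w : dghom W L i') : i + 1 = i' ->
  cp i sq_h w = cp i m2 w - cp i m1 w - cp i f2 (cp i s (cp i' l2 w)).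
Proof.
move=> e; rewrite /sq_h !cpBl (@cpA _ _ _ _ _ _ _ _ _ _ i) //; try lia.
by rewrite (@cpA _ _ _ _ _ _ _ _ _ _ i') ?add0r.
Qed.

Lemma sq_h_dd : dd 0 sq_h = - cp 0 f1 l1.
Proof.
rewrite /sq_h !ddB hm1 hm2 dd_cpl0 // (@dS _ _ _ 1) // hl2 cp0r subr0.
have key (V : zmodType) (a b c : V) : a - b - (c - b) - a = - c by zmodule.
exact: key.
Qed.

(** The values at [X2] and [X3] are eliminated, the first by means of the contraction [s], the
    second because the edge from [X1] determines it up to a coboundary. *)
Lemma acy5_lex : acy5 f1 f2 l1 l2 l3 m1 m2 <-> lex_data l1 f1 sq_h.
Proof.
split=> [H W e e1 he ee r x1 z hr hx1 hz|H W e e1 r p1 p2 p3 q1 q2 he ee hr h1 h2 h3 h4 h5].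
  have ee' : e - 1 + 1 = e by lia.
  have dl2r : dd (e1 + 1) (cp e1 l2 r) = 0 by rewrite dd_cpl0 // hr cp0r.
  have [||||x [y1 [y2 [y3 [t1 [t2 [[a1 a2 a3 a4] [a5 a6]]]]]]]] := H W e e1 r x1 (cp e s (cp e1 l2 r))
    (cp e f1 x1 - cp e m1 r) 0 (- z) he ee hr hx1.
  - by rewrite (@dS _ _ _ (e1 + 1)) // dl2r cp0r subr0.
  - rewrite ddB dd_cpl0 // hx1 (@dm1 _ _ _ (e1 + 1)) // hr cp0r.
    have key (V : zmodType) (a b : V) : a - (a - b - 0) = b by zmodule.
    exact: key.
  - have key (V : zmodType) (a b : V) : 0 = a - (a - b) - b by zmodule.
    by rewrite dd0; exact: key.
  - rewrite ddN hz (hE _ ee).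
    have key (V : zmodType) (a b c d : V) : - (a + (b - c - d)) = d - (a - c) - b by zmodule.
    exact: key.
  exists x, y1, (t2 - t1 - cp (e - 1 - 1) f2 (cp (e - 1 - 1) s (y2 - cp (e - 1) s (cp e l2 x)))).
  split=> //; rewrite !ddB a5 a6 dd_cpl0 //; last by lia.
  rewrite (@dS _ _ _ e) //; last by lia.
  rewrite ddB a3 (@dS _ _ _ e1) // dd_cpl0 // a1 (hE _ ee').
  have -> : cp e l2 x - cp e s (cp e1 l2 r) - (cp e l2 x - cp e s (cp e1 l2 r)) = 0 by exact: subrr.
  rewrite cp0r subr0 cpBr.
  have key (V : zmodType) (a b c d f g h i : V) :
    - a - b + c - d - (0 - f + g - d) - (c - h) = - (b - f - h) - a - g by zmodule.
  exact: key.
have ee' : e - 1 + 1 = e by lia.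
have dl2r : dd (e1 + 1) (cp e1 l2 r) = 0 by rewrite dd_cpl0 // hr cp0r.
pose z := q1 - q2 + cp (e - 1) f2 (cp (e - 1) s (p2 - cp e s (cp e1 l2 r))).
have hz : dd e z = cp e f1 p1 + cp e sq_h r.
  rewrite /z ddD ddB h4 h5 dd_cpl0 // (@dS _ _ _ e1) // ddB h2 (@dS _ _ _ (e1 + 1)) // dl2r cp0r subr0.
  rewrite subrr cp0r subr0 cpBr (hE _ ee).
  have key (V : zmodType) (a b c d f g : V) :
    a - b - c - (d - b - f) + (d - g) = a + (f - c - g) by zmodule.
  exact: key.
have [x [u [v [a1 a2 a3]]]] := H W e e1 he ee r p1 z hr h1 hz.
exists x, u, (cp (e - 1) s (cp e l2 x - p2)), (q1 - cp (e - 1) m1 x + cp (e - 1) f1 u), 0,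
  (v - cp (e - 1 - 1) f2 (cp (e - 1 - 1) s (cp (e - 1) s (cp e l2 x)))).
split; [split=> //|split].
- rewrite (@dS _ _ _ e1) // ddB dd_cpl0 // a1 h2 subrr cp0r subr0 //.
- rewrite ddD ddB h4 (@dm1 _ _ _ e1) // dd_cpl0 // a1 a2 cpBr.
  have key (V : zmodType) (a b c d f : V) : a - b - c - (d - f - c) + (d - a) = f - b by zmodule.
  exact: key.
- by rewrite dd0 subrr.
rewrite ddB a3 dd_cpl0 //; last by lia.
rewrite (@dS _ _ _ e) //; last by lia.
rewrite (@dS _ _ _ e1) // dd_cpl0 // a1 (hE _ ee') /z !cpBr.
have key (V : zmodType) (a b c d f g h i j : V) :
  - (a - b - c) - (d - f + (g - h)) - i - (c - (c - h)) =
  f - a + (c - g) - (d - b + i) by zmodule.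
exact: key.
Qed.
End Contraction.
End CospanAlgebra.

Lemma cmap_ext (k : comPzRingType) (M N : cplx k) (phi psi : cmap M N) :
  (forall i x, phi i x = psi i x) -> phi = psi.
Proof.
case: phi psi => [f f1 f2] [g g1 g2] /= h.
have e : f = g.
  by apply: functional_extensionality_dep => i; apply: functional_extensionality => x; exact: h.
by subst g; congr Cmap; exact: proof_irrelevance.
Qed.

Lemma H_bij_fib (k : comPzRingType) (P M N : cplx k) (phi phi' : cmap M N)
    (psi : cmap P (fib phi)) (psi' : cmap P (fib phi')) i : (forall i x, phi i x = phi' i x) ->
  (forall i x, psi i x = psi' i x :> (M i * N (i - 1))%type) -> H_bij psi i <-> H_bij psi' i.
Proof. by move=> /cmap_ext e h; subst phi'; rewrite (@cmap_ext k P (fib phi) psi psi' h). Qed.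

(** * Exactness in the opposite DG-category *)

Section Opposite.
Variables (k : comPzRingType) (A : dgcat k).

Definition closed0_unop (X Y : A) (f : @closed0 k (dgop A) X Y) : @closed0 k A Y X :=
  @Closed0 k A Y X (c0 f) (c0_closed f).

Definition hc_op (X Y Z : A) (T : @hcomplex3 k A X Y Z) : @hcomplex3 k (dgop A) Z Y X.
Proof.
refine (@HComplex3 k (dgop A) Z Y X (closed0_op (hc_g T)) (closed0_op (hc_f T)) (hc_h T) _).
rewrite /= /dgop_comp mul0n expr0 scale1r; apply: (etrans (hc_d T)).
by congr (- _); exact: dgcomp_irr.
Defined.

Definition hc_unop (X Y Z : A) (T : @hcomplex3 k (dgop A) X Y Z) : @hcomplex3 k A Z Y X.
Proof.
refine (@HComplex3 k A Z Y X (closed0_unop (hc_g T)) (closed0_unop (hc_f T)) (hc_h T) _).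
apply: (etrans (hc_d T)); rewrite /= /dgop_comp mul0n expr0 scale1r.
by congr (- _); exact: dgcomp_irr.
Defined.

(** The sign [(-1)^|u|] in [from_cofib] is the Koszul sign of composition with [h], of degree -1, in
    [dgop A]. *)
Lemma right_exact_op (X Y Z : A) (T : @hcomplex3 k A X Y Z) : right_exact T <-> left_exact (hc_op T).
Proof.
suff H W i : H_bij (from_cofib T W) i <-> H_bij (to_fib (hc_op T) W) i.
  by split=> h W i hi; apply/H/h.
apply: H_bij_fib => j x.
  rewrite /= /dgop_comp mul0n expr0 scale1r; exact: dgcomp_irr.
rewrite /= /dgop_comp mul0n mul1n expr0 scale1r; congr pair; first exact: dgcomp_irr.
by congr (_ *: _); exact: dgcomp_irr.
Qed.

Lemma left_exact_unop (X Y Z : A) (T : @hcomplex3 k (dgop A) X Y Z) :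
  left_exact T <-> right_exact (hc_unop T).
Proof.
suff H W i : H_bij (to_fib T W) i <-> H_bij (from_cofib (hc_unop T) W) i.
  by split=> h W i hi; apply/H/h.
apply: H_bij_fib => j x.
  rewrite /= /dgop_comp mul0n expr0 scale1r; exact: dgcomp_irr.
rewrite /= /dgop_comp mul0n mul1n expr0 scale1r; congr pair; first exact: dgcomp_irr.
by congr (_ *: _); exact: dgcomp_irr.
Qed.

Lemma right_exact_unop (X Y Z : A) (T : @hcomplex3 k (dgop A) X Y Z) :
  right_exact T <-> left_exact (hc_unop T).
Proof.
suff H W i : H_bij (from_cofib T W) i <-> H_bij (to_fib (hc_unop T) W) i.
  by split=> h W i hi; apply/H/h.
apply: H_bij_fib => j x.
  rewrite /= /dgop_comp muln0 expr0 scale1r; exact: dgcomp_irr.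
rewrite /= /dgop_comp muln0 muln1 expr0 scale1r signK; congr pair; exact: dgcomp_irr.
Qed.

Lemma kernel_op : (forall (X Y : A) (f : closed0 X Y), has_homotopy_cokernel f) ->
  forall (Y Z : dgop A) (g : @closed0 k (dgop A) Y Z), has_homotopy_kernel g.
Proof.
move=> hc Y Z g; have [X [T [eT hT]]] := hc Z Y (closed0_unop g).
exists X, (hc_op T); split; last exact/right_exact_op.
by rewrite /= eT; case: g {eT}.
Qed.

Lemma cokernel_unop : (forall (Y Z : dgop A) (g : @closed0 k (dgop A) Y Z), has_homotopy_kernel g) ->
  forall (X Y : A) (f : closed0 X Y), has_homotopy_cokernel f.
Proof.
move=> hk X Y f; have [Z [T [eT /left_exact_unop hT]]] := hk Y X (closed0_op f).
exists Z, (hc_unop T); split=> //.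
by rewrite /= eT; case: f {eT}.
Qed.

Lemma H0_additive_op : H0_additive A -> H0_additive (dgop A).
Proof.
move=> [[O hO] hb]; split; first by exists O => X; have [h1 h2] := hO X; split=> f;
  [exact: (h2 (closed0_unop f)) | exact: (h1 (closed0_unop f))].
move=> X Y; have [S [i1 [i2 [p1 [p2 [h1 h2 h3 h4 h5]]]]]] := hb X Y.
exists S, (closed0_op p1), (closed0_op p2), (closed0_op i1), (closed0_op i2).
have E (X' Y' Z' : A) (g : closed0 Y' Z') (f : closed0 X' Y') :
    @comp0 k (dgop A) Z' Y' X' (closed0_op f) (closed0_op g) = comp0 g f.
  by rewrite /comp0 /= /dgop_comp mul0n expr0 scale1r; exact: dgcomp_irr.
by rewrite /H0_biproduct !E; split.
Qed.

Lemma nonpositive_op : nonpositive A -> nonpositive (dgop A).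
Proof. by move=> h X Y i x; exact: h. Qed.
End Opposite.

(** * The cospan shape and its cochains *)

Lemma in_cospan1 l (J : dmap l 1) : @in_cospan l (dconst l ord_max, J).
Proof. by move=> i [] /= /(congr1 val). Qed.

Lemma in_cospan2 l (J : dmap l 1) : @in_cospan l (J, dconst l ord_max).
Proof. by move=> i [_] /= /(congr1 val). Qed.

(** [cl1] and [cl2] are the simplices of the two legs of the cospan, one coordinate being constant
    at 1; the legs meet in the vertex [cv3]. *)
Definition cl1 l (J : dmap l 1) : cospan_shape l := exist (@in_cospan l) (dconst l ord_max, J) (@in_cospan1 l J).
Definition cl2 l (J : dmap l 1) : cospan_shape l := exist (@in_cospan l) (J, dconst l ord_max) (@in_cospan2 l J).
Definition ce1 := cl1 (did 1).
Definition ce2 := cl2 (did 1).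
Definition cv1 := cl1 (dconst 0 ord0).
Definition cv2 := cl2 (dconst 0 ord0).
Definition cv3 := cl1 (dconst 0 ord_max).

Lemma act_cl1 m l (a : dmap m l) J : act a (cl1 J) = cl1 (dcomp J a).
Proof. by apply: sig_eq => /=; congr pair; exact: dmap_eq. Qed.

Lemma act_cl2 m l (a : dmap m l) J : act a (cl2 J) = cl2 (dcomp J a).
Proof. by apply: sig_eq => /=; congr pair; exact: dmap_eq. Qed.

Lemma cv3E : cl2 (dconst 0 ord_max) = cv3.
Proof. exact: sig_eq. Qed.

Lemma ord2P (i : 'I_2) : i = ord0 \/ i = ord_max.
Proof. by case: i => [[|[|//]] h]; [left|right]; exact: val_inj. Qed.

Lemma cospan_cases l (u : cospan_shape l) : (exists J, u = cl1 J) \/ (exists J, u = cl2 J).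
Proof.
case: u => [[x y] h]; case: (ord2P ((x : dmap l 1) ord0)) => hx.
  right; exists x; apply: sig_eq => /=; congr pair; apply: dmap_eq => i /=.
  case: (ord2P ((y : dmap l 1) ord0)) => hy; first by case: (h ord0); split.
  case: (ord2P ((y : dmap l 1) i)) => // hi.
  by have := dfun_homo (y : dmap l 1) (leq0n i : ((ord0 : 'I_l.+1) <= i)%N); rewrite hy hi.
left; exists y; apply: sig_eq => /=; congr pair; apply: dmap_eq => i /=.
case: (ord2P ((x : dmap l 1) i)) => // hi.
by have := dfun_homo (x : dmap l 1) (leq0n i : ((ord0 : 'I_l.+1) <= i)%N); rewrite hx hi.
Qed.

Lemma cospan_ind (P : forall l, cospan_shape l -> Prop) :
  (forall l (u : cospan_shape l), degenerate u -> P l u) ->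
  P 0%N cv1 -> P 0%N cv2 -> P 0%N cv3 -> P 1%N ce1 -> P 1%N ce2 -> forall l (u : cospan_shape l), P l u.
Proof.
move=> hd h1 h2 h3 h4 h5 l u.
have J1 m (J : dmap m 1) : cl1 J = act J ce1 by rewrite act_cl1; congr cl1; exact: dmap_eq.
have J2 m (J : dmap m 1) : cl2 J = act J ce2 by rewrite act_cl2; congr cl2; exact: dmap_eq.
have K0 (J : dmap 0 1) : J = dconst 0 ord0 \/ J = dconst 0 ord_max.
  case: (ord2P (J ord0)) => e; [left|right]; apply: dmap_eq => i; by rewrite ord1 e.
case: (cospan_cases u) => -[J ->]; case: (boolP (dstrict J)) => hJ.
- have := strict_le hJ; case: l J hJ {u} => [|[|//]] J hJ _; last by rewrite (strict_self hJ).
  by case: (K0 J) => ->.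
- by apply: hd; rewrite J1; exact: degenerate_act.
- have := strict_le hJ; case: l J hJ {u} => [|[|//]] J hJ _; last by rewrite (strict_self hJ).
  by case: (K0 J) => -> //; rewrite cv3E.
- by apply: hd; rewrite J2; exact: degenerate_act.
Qed.

Lemma cospan_nondeg l (J : dmap l 1) : dstrict J -> ~ degenerate (cl1 J) /\ ~ degenerate (cl2 J).
Proof.
move=> hJ; split=> -[m [a [y [hm e]]]].
  have e2 : J = dcomp ((proj1_sig y).2 : dmap m 1) a := congr1 (fun u => (proj1_sig u).2) e.
  by rewrite e2 in hJ; have := strict_le (dstrict_compr hJ); lia.
have e2 : J = dcomp ((proj1_sig y).1 : dmap m 1) a := congr1 (fun u => (proj1_sig u).1) e.
by rewrite e2 in hJ; have := strict_le (dstrict_compr hJ); lia.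
Qed.

Section CospanCochains.
Variables (k : comPzRingType) (A : dgcat k) (C : sset) (I : nerve_iso C A).

Section Low.
Variables (K : sset) (p : smap K C) (W : A) (c : coch K W).

Lemma cD_vert (u : K 0%N) Y i : cD I p c u Y i = dd i (@c _ u Y (i - 1)).
Proof. by rewrite /cD /cR big_ord0 subr0 expr0 scale1r. Qed.

Lemma cD_edge (u : K 1%N) X Y i : X = oK I p u 0 ->
  cD I p c u Y i = cp i (mK I p u X Y 0) (@c 0%N (sb 0 (fun=> 0%N) u) X i) -
    @c 0%N (sb 0 (fun=> 1%N) u) Y i - dd i (@c _ u Y (i - 1)).
Proof.
move=> ->; rewrite /cD /cR big_ord_recl big_ord0 addr0 /= subn0 !expr1 !scaleN1r subrK.
rewrite (_ : sb 1 (addn 0) u = u); last by apply: sb_id.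
rewrite (_ : sb 0 (bump 0) u = sb 0 (fun=> 1%N) u); last by apply: sb_eq => -[].
rewrite (_ : sb 0 id u = sb 0 (fun=> 0%N) u); last by apply: sb_eq => -[].
have key (V : zmodType) (a b d : V) : - (a - - (b - d)) = d - b - a by zmodule.
exact: key.
Qed.
End Low.

Variable p : smap cospan_shape C.
Variables (X1 X2 X3 : A).
Hypotheses (hX1 : X1 = oK I p cv1 0) (hX2 : X2 = oK I p cv2 0) (hX3 : X3 = oK I p cv3 0).

Lemma sb_ce : [/\ sb 0 (fun=> 0%N) ce1 = cv1, sb 0 (fun=> 1%N) ce1 = cv3,
  sb 0 (fun=> 0%N) ce2 = cv2 & sb 0 (fun=> 1%N) ce2 = cv3].
Proof.
have E a (b : 'I_2) : (a <= 1)%N -> b = a :> nat -> dcomp (did 1) (mkd 0 1 (fun=> a)) = dconst 0 b.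
  by move=> ha hb; apply: dmap_jn => u hu; rewrite jn_comp jn_dconst // jn_mkd // jn_did.
split.
- by rewrite /sb act_cl1 (@E 0%N ord0).
- by rewrite /sb act_cl1 (@E 1%N ord_max).
- by rewrite /sb act_cl2 (@E 0%N ord0).
- by rewrite /sb act_cl2 (@E 1%N ord_max) // cv3E.
Qed.

Lemma oK_ce : [/\ X1 = oK I p ce1 0, X3 = oK I p ce1 1, X2 = oK I p ce2 0 & X3 = oK I p ce2 1].
Proof.
have [s1 s2 s3 s4] := sb_ce.
split; [rewrite hX1 -s1|rewrite hX3 -s2|rewrite hX2 -s3|rewrite hX3 -s4]; by rewrite oK_sb.
Qed.

Definition coch5 W j1 j2 (p1 : dghom W X1 j1) (p2 : dghom W X2 j1) (p3 : dghom W X3 j1)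
    (q1 q2 : dghom W X3 j2) : coch cospan_shape W := fun l u Y i =>
  cell cv1 p1 u Y i + cell cv2 p2 u Y i + cell cv3 p3 u Y i + cell ce1 q1 u Y i + cell ce2 q2 u Y i.

(** Dimension and first vertex tell the five cells apart by computation. *)
Let key (s : {n : nat & cospan_shape n}) : nat * nat * nat :=
  (projT1 s, nat_of_ord (((proj1_sig (projT2 s)).1 : dmap _ 1) ord0),
   nat_of_ord (((proj1_sig (projT2 s)).2 : dmap _ 1) ord0)).

Lemma coch5E W j1 j2 (p1 : dghom W X1 j1) p2 p3 (q1 q2 : dghom W X3 j2) Y i :
  [/\ coch5 p1 p2 p3 q1 q2 cv1 Y i = hc W Y i p1, coch5 p1 p2 p3 q1 q2 cv2 Y i = hc W Y i p2,
    coch5 p1 p2 p3 q1 q2 cv3 Y i = hc W Y i p3 & coch5 p1 p2 p3 q1 q2 ce1 Y i = hc W Y i q1 /\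
    coch5 p1 p2 p3 q1 q2 ce2 Y i = hc W Y i q2].
Proof.
by split; [| | |split]; rewrite /coch5 ?cellE ?cell0 ?addr0 ?add0r //; move/(congr1 key).
Qed.

Lemma coch5_normal W j1 j2 (p1 : dghom W X1 j1) p2 p3 (q1 q2 : dghom W X3 j2) :
  cnormal (coch5 p1 p2 p3 q1 q2).
Proof.
have s0 i : dstrict (dconst 0 (i : 'I_2)) by apply/dstrictP => a b; rewrite !ord1.
have s1 : dstrict (did 1) by exact: dstrict_did.
have H n (v : cospan_shape n) Y0 j (x : dghom W Y0 j) l (u : cospan_shape l) Y i : ~ degenerate v ->
    degenerate u -> cell v x u Y i = 0.
  move=> hv hu; apply: cell0 => e; move: hu.
  exact: (@cell_ind _ _ v (fun l u => ~ degenerate u) hv l u e).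
move=> l u Y i hu; rewrite /coch5 !H ?addr0 //; first [exact: (proj1 (cospan_nondeg (s0 _))) |
  exact: (proj2 (cospan_nondeg (s0 _))) | exact: (proj1 (cospan_nondeg s1)) | exact: (proj2 (cospan_nondeg s1))].
Qed.

Lemma acyclic_acy5 L (lam : coch cospan_shape L) : cnormal lam ->
  acyclic_cone I p lam <-> acy5 (mK I p ce1 X1 X3 0) (mK I p ce2 X2 X3 0)
    (lam 0%N cv1 X1 0) (lam 0%N cv2 X2 0) (lam 0%N cv3 X3 0) (lam 1%N ce1 X3 (-1)) (lam 1%N ce2 X3 (-1)).
Proof.
move=> hn; have [s1 s2 s3 s4] := sb_ce; have [o1 o2 o3 o4] := oK_ce.
split=> [H W e e1 r p1 p2 p3 q1 q2 he ee hr h1 h2 h3 h4 h5|H W e e1 r rho he ee hr rn hrho].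
  have rn := coch5_normal p1 p2 p3 q1 q2.
  have ev Y i := coch5E p1 p2 p3 q1 q2 Y i.
  have e1e : e1 - 1 = e by lia.
  have [|x [y [yn hx hy]]] := H W e e1 r (coch5 p1 p2 p3 q1 q2) he ee hr rn.
    apply: cospan_ind.
    - by move=> l u hu Y i eY ei; rewrite cD_normal // hn // cp0l.
    - move=> Y i; rewrite -hX1 => -> ->; rewrite subr0 oppr0 cD_vert e1e.
      by have [-> _ _ _] := ev X1 e; rewrite hc_id.
    - move=> Y i; rewrite -hX2 => -> ->; rewrite subr0 oppr0 cD_vert e1e.
      by have [_ -> _ _] := ev X2 e; rewrite hc_id.
    - move=> Y i; rewrite -hX3 => -> ->; rewrite subr0 oppr0 cD_vert e1e.
      by have [_ _ -> _] := ev X3 e; rewrite hc_id.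
    - move=> Y i; rewrite -o2 => -> ->; rewrite e1e (cD_edge _ _ _ o1) s1 s2.
      have [-> _ _ _] := ev X1 e; have [_ _ -> _] := ev X3 e; have [_ _ _ [-> _]] := ev X3 (e - 1).
      by rewrite !hc_id h4 subKr.
    - move=> Y i; rewrite -o4 => -> ->; rewrite e1e (cD_edge _ _ _ o3) s3 s4.
      have [_ -> _ _] := ev X2 e; have [_ _ -> _] := ev X3 e; have [_ _ _ [_ ->]] := ev X3 (e - 1).
      by rewrite !hc_id h5 subKr.
  exists x, (y 0%N cv1 X1 (e - 1)), (y 0%N cv2 X2 (e - 1)), (y 0%N cv3 X3 (e - 1)),
    (y 1%N ce1 X3 (e - 1 - 1)), (y 1%N ce2 X3 (e - 1 - 1)).
  have E0 : e = e - 0%:Z by rewrite subr0.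
  have kk (V : zmodType) (a b c : V) : a - b = c -> b = a - c by move=> <-; rewrite subKr.
  split; [split=> //|split].
  - have := hy 0%N cv1 X1 e hX1 E0; have [-> _ _ _] := ev X1 e.
    by rewrite cD_vert hc_id oppr0; exact: kk.
  - have := hy 0%N cv2 X2 e hX2 E0; have [_ -> _ _] := ev X2 e.
    by rewrite cD_vert hc_id oppr0; exact: kk.
  - have := hy 0%N cv3 X3 e hX3 E0; have [_ _ -> _] := ev X3 e.
    by rewrite cD_vert hc_id oppr0; exact: kk.
  - have := hy 1%N ce1 X3 (e - 1) o2 erefl; have [_ _ _ [-> _]] := ev X3 (e - 1).
    rewrite (cD_edge _ _ _ o1) s1 s2 hc_id => <-.
    have k2 (V : zmodType) (a b c d : V) : d = a - (b - c - d) - a + b - c by zmodule.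
    exact: k2.
  have := hy 1%N ce2 X3 (e - 1) o4 erefl; have [_ _ _ [_ ->]] := ev X3 (e - 1).
  rewrite (cD_edge _ _ _ o3) s3 s4 hc_id => <-.
  have k2 (V : zmodType) (a b c d : V) : d = a - (b - c - d) - a + b - c by zmodule.
  exact: k2.
have e1e : e1 - 1 = e by lia.
have E1 : e1 = e1 - 0%:Z by rewrite subr0.
have k3 (V : zmodType) (a b c d : V) : a - b - c = d -> c = a - b - d by move=> <-; rewrite subKr.
have [||||| x [y1 [y2 [y3 [t1 [t2 [[a1 a2 a3 a4] [a5 a6]]]]]]]] := H W e e1 r (rho 0%N cv1 X1 e)
  (rho 0%N cv2 X2 e) (rho 0%N cv3 X3 e) (rho 1%N ce1 X3 (e - 1)) (rho 1%N ce2 X3 (e - 1)) he ee hr.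
- by have := hrho 0%N cv1 X1 e1 hX1 E1; rewrite cD_vert e1e oppr0.
- by have := hrho 0%N cv2 X2 e1 hX2 E1; rewrite cD_vert e1e oppr0.
- by have := hrho 0%N cv3 X3 e1 hX3 E1; rewrite cD_vert e1e oppr0.
- by have := hrho 1%N ce1 X3 e o2 (esym e1e); rewrite (cD_edge _ _ _ o1) s1 s2; exact: k3.
- by have := hrho 1%N ce2 X3 e o4 (esym e1e); rewrite (cD_edge _ _ _ o3) s3 s4; exact: k3.
exists x, (coch5 y1 y2 y3 t1 t2); split=> //; first exact: coch5_normal.
have ev Y i := coch5E y1 y2 y3 t1 t2 Y i.
apply: cospan_ind.
- move=> l u hu Y i eY ei; rewrite hn // cp0l cD_normal ?subr0 ?rn //; exact: coch5_normal.
- move=> Y i; rewrite -hX1 => -> ->; rewrite subr0 oppr0 cD_vert.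
  by have [-> _ _ _] := ev X1 (e - 1); rewrite hc_id a2 subKr.
- move=> Y i; rewrite -hX2 => -> ->; rewrite subr0 oppr0 cD_vert.
  by have [_ -> _ _] := ev X2 (e - 1); rewrite hc_id a3 subKr.
- move=> Y i; rewrite -hX3 => -> ->; rewrite subr0 oppr0 cD_vert.
  by have [_ _ -> _] := ev X3 (e - 1); rewrite hc_id a4 subKr.
- move=> Y i; rewrite -o2 => -> ->; rewrite (cD_edge _ _ _ o1) s1 s2.
  have [-> _ _ _] := ev X1 (e - 1); have [_ _ -> _] := ev X3 (e - 1); have [_ _ _ [-> _]] := ev X3 (e - 1 - 1).
  rewrite !hc_id a5.
  have k2 (V : zmodType) (a b c d : V) : a - (b - c - (d - a + b - c)) = d by zmodule.
  exact: k2.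
move=> Y i; rewrite -o4 => -> ->; rewrite (cD_edge _ _ _ o3) s3 s4.
have [_ -> _ _] := ev X2 (e - 1); have [_ _ -> _] := ev X3 (e - 1); have [_ _ _ [_ ->]] := ev X3 (e - 1 - 1).
rewrite !hc_id a6.
have k2 (V : zmodType) (a b c d : V) : a - (b - c - (d - a + b - c)) = d by zmodule.
exact: k2.
Qed.
End CospanCochains.

(** * Squares with a contractible corner *)

Definition sqx (C : sset) (q : square C) m f g : C m := q m (mkd m 1 f, mkd m 1 g).

Lemma sq_eq (C : sset) (q : square C) m (x y : square_shape m) :
  (forall u, (u <= m)%N -> jn (x.1 : dmap m 1) u = jn (y.1 : dmap m 1) u) ->
  (forall u, (u <= m)%N -> jn (x.2 : dmap m 1) u = jn (y.2 : dmap m 1) u) -> q m x = q m y.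
Proof. by case: x y => [x1 x2] [y1 y2] /= /dmap_jn -> /dmap_jn ->. Qed.

Lemma jn_dcone j (a : dmap j 1) u : (u <= j.+1)%N -> jn (dcone a) u = if u is v.+1 then jn a v else 0%N.
Proof.
move=> hu; rewrite /jn /= /dcone_fun; case: splitP => v /=; rewrite inordK ?ltnS //.
  by case: u hu => // u hu; case: v => /= v hv; lia.
case: u hu => // u hu; rewrite add1n => -[e]; congr (nat_of_ord (a _)); apply: val_inj.
by rewrite /= inordK.
Qed.

Lemma sq_vertexE (C : sset) (q : square C) m f g u (a b : 'I_2) : mono_on m 1 f -> mono_on m 1 g ->
  (u <= m)%N -> f u = a -> g u = b -> sb 0 (fun=> u) (sqx q m f g) = sq_vertex q a b.
Proof.
move=> hf hg hu ea eb; rewrite /sb /sqx -sfun_act; apply: sq_eq => v hv /=;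
  by rewrite jn_comp jn_dconst ?jn_mkd // jn_mkd.
Qed.

Lemma jn_drev m n (a : dmap m n) u : (u <= m)%N -> jn (drev a) u = (n - jn a (m - u))%N.
Proof.
move=> hu; rewrite /jn /= subSS; congr (n - nat_of_ord (a _))%N; apply: val_inj.
by rewrite /= !inordK // ltnS leq_subr.
Qed.

Lemma acy5_eq (k : comPzRingType) (A : dgcat k) (L X1 X2 X3 : A) (f1 f1' : dghom X1 X3 0)
    (f2 f2' : dghom X2 X3 0) (l1 l1' : dghom L X1 0) (l2 l2' : dghom L X2 0) (l3 l3' : dghom L X3 0)
    (m1 m1' m2 m2' : dghom L X3 (-1)) :
  f1 = f1' -> f2 = f2' -> l1 = l1' -> l2 = l2' -> l3 = l3' -> m1 = m1' -> m2 = m2' ->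
  acy5 f1 f2 l1 l2 l3 m1 m2 <-> acy5 f1' f2' l1' l2' l3' m1' m2'.
Proof. by do 7!move=> ->. Qed.

Section Squares.
Variables (k : comPzRingType) (A : dgcat k) (C : sset) (I : nerve_iso C A).

Lemma pullback_acy5 (q : square C) (X00 X10 X01 X11 : A) :
  X00 = ob I (sq_vertex q ord0 ord0) -> X10 = ob I (sq_vertex q ord_max ord0) ->
  X01 = ob I (sq_vertex q ord0 ord_max) -> X11 = ob I (sq_vertex q ord_max ord_max) ->
  nonpositive A -> is_pullback q <->
  acy5 (mr I (sqx q 1 (fun=> 1%N) id) X10 X11 0) (mr I (sqx q 1 id (fun=> 1%N)) X01 X11 0)
    (mr I (sqx q 1 id (fun=> 0%N)) X00 X10 0) (mr I (sqx q 1 (fun=> 0%N) id) X00 X01 0)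
    (mr I (sqx q 1 id id) X00 X11 0)
    (mr I (sqx q 2 (fun u => 0 < u)%N (fun u => u - 1)%N) X00 X11 (-1))
    (mr I (sqx q 2 (fun u => u - 1)%N (fun u => 0 < u)%N) X00 X11 (-1)).
Proof.
move=> h00 h10 h01 h11 hA.
have -> : is_pullback q <-> acyclic_cone I (sq_cospan q) (cone_coch I (sq_cone q)).
  by split; [exact: limit_acyclic | exact: acyclic_limit].
have [hx1 hx2 hx3] : [/\ X10 = oK I (sq_cospan q) cv1 0, X01 = oK I (sq_cospan q) cv2 0 &
    X11 = oK I (sq_cospan q) cv3 0].
  by split; rewrite ?h10 ?h01 ?h11 /oK obv0.
subst X00; have E := @acyclic_acy5 k A C I (sq_cospan q) _ _ _ hx1 hx2 hx3 _ (cone_coch I (sq_cone q))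
  (@join_normal _ _ _ I _ _ _ (sq_cone q) _).
apply: (iff_trans E); apply: acy5_eq; apply: (congr1 (fun x => mr I x _ _ _)); apply: sq_eq => u hu;
  rewrite /= ?jn_dcone // ?jn_mkd //; try mono; case: u hu => [|[|[|u]]] hu //;
  rewrite ?jn_dconst ?jn_did //.
Qed.

End Squares.

Section SquaresOp.
Variables (k : comPzRingType) (A : dgcat k) (C : sset) (I : nerve_iso C A).

(** The pullback criterion in the opposite, the corners being renamed by reversal. Only simplices of
    dimension at most 2 occur, so the reversal sign is trivial. *)
Lemma pushout_acy5 (q : square C) (X00 X10 X01 X11 : A) :
  X00 = ob I (sq_vertex q ord0 ord0) -> X10 = ob I (sq_vertex q ord_max ord0) ->
  X01 = ob I (sq_vertex q ord0 ord_max) -> X11 = ob I (sq_vertex q ord_max ord_max) ->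
  nonpositive A -> is_pushout q <->
  @acy5 k (dgop A) X11 X01 X10 X00 (mr I (sqx q 1 (fun=> 0%N) id) X00 X01 0)
    (mr I (sqx q 1 id (fun=> 0%N)) X00 X10 0) (mr I (sqx q 1 id (fun=> 1%N)) X01 X11 0)
    (mr I (sqx q 1 (fun=> 1%N) id) X10 X11 0) (mr I (sqx q 1 id id) X00 X11 0)
    (mr I (sqx q 2 (fun u => u - 1)%N (fun u => 0 < u)%N) X00 X11 (-1))
    (mr I (sqx q 2 (fun u => 0 < u)%N (fun u => u - 1)%N) X00 X11 (-1)).
Proof.
move=> h00 h10 h01 h11 hA; have [I' [hob hmr]] := nerve_iso_op I.
have V m f g f' g' (x0 y0 x1 y1 : 'I_2) X Y i :
    mono_on m 1 f -> mono_on m 1 g -> mono_on m 1 f' -> mono_on m 1 g' ->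
    (forall u, (u <= m)%N -> f' u = 1 - f (m - u))%N -> (forall u, (u <= m)%N -> g' u = 1 - g (m - u))%N ->
    f' 0%N = x0 -> g' 0%N = y0 -> f' m = x1 -> g' m = y1 -> X = ob I (sq_vertex q x0 y0) ->
    Y = ob I (sq_vertex q x1 y1) -> i = 1 - m%:Z -> 'C(m.-1, 2) = 0%N ->
    mr I' (sqx (square_op q) m f g : sset_op C m) Y X i = mr I (sqx q m f' g') X Y i.
  move=> hf hg hf' hg' ef eg e0 e0' e1 e1' eX eY ei eC.
  have -> : (sqx (square_op q) m f g : sset_op C m) = sqx q m f' g'.
    change (q m (drev (mkd m 1 f), drev (mkd m 1 g)) = q m (mkd m 1 f', mkd m 1 g')).
    by apply: sq_eq => u hu /=; rewrite jn_drev // !jn_mkd ?leq_subr // ?ef ?eg.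
  rewrite hmr ?eC ?expr0 ?scale1r //.
  - by rewrite eX /obv (sq_vertexE q hf' hg' (leq0n m) e0 e0').
  - by rewrite eY /obv (sq_vertexE q hf' hg' (leqnn m) e1 e1').
have U (a b a' b' : 'I_2) X : X = ob I (sq_vertex q a b) -> (a' = 1 - a :> nat)%N -> (b' = 1 - b :> nat)%N ->
    X = ob I' (sq_vertex (square_op q) a' b').
  move=> -> ea eb; rewrite hob; congr ob; apply: sq_eq => u hu /=; rewrite jn_drev // !jn_dconst ?ea ?eb;
    by [case: (ord2P a) => -> | case: (ord2P b) => ->].
apply: (iff_trans (@pullback_acy5 k (dgop A) (sset_op C) I' (square_op q) X11 X01 X10 X00
  (U ord_max ord_max ord0 ord0 _ h11 erefl erefl) (U ord0 ord_max ord_max ord0 _ h01 erefl erefl)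
  (U ord_max ord0 ord0 ord_max _ h10 erefl erefl) (U ord0 ord0 ord_max ord_max _ h00 erefl erefl)
  (nonpositive_op hA))).
apply: acy5_eq.
- by apply: (V 1%N _ _ _ _ ord0 ord0 ord0 ord_max) => //; try mono; case=> [|[|]].
- by apply: (V 1%N _ _ _ _ ord0 ord0 ord_max ord0) => //; try mono; case=> [|[|]].
- by apply: (V 1%N _ _ _ _ ord0 ord_max ord_max ord_max) => //; try mono; case=> [|[|]].
- by apply: (V 1%N _ _ _ _ ord_max ord0 ord_max ord_max) => //; try mono; case=> [|[|]].
- by apply: (V 1%N _ _ _ _ ord0 ord0 ord_max ord_max) => //; try mono; case=> [|[|]].
- by apply: (V 2%N _ _ _ _ ord0 ord0 ord_max ord_max) => //; try mono; case=> [|[|[|]]].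
- by apply: (V 2%N _ _ _ _ ord0 ord0 ord_max ord_max) => //; try mono; case=> [|[|[|]]].
Qed.

Lemma edge_dd (x : C 1%N) X Y : X = obv I x 0 -> Y = obv I x 1 -> dd 1 (mr I x X Y 0) = 0.
Proof.
move=> eX eY; have := @mr_d k A C I 1 x X Y 0 eX eY erefl.
by rewrite big1 // => w; have := ltn_ord w; case: (nat_of_ord w).
Qed.

Lemma sqx_face (q : square C) n m f g h f' g' : mono_on n 1 f -> mono_on n 1 g -> mono_on m n h ->
  mono_on m 1 f' -> mono_on m 1 g' ->
  (forall u, (u <= m)%N -> f (h u) = f' u) -> (forall u, (u <= m)%N -> g (h u) = g' u) ->
  sb m h (sqx q n f g) = sqx q m f' g'.
Proof.
move=> hf hg hh hf' hg' ef eg; have hm u : (u <= m)%N -> (h u <= n)%N.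
  by move=> hu; apply: leq_trans (proj2 hh); apply: (proj1 hh).
rewrite /sb /sqx -sfun_act; apply: sq_eq => u hu /=; rewrite jn_comp (jn_mkd hh) // !jn_mkd //;
  by [exact: hm | exact: ef | exact: eg].
Qed.

(** One 3-term complex serves for pullbacks and pushouts alike: the homotopy [sq_h] formed in
    [dgop A] from the reversed square is the same morphism, by associativity of the composite
    through the contractible corner. *)
Lemma square_T (q : square C) (X00 X10 X01 X11 : A) (s : dghom X01 X01 (-1)) :
  X00 = ob I (sq_vertex q ord0 ord0) -> X10 = ob I (sq_vertex q ord_max ord0) ->
  X01 = ob I (sq_vertex q ord0 ord_max) -> X11 = ob I (sq_vertex q ord_max ord_max) ->
  nonpositive A -> dd 0 s = dgid X01 ->
  exists T : hcomplex3 X00 X10 X11, [/\ c0 (hc_f T) = mr I (sqx q 1 id (fun=> 0%N)) X00 X10 0,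
    c0 (hc_g T) = mr I (sqx q 1 (fun=> 1%N) id) X10 X11 0,
    hc_h T = sq_h (mr I (sqx q 1 id (fun=> 1%N)) X01 X11 0) (mr I (sqx q 1 (fun=> 0%N) id) X00 X01 0)
      (mr I (sqx q 2 (fun u => 0 < u)%N (fun u => u - 1)%N) X00 X11 (-1))
      (mr I (sqx q 2 (fun u => u - 1)%N (fun u => 0 < u)%N) X00 X11 (-1)) s
    & (is_pullback q <-> left_exact T) /\ (is_pushout q <-> right_exact T)].
Proof.
move=> h00 h10 h01 h11 hA hs.
have ov m f g u (a b : 'I_2) X : mono_on m 1 f -> mono_on m 1 g -> (u <= m)%N -> f u = a -> g u = b ->
    X = ob I (sq_vertex q a b) -> X = obv I (sqx q m f g) u.
  by move=> hf hg hu ea eb ->; rewrite /obv (sq_vertexE q hf hg hu ea eb).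
have m0 : mono_on 1 1 (fun=> 0%N) by mono.
have m1' : mono_on 1 1 (fun=> 1%N) by mono.
have mi : mono_on 1 1 id by mono.
have ma : mono_on 2 1 (fun u => 0 < u)%N by mono.
have mb : mono_on 2 1 (fun u => u - 1)%N by mono.
set f1 := mr I (sqx q 1 (fun=> 1%N) id) X10 X11 0; set f2 := mr I (sqx q 1 id (fun=> 1%N)) X01 X11 0.
set l1 := mr I (sqx q 1 id (fun=> 0%N)) X00 X10 0; set l2 := mr I (sqx q 1 (fun=> 0%N) id) X00 X01 0.
pose l3 := mr I (sqx q 1 id id) X00 X11 0.
set m1 := mr I (sqx q 2 (fun u => 0 < u)%N _) X00 X11 (-1).
set m2 := mr I (sqx q 2 (fun u => u - 1)%N _) X00 X11 (-1).
have hf1 : dd 1 f1 = 0.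
  by apply: edge_dd; [apply: (ov 1%N _ _ 0%N ord_max ord0) | apply: (ov 1%N _ _ 1%N ord_max ord_max)].
have hf2 : dd 1 f2 = 0.
  by apply: edge_dd; [apply: (ov 1%N _ _ 0%N ord0 ord_max) | apply: (ov 1%N _ _ 1%N ord_max ord_max)].
have hl1 : dd 1 l1 = 0.
  by apply: edge_dd; [apply: (ov 1%N _ _ 0%N ord0 ord0) | apply: (ov 1%N _ _ 1%N ord_max ord0)].
have hl2 : dd 1 l2 = 0.
  by apply: edge_dd; [apply: (ov 1%N _ _ 0%N ord0 ord0) | apply: (ov 1%N _ _ 1%N ord0 ord_max)].
have hl3 : dd 1 l3 = 0.
  by apply: edge_dd; [apply: (ov 1%N _ _ 0%N ord0 ord0) | apply: (ov 1%N _ _ 1%N ord_max ord_max)].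
have hm1 : dd 0 m1 = cp 0 f1 l1 - l3.
  rewrite /m1 (@mr_d2 k A C I _ X00 X10 X11); last first.
  - by apply: (ov 2%N _ _ 2%N ord_max ord_max).
  - by apply: (ov 2%N _ _ 1%N ord_max ord0).
  - by apply: (ov 2%N _ _ 0%N ord0 ord0).
  rewrite (@sqx_face q 2 1 _ _ _ (fun=> 1%N) (id)) //; try mono; try by case=> [|[|]].
  rewrite (@sqx_face q 2 1 _ _ _ (id) (fun=> 0%N)) //; try mono; try by case=> [|[|]].
  by rewrite (@sqx_face q 2 1 _ _ _ (id) (id)) //; try mono; case=> [|[|]].
have hm2 : dd 0 m2 = cp 0 f2 l2 - l3.
  rewrite /m2 (@mr_d2 k A C I _ X00 X01 X11); last first.
  - by apply: (ov 2%N _ _ 2%N ord_max ord_max).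
  - by apply: (ov 2%N _ _ 1%N ord0 ord_max).
  - by apply: (ov 2%N _ _ 0%N ord0 ord0).
  rewrite (@sqx_face q 2 1 _ _ _ (id) (fun=> 1%N)) //; try mono; try by case=> [|[|]].
  rewrite (@sqx_face q 2 1 _ _ _ (fun=> 0%N) (id)) //; try mono; try by case=> [|[|]].
  by rewrite (@sqx_face q 2 1 _ _ _ (id) (id)) //; try mono; case=> [|[|]].
have hh := sq_h_dd hf2 hl2 hm1 hm2 hs.
have hT : cd (addNr 1) (sq_h f2 l2 m1 m2 s) = - dgcomp (addr0 0) f1 l1 by rewrite -ddE -cpE.
pose F := @Closed0 k A X00 X10 l1 (proj2 (@cocycleE _ _ 0 _) hl1).
pose G := @Closed0 k A X10 X11 f1 (proj2 (@cocycleE _ _ 0 _) hf1).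
pose T := @HComplex3 k A X00 X10 X11 F G (sq_h f2 l2 m1 m2 s) hT.
exists T; split=> //; split.
  apply: (iff_trans (pullback_acy5 h00 h10 h01 h11 hA)).
  apply: (iff_trans (B := lex_data l1 f1 (sq_h f2 l2 m1 m2 s))); first by apply: acy5_lex.
  exact: (iff_sym (left_exact_lex T hA)).
have opE (X Y Z : A) (g : dghom Y Z 0) j (f : dghom X Y j) : @cp k (dgop A) Z Y X j 0 j f g = cp j g f.
  by rewrite cp_op muln0 expr0 scale1r.
have opE' (X Y Z : A) j (g : dghom Y Z j) (f : dghom X Y 0) : @cp k (dgop A) Z Y X 0 j j f g = cp j g f.
  by rewrite cp_op mul0n expr0 scale1r.
apply: (iff_trans (pushout_acy5 h00 h10 h01 h11 hA)).
have sym (X Y Z W : A) f f' l l' ll m m' : @acy5 k (dgop A) X Y Z W f f' l l' ll m m' <->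
    @acy5 k (dgop A) X Z Y W f' f l' l ll m' m by split; exact: acy5_sym.
apply: (iff_trans (sym _ _ _ _ _ _ _ _ _ _ _)).
have hm1o : dd 0 m1 = @cp k (dgop A) _ _ _ 0 0 0 l1 f1 - l3 by rewrite opE.
have hm2o : dd 0 m2 = @cp k (dgop A) _ _ _ 0 0 0 l2 f2 - l3 by rewrite opE.
have E : hc_h (hc_op T) = @sq_h k (dgop A) X11 X01 X00 l2 f2 m1 m2 s.
  rewrite /= /sq_h opE opE'; congr (_ - _); by rewrite (@cpA _ _ _ _ _ _ _ _ _ _ (-1)).
apply: (iff_trans (B := @lex_data k (dgop A) X11 X10 X00 f1 l1 (@sq_h k (dgop A) X11 X01 X00 l2 f2 m1 m2 s))).
  by apply: (@acy5_lex k (dgop A) X11 X10 X01 X00 l1 l2 f1 f2 l3 m1 m2 s).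
apply: iff_sym; apply: (iff_trans (right_exact_op T)).
apply: (iff_trans (left_exact_lex (hc_op T) (nonpositive_op hA))).
by rewrite E.
Qed.
End SquaresOp.

Section SquareExists.
Variables (C : sset) (x y : C 2).
Hypothesis diag : sb 1 (fun u => u.*2) x = sb 1 (fun u => u.*2) y.

Let md m (a b : dmap m 1) : mono_on m 2 (fun u => jn a u + jn b u)%N.
Proof.
split=> [u v h h'|]; first by rewrite leq_add // jn_mono.
by rewrite (leq_add (jn_le a m) (jn_le b m)).
Qed.

(** The square is the union of two triangles along the diagonal, since on every simplex one
    coordinate dominates the other. The map [(a, b) |-> a + b] identifies each triangle with
    [std 2]. *)
Lemma square_exists : exists q : square C,
  (forall m f g, mono_on m 1 f -> mono_on m 1 g -> (forall u, (u <= m)%N -> (g u <= f u)%N) ->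
     sqx q m f g = sb m (fun u => f u + g u)%N x) /\
  (forall m f g, mono_on m 1 f -> mono_on m 1 g -> (forall u, (u <= m)%N -> (f u <= g u)%N) ->
     sqx q m f g = sb m (fun u => f u + g u)%N y).
Proof.
pose F n (ab : square_shape n) : C n :=
  if excluded_middle_informative (forall u, (u <= n)%N -> (jn (ab.2 : dmap n 1) u <= jn (ab.1 : dmap n 1) u)%N)
  then sb n (fun u => jn (ab.1 : dmap n 1) u + jn (ab.2 : dmap n 1) u)%N x
  else sb n (fun u => jn (ab.1 : dmap n 1) u + jn (ab.2 : dmap n 1) u)%N y.
have eqd n (a b : dmap n 1) : (forall u, (u <= n)%N -> jn a u = jn b u) ->
    sb n (fun u => jn a u + jn b u)%N x = sb n (fun u => jn a u + jn b u)%N y.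
  move=> h; have D (z : C 2) : sb n (fun u => jn a u + jn b u)%N z = sb n (jn a) (sb 1 (fun u => u.*2) z).
    rewrite sb_sb //; [|by split=> [u v|]; [rewrite leq_double|]|exact: jn_monoon].
    by apply: sb_eq => u hu /=; rewrite -h // addnn.
  by rewrite !D diag.
have Fy n (ab : square_shape n) :
    (forall u, (u <= n)%N -> (jn (ab.1 : dmap n 1) u <= jn (ab.2 : dmap n 1) u)%N) ->
    F n ab = sb n (fun u => jn (ab.1 : dmap n 1) u + jn (ab.2 : dmap n 1) u)%N y.
  move=> h; rewrite /F; case: excluded_middle_informative => // h'.
  by apply: eqd => u hu; apply/eqP; rewrite eqn_leq h // h'.
have Fx n (ab : square_shape n) :
    (forall u, (u <= n)%N -> (jn (ab.2 : dmap n 1) u <= jn (ab.1 : dmap n 1) u)%N) ->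
    F n ab = sb n (fun u => jn (ab.1 : dmap n 1) u + jn (ab.2 : dmap n 1) u)%N x.
  by move=> h; rewrite /F; case: excluded_middle_informative.
have cs n (ab : square_shape n) :
    (forall u, (u <= n)%N -> (jn (ab.2 : dmap n 1) u <= jn (ab.1 : dmap n 1) u)%N) \/
    (forall u, (u <= n)%N -> (jn (ab.1 : dmap n 1) u <= jn (ab.2 : dmap n 1) u)%N).
  case: (excluded_middle_informative (exists2 u, (u <= n)%N & (jn (ab.1 : dmap n 1) u < jn (ab.2 : dmap n 1) u)%N)).
    move=> [u hu hlt]; right=> v hv; have h1 := jn_le (ab.1 : dmap n 1) v; have h2 := jn_le (ab.2 : dmap n 1) u.
    case: (leqP u v) => huv; first by have := jn_mono (ab.2 : dmap n 1) huv hv; lia.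
    by have := jn_mono (ab.1 : dmap n 1) (ltnW huv) hu; lia.
  by move=> h; left=> u hu; rewrite leqNgt; apply/negP => hlt; apply: h; exists u.
have Fact m n (al : dmap m n) (ab : square_shape n) : F m (act al ab) = act al (F n ab).
  have jc (a : dmap n 1) u : (u <= m)%N -> jn (dcomp a al) u = jn a (jn al u) by move=> hu; rewrite jn_comp.
  have E (z : C 2) : sb m (fun u => jn (dcomp (ab.1 : dmap n 1) al) u + jn (dcomp (ab.2 : dmap n 1) al) u)%N z =
      act al (sb n (fun u => jn (ab.1 : dmap n 1) u + jn (ab.2 : dmap n 1) u)%N z).
    rewrite (dmap_mkdE al) -/(sb m (fun u => nat_of_ord (al (inord u))) _) sb_sb //; last exact: (jn_monoon al).
    by apply: sb_eq => u hu /=; rewrite -dmap_mkdE !jc.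
  case: (cs n ab) => h.
    by rewrite (Fx n) // Fx // => u hu /=; rewrite !jc //; apply: h; exact: jn_le.
  by rewrite (Fy n) // Fy // => u hu /=; rewrite !jc //; apply: h; exact: jn_le.
exists (@SMap square_shape C F Fact); split=> m f g hf hg h; rewrite /sqx /=.
  rewrite Fx => [|u hu /=]; last by rewrite !jn_mkd //; exact: h.
  by apply: sb_eq => u hu /=; rewrite !jn_mkd.
rewrite Fy => [|u hu /=]; last by rewrite !jn_mkd //; exact: h.
by apply: sb_eq => u hu /=; rewrite !jn_mkd.
Qed.
End SquareExists.

(** * Additivity *)

Section Coh.
Variables (k : comPzRingType) (A : dgcat k).

Definition coh (X Y : A) (x y : dghom X Y 0) : Prop := exists v : dghom X Y (-1), dd 0 v = x - y.

Lemma coh_refl (X Y : A) (x : dghom X Y 0) : coh x x.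
Proof. by exists 0; rewrite dd0 subrr. Qed.

Lemma coh_sym (X Y : A) (x y : dghom X Y 0) : coh x y -> coh y x.
Proof. by move=> [v hv]; exists (- v); rewrite ddN hv opprB. Qed.

Lemma coh_trans (X Y : A) (y x z : dghom X Y 0) : coh x y -> coh y z -> coh x z.
Proof. by move=> [v hv] [w hw]; exists (v + w); rewrite ddD hv hw; zmodule. Qed.

Lemma cohD (X Y : A) (x y x' y' : dghom X Y 0) : coh x y -> coh x' y' -> coh (x + x') (y + y').
Proof. by move=> [v hv] [w hw]; exists (v + w); rewrite ddD hv hw; zmodule. Qed.

Lemma coh_compl (X Y Z : A) (g : dghom Y Z 0) (x y : dghom X Y 0) : dd 1 g = 0 -> coh x y ->
  coh (cp 0 g x) (cp 0 g y).
Proof. by move=> hg [v hv]; exists (cp (-1) g v); rewrite (dd_cpl0 (j' := 0)) // hv cpBr. Qed.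

Lemma coh_compr (X Y Z : A) (g : dghom X Y 0) (x y : dghom Y Z 0) : dd 1 g = 0 -> coh x y ->
  coh (cp 0 x g) (cp 0 y g).
Proof.
move=> hg [v hv]; exists (cp (-1) v g); rewrite (dd_cpr (l' := 0) (i' := 0)) //; first by rewrite hv cpBl.
Qed.

Lemma cp00A (X Y Z T : A) (h : dghom Z T 0) (g : dghom Y Z 0) (f : dghom X Y 0) :
  cp 0 (cp 0 h g) f = cp 0 h (cp 0 g f).
Proof. by rewrite (@cpA _ _ _ _ _ _ 0 0 0 0 0). Qed.

Lemma coh0_compl (X Y Z : A) (f : dghom Y Z 0) (x : dghom X Y 0) : dd 1 f = 0 -> coh x 0 -> coh (cp 0 f x) 0.
Proof. by move=> hf h; have := coh_compl hf h; rewrite cp0r. Qed.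

Lemma cp_closed (X Y Z : A) (g : dghom Y Z 0) (f : dghom X Y 0) : dd 1 g = 0 -> dd 1 f = 0 ->
  dd 1 (cp 0 g f) = 0.
Proof. by move=> hg hf; rewrite (dd_cpl0 (j' := 1)) // hf cp0r. Qed.

Section Matrix.
Variables (B : bool -> A) (S T : A) (i : forall a, dghom (B a) S 0) (pr : forall a, dghom T (B a) 0).
Variables (m : dghom S T 0) (E F : forall a b, dghom (B a) (B b) 0).
Hypotheses (hi : forall a, dd 1 (i a) = 0) (hpr : forall a, dd 1 (pr a) = 0) (hm : dd 1 m = 0)
  (hF : forall a b, dd 1 (F a b) = 0).

Definition delta (a b : bool) : dghom (B a) (B b) 0 :=
  if a == b then hc (B a) (B b) 0 (dgid (B a)) else 0.

Lemma delta_closed a b : dd 1 (delta a b) = 0.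
Proof. by rewrite /delta; case: a; case: b; rewrite /= ?dd0 ?hc_id ?dd_id. Qed.

Hypotheses (iinj : forall W (x : dghom S W 0), dd 1 x = 0 -> (forall a, coh (cp 0 x (i a)) 0) -> coh x 0)
  (pinj : forall W (x : dghom W T 0), dd 1 x = 0 -> (forall a, coh (cp 0 (pr a) x) 0) -> coh x 0)
  (hE : forall a b, coh (cp 0 (pr b) (cp 0 m (i a))) (E a b))
  (hFE : forall a c, cp 0 (F true c) (E a true) + cp 0 (F false c) (E a false) = delta a c)
  (hEF : forall a c, cp 0 (E true c) (F a true) + cp 0 (E false c) (F a false) = delta a c).

(** The sum of the composites of [pr a], [F a c] and [i c], for [F] inverse to the matrix [E] of
    [m]. It treats comparison maps and shear maps at once. *)
Definition minv : dghom T S 0 :=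
  cp 0 (i true) (cp 0 (F true true) (pr true) + cp 0 (F false true) (pr false)) +
  cp 0 (i false) (cp 0 (F true false) (pr true) + cp 0 (F false false) (pr false)).

Lemma minv_closed : dd 1 minv = 0.
Proof.
rewrite /minv ddD !(dd_cpl0 (j' := 1)) // !ddD !(dd_cpl0 (j' := 1)) // !hpr !cp0r !addr0 !cp0r addr0 //.
Qed.

Lemma cohB0 (X Y : A) (x y : dghom X Y 0) : coh x y <-> coh (x - y) 0.
Proof. by rewrite /coh subr0. Qed.

Lemma minv_right : coh (cp 0 m minv) (dgid T).
Proof.
have e3 a c : cp 0 (delta a c) (pr a) = if a == c then pr c else 0.
  by rewrite /delta; case: a; case: c; rewrite /= ?cp0l ?hc_id ?cp1l.
apply/cohB0/pinj; first by rewrite ddB dd_id cp_closed ?subrr //; exact: minv_closed.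
move=> c; rewrite cpBr cp1r; apply: (proj1 (cohB0 _ _)).
have e1 : cp 0 (pr c) (cp 0 m minv) =
    cp 0 (cp 0 (pr c) (cp 0 m (i true))) (cp 0 (F true true) (pr true) + cp 0 (F false true) (pr false)) +
    cp 0 (cp 0 (pr c) (cp 0 m (i false))) (cp 0 (F true false) (pr true) + cp 0 (F false false) (pr false)).
  by rewrite /minv !cpDr !cp00A.
have cl a : dd 1 (cp 0 (F true a) (pr true) + cp 0 (F false a) (pr false)) = 0.
  by rewrite ddD !cp_closed // addr0.
have e2 : cp 0 (E true c) (cp 0 (F true true) (pr true) + cp 0 (F false true) (pr false)) +
    cp 0 (E false c) (cp 0 (F true false) (pr true) + cp 0 (F false false) (pr false)) = pr c.
  have : cp 0 (delta true c) (pr true) + cp 0 (delta false c) (pr false) = pr c.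
    by rewrite !e3; case: (c); rewrite /= ?addr0 ?add0r.
  rewrite -!hEF !cpDl !cpDr !cp00A => <-.
  have key (V : zmodType) (x y z w : V) : x + y + (z + w) = x + z + (y + w) by zmodule.
  exact: key.
rewrite e1 -[X in coh _ X]e2; apply: cohD; apply: coh_compr => //.
Qed.

Lemma minv_left : coh (cp 0 minv m) (dgid S).
Proof.
apply/cohB0/iinj; first by rewrite ddB dd_id cp_closed ?subrr //; exact: minv_closed.
move=> a; rewrite cpBl cp1l; apply: (proj1 (cohB0 _ _)).
have e1 : cp 0 (cp 0 minv m) (i a) =
    cp 0 (i true) (cp 0 (F true true) (cp 0 (pr true) (cp 0 m (i a))) +
      cp 0 (F false true) (cp 0 (pr false) (cp 0 m (i a)))) +
    cp 0 (i false) (cp 0 (F true false) (cp 0 (pr true) (cp 0 m (i a))) +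
      cp 0 (F false false) (cp 0 (pr false) (cp 0 m (i a)))).
  by rewrite /minv !(cpDl, cpDr, cp00A).
have e2 : cp 0 (i true) (delta a true) + cp 0 (i false) (delta a false) = i a.
  by rewrite /delta; case: (a); rewrite /= hc_id cp1r cp0r ?addr0 ?add0r.
rewrite e1 -[X in coh _ X]e2 -!hFE; apply: cohD; apply: coh_compl => //; apply: cohD; exact: coh_compl.
Qed.
End Matrix.
End Coh.

(** * Composites, equivalences and zero objects *)

Section Arrows.
Variables (k : comPzRingType) (A : dgcat k) (C : sset) (I : nerve_iso C A).

Lemma srcE (e : C 1%N) : src e = sb 0 (fun=> 0%N) e.
Proof. exact: vertexE. Qed.

Lemma tgtE (e : C 1%N) : tgt e = sb 0 (fun=> 1%N) e.
Proof. exact: vertexE. Qed.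

Lemma edge_ext (e e' : C 1%N) : src e = src e' -> tgt e = tgt e' ->
  mr I e (ob I (src e)) (ob I (tgt e)) 0 = mr I e' (ob I (src e)) (ob I (tgt e)) 0 -> e = e'.
Proof.
move=> es et em; apply: (simplex_ext (I := I)).
  by case=> [|[|]] // _; rewrite /obv; [move: es; rewrite !srcE => -> | move: et; rewrite !tgtE => ->].
move=> l J X Y i hJ l0 eX eY ei; have hl := strict_le hJ; have el : l = 1%N by lia.
subst l; rewrite (strict_self hJ) !act_id in eX eY *; subst i; rewrite eX eY.
by move: em; rewrite srcE tgtE.
Qed.

(** Once the edges have matching ends, the only further datum of a 2-simplex is a homotopy between a
    composite and the third edge. *)
Lemma triangle_exists (a b c : C 1%N) (X Y Z : A) (v : dghom X Z (-1)) :
  src c = src a -> tgt a = src b -> tgt c = tgt b ->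
  X = ob I (src a) -> Y = ob I (src b) -> Z = ob I (tgt b) ->
  dd 0 v = cp 0 (mr I b Y Z 0) (mr I a X Y 0) - mr I c X Z 0 ->
  exists s : C 2, [/\ sb 1 (bump 2) s = a, sb 1 (bump 0) s = b, sb 1 (bump 1) s = c & mr I s X Z (-1) = v].
Proof.
move=> ca ab cb eX eY eZ hv.
pose P (i : 'I_3) : A := match nat_of_ord i with 0 => X | 1 => Y | _ => Z end.
pose M1 (J : dmap 1 2) X' Y' i : dghom X' Y' i := match jn J 0, jn J 1 with
  | 0, 1 => mr I a X' Y' i | 1, _ => mr I b X' Y' i | _, _ => mr I c X' Y' i end.
pose M l : dmap l 2 -> forall X' Y' i, dghom X' Y' i := match l with
  | 1 => M1 | 2 => fun _ X' Y' i => hc X' Y' i v | _ => fun _ _ _ _ => 0 end.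
have Pj m (J : dmap m 2) u w : (u <= m)%N -> jn J u = w -> P (J (inord u)) = match w with 0 => X | 1 => Y | _ => Z end.
  by move=> hu <-.
have i0 m : (ord0 : 'I_m.+1) = inord 0 by apply: val_inj; rewrite /= inordK.
have im m : (ord_max : 'I_m.+1) = inord m by apply: val_inj; rewrite /= inordK.
have ao0 : X = obv I a 0 by rewrite eX srcE.
have ao1 : Y = obv I a 1 by rewrite eY -ab tgtE.
have bo0 : Y = obv I b 0 by rewrite eY srcE.
have bo1 : Z = obv I b 1 by rewrite eZ tgtE.
have co0 : X = obv I c 0 by rewrite eX -ca srcE.
have co1 : Z = obv I c 1 by rewrite eZ -cb tgtE.
have cases1 (J : dmap 1 2) : dstrict J ->
    [\/ jn J 0 = 0%N /\ jn J 1 = 1%N, jn J 0 = 1%N /\ jn J 1 = 2 | jn J 0 = 0%N /\ jn J 1 = 2].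
  move=> hJ; have h := @jn_strict _ _ J 0 1 hJ isT isT; have h2 := jn_le J 1.
  case E0 : (jn J 0) h => [|[|n]]; case E1 : (jn J 1) h2 => [|[|[|n']]] // _ _;
    by [constructor 1 | constructor 2 | constructor 3].
have [|s [so sm]] := @simplex_exists k A C I 2 P M.
  move=> m J X' Y' i hJ m0 eX' eY' ei; have := strict_le hJ.
  case: m J hJ m0 eX' eY' ei => [|[|[|m]]] // J hJ _ eX' eY' ei _.
    rewrite big1; last by move=> w; have := ltn_ord w; case: (nat_of_ord w).
    rewrite i0 in eX'; rewrite im in eY'; subst i.
    have -> : 1 - 1%:Z + 1 = 1 by [].
    have -> : 1 - 1%:Z = 0 by [].
    rewrite /M /M1; case: (cases1 J hJ) => -[e0 e1];
      rewrite (Pj 1%N J 0%N _ isT e0) in eX'; rewrite (Pj 1%N J 1%N _ isT e1) in eY';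
      rewrite e0 ?e1; subst X' Y'; exact: edge_dd.
  rewrite (strict_self hJ) in eX' eY' *.
  have {}eX' : X' = X by rewrite eX'.
  have {}eY' : Y' = Z by rewrite eY'.
  subst X' Y' i; rewrite sum_pos1 [nat_of_ord ord_max]/=.
  have -> : P (did 2 (inord 1)) = Y by rewrite (Pj 2 (did 2) 1%N 1%N) ?jn_did.
  have -> : 1 - 2%:Z + 1 = 0 by [].
  have -> : (2 - 1)%N = 1%N by [].
  have -> : 1 - 1%:Z = 0 by [].
  have -> : 1 - 2%:Z = -1 by [].
  have b1 : mono_on 1 2 (bump 1) by mono.
  have b2 : mono_on 1 2 (addn 1) by mono.
  have b3 : mono_on 1 2 id by mono.
  rewrite /M /M1 !jn_comp ?jn_mkd // !jn_did // hc_id hv expr1 scaleN1r opprB //.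
  by rewrite !(@jn_comp 2.-1 _ _) ?jn_mkd // ?jn_did.
have edge h (e : C 1%N) f0 f1 : mono_on 1 2 h -> h 0%N = f0 -> h 1%N = f1 -> (f0 < f1)%N ->
    match f0 with 0 => X | 1 => Y | _ => Z end = obv I e 0 ->
    match f1 with 0 => X | 1 => Y | _ => Z end = obv I e 1 ->
    (forall X' Y' i, match f0, f1 with
  | 0, 1 => mr I a X' Y' i | 1, _ => mr I b X' Y' i | _, _ => mr I c X' Y' i end = mr I e X' Y' i) ->
    sb 1 h s = e.
  move=> hh h0 h1 hlt e0 e1 em.
  have hf1 : (f1 <= 2)%N by rewrite -h1; exact: (proj2 hh).
  have ost u : (u <= 2)%N -> obv I s u = match u with 0 => X | 1 => Y | _ => Z end.
    by move=> hu; have := so (inord u); rewrite inordK // => ->; rewrite /P inordK.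
  have es : src (sb 1 h s) = src e.
    by apply: (@ob_inj _ _ _ I); rewrite !srcE -/(obv I _ 0) obv_sb // h0 ost ?e0 //; lia.
  have et : tgt (sb 1 h s) = tgt e.
    by apply: (@ob_inj _ _ _ I); rewrite !tgtE -/(obv I _ 1) obv_sb // h1 ost ?e1.
  apply: edge_ext => //; rewrite es et.
  have st : dstrict (mkd 1 2 h).
    by apply: dstrict_mkd => // u w huw hw; have [-> ->] : u = 0%N /\ w = 1%N by [lia]; rewrite h0 h1.
  rewrite /sb (sm 1%N (mkd 1 2 h)) //.
  - by rewrite /M /M1 !jn_mkd // h0 h1 em.
  - by rewrite i0 (Pj 1%N _ 0%N f0) ?jn_mkd // e0 srcE.
  - by rewrite im (Pj 1%N _ 1%N f1) ?jn_mkd // e1 tgtE.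
exists s; split.
- by apply: (edge _ _ 0%N 1%N) => //; mono.
- by apply: (edge _ _ 1%N 2) => //; mono.
- by apply: (edge _ _ 0%N 2) => //; mono.
have := sm 2 (did 2) X Z (-1) (dstrict_did 2) isT erefl erefl erefl; rewrite act_id => ->.
exact: hc_id.
Qed.

Lemma dfaceE n i (s : C n.+1) : (i <= n.+1)%N -> act (dface (inord i)) s = sb n (bump i) s.
Proof.
move=> hi; rewrite /sb; congr act; apply: dmap_jn => u hu.
rewrite jn_mkd //; last exact: bump_mono.
by rewrite /jn /= !inordK.
Qed.

Lemma composite_coh (f g h : C 1%N) X Y Z : composite f g h -> X = ob I (src f) -> Y = ob I (src g) ->
  Z = ob I (tgt g) -> [/\ src h = src f, tgt f = src g, tgt h = tgt g &
  coh (cp 0 (mr I g Y Z 0) (mr I f X Y 0)) (mr I h X Z 0)].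
Proof.
move=> [s []]; rewrite !dfaceE // => <- <- <- eX eY eZ.
have v ff u w : mono_on 1 2 ff -> (u <= 1)%N -> ff u = w -> sb 0 (fun=> u) (sb 1 ff s) = sb 0 (fun=> w) s.
  by move=> hh hu <-; rewrite sb_sb //; apply: sb_eq.
have b0 : mono_on 1 2 (bump 0) by mono.
have b1 : mono_on 1 2 (bump 1) by mono.
have b2 : mono_on 1 2 (bump 2) by mono.
rewrite !srcE !tgtE in eX eY eZ *.
have q20 := v _ 0%N 0%N b2 isT erefl; have q21 := v _ 1%N 1%N b2 isT erefl.
have q10 := v _ 0%N 0%N b1 isT erefl; have q11 := v _ 1%N 2 b1 isT erefl.
have q00 := v _ 0%N 1%N b0 isT erefl; have q01 := v _ 1%N 2 b0 isT erefl.
rewrite q20 in eX; rewrite q00 in eY; rewrite q01 in eZ; rewrite q20 q21 q10 q11 q00 q01.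
by split=> //; exists (mr I s X Z (-1)); exact: mr_d2.
Qed.

Lemma coh_composite (f g h : C 1%N) X Y Z : src h = src f -> tgt f = src g -> tgt h = tgt g ->
  X = ob I (src f) -> Y = ob I (src g) -> Z = ob I (tgt g) ->
  coh (cp 0 (mr I g Y Z 0) (mr I f X Y 0)) (mr I h X Z 0) -> composite f g h.
Proof.
move=> h1 h2 h3 eX eY eZ [v hv]; have [s [s1 s2 s3 _]] := triangle_exists h1 h2 h3 eX eY eZ hv.
by exists s; rewrite !dfaceE.
Qed.

Lemma idarrow_ends (x : C 0) : src (idarrow x) = x /\ tgt (idarrow x) = x.
Proof. by rewrite srcE tgtE /idarrow !sb_const !const_simplex0. Qed.

Lemma mr_idarrow (x : C 0) X : X = ob I x -> mr I (idarrow x) X X 0 = dgid X.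
Proof. by move=> eX; have := @mr_edge_id _ _ _ I x 1 id X eX; rewrite sb_const => -> //; mono. Qed.

Lemma coh_equivalence (f : C 1%N) X Y (g : dghom Y X 0) : X = ob I (src f) -> Y = ob I (tgt f) ->
  dd 1 g = 0 -> coh (cp 0 g (mr I f X Y 0)) (dgid X) -> coh (cp 0 (mr I f X Y 0) g) (dgid Y) ->
  is_equivalence f.
Proof.
move=> eX eY; subst X Y => hg h1 h2; have [e [es et em]] := edge_exists hg.
have [s1 t1] := idarrow_ends (src f); have [s2 t2] := idarrow_ends (tgt f).
exists e; split.
  apply: (@coh_composite _ _ _ (ob I (src f)) (ob I (tgt f)) (ob I (src f))); rewrite ?s1 ?t1 ?es ?et //.
  by rewrite em mr_idarrow.
apply: (@coh_composite _ _ _ (ob I (tgt f)) (ob I (src f)) (ob I (tgt f))); rewrite ?s2 ?t2 ?es ?et //.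
by rewrite em mr_idarrow.
Qed.

Lemma terminal_contraction (z : C 0) : terminal z <-> exists s : dghom (ob I z) (ob I z) (-1), dd 0 s = dgid _.
Proof.
split=> [hz|[s hs]]; last exact: null_terminal hs.
by have [h e] := terminal_null hz (dd_id (ob I z) 1); exists h.
Qed.
End Arrows.

(** Contractibility of the identity is a self-dual condition, so the criterion for terminal objects
    also yields initial ones. *)
Lemma zero_contraction (k : comPzRingType) (A : dgcat k) (C : sset) (I : nerve_iso C A) (z : C 0) :
  zero_object z <-> exists s : dghom (ob I z) (ob I z) (-1), dd 0 s = dgid _.
Proof.
split=> [[h _]|h]; first exact/(terminal_contraction I).
split; first exact/(terminal_contraction I).
have [I' [hob _]] := nerve_iso_op I.
by apply/(terminal_contraction I'); rewrite hob.
Qed.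

Lemma H0_zeroE (k : comPzRingType) (A : dgcat k) (O : A) :
  H0_zero_object O <-> exists s : dghom O O (-1), dd 0 s = dgid O.
Proof.
split=> [h|[s hs] X].
  by have [/(_ (closed0_id O))/cohomE[v hv] _] := h O; exists v; rewrite hv subr0.
split=> f; apply/cohomE; rewrite subr0; have hf : dd 1 (c0 f) = 0 := proj1 (cocycleE _) (c0_closed f).
  by exists (cp (-1) s (c0 f)); rewrite (dd_cpr (l' := 0) (i' := 0)) // hs cp1l.
by exists (cp (-1) (c0 f) s); rewrite (dd_cpl0 (j' := 0)) // hs cp1r.
Qed.

Section Products.
Variables (k : comPzRingType) (A : dgcat k) (C : sset) (I : nerve_iso C A).
Hypothesis hA : nonpositive A.

Lemma disc_finite : finite_sset (sset_disc bool).
Proof.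
exists [:: existT (fun n => sset_disc bool n) 0%N true; existT (fun n => sset_disc bool n) 0%N false].
move=> [|n] x h; first by case: x {h}; [left | right; left].
by case: h; exists 0%N, (dconst n.+1 ord0), x.
Qed.

Variables (p : smap (sset_disc bool) C) (t : slice p 0) (L : A) (B : bool -> A).
Hypotheses (hL : L = ob I (sl_front t)) (hB : forall a, B a = ob I (p 0%N a)) (ht : is_limit t).

Definition proj a : dghom L (B a) 0 := mr I (sl_join t (a : sset_disc bool 0) : C 1%N) L (B a) 0.

Lemma proj_ends a : src (sl_join t (a : sset_disc bool 0) : C 1%N) = sl_front t /\
  tgt (sl_join t (a : sset_disc bool 0) : C 1%N) = p 0%N a.
Proof.
rewrite srcE tgtE; split.
  rewrite -(sl_inl t (a : sset_disc bool 0)) /sb; congr act; apply: dmap_jn => u.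
  by rewrite leqn0 => /eqP ->; rewrite jn_mkd ?jn_dinl.
rewrite -(sl_inr t (a : sset_disc bool 0)) /sb; congr act; apply: dmap_jn => u.
by rewrite leqn0 => /eqP ->; have E := @jn_dinr 0 0 0 isT; rewrite jn_mkd //; exact: esym E.
Qed.

Lemma proj_closed a : dd 1 (proj a) = 0.
Proof.
have [e1 e2] := proj_ends a.
by apply: edge_dd; rewrite /obv ?hL ?hB -?e1 -?e2 ?srcE ?tgtE.
Qed.

Let K := sset_disc bool.
Let rhoc W j (g : forall a, dghom W (B a) j) : coch K W := fun l (u : bool) Y i =>
  if l is 0 then hc W Y i (g u) else 0.

Let rho_normal W j (g : forall a, dghom W (B a) j) : cnormal (rhoc g).
Proof. by move=> [|l] u Y i // [m [a [y [hm _]]]]. Qed.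

Let oB a : B a = oK I p (a : K 0%N) 0.
Proof. by rewrite hB /oK obv0. Qed.

Let deg l (u : K l.+1) : degenerate u.
Proof. by exists 0%N, (dconst l.+1 ord0), u. Qed.

(** Acyclicity of the limit cone in degree 0, applied to a family of cocycles on the two points. *)
Lemma proj_surj W (g : forall a, dghom W (B a) 0) : (forall a, dd 1 (g a) = 0) ->
  exists x : dghom W L 0, dd 1 x = 0 /\ forall a, coh (cp 0 (proj a) x) (g a).
Proof.
move=> hg; rewrite /proj hL.
have [|||x [y [yn hx hy]]] := @limit_acyclic k A C I K p t hA ht W 0 1 0 (rhoc g) (lexx _) erefl.
- by rewrite dd0.
- exact: rho_normal.
- move=> [|l] u Y i eY ei; last by rewrite cD_normal ?cp0r //; exact: rho_normal.
  by rewrite cp0r cD_vert /rhoc; rewrite -oB in eY; subst Y i; rewrite hc_id.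
exists x; split=> // a; exists (y 0%N (a : K 0%N) (B a) (-1)).
have := hy 0%N (a : K 0%N) (B a) 0 (oB a) erefl; rewrite cD_vert /rhoc hc_id => <-.
by rewrite subKr.
Qed.

(** Acyclicity in degree -1, applied to [x] with the null-homotopies of its projections as
    cochain. *)
Lemma proj_inj W (x : dghom W L 0) : dd 1 x = 0 -> (forall a, coh (cp 0 (proj a) x) 0) -> coh x 0.
Proof.
rewrite /proj; move: x; rewrite hL => x hx h.
have [vt ht'] := h true; have [vf hf'] := h false.
pose v a : dghom W (B a) (-1) := match a with true => vt | false => vf end.
have hv a : dd 0 (v a) = cp 0 (mr I (sl_join t (a : K 0%N)) (ob I (sl_front t)) (B a) 0) x.
  by case: a; rewrite /= ?ht' ?hf' subr0.
have [||| x' [y [yn hx' hy]]] := @limit_acyclic k A C I K p t hA ht W (-1) 0 x (rhoc v) isT erefl.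
- exact: hx.
- exact: rho_normal.
- move=> [|l] u Y i eY ei; last first.
    rewrite cD_normal //.
    have -> : cone_coch I t u Y (- l.+1%:Z) = 0 by exact: (@join_normal _ _ _ I _ _ _ t _ _ u Y _ (deg u)).
    by rewrite cp0l.
  by rewrite cD_vert /rhoc; rewrite -oB in eY; subst Y i; rewrite hc_id hv.
by exists x'; rewrite hx' subr0.
Qed.

(** The injections lift the rows of the identity matrix; the last relation can be tested after both
    projections. *)
Lemma product_biproduct : exists j : forall a, dghom (B a) L 0, [/\ forall a, dd 1 (j a) = 0,
  forall a b, coh (cp 0 (proj b) (j a)) (delta B a b) &
  coh (cp 0 (j true) (proj true) + cp 0 (j false) (proj false)) (dgid L)].
Proof.
have H a : exists x : dghom (B a) L 0, dd 1 x = 0 /\ forall b, coh (cp 0 (proj b) x) (delta B a b).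
  by apply: proj_surj => b; exact: delta_closed.
have [jt [ct ht']] := H true; have [jf [cf hf']] := H false.
exists (fun a => match a with true => jt | false => jf end); split=> [[]|[]|] //.
apply/cohB0/proj_inj; first by rewrite ddB ddD dd_id !cp_closed ?addr0 ?subrr //; exact: proj_closed.
move=> b; rewrite cpBr cp1r cpDr; apply: (proj1 (cohB0 _ _)).
rewrite -!cp00A; apply: (@coh_trans _ _ _ _ (cp 0 (delta B true b) (proj true) + cp 0 (delta B false b) (proj false))).
  by apply: cohD; apply: coh_compr => //; exact: proj_closed.
have -> : cp 0 (delta B true b) (proj true) + cp 0 (delta B false b) (proj false) = proj b; last exact: coh_refl.
by rewrite /delta; case: b; rewrite /= ?cp0l ?hc_id ?cp1l ?addr0 ?add0r.
Qed.
End Products.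

Lemma hc_eq (k : comPzRingType) (A : dgcat k) (X Y Z : A) (T T' : hcomplex3 X Y Z) :
  c0 (hc_f T) = c0 (hc_f T') -> c0 (hc_g T) = c0 (hc_g T') -> hc_h T = hc_h T' -> T = T'.
Proof.
case: T T' => [[f hf] [g hg] h hd] [[f' hf'] [g' hg'] h' hd'] /= ef eg eh; subst.
have e1 := proof_irrelevance _ hf hf'; have e2 := proof_irrelevance _ hg hg'; subst.
by congr HComplex3; exact: proof_irrelevance.
Qed.

(** * Finite limits and fiber sequences *)

Section FiniteLimits.
Variables (k : comPzRingType) (A : dgcat k) (C : sset) (I : nerve_iso C A).
Hypothesis hA : nonpositive A.

Lemma nerve_finite_limits : H0_additive A ->
  (forall (Y Z : A) (g : closed0 Y Z), has_homotopy_kernel g) -> has_finite_limits C.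
Proof.
move=> hadd hk K p hK; have [[O /H0_zeroE[s hs]] _] := hadd.
apply: (finite_limit I p hs) => // d; apply: fiber_exists_all => //.
by exists O, s.
Qed.

Lemma cospan_finite : finite_sset cospan_shape.
Proof.
exists [:: existT (fun n => cospan_shape n) 0%N cv1; existT (fun n => cospan_shape n) 0%N cv2;
  existT (fun n => cospan_shape n) 0%N cv3; existT (fun n => cospan_shape n) 1%N ce1;
  existT (fun n => cospan_shape n) 1%N ce2].
apply: cospan_ind => [l u hu /(_ hu)//|_|_|_|_|_]; rewrite /=; tauto.
Qed.

Lemma cospan_map (e1 e2 : C 1%N) : tgt e1 = tgt e2 -> exists p : smap cospan_shape C,
  (forall l (J : dmap l 1), p l (cl1 J) = act J e1) /\ (forall l (J : dmap l 1), p l (cl2 J) = act J e2).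
Proof.
move=> et.
pose F n (x : cospan_shape n) : C n :=
  if excluded_middle_informative ((proj1_sig x).1 = dconst n ord_max :> dmap n 1)
  then act ((proj1_sig x).2 : dmap n 1) e1 else act ((proj1_sig x).1 : dmap n 1) e2.
have cE (e : C 1%N) l : act (dconst l ord_max) e = const_simplex l (tgt e).
  by rewrite /tgt /vertex /const_simplex -act_comp; congr act; exact: dmap_eq.
have F1 l (J : dmap l 1) : F l (cl1 J) = act J e1.
  by rewrite /F /=; case: excluded_middle_informative.
have F2 l (J : dmap l 1) : F l (cl2 J) = act J e2.
  by rewrite /F /=; case: excluded_middle_informative => // e /=; have -> : J = dconst l ord_max by [exact: e]; rewrite !cE et.
have Fa m n (a : dmap m n) (x : cospan_shape n) : F m (act a x) = act a (F n x).
  by case: (cospan_cases x) => -[J ->]; rewrite ?act_cl1 ?act_cl2 ?F1 ?F2 act_comp.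
by exists (@SMap cospan_shape C F Fa).
Qed.

(** The kernel is the pullback of [g] along the zero morphism from a contractible object; [acy5_lex]
    turns the universal property into left exactness. *)
Lemma limits_kernels : has_finite_limits C -> (exists (O : A) (s : dghom O O (-1)), dd 0 s = dgid O) ->
  forall (Y Z : A) (g : closed0 Y Z), has_homotopy_kernel g.
Proof.
move=> hl [O [s hs]] Y Z g; have [y ey] := ob_surj I Y; have [z ez] := ob_surj I Z.
have [o eo] := ob_surj I O; subst Y Z O.
have [eg [gs gt gm]] := edge_exists (c0_dd g).
have [eo [os ot om]] := @edge_exists k A C I o z 0 (dd0 _ _ _).
have [p [p1 p2]] := @cospan_map eg eo (etrans gt (esym ot)).
have [t ht] := hl _ p cospan_finite.
have hX1 : ob I y = oK I p cv1 0.
  by rewrite /oK obv0 p1 -gs.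
have hX2 : ob I o = oK I p cv2 0.
  by rewrite /oK obv0 p2 -os.
have hX3 : ob I z = oK I p cv3 0.
  by rewrite /oK obv0 p1 -gt.
pose lam := cone_coch I t.
have [s1 s2 s3 s4] := sb_ce; have [o1 o2 o3 o4] := oK_ce hX1 hX2 hX3.
have H := proj1 (acyclic_acy5 hX1 hX2 hX3 (@join_normal _ _ _ I _ _ _ t _)) (limit_acyclic hA ht).
have vc (v : cospan_shape 0%N) X : X = oK I p v 0 -> dd 1 (lam 0%N v X 0) = 0.
  move=> eX; have := @cone_closed _ _ _ I _ p t 0%N v X 1 eX erefl; rewrite cD_vert; exact.
have c1 := @cone_closed k A C I _ p t 1%N ce1 (ob I z) 0 o2 erefl.
have c2 := @cone_closed k A C I _ p t 1%N ce2 (ob I z) 0 o4 erefl.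
rewrite (cD_edge _ _ _ o1) s1 s2 in c1; rewrite (cD_edge _ _ _ o3) s3 s4 in c2.
have kk (V : zmodType) (a b c : V) : a - b - c = 0 -> c = a - b by move/eqP; rewrite subr_eq0 => /eqP.
have hm1 : dd 0 (lam 1%N ce1 (ob I z) (-1)) = cp 0 (mK I p ce1 (ob I y) (ob I z) 0) (lam 0%N cv1 (ob I y) 0) -
    lam 0%N cv3 (ob I z) 0 by exact: kk c1.
have hm2 : dd 0 (lam 1%N ce2 (ob I z) (-1)) = cp 0 (mK I p ce2 (ob I o) (ob I z) 0) (lam 0%N cv2 (ob I o) 0) -
    lam 0%N cv3 (ob I z) 0 by exact: kk c2.
have g1 : mK I p ce1 (ob I y) (ob I z) 0 = c0 g by rewrite /mK p1 act_id gm.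
have g2 : mK I p ce2 (ob I o) (ob I z) 0 = 0 by rewrite /mK p2 act_id om.
rewrite g1 in hm1 H; rewrite g2 in hm2 H.
have hl1 := vc _ _ hX1; have hl2 := vc _ _ hX2; have hl3 := vc _ _ hX3.
have hg := c0_dd g; have h0 : dd 1 (0 : dghom (ob I o) (ob I z) 0) = 0 by exact: dd0.
have D : lex_data (lam 0%N cv1 (ob I y) 0) (c0 g) (sq_h (0 : dghom (ob I o) (ob I z) 0) (lam 0%N cv2 (ob I o) 0)
   (lam 1%N ce1 (ob I z) (-1)) (lam 1%N ce2 (ob I z) (-1)) s).
  by apply: (proj1 (_ : acy5 _ _ _ _ _ _ _ <-> _) H); apply: acy5_lex.
have hh : dd 0 (sq_h (0 : dghom (ob I o) (ob I z) 0) (lam 0%N cv2 (ob I o) 0)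
   (lam 1%N ce1 (ob I z) (-1)) (lam 1%N ce2 (ob I z) (-1)) s) = - cp 0 (c0 g) (lam 0%N cv1 (ob I y) 0).
  by apply: sq_h_dd hm1 hm2 hs.
rewrite (ddE (addNr 1)) (cpE (addr0 0)) in hh.
pose T := @HComplex3 k A _ _ _ (@Closed0 k A _ _ (lam 0%N cv1 (ob I y) 0) (proj2 (@cocycleE _ _ 0 _) hl1)) g _ hh.
by exists (ob I (sl_front t)), T; split=> //; apply/(left_exact_lex T hA).
Qed.

Lemma square_top_edge (q : square C) : sq_top q = sqx q 1 id (fun=> 0%N).
Proof. by apply: sq_eq => u hu /=; rewrite ?jn_did ?jn_dconst ?jn_mkd. Qed.

Lemma cofiber_fiber n : (0 < n)%N ->
  (forall (X Y Z : A) (T : hcomplex3 X Y Z), right_exact T -> n_mono n (hc_f T) -> homotopy_ses T) ->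
  cofiber_is_fiber n C.
Proof.
move=> hn ax q htr /(zero_contraction I)[s hs] hpo.
have m0 : mono_on 1 1 (fun=> 0%N) by mono.
have mi : mono_on 1 1 id by mono.
have z0 : 0%N = (ord0 : 'I_2) :> nat by [].
have z1 : 1%N = (ord_max : 'I_2) :> nat by [].
have h00 : ob I (src (sq_top q)) = ob I (sq_vertex q ord0 ord0).
  by rewrite srcE square_top_edge (sq_vertexE q mi m0 (leq0n 1) z0 z0).
have h10 : ob I (tgt (sq_top q)) = ob I (sq_vertex q ord_max ord0).
  by rewrite tgtE square_top_edge (sq_vertexE q mi m0 (leqnn 1) z1 z0).
have [T [Tf _ _ [Tl Tr]]] := square_T (I := I) h00 h10 erefl erefl hA hs.
apply/Tl; apply: (proj1 (ax _ _ _ T _ _)); first exact/Tr.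
apply/n_mono_cone; rewrite Tf -square_top_edge; exact: truncated_cone.
Qed.

(** [T] is realized as the 3-term complex of a square glued from two triangles with common diagonal
    0, one through [Y] and one through a contractible object. *)
Lemma fiber_cofiber n : (0 < n)%N -> (exists (O : A) (s : dghom O O (-1)), dd 0 s = dgid O) ->
  cofiber_is_fiber n C ->
  forall (X Y Z : A) (T : hcomplex3 X Y Z), right_exact T -> n_mono n (hc_f T) -> homotopy_ses T.
Proof.
move=> hn [O [s hs]] hcf X Y Z T hr hm.
have [x ex] := ob_surj I X; have [y ey] := ob_surj I Y; have [z ez] := ob_surj I Z.
have [o eo] := ob_surj I O; subst X Y Z O.
have [ef [fs ft fm]] := edge_exists (c0_dd (hc_f T)).
have [eg [gs gt gm]] := edge_exists (c0_dd (hc_g T)).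
have [xo [as1 at1 am]] := @edge_exists k A C I x o 0 (dd0 _ _ _).
have [oz [bs bt bm]] := @edge_exists k A C I o z 0 (dd0 _ _ _).
have [ed [ds dt dm]] := @edge_exists k A C I x z 0 (dd0 _ _ _).
(* The homotopy [sq_h] subtracts the component of this triangle, which is therefore [- hc_h T]; the
   triangle through the contractible corner has component 0. *)
have [|||||||s1 [s12 s10 s11 s1m]] := @triangle_exists k A C I ef eg ed (ob I x) (ob I y) (ob I z) (- hc_h T).
- by rewrite ds fs.
- by rewrite ft gs.
- by rewrite dt gt.
- by rewrite fs.
- by rewrite gs.
- by rewrite gt.
- by rewrite gm fm dm ddN hc_dd opprK subr0.
have [|||||||s2 [s22 s20 s21 s2m]] := @triangle_exists k A C I xo oz ed (ob I x) (ob I o) (ob I z) 0.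
- by rewrite ds as1.
- by rewrite at1 bs.
- by rewrite dt bt.
- by rewrite as1.
- by rewrite bs.
- by rewrite bt.
- by rewrite bm am dm dd0 cp0l subr0.
have dE (w : C 2) : sb 1 (fun u => u.*2) w = sb 1 (bump 1) w by apply: sb_eq => -[|[|]].
have [|q [q1 q2]] := @square_exists C s1 s2; first by rewrite !dE s11 s21.
have m0 : mono_on 1 1 (fun=> 0%N) by mono.
have m1 : mono_on 1 1 (fun=> 1%N) by mono.
have mi : mono_on 1 1 id by mono.
have ma : mono_on 2 1 (fun u => 0 < u)%N by mono.
have mb : mono_on 2 1 (fun u => u - 1)%N by mono.
have E1 : sqx q 1 id (fun=> 0%N) = ef.
  by rewrite q1 // -s12; apply: sb_eq => -[|[|]].
have E2 : sqx q 1 (fun=> 1%N) id = eg.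
  by rewrite q1 // -s10; apply: sb_eq => -[|[|]].
have E3 : sqx q 1 (fun=> 0%N) id = xo.
  by rewrite q2 // -s22; apply: sb_eq => -[|[|]].
have E4 : sqx q 1 id (fun=> 1%N) = oz.
  by rewrite q2 // -s20; apply: sb_eq => -[|[|]].
have E5 : sqx q 2 (fun u => 0 < u)%N (fun u => u - 1)%N = s1.
  rewrite q1 //; last by case=> [|[|[|]]].
  by apply: sb_id => -[|[|[|]]].
have E6 : sqx q 2 (fun u => u - 1)%N (fun u => 0 < u)%N = s2.
  rewrite q2 //; last by case=> [|[|[|]]].
  by apply: sb_id => -[|[|[|]]].
have z0 : 0%N = (ord0 : 'I_2) :> nat by [].
have z1 : 1%N = (ord_max : 'I_2) :> nat by [].
have v00 : sq_vertex q ord0 ord0 = x.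
  by rewrite -(sq_vertexE q mi m0 (leq0n 1) z0 z0) E1 -srcE.
have v10 : sq_vertex q ord_max ord0 = y.
  by rewrite -(sq_vertexE q mi m0 (leqnn 1) z1 z0) E1 -tgtE.
have v01 : sq_vertex q ord0 ord_max = o.
  by rewrite -(sq_vertexE q m0 mi (leqnn 1) z0 z1) E3 -tgtE.
have v11 : sq_vertex q ord_max ord_max = z.
  by rewrite -(sq_vertexE q m1 mi (leqnn 1) z1 z1) E2 -tgtE.
have [T' [Tf Tg Th [Tl Tr]]] := @square_T k A C I q (ob I x) (ob I y) (ob I o) (ob I z) s
  (congr1 _ (esym v00)) (congr1 _ (esym v10)) (congr1 _ (esym v01)) (congr1 _ (esym v11)) hA hs.
have eT : T' = T.
  apply: hc_eq; first by rewrite Tf E1.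
    by rewrite Tg E2.
  by rewrite Th E3 E4 E5 E6 /sq_h s1m s2m bm cp0l subr0 sub0r opprK.
subst T'; split=> //; apply/Tl/hcf; last exact/Tr.
  rewrite square_top_edge E1; have := cone_truncated (I := I) (f := ef) hn; apply.
  have G x' y' : x' = x -> y' = y -> cone_exact n (mr I ef (ob I x') (ob I y') 0).
    by move=> -> ->; rewrite fm; exact/n_mono_cone.
  exact: G.
by rewrite v01; apply/(zero_contraction I); exists s.
Qed.
End FiniteLimits.

(** * Additive structure of the nerve *)

Section Additive.
Variables (k : comPzRingType) (A : dgcat k) (C : sset) (I : nerve_iso C A).
Hypothesis hA : nonpositive A.

Lemma src_op (x : C 1%N) : @src (sset_op C) x = @tgt C x.
Proof.
change (@act C 0 1 (drev (dconst 0 ord0)) x = @act C 0 1 (dconst 0 ord_max) x).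
by congr act; apply: dmap_eq => i; exact: val_inj.
Qed.

Lemma tgt_op (x : C 1%N) : @tgt (sset_op C) x = @src C x.
Proof.
change (@act C 0 1 (drev (dconst 0 ord_max)) x = @act C 0 1 (dconst 0 ord0) x).
by congr act; apply: dmap_eq => i; exact: val_inj.
Qed.

(** Products in the opposite simplicial set; on edges the reversal sign is trivial. *)
Lemma coproduct_data (q : smap (sset_disc bool) (sset_op C)) (s : slice q 0) (L : A) (B : bool -> A) :
  L = ob I (sl_front s : C 0) -> (forall a, B a = ob I (q 0%N a : C 0)) -> is_limit s ->
  [/\ forall a : bool, src (sl_join s (a : sset_disc bool 0) : C 1%N) = q 0%N a /\
        tgt (sl_join s (a : sset_disc bool 0) : C 1%N) = sl_front s &
    forall W (x : dghom L W 0), dd 1 x = 0 ->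
      (forall a : bool, coh (cp 0 x (mr I (sl_join s (a : sset_disc bool 0) : C 1%N) (B a) L 0)) 0) -> coh x 0].
Proof.
move=> hL hB hs; have [I' [hob hmr]] := nerve_iso_op I.
have ends (a : bool) : src (sl_join s (a : sset_disc bool 0) : C 1%N) = q 0%N a /\
    tgt (sl_join s (a : sset_disc bool 0) : C 1%N) = sl_front s.
  have [e1 e2] := proj_ends s a; split; first exact: etrans (esym (tgt_op _)) e2.
  exact: etrans (esym (src_op _)) e1.
split=> // W x hx h.
have P := @proj_inj k (dgop A) (sset_op C) I' (nonpositive_op hA) q s L B.
apply: (P _ _ hs W x hx) => [|a|a].
- by rewrite hob.
- by rewrite hob.
have [e1 e2] := ends a.
have -> : proj I' s L B a = mr I (sl_join s (a : sset_disc bool 0) : C 1%N) (B a) L 0.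
  rewrite /proj hmr ?scale1r //; first by rewrite hB -e1 srcE.
  by rewrite hL -e2 tgtE.
rewrite cp_op mul0n expr0 scale1r; exact: h.
Qed.

Lemma matrix_entries (q : smap (sset_disc bool) (sset_op C)) (p : smap (sset_disc bool) C)
    (s : slice q 0) (t : slice p 0) (M : bool -> bool -> bool) (m : C 1%N) (S T : A) (B : bool -> A) :
  S = ob I (sl_front s : C 0) -> T = ob I (sl_front t) -> (forall a, B a = ob I (q 0%N a : C 0)) ->
  (forall a, B a = ob I (p 0%N a)) -> is_limit s -> is_limit t -> matrix_arrow s t M m ->
  forall a b, coh (cp 0 (proj I t T B b) (cp 0 (mr I m S T 0)
      (mr I (sl_join s (a : sset_disc bool 0) : C 1%N) (B a) S 0)))
    (if M a b then hc (B a) (B b) 0 (dgid (B a)) else 0).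
Proof.
move=> hS hT hBq hBp hs ht [ms mt hM] a b; have [u [w [cu cw hw]]] := hM a b.
have [ends _] := coproduct_data hS hBq hs.
have [e1 e2] := ends a; have [e3 e4] := proj_ends t b.
have [u1 u2 u3 hu] := composite_coh (I := I) (X := B a) (Y := S) (Z := T) cu
  (etrans (hBq a) (congr1 _ (esym e1))) (etrans hS (congr1 _ (esym ms))) (etrans hT (congr1 _ (esym mt))).
have [w1 w2 w3 hw'] := composite_coh (I := I) (X := B a) (Y := T) (Z := B b) cw
  (etrans (hBq a) (congr1 _ (esym (etrans u1 e1)))) (etrans hT (congr1 _ (esym e3)))
  (etrans (hBp b) (congr1 _ (esym e4))).
apply: (@coh_trans _ _ _ _ (cp 0 (proj I t T B b) (mr I u (B a) T 0))).
  by apply: coh_compl => //; exact: proj_closed.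
apply: (coh_trans hw'); case: (M a b) hw => hw.
  have H Y : Y = B a -> mr I w (B a) Y 0 = hc (B a) Y 0 (dgid (B a)).
    by move=> ->; rewrite hc_id hw mr_idarrow.
  rewrite H; first exact: coh_refl.
  by rewrite hBp hBq -e4 -w3 hw; have [_ ->] := idarrow_ends (q 0%N a : C 0).
have [z [u' [v' [/(zero_contraction I)[c hc'] tz cz]]]] := hw.
have [x1 x2 x3 hx] := composite_coh (I := I) (X := ob I (src u')) (Y := ob I (src v')) (Z := ob I (tgt v')) cz
  erefl erefl erefl.
have eX : B a = ob I (src u') by rewrite -x1 w1 u1 e1.
have eY : B b = ob I (tgt v') by rewrite -x3 w3 e4.
rewrite eX eY; apply: (coh_trans (coh_sym hx)); apply: coh0_compl.
  by apply: edge_dd; rewrite /obv ?srcE ?tgtE.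
have hu' : dd 1 (mr I u' (ob I (src u')) (ob I (src v')) 0) = 0.
  by apply: edge_dd; rewrite /obv -?x2 ?srcE ?tgtE.
rewrite -x2 tz in hu' *; exists (cp (-1) c (mr I u' (ob I (src u')) (ob I z) 0)).
by rewrite (dd_cpr (l' := 0) (i' := 0)) // hc' cp1l subr0.
Qed.

Lemma matrix_equivalence (q : smap (sset_disc bool) (sset_op C)) (p : smap (sset_disc bool) C)
    (s : slice q 0) (t : slice p 0) (M : bool -> bool -> bool) (m : C 1%N) (B : bool -> A)
    (F : forall a b, dghom (B a) (B b) 0) (E := fun a b => if M a b then hc (B a) (B b) 0 (dgid (B a)) else 0) :
  (forall a, B a = ob I (q 0%N a : C 0)) ->
  (forall a, B a = ob I (p 0%N a)) -> is_limit s -> is_limit t -> matrix_arrow s t M m ->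
  (forall a b, dd 1 (F a b) = 0) ->
  (forall a c, cp 0 (F true c) (E a true) + cp 0 (F false c) (E a false) = delta B a c) ->
  (forall a c, cp 0 (E true c) (F a true) + cp 0 (E false c) (F a false) = delta B a c) ->
  is_equivalence m.
Proof.
move=> hBq hBp hs ht hM hF hFE hEF.
have [ms mt _] := hM; have [ends iinj] := coproduct_data erefl hBq hs.
pose i (a : bool) := mr I (sl_join s (a : sset_disc bool 0) : C 1%N) (B a) (ob I (sl_front s : C 0)) 0.
have hi a : dd 1 (i a) = 0.
  have [e1 e2] := ends a; apply: edge_dd; rewrite /obv ?hBq -?e1 -?e2 ?srcE ?tgtE //.
have hp a : dd 1 (proj I t (ob I (sl_front t)) B a) = 0 by exact: proj_closed.
have hm : dd 1 (mr I m (ob I (sl_front s : C 0)) (ob I (sl_front t)) 0) = 0.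
  by apply: edge_dd; rewrite /obv -?ms -?mt ?srcE ?tgtE.
have pinj W (x : dghom W (ob I (sl_front t)) 0) : dd 1 x = 0 ->
    (forall a, coh (cp 0 (proj I t (ob I (sl_front t)) B a) x) 0) -> coh x 0 by exact: proj_inj.
have hE := matrix_entries erefl erefl hBq hBp hs ht hM.
apply: (@coh_equivalence _ _ _ I m (ob I (sl_front s : C 0)) (ob I (sl_front t))
  (minv i (proj I t (ob I (sl_front t)) B) F)).
- by rewrite ms.
- by rewrite mt.
- exact: minv_closed.
- by apply: (minv_left (E := E)).
- by apply: (minv_right (E := E)).
Qed.

Lemma nerve_additive : H0_additive A -> has_finite_limits C -> has_finite_colimits C ->
  additive_quasicategory C.
Proof.
move=> [[O /H0_zeroE hO] _] hl hc'; split.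
- have [o eo] := ob_surj I O; subst O; exists o; exact/(zero_contraction I).
- by move=> p; apply: hl; exact: disc_finite.
- by move=> q; apply: hc'; exact: disc_finite.
- move=> q p s t m hqp hs ht hM.
  pose B a := ob I (p 0%N a).
  apply: (@matrix_equivalence q p s t _ m B (delta B)) hM _ _ _ => //.
  + by move=> a; rewrite hqp.
  + exact: delta_closed.
  + by move=> a c; rewrite /delta; case: a; case: c; rewrite /= !hc_id ?cp0l ?cp0r ?cp1l ?addr0 ?add0r.
  + by move=> a c; rewrite /delta; case: a; case: c; rewrite /= !hc_id ?cp0l ?cp0r ?cp1l ?addr0 ?add0r.
move=> q p X s t m hq hp hs ht hM.
pose B (a : bool) := ob I X.
(* The inverse of the shear matrix: its off-diagonal entry changes sign. *)
pose F (a b : bool) : dghom (B a) (B b) 0 :=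
  if a == b then dgid (ob I X) else if a then - dgid (ob I X) else 0.
apply: (@matrix_equivalence q p s t _ m B F) hM _ _ _ => //.
+ by move=> a; rewrite hq.
+ by move=> a; rewrite hp.
+ by move=> a b; rewrite /F; case: a; case: b; rewrite /= ?ddN ?dd_id ?oppr0 ?dd0.
+ move=> a c; rewrite /delta /F /B; case: a; case: c;
    by rewrite /= !hc_id ?cp0l ?cp0r ?cpNl ?cp1l ?addr0 ?add0r ?addNr.
+ move=> a c; rewrite /delta /F /B; case: a; case: c;
    by rewrite /= !hc_id ?cp0l ?cp0r ?cpNr ?cp1l ?addr0 ?add0r ?subrr ?addNr.
Qed.

Lemma additive_contraction : additive_quasicategory C ->
  exists (O : A) (s : dghom O O (-1)), dd 0 s = dgid O.
Proof. by move=> [[z /(zero_contraction I)[s hs]] _ _ _ _]; exists (ob I z), s. Qed.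

Lemma additive_H0 : additive_quasicategory C -> H0_additive A.
Proof.
move=> hadd; split; first by have [O hO] := additive_contraction hadd; exists O; exact/H0_zeroE.
move=> X Y; have [x ex] := ob_surj I X; have [y ey] := ob_surj I Y; subst X Y.
pose p : smap (sset_disc bool) C := @SMap (sset_disc bool) C (fun n b => const_simplex n (if b then x else y))
  (fun m n a b => esym (act_const a _)).
have [_ /(_ p)[t ht] _ _ _] := hadd.
pose B (a : bool) := if a then ob I x else ob I y.
have hB a : B a = ob I (p 0%N a) by rewrite /B /= const_simplex0; case: a.
have [j [hj hd hsum]] := product_biproduct hA erefl hB ht.
have cp' := proj_closed (I := I) (t := t) erefl hB.
pose cl (X Y : A) (f : dghom X Y 0) (h : dd 1 f = 0) := @Closed0 k A X Y f (proj2 (@cocycleE _ _ 0 _) h).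
exists (ob I (sl_front t)), (cl _ _ _ (hj true)), (cl _ _ _ (hj false)), (cl _ _ _ (cp' true)), (cl _ _ _ (cp' false)).
have ce (X' Y' : A) (f g : dghom X' Y' 0) : coh f g -> cohomologous f g by move=> h; apply/cohomE.
rewrite /H0_biproduct /comp0 -!(cpE (addr0 0)) /=; split; apply: ce => //.
- by have := hd true true; rewrite /delta /= hc_id.
- by have := hd false false; rewrite /delta /= hc_id.
- exact: (hd false true).
- exact: (hd true false).
Qed.
End Additive.

(** * The two implications *)

Section Assembly.
Variables (k : comPzRingType) (A : dgcat k) (n : nat) (C : sset) (I : nerve_iso C A).
Hypotheses (hn : (0 < n)%N) (hA : nonpositive A).

(** Cokernels and condition (iii) of the DG side are kernels and condition (ii) over [dgop A], so
    each argument is run for [C] and for its opposite. *)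
Lemma abelian_dg_nerve : abelian_truncated_dg n A -> abelian_n1 n C.
Proof.
move=> [hT [hadd hk hck] hii hiii]; have [I' _] := nerve_iso_op I.
have hl := nerve_finite_limits I hA hadd hk.
have hcl : has_finite_colimits C.
  by apply: (nerve_finite_limits I' (nonpositive_op hA) (H0_additive_op hadd)); exact: kernel_op.
split; first exact: nerve_quasicategory I.
split=> //.
- split; first exact: (nerve_additive I).
  by move=> X Y; exact: (map_space_truncated I).
- exact: (cofiber_fiber I).
apply: (cofiber_fiber I' (nonpositive_op hA)) => // X Y Z T hr hm.
have hs : homotopy_ses (hc_unop T).
  apply: hiii; first exact/right_exact_unop.
  by rewrite /n_epi /=; case: (hc_f T) hm.
by split=> //; apply/left_exact_unop; have [] := hs.
Qed.

Lemma nerve_abelian_dg : abelian_n1 n C -> abelian_truncated_dg n A.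
Proof.
move=> [_ [[hadd htr] [hl hcl] hcf hcf']]; have [I' _] := nerve_iso_op I.
have hO := additive_contraction I hadd.
have hO' : exists (O : dgop A) (s : dghom O O (-1)), dd 0 s = dgid O by exact: hO.
split.
- exact: (@map_space_truncatedE k A C I n hn htr).
- split; first exact: (additive_H0 I).
    exact: (limits_kernels I).
  by apply: cokernel_unop; exact: (limits_kernels I' (nonpositive_op hA)).
- exact: (fiber_cofiber I).
move=> X Y Z T hle he.
have uo : hc_unop (hc_op T) = T by exact: hc_eq.
have [|h1 h2] := fiber_cofiber I' (nonpositive_op hA) hn hO' hcf' (T := hc_op T) _ he.
  by apply/right_exact_unop; rewrite uo.
by split=> //; move/left_exact_unop: h1; rewrite uo.
Qed.
End Assembly.

Theorem proposition4p19 (k : comPzRingType) (A : dgcat k) (n : nat)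
    (hn : (0 < n)%N) (hA : nonpositive A) :
  abelian_truncated_dg n A <-> abelian_n1 n (dg_nerve A).
Proof.
split; first exact: (abelian_dg_nerve (nerve_iso_id A)).
exact: (nerve_abelian_dg (nerve_iso_id A)).
Qed.
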